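(* Let $d\ge2$, let $E_0\subseteq\mathbb{R}^d$ be a bounded set with $C^{2,\alpha}$-boundary for some $\alpha\in(0,1]$, and let $K$ be a suitable convolution kernel on $\mathbb{R}^d$ satisfying one of the following conditions: (I) $K\in C_c^{0,\alpha}(\mathbb{R}^d)$; (II) $K\in C^{0,1}(\mathbb{R}^d)$ and there are positive numbers $C,\varepsilon,\delta$ such that for all $x,\overline{x}\in\mathbb{R}^d$ and $n\in\mathbb{S}^{d-1}$ $$|K(x)|\le C|x|^{-d-2-\varepsilon},\qquad |K(x)-K(\overline{x})|\le C\min(|x|,|\overline{x}|)^{-d-3-\delta}|x-\overline{x}|,$$ $$\frac{1}{\mu_K(n)}=2\int_{\{x\cdot n=0\}}K(x)\,d\mathcal{H}^{d-1}(x)>0.$$ For $h>0$ let $E_1^{K,h}:=\{x\in\mathbb{R}^d:(K_h*\chi_{E_0})(x)>1/2\}$, let $\nu(x)$ be the outer unit normal of $E_0$ at $x\in\partial E_0$, and define $$z(x):=\begin{cases}\sup\{l\in\mathbb{R}_-: x+l\nu(x)\in E_1^{K,h}\}&\text{if }x\notin E_1^{K,h},\\ \inf\{l\in\mathbb{R}_+: x+l\nu(x)\notin E_1^{K,h}\}&\text{if }x\in E_1^{K,h}.\end{cases}$$ Then, as $h\downarrow0$, uniformly in $x\in\partial E_0$, $$\frac{1}{\mu_K(\nu(x))}z(x)=-hH_{\sigma_K}(x;E_0)+\mathcal{O}(h^{1+\alpha/2}).$$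
   Context: A suitable convolution kernel is a function $K:\mathbb{R}^d\to\mathbb{R}$ with $K\ge0$, $K(-x)=K(x)$, $\int_{\mathbb{R}^d}K\,dx=1$. $K_h(x):=h^{-d/2}K(x/\sqrt h)$. The mobility is given by $\frac{1}{\mu_K(n)}:=2\int_{\{x\cdot n=0\}}K(x)\,d\mathcal{H}^{d-1}(x)$, $n\in\mathbb{S}^{d-1}$ (when this is $0$, the product $\frac{1}{\mu_K}z$ is understood as $0$). The surface tension is $\sigma_K(p):=\frac12\int_{\mathbb{R}^d}|p\cdot x|K(x)\,dx$, $p\in\mathbb{R}^d$. The anisotropic mean curvature at $x\in\partial E_0$ is $H_{\sigma_K}(x;E_0):=\sum_{i=1}^{d-1}\kappa_i\bigl(\tau_i\cdot D^2\sigma_K(\nu)\tau_i\bigr)$, where $\kappa_i$ are the principal curvatures and $\tau_i$ orthonormal principal directions ($\nabla\nu\,\tau_i=\kappa_i\tau_i$, so convex sets have $\kappa_i\ge0$). *)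

(* Defs.v *)
From HB Require Import structures.
From mathcomp Require Import all_boot all_order all_algebra.
From mathcomp Require Import all_classical all_reals all_analysis.

Set Implicit Arguments.
Unset Strict Implicit.
Unset Printing Implicit Defensive.

Import Order.TTheory GRing.Theory Num.Theory.
Import numFieldNormedType.Exports.

Local Open Scope classical_set_scope.
Local Open Scope ring_scope.

(* The norm [`|x|] that the library puts on ['rV[R]_n] is the sup norm;
   the Euclidean norm is [enorm]. *)
Definition dotv (R : realType) (n : nat) (x y : 'rV[R]_n) : R :=
  \sum_(i < n) x 0 i * y 0 i.

Definition enorm (R : realType) (n : nat) (x : 'rV[R]_n) : R :=
  Num.sqrt (dotv x x).

(* The Borel sigma-algebra of R^n, as the product sigma-algebra generated by
   the coordinates. *)
Definition rV_display (R : realType) : measure_display.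
Proof. exact. Qed.

Section measurable_rV.
Variables (R : realType) (n : nat).

Let coord (i : 'I_n) (x : 'rV[R]_n) : measurableTypeR R := x 0 i.

Let measurable_rV0 : g_sigma_preimage coord set0.
Proof. exact: sigma_algebra0. Qed.

Let measurable_rVC A : g_sigma_preimage coord A -> g_sigma_preimage coord (~` A).
Proof. exact: sigma_algebraC. Qed.

Let measurable_rV_bigcup (F : (set 'rV[R]_n)^nat) :
  (forall i, g_sigma_preimage coord (F i)) ->
  g_sigma_preimage coord (\bigcup_i (F i)).
Proof. exact: sigma_algebra_bigcup. Qed.

HB.instance Definition _ := @isMeasurable.Build (rV_display R)
  'rV[R]_n (g_sigma_preimage coord)
  measurable_rV0 measurable_rVC measurable_rV_bigcup.

End measurable_rV.


Lemma measurable_coord (R : realType) (n : nat) (i : 'I_n) :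
  measurable_fun setT (fun x : 'rV[R]_n => x 0 i : measurableTypeR R).
Proof.
move=> _ A mA; rewrite setTI; apply: sub_sigma_algebra.
case: n i => [[]//|n] i; rewrite -bigcup_mkord_ord.
exists (i : nat); first exact: (ltn_ord i).
by exists A => //; rewrite setTI inord_val.
Qed.

Lemma measurable_fun_rV d (T : measurableType d) (R : realType) (n : nat)
    (f : T -> 'rV[R]_n) :
  (forall i, measurable_fun setT (fun t => f t 0 i : measurableTypeR R)) ->
  measurable_fun setT f.
Proof.
move=> mf; suff H : measurable `<=` [set A : set 'rV[R]_n | measurable (f @^-1` A)].
  by move=> _ A mA; rewrite setTI; exact: H.
apply: smallest_sub.
  split=> [|A mA|F mF] /=; first by rewrite preimage_set0; exact: measurable0.
    by rewrite setTD -preimage_setC; exact: measurableC.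
  by rewrite preimage_bigcup; exact: bigcupT_measurable.
case: n f mf => [|n] f mf; first by rewrite big_ord0; exact: sub0set.
rewrite -bigcup_mkord_ord; apply: bigcup_sub => i _ _ [B mB <-] /=.
rewrite setTI -comp_preimage -[X in measurable X]setTI.
exact: (mf (inord i)).
Qed.

Definition consrV (R : realType) (n : nat)
    (p : measurableTypeR R * 'rV[R]_n) : 'rV[R]_n.+1 :=
  \row_i oapp (fun j => p.2 0 j) (p.1 : R) (unlift 0 i).

Section lebesgue_rV_step.
Variables (R : realType) (n : nat).
Variable mu : {sigma_finite_measure set 'rV[R]_n -> \bar R}.

Let measurable_consrV : measurable_fun setT (@consrV R n).
Proof.
apply: measurable_fun_rV => i; case: (unliftP 0 i) => [j|] ->.
  rewrite (_ : (fun _ => _) =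
      (fun x : 'rV[R]_n => x 0 j : measurableTypeR R) \o snd).
    by apply: measurableT_comp; [exact: measurable_coord|exact: measurable_snd].
  by apply/funext => p; rewrite /= mxE liftK.
rewrite (_ : (fun _ => _) = fst); first exact: measurable_fst.
by apply/funext => p; rewrite /= mxE unlift_none.
Qed.

Let unconsrV (x : 'rV[R]_n.+1) : measurableTypeR R * 'rV[R]_n :=
  (x 0 0, \row_j x 0 (lift 0 j)).

Let measurable_unconsrV : measurable_fun setT unconsrV.
Proof.
apply: measurable_fun_pair; first exact: measurable_coord.
apply: measurable_fun_rV => i.
rewrite (_ : (fun _ => _) =
  (fun x : 'rV[R]_n.+1 => x 0 (lift 0 i) : measurableTypeR R)).
  exact: measurable_coord.
by apply/funext => x; rewrite mxE.
Qed.

Let consrVK : cancel (@consrV R n) unconsrV.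
Proof.
move=> [t x]; congr (_, _); first by rewrite mxE unlift_none.
by apply/rowP => j; rewrite !mxE liftK.
Qed.

Definition lebesgue_consrV : set 'rV[R]_n.+1 -> \bar R :=
  pushforward (@lebesgue_measure R \x mu)%E (@consrV R n).

Let lebesgue_consrV0 : lebesgue_consrV set0 = 0%E.
Proof. by rewrite /lebesgue_consrV /pushforward preimage_set0 measure0. Qed.

Let lebesgue_consrV_ge0 A : (0 <= lebesgue_consrV A)%E.
Proof. exact: measure_ge0. Qed.

Let lebesgue_consrV_sigma_additive : semi_sigma_additive lebesgue_consrV.
Proof.
move=> F mF tF mUF; rewrite /lebesgue_consrV /pushforward preimage_bigcup.
apply: measure_semi_sigma_additive.
- by move=> i; rewrite -[X in measurable X]setTI; exact: measurable_consrV.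
- apply/trivIsetP => i j _ _ ij; rewrite -preimage_setI.
  by move/trivIsetP : tF => /(_ _ _ _ _ ij) ->//; rewrite preimage_set0.
- by rewrite -preimage_bigcup -[X in measurable X]setTI; exact: measurable_consrV.
Qed.

HB.instance Definition _ := isMeasure.Build _ _ _ lebesgue_consrV
  lebesgue_consrV0 lebesgue_consrV_ge0 lebesgue_consrV_sigma_additive.

Let lebesgue_consrV_sigma_finite : sigma_finite setT lebesgue_consrV.
Proof.
have /sigma_finiteP[F [TF ndF Foo]] := sigma_finiteT (@lebesgue_measure R).
have /sigma_finiteP[G [TG ndG Goo]] := sigma_finiteT mu.
exists (fun k => unconsrV @^-1` (F k `*` G k)).
  rewrite -preimage_bigcup -(preimage_setT unconsrV); congr (_ @^-1` _).
  rewrite -setXTT TF TG predeqE => -[x y]; split.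
    move=> [/= [k _ Fkx] [l _ Gly]]; exists (maxn k l) => //; split.
    - by move: x Fkx; exact/subsetPset/ndF/leq_maxl.
    - by move: y Gly; exact/subsetPset/ndG/leq_maxr.
  by move=> [k _ []/= ? ?]; split; exists k.
move=> k; have [mF Fk] := Foo k; have [mG Gk] := Goo k; split.
  by rewrite -[X in measurable X]setTI; apply: measurable_unconsrV => //;
    exact: measurableX.
rewrite /lebesgue_consrV /pushforward -comp_preimage.
rewrite (_ : _ \o _ = id); last by apply/funext => p; exact: consrVK.
by rewrite preimage_id product_measure1E// lte_mul_pinfty// ge0_fin_numE.
Qed.

HB.instance Definition _ := Measure_isSigmaFinite.Build _ _ _ lebesgue_consrV
  lebesgue_consrV_sigma_finite.

End lebesgue_rV_step.

(* Lebesgue measure on R^n. *)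
Fixpoint lebesgue_rV (R : realType) (n : nat) :
    {sigma_finite_measure set 'rV[R]_n -> \bar R} :=
  match n with
  | 0 => \d_(0 : 'rV[R]_0)
  | n'.+1 => lebesgue_consrV (lebesgue_rV R n')
  end.

Section hausdorff.
Variables (R : realType) (n k : nat).
Implicit Types (A U : set 'rV[R]_n) (delta : R).
Local Open Scope ereal_scope.

Definition ediam U : \bar R :=
  ereal_sup [set (enorm (x - y))%:E | x in U & y in U].

Definition unit_ball_volume : \bar R :=
  lebesgue_rV R k [set x | (enorm x <= 1)%R].

(* The empty set needs its own case: its [ediam] is -oo. *)
Definition hausdorff_weight U : \bar R :=
  if U == set0 then 0 else unit_ball_volume * (2^-1%:E * ediam U) ^+ k.

Definition hausdorff_delta delta A : \bar R :=
  ereal_inf [set \sum_(i <oo) hausdorff_weight (U i) | U in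
    [set U : (set 'rV[R]_n)^nat | A `<=` \bigcup_i U i /\
                                  forall i, ediam (U i) <= delta%:E]].

Definition hausdorff A : \bar R :=
  ereal_sup [set hausdorff_delta delta A | delta in [set delta | (0 < delta)%R]].

Let weight_ge0 U : 0 <= hausdorff_weight U.
Proof.
rewrite /hausdorff_weight; case: eqP => [//|/eqP/set0P[x Ux]].
apply: mule_ge0; first exact: measure_ge0.
apply: expe_ge0; apply: mule_ge0; first by rewrite lee_fin.
apply: ereal_sup_ubound; exists x => //; exists x => //.
by rewrite subrr /enorm /dotv big1 ?sqrtr0// => i _; rewrite mxE mul0r.
Qed.

(* [hausdorff_delta] as an outer measure generated by a weight that is +oo on
   the sets of diameter larger than delta. *)
Let pT : measurableType _ := g_sigma_algebraType [set: set 'rV[R]_n].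

Let weight delta (U : set pT) : \bar R :=
  if ediam U <= delta%:E then hausdorff_weight U else +oo.

Let weight0 delta : (0 < delta)%R -> weight delta set0 = 0.
Proof.
move=> d0; rewrite /weight /ediam image2E.
rewrite (_ : _ `*` _ = set0); last by rewrite setX0.
by rewrite image_set0 ereal_sup0 leNye /hausdorff_weight eqxx.
Qed.

Let weight_delta_ge0 delta U : 0 <= weight delta U.
Proof. by rewrite /weight; case: ifPn. Qed.

Let hausdorff_deltaE delta A : 
    hausdorff_delta delta A = @mu_ext _ pT R (weight delta) A.
Proof.
apply/eqP; rewrite eq_le; apply/andP; split.
  apply: le_ereal_inf_tmp => _ [U [_ AU] <-].
  have [Ud|/existsNP[i Ui]] := pselect (forall i, ediam (U i) <= delta%:E).
    apply: ereal_inf_lbound; exists U => //.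
    by apply: eq_eseriesr => i _; rewrite /weight Ud.
  rewrite (@eseries_pinfty _ _ xpredT i) ?leey//.
    by move=> m _; rewrite gt_eqF// (lt_le_trans _ (weight_delta_ge0 _ _)).
  by rewrite /weight; case: ifPn.
apply: le_ereal_inf_tmp => _ [U [AU Ud] <-].
apply: ereal_inf_lbound; exists U.
  by split => // i; exact: sub_sigma_algebra.
by apply: eq_eseriesr => i _; rewrite /weight Ud.
Qed.

Let hausdorff_ge A delta : (0 < delta)%R -> hausdorff_delta delta A <= hausdorff A.
Proof. by move=> d0; apply: ereal_sup_ubound; exists delta. Qed.

Let hausdorff_ge0 A : 0 <= hausdorff A.
Proof.
apply: le_trans (hausdorff_ge A ltr01).
by rewrite hausdorff_deltaE; exact/mu_ext_ge0/weight_delta_ge0.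
Qed.

Let hausdorff0 : hausdorff set0 = 0.
Proof.
apply/eqP; rewrite eq_le hausdorff_ge0 andbT.
apply: ge_ereal_sup => _ [delta d0 <-].
by rewrite hausdorff_deltaE mu_ext0//; exact: weight0.
Qed.

Let le_hausdorff : {homo hausdorff : A B / A `<=` B >-> A <= B}.
Proof.
move=> A B AB; apply: ge_ereal_sup => _ [delta d0 <-].
apply: le_trans (hausdorff_ge B d0).
by rewrite !hausdorff_deltaE; exact: le_mu_ext.
Qed.

Let hausdorff_sigma_subadditive : sigma_subadditive hausdorff.
Proof.
move=> F; apply: ge_ereal_sup => _ [delta d0 <-]; rewrite hausdorff_deltaE.
apply: (@le_trans _ _ (\sum_(i <oo) @mu_ext _ pT R (weight delta) (F i))).
  exact: (@mu_ext_sigma_subadditive _ pT R _ (@weight_delta_ge0 delta) F).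
apply: lee_nneseries => i _.
  by move=> _; exact: (@mu_ext_ge0 _ pT R _ (@weight_delta_ge0 delta)).
by rewrite -hausdorff_deltaE; exact: hausdorff_ge.
Qed.

HB.instance Definition _ := isOuterMeasure.Build R 'rV[R]_n hausdorff
  hausdorff0 hausdorff_ge0 le_hausdorff hausdorff_sigma_subadditive.

Definition hausdorff_outer : {outer_measure set 'rV[R]_n -> \bar R} :=
  hausdorff.

(* k-dimensional Hausdorff measure on R^n, on its Caratheodory measurable
   sets. *)
Definition hausdorff_measure :
    {measure set (caratheodory_type hausdorff_outer) -> \bar R} :=
  hausdorff_outer.

End hausdorff.

Definition hessian (R : realType) (n : nat) (f : 'rV[R]_n -> R) (p : 'rV[R]_n) :
    'M[R]_n :=
  \matrix_(i, j) 'D_(delta_mx 0 i) ('D_(delta_mx 0 j) f) p.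

Definition holder (R : realType) (n : nat) (alpha : R) (f : 'rV[R]_n -> R) :
    Prop :=
  exists L : R, forall x y, `|f x - f y| <= L * enorm (x - y) `^ alpha.

Definition C2holder_on (R : realType) (n : nat) (alpha : R)
    (U : set 'rV[R]_n) (f : 'rV[R]_n -> R) : Prop :=
  [/\ forall y, U y -> differentiable f y,
      forall i y, U y -> differentiable ('D_(delta_mx 0 i) f) y &
      exists L : R, forall i j y y', U y -> U y' ->
        `|hessian f y i j - hessian f y' i j| <= L * enorm (y - y') `^ alpha].

Definition boundary (T : topologicalType) (E : set T) : set T :=
  closure E `\` interior E.

(* Near each of its boundary points, E is, up to a relabelling and a reflection
   of the coordinate axes, the region on one side of a C^{2,alpha} graph over
   the other coordinates. Points on the graph itself may or may not belong to
   E, so that E is not required to be open or closed. *)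
Definition C2holder_boundary (R : realType) (d : nat) (alpha : R)
    (E : set 'rV[R]_d) : Prop :=
  forall x0, boundary E x0 ->
    exists (j : 'I_d) (s : bool) (gamma : 'rV[R]_d.-1 -> R) (U : set 'rV[R]_d.-1),
      [/\ open_nbhs (col' j x0) U, C2holder_on alpha U gamma &
          nbhs x0 [set x : 'rV[R]_d |
            ((-1) ^+ s * x 0 j < gamma (col' j x) -> E x) /\
            (gamma (col' j x) < (-1) ^+ s * x 0 j -> ~ E x)]].

Section geometry.
Variables (R : realType) (d : nat).
Implicit Types (E : set 'rV[R]_d) (x nu : 'rV[R]_d) (K : 'rV[R]_d -> R) (h : R).

(* nu is a unit vector, orthogonal to the tangent space of the boundary at x
   (the secants of the boundary at x make an angle tending to pi/2 with nu), and
   points out of E. *)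
Definition is_outer_unit_normal E x nu : Prop :=
  [/\ enorm nu = 1,
      forall e : R, 0 < e -> \forall y \near x, boundary E y ->
        `|dotv (y - x) nu| <= e * enorm (y - x) &
      \forall t \near (0 : R)^'+, ~ E (x + t *: nu)].

Definition outer_unit_normal E x : 'rV[R]_d :=
  xget 0 [set nu | is_outer_unit_normal E x nu].

(* The matrix L (acting on row vectors on the right) represents, on tangent
   vectors, the differential at x of the restriction of f to the hypersurface
   M. *)
Definition is_tangential_differential (M : set 'rV[R]_d)
    (f : 'rV[R]_d -> 'rV[R]_d) x (L : 'M[R]_d) : Prop :=
  forall e : R, 0 < e -> \forall y \near x, M y ->
    enorm (f y - f x - (y - x) *m L) <= e * enorm (y - x).

(* kt.1 are the principal curvatures and kt.2 the principal directions. *)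
Definition is_principal_frame E x
    (kt : ('I_d.-1 -> R) * ('I_d.-1 -> 'rV[R]_d)) : Prop :=
  [/\ forall i j, dotv (kt.2 i) (kt.2 j) = (i == j)%:R,
      forall i, dotv (kt.2 i) (outer_unit_normal E x) = 0 &
      exists2 L : 'M[R]_d,
        is_tangential_differential (boundary E) (outer_unit_normal E) x L &
        forall i, kt.2 i *m L = kt.1 i *: kt.2 i].

Definition principal_frame E x : ('I_d.-1 -> R) * ('I_d.-1 -> 'rV[R]_d) :=
  xget (fun=> 0, fun=> 0) [set kt | is_principal_frame E x kt].

Definition suitable_kernel K : Prop :=
  [/\ forall x, 0 <= K x, forall x, K (- x) = K x &
      (\int[lebesgue_rV R d]_x (K x)%:E = 1)%E].

Definition rescaled_kernel K h : 'rV[R]_d -> R :=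
  fun x => h `^ (- (d%:R / 2)) * K ((Num.sqrt h)^-1 *: x).

Definition inv_mobility K nu : R :=
  2 * \int[hausdorff_measure R d d.-1]_(x in [set x | dotv x nu = 0]) K x.

Definition surface_tension K (p : 'rV[R]_d) : R :=
  2^-1 * \int[lebesgue_rV R d]_x (`|dotv p x| * K x).

Definition aniso_mean_curvature K E x : R :=
  let kt := principal_frame E x in
  let D2sigma := hessian (surface_tension K) (outer_unit_normal E x) in
  \sum_(i < d.-1) kt.1 i * dotv (kt.2 i) (kt.2 i *m D2sigma).

Definition convolution (f g : 'rV[R]_d -> R) x : R :=
  \int[lebesgue_rV R d]_y (f (x - y) * g y).

Definition thresholded_set K h E : set 'rV[R]_d :=
  [set x | 2^-1 < convolution (rescaled_kernel K h) \1_E x].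

(* Extended-real valued: a priori the supremum may be -oo and the infimum +oo.
   Since [0 * +oo = 0 * -oo = 0] in [\bar R], the product with a vanishing
   inverse mobility is 0. *)
Definition normal_displacement K h E x : \bar R :=
  let nu := outer_unit_normal E x in
  let E1 := thresholded_set K h E in
  if `[< E1 x >]
  then ereal_inf [set l%:E | l in [set l : R | 0 <= l /\ ~ E1 (x + l *: nu)]]
  else ereal_sup [set l%:E | l in [set l : R | l <= 0 /\ E1 (x + l *: nu)]].

Definition compactly_supported_holder_kernel alpha K : Prop :=
  compact (closure [set x | K x != 0]) /\ holder alpha K.

(* The bounds involve negative powers of |x| and of min(|x|, |y|), which are
   +oo at 0 (whereas [0 `^ a = 0]): they are void there. *)
Definition decaying_lipschitz_kernel K : Prop :=
  holder 1 K /\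
  exists C eps delta : R,
    [/\ [/\ 0 < C, 0 < eps & 0 < delta],
        forall x, x != 0 -> `|K x| <= C * enorm x `^ (- (d%:R + 2 + eps)),
        forall x y, x != 0 -> y != 0 ->
          `|K x - K y| <=
            C * Num.min (enorm x) (enorm y) `^ (- (d%:R + 3 + delta)) *
            enorm (x - y) &
        forall nu, enorm nu = 1 -> 0 < inv_mobility K nu].

End geometry.

(* Main.v *)
From HB Require Import structures.
Require Import Defs.
From mathcomp Require Import all_boot all_order all_algebra.
From mathcomp Require Import all_classical all_reals all_analysis.
From mathcomp Require Import measurable_realfun lra ring zify.

(** Write eps = sqrt h and f(l) = (K_h * 1_E)(x + l nu) for a boundary point x of
    E with outer normal nu. In the variable u = (y - x - l nu) / eps the number
    f(l) is the integral of K over a rescaled copy of E. The boundary of E is,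
    uniformly in x, a paraboloid b up to an error of order 2 + alpha
    ([uniform_boundary_paraboloid]), so this copy is the region
    s < eps b(y) - l / eps + O(eps^(1+alpha)), where s and y are the components
    of u along nu and along the hyperplane orthogonal to nu; the part of K far
    away carries mass O(eps^2) ([far_mass]).

    By evenness the half space s < 0 carries half of the mass of K ([half_mass]),
    and by Hölder continuity of K a thin band along the hyperplane carries the
    integral over the hyperplane of its thickness times K, up to higher order
    ([band_expansion]). The constant part of the thickness integrates to a
    multiple of 1 / mu. The quadratic part gives the curvature: D^2 sigma(nu) is
    the matrix of second moments of K on the hyperplane
    ([hessian_surface_tension]), and the principal frame diagonalises the
    paraboloid ([aniso_mean_curvatureE]). Altogether ([convolution_expansion])
    f(l) = 1/2 - (eps H + (l / eps) / mu) / 2 + O(eps^(1+alpha)) for |l| <= A h.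

    The displacement z is the first crossing of the level 1/2 along the normal.
    As soon as a crossing is known to occur for |l| <= A h, the expansion on both
    sides of z yields |h H + z / mu| <= C eps^(2+alpha) = C h^(1+alpha/2)
    ([first_crossing], [displacement_expansion]). It remains to trap the crossing
    in |l| <= A h. For a decaying kernel 1 / mu has a positive lower bound, by
    compactness of the sphere, and the linear term of the expansion dominates the
    others ([crossing_trapped_mobility]). For a kernel of bounded support only the
    part of E near x counts: seen from x + A h nu it lies inside a half space of
    mass 1/2, and seen from x - A h nu it contains a half space pushed outwards,
    of mass above 1/2 if 1 / mu > 0 ([crossing_trapped_support]). If 1 / mu = 0,
    then K vanishes on the whole hyperplane, so that H = 0 too.

    The mobility is an integral against Hausdorff measure. To compute it, the
    (d-1)-dimensional Hausdorff measure of a hyperplane is identified with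
    Lebesgue measure ([ge0_integral_hyperplane]); the normalisation rests on the
    isodiametric inequality, deduced here from the Prekopa-Leindler inequality. *)

Set Implicit Arguments.
Unset Strict Implicit.
Unset Printing Implicit Defensive.

Import Order.TTheory GRing.Theory Num.Theory.
Import numFieldNormedType.Exports.
Local Open Scope classical_set_scope.
Local Open Scope ring_scope.

(** * Euclidean geometry of row vectors *)

Section euclid.
Context {R : realType} {n : nat}.
Implicit Types (x y z : 'rV[R]_n) (a : R).

Lemma dotvE x y : dotv x y = (x *m y^T) 0 0.
Proof. by rewrite mxE; apply: eq_bigr => i _; rewrite mxE. Qed.

Lemma dotvC x y : dotv x y = dotv y x.
Proof. by apply: eq_bigr => i _; rewrite mulrC. Qed.

Lemma dotvDl x y z : dotv (x + y) z = dotv x z + dotv y z.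
Proof. by rewrite !dotvE mulmxDl mxE. Qed.

Lemma dotvDr x y z : dotv z (x + y) = dotv z x + dotv z y.
Proof. by rewrite dotvC dotvDl !(dotvC z). Qed.

Lemma dotvZl a x y : dotv (a *: x) y = a * dotv x y.
Proof. by rewrite !dotvE -scalemxAl mxE. Qed.

Lemma dotvZr a x y : dotv x (a *: y) = a * dotv x y.
Proof. by rewrite dotvC dotvZl dotvC. Qed.

Lemma dotvNl x y : dotv (- x) y = - dotv x y.
Proof. by rewrite -scaleN1r dotvZl mulN1r. Qed.

Lemma dotvNr x y : dotv x (- y) = - dotv x y.
Proof. by rewrite dotvC dotvNl dotvC. Qed.

Lemma dotvBl x y z : dotv (x - y) z = dotv x z - dotv y z.
Proof. by rewrite dotvDl dotvNl. Qed.

Lemma dotvBr x y z : dotv z (x - y) = dotv z x - dotv z y.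
Proof. by rewrite dotvDr dotvNr. Qed.

Lemma dot0v x : dotv 0 x = 0.
Proof. by rewrite -(scale0r x) dotvZl mul0r. Qed.

Lemma dotv0 x : dotv x 0 = 0.
Proof. by rewrite dotvC dot0v. Qed.

Lemma dotvv_ge0 x : 0 <= dotv x x.
Proof. by apply: sumr_ge0 => i _; rewrite -expr2 sqr_ge0. Qed.

Lemma enorm_ge0 x : 0 <= enorm x.
Proof. exact: sqrtr_ge0. Qed.

Lemma sqr_enorm x : enorm x ^+ 2 = dotv x x.
Proof. by rewrite sqr_sqrtr// dotvv_ge0. Qed.

Lemma enorm0 : enorm (0 : 'rV[R]_n) = 0.
Proof. by rewrite /enorm dot0v sqrtr0. Qed.

Lemma enormZ a x : enorm (a *: x) = `|a| * enorm x.
Proof. by rewrite /enorm dotvZl dotvZr mulrA -expr2 sqrtrM ?sqr_ge0// sqrtr_sqr. Qed.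

Lemma enormN x : enorm (- x) = enorm x.
Proof. by rewrite -scaleN1r enormZ normrN1 mul1r. Qed.

Lemma enormB x y : enorm (x - y) = enorm (y - x).
Proof. by rewrite -opprB enormN. Qed.

Lemma coord_le_enorm x i : `|x 0 i| <= enorm x.
Proof.
rewrite -sqrtr_sqr; apply: ler_wsqrtr.
rewrite /dotv (bigD1 i)//= expr2 lerDl.
by apply: sumr_ge0 => j _; rewrite -expr2 sqr_ge0.
Qed.

Lemma enorm_eq0 x : (enorm x == 0) = (x == 0).
Proof.
apply/eqP/eqP => [x0|->]; last exact: enorm0.
apply/rowP => i; rewrite mxE; apply/eqP.
by rewrite -normr_le0 -x0 coord_le_enorm.
Qed.

Lemma enorm_gt0 x : (0 < enorm x) = (x != 0).
Proof. by rewrite lt_neqAle enorm_ge0 andbT eq_sym enorm_eq0. Qed.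

Lemma cauchy_schwarz x y : `|dotv x y| <= enorm x * enorm y.
Proof.
rewrite -sqrtrM ?dotvv_ge0// -sqrtr_sqr; apply: ler_wsqrtr.
have [->|y0] := eqVneq y 0; first by rewrite !dotv0 expr0n mulr0.
have yy : 0 < dotv y y by rewrite -sqr_enorm exprn_gt0// enorm_gt0.
have := dotvv_ge0 (dotv y y *: x - dotv x y *: y).
rewrite dotvBl !dotvBr !dotvZl !dotvZr (dotvC y x).
rewrite (_ : _ - _ = dotv y y * (dotv x x * dotv y y - dotv x y ^+ 2)); last by ring.
by rewrite pmulr_rge0// subr_ge0.
Qed.

Lemma ler_enormD x y : enorm (x + y) <= enorm x + enorm y.
Proof.
rewrite -(ler_pXn2r (ltn0Sn 1)) ?nnegrE ?addr_ge0 ?enorm_ge0//.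
rewrite sqrrD !sqr_enorm dotvDl !dotvDr (dotvC y x).
by have := le_trans (ler_norm _) (cauchy_schwarz x y); lra.
Qed.

Lemma ler_enormB x y : enorm (x - y) <= enorm x + enorm y.
Proof. by rewrite -(enormN y) ler_enormD. Qed.

Lemma enorm_sup x : enorm x <= Num.sqrt n%:R * `|x|.
Proof.
rewrite -[`|x|]normr_id -sqrtr_sqr -sqrtrM ?ler0n//; apply: ler_wsqrtr.
have -> : n%:R * `|x| ^+ 2 = \sum_(i < n) `|x| ^+ 2.
  by rewrite sumr_const card_ord mulr_natl.
apply: ler_sum => i _; rewrite -expr2 -real_normK ?num_real//.
rewrite ler_pXn2r ?nnegrE//.
rewrite [leRHS]/Num.Def.normr /= mx_normrE.
by apply/bigmax_geP; right => /=; exists (0, i).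
Qed.

Lemma sup_enorm x : `|x| <= enorm x.
Proof.
rewrite [leLHS]/Num.Def.normr /= mx_normrE; apply/bigmax_leP; split => [|[i j] _] /=.
  exact: enorm_ge0.
by rewrite ord1 coord_le_enorm.
Qed.

Lemma dotv_enorm1 x : enorm x = 1 -> dotv x x = 1.
Proof. by move=> x1; rewrite -sqr_enorm x1 expr1n. Qed.

Lemma dotv_delta x i : dotv x (delta_mx 0 i) = x 0 i.
Proof.
rewrite /dotv (bigD1 i)//= big1 ?addr0 => [|j ji]; rewrite mxE ?eqxx ?mulr1//=.
by rewrite (negbTE ji) mulr0.
Qed.

Lemma enorm_delta i : enorm (delta_mx 0 i : 'rV[R]_n) = 1.
Proof. by rewrite /enorm dotv_delta mxE !eqxx sqrtr1. Qed.

End euclid.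

Section isometries.
Context {R : realType}.

Lemma dotv_mulmx n m (x : 'rV[R]_n) (A : 'M[R]_(n, m)) (y : 'rV_m) :
  dotv (x *m A) y = dotv x (y *m A^T).
Proof. by rewrite !dotvE trmx_mul trmxK mulmxA. Qed.

Lemma dotv_isometry n m (J : 'M[R]_(n, m)) x y :
  J *m J^T = 1%:M -> dotv (x *m J) (y *m J) = dotv x y.
Proof. by move=> JJ; rewrite dotv_mulmx -mulmxA JJ mulmx1. Qed.

Lemma enorm_isometry n m (J : 'M[R]_(n, m)) x :
  J *m J^T = 1%:M -> enorm (x *m J) = enorm x.
Proof. by move=> JJ; rewrite /enorm dotv_isometry. Qed.

(** The reflection across the hyperplane orthogonal to v. *)
Definition householder n (v : 'rV[R]_n) : 'M[R]_n :=
  1%:M - (2 / dotv v v) *: (v^T *m v).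

Lemma mul_householder n (v x : 'rV[R]_n) :
  x *m householder v = x - (2 * dotv x v / dotv v v) *: v.
Proof.
rewrite mulmxBr mulmx1 -scalemxAr mulmxA [x *m v^T]mx11_scalar -dotvE.
by rewrite mul_scalar_mx scalerA mulrAC.
Qed.

Lemma householder_tr n (v : 'rV[R]_n) : (householder v)^T = householder v.
Proof. by rewrite linearB linearZ /= trmx1 trmx_mul trmxK. Qed.

Lemma householder_unitary n (v : 'rV[R]_n) : v != 0 ->
  householder v *m (householder v)^T = 1%:M.
Proof.
move=> v0; have vv : dotv v v != 0 by rewrite -sqr_enorm expf_neq0 ?enorm_eq0.
apply/row_matrixP => i; rewrite row_mul householder_tr rowE mul_householder.
rewrite mul_householder row1 dotvBl dotvZl mulrBr.
rewrite divfK// -addrA -opprD -scalerDl -mulrDl (_ : 2 * _ + _ = 0); last by ring.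
by rewrite mul0r scale0r subr0.
Qed.

(** The reflection exchanging v and the first basis vector is an orthogonal
    matrix whose first row is v; J consists of the other rows. *)
Lemma orthonormal_completion n (v : 'rV[R]_n.+1) : enorm v = 1 ->
  exists J : 'M[R]_(n, n.+1), [/\ J *m J^T = 1%:M, v *m J^T = 0 &
    col_mx v J *m (col_mx v J)^T = 1%:M].
Proof.
move=> v1; have vv := dotv_enorm1 v1.
have [Q [QQ vQ]] : exists Q : 'M[R]_(1 + n), Q *m Q^T = 1%:M /\ usubmx Q = v; last first.
  exists (dsubmx Q); rewrite -vQ vsubmxK; split => //.
    move: QQ; rewrite -{1 2}(vsubmxK Q) tr_col_mx mul_col_row.
    rewrite (@scalar_mx_block _ 1 n) => E; have [_ _ _ E4] := eq_block_mx E.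
    exact: E4.
  move: QQ; rewrite -{1 2}(vsubmxK Q) tr_col_mx mul_col_row.
  rewrite (@scalar_mx_block _ 1 n) => E; have [_ E2 _ _] := eq_block_mx E.
  exact: E2.
pose e : 'rV[R]_(1 + n) := delta_mx 0 0.
have rowO (O : 'M[R]_(1 + n)) : usubmx O = e *m O.
  rewrite -rowE; apply/rowP => j; rewrite !mxE; congr (O _ _); exact/val_inj.
have [ve|ve] := eqVneq v e.
  by exists 1%:M; rewrite mul1mx trmx1; split => //; rewrite rowO mulmx1 ve.
exists (householder (e - v)); split; first by rewrite householder_unitary// subr_eq0 eq_sym.
rewrite rowO mul_householder.
have ee : dotv e e = 1 by apply: dotv_enorm1; exact: enorm_delta.
rewrite dotvBl !dotvBr ee vv (dotvC v e).
rewrite (_ : 2 * (1 - dotv e v) / _ = 1).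
  by rewrite scale1r opprB addrC subrK.
rewrite (_ : 2 * _ = 1 - dotv e v - (dotv e v - 1)); last by ring.
apply: divff; rewrite (_ : _ - _ = dotv (e - v) (e - v)).
  by rewrite -sqr_enorm expf_neq0// enorm_eq0 subr_eq0 eq_sym.
by rewrite dotvBl !dotvBr ee vv (dotvC v e).
Qed.

End isometries.

(** * Topology and Borel sets *)

Section topology_rV.
Context {R : realType} {n : nat}.
Implicit Types (x y : 'rV[R]_n) (A : set 'rV[R]_n).

Lemma nbhs_enormP x A :
  nbhs x A <-> exists2 e : R, 0 < e & forall y, enorm (y - x) < e -> A y.
Proof.
split=> [/nbhs_normP[e /= e0 eA]|[e e0 eA]].
  exists e => // y yx; apply: eA => /=; rewrite /ball_/= distrC.
  exact: le_lt_trans (sup_enorm _) yx.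
have s0 : 0 < Num.sqrt n%:R + 1 :> R by rewrite ltr_wpDl// sqrtr_ge0.
apply/nbhs_ballP; exists (e / (Num.sqrt n%:R + 1)); first by rewrite /= divr_gt0.
move=> y /=; rewrite mx_norm_ball /ball_/= distrC ltr_pdivlMr// => yx; apply: eA.
apply: le_lt_trans (enorm_sup _) (le_lt_trans _ yx).
by rewrite mulrC ler_wpM2l// lerDl.
Qed.

Lemma continuous_enormP (f : 'rV[R]_n -> R) :
  (forall x e, 0 < e -> exists2 r, 0 < r &
    forall y, enorm (y - x) < r -> `|f y - f x| < e) -> continuous f.
Proof.
move=> H x; apply/(@cvgrPdist_lt _ _ _ _ (nbhs_filter (x : 'rV[R]_n))) => e e0.
by apply/nbhs_enormP; have [r r0 xr] := H x e e0; exists r => // y /xr; rewrite distrC.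
Qed.

Lemma continuous_dotv v : continuous (fun x : 'rV[R]_n => dotv x v).
Proof.
apply: continuous_enormP => x e e0.
have v0 : 0 < enorm v + 1 by rewrite ltr_wpDl// enorm_ge0.
exists (e / (enorm v + 1)); first by rewrite divr_gt0.
move=> y; rewrite ltr_pdivlMr// => yx.
rewrite -dotvBl (le_lt_trans (cauchy_schwarz _ _))//.
by apply: le_lt_trans yx; rewrite ler_wpM2l ?enorm_ge0// lerDl.
Qed.

Lemma ler_dist_enorm x y : `|enorm x - enorm y| <= enorm (x - y).
Proof.
rewrite ler_norml lerBlDr lerBrDr addrC lerBlDr; apply/andP; split.
  by have := ler_enormD (y - x) x; rewrite subrK (enormB y); lra.
by rewrite -{1}(subrK y x); exact: ler_enormD.
Qed.

Lemma continuous_enorm : continuous (@enorm R n).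
Proof.
apply: continuous_enormP => x e e0; exists e => // y.
exact/le_lt_trans/ler_dist_enorm.
Qed.

(** An open set is the union of the countably many boxes with rational center
    and radius 1/m that it contains. *)
Lemma open_measurable_rV A : open A -> measurable A.
Proof.
move=> oA.
pose box (p : 'rV[rat]_n * nat) : set 'rV[R]_n :=
  [set x | forall i, `|x 0 i - ratr (p.1 0 i)| < p.2.+1%:R^-1].
have mbox p : measurable (box p).
  rewrite (_ : box p = \bigcap_(i in [set: 'I_n])
      ((fun x : 'rV[R]_n => x 0 i : measurableTypeR R) @^-1`
        ball (ratr (p.1 0 i) : R) p.2.+1%:R^-1)); last first.
    apply/seteqP; split => [x xp i _|x xp i] /=.
      by rewrite /ball/= distrC; exact: xp.
    by have := xp i I; rewrite /= /ball/= distrC.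
  apply: fin_bigcap_measurable => // i _.
  rewrite -[X in measurable X]setTI; apply: measurable_coord => //.
  exact: measurable_ball.
have -> : A = \bigcup_(p in [set: 'rV[rat]_n * nat])
    (if `[< box p `<=` A >] then box p else set0).
  apply/seteqP; split => [x Ax|x [p _]]; last by case: asboolP => // pA /pA.
  have /nbhs_normP[e /= e0 eA] : nbhs x A by exact: open_nbhs_nbhs.
  have [m me] : exists m, m.+1%:R^-1 < e / 2.
    have [m _ me] := @near_infty_natSinv_lt R (PosNum (divr_gt0 e0 (ltr0n _ 2))).
    by exists m; apply: me => /=.
  have m0 : 0 < m.+1%:R^-1 :> R by rewrite invr_gt0.
  have /choice[q xq] : forall i, exists q : rat, `|x 0 i - ratr q| < m.+1%:R^-1.
    move=> i; have [q] := @rat_in_itvoo R (x 0 i - m.+1%:R^-1) (x 0 i + m.+1%:R^-1)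
      ltac:(by rewrite ltrD2l (lt_trans _ m0)// oppr_lt0).
    rewrite in_itv /= => /andP[q1 q2]; exists q.
    by move: q1 q2; move: (_^-1) => t q1 q2; rewrite ltr_norml; apply/andP; split; lra.
  exists (\row_i q i, m) => //.
  case: asboolP => [_ i|]; first by rewrite mxE.
  case=> y yq; apply: eA; rewrite /ball_/= [X in X < _]/Num.Def.normr/= mx_normrE.
  apply/bigmax_ltP; split => // -[i0 i] _ /=; rewrite (ord1 i0) !mxE.
  have := yq i; rewrite mxE /= => yqi; have xqi := xq i.
  rewrite (_ : _ - _ = (x 0 i - ratr (q i)) - (y 0 i - ratr (q i))); last by ring.
  move: yqi xqi me; move: (_^-1) => t yqi xqi me.
  by rewrite (le_lt_trans (ler_normB _ _))//; lra.
apply: countable_bigcupT_measurable; first exact: countableP.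
by move=> p; case: asboolP => // _; exact: measurable0.
Qed.

Lemma closed_measurable_rV A : closed A -> measurable A.
Proof.
by move=> cA; rewrite -(setCK A); apply/measurableC; apply: open_measurable_rV; exact: closed_openC.
Qed.

Lemma continuous_measurable_rV (f : 'rV[R]_n -> R) :
  continuous f -> measurable_fun setT f.
Proof.
move=> /continuousP cf; apply: (measurability _ (RGenOpens.measurableE R)).
move=> _ [_ [a [b ->] <-]]; rewrite setTI; apply: open_measurable_rV.
exact/cf/interval_open.
Qed.

Lemma measurable_enorm : measurable_fun setT (@enorm R n).
Proof. apply: continuous_measurable_rV; exact: continuous_enorm. Qed.

Lemma measurable_dotv v : measurable_fun setT (fun x : 'rV[R]_n => dotv x v).
Proof. apply: continuous_measurable_rV; exact: continuous_dotv. Qed.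

Lemma measurable_mulmx m (A : 'M[R]_(n, m)) :
  measurable_fun setT (fun x : 'rV[R]_n => x *m A).
Proof.
apply: measurable_fun_rV => i.
rewrite (_ : (fun _ => _) = (fun x : 'rV_n => dotv x (col i A)^T)).
  exact: measurable_dotv.
by apply/funext => x; rewrite mxE; apply: eq_bigr => j _; rewrite !mxE.
Qed.

Lemma measurable_addrV d (T : measurableType d) (f g : T -> 'rV[R]_n) :
  measurable_fun setT f -> measurable_fun setT g ->
  measurable_fun setT (fun t => f t + g t).
Proof.
move=> mf mg; apply: measurable_fun_rV => i.
rewrite (_ : (fun _ => _) = (fun t => f t 0 i + g t 0 i)); last first.
  by apply/funext => t; rewrite mxE.
apply: measurable_funD.
  exact: (measurableT_comp (@measurable_coord R n i) mf).
exact: (measurableT_comp (@measurable_coord R n i) mg).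
Qed.

Lemma measurable_scalerV d (T : measurableType d) (a : T -> R) (f : T -> 'rV[R]_n) :
  measurable_fun setT a -> measurable_fun setT f ->
  measurable_fun setT (fun t => a t *: f t).
Proof.
move=> ma mf; apply: measurable_fun_rV => i.
rewrite (_ : (fun _ => _) = (fun t => a t * f t 0 i)); last first.
  by apply/funext => t; rewrite mxE.
apply: measurable_funM => //.
exact: (measurableT_comp (@measurable_coord R n i) mf).
Qed.

Lemma measurable_opprV : measurable_fun setT (fun x : 'rV[R]_n => - x).
Proof.
rewrite (_ : (fun _ => _) = (fun x : 'rV[R]_n => (cst (- 1) x : R) *: x)); last first.
  by apply/funext => x; rewrite scaleN1r.
exact: measurable_scalerV.
Qed.

Lemma measurable_translation (v : 'rV[R]_n) :
  measurable_fun setT (fun x : 'rV[R]_n => x + v).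
Proof. exact: measurable_addrV. Qed.

End topology_rV.

Lemma measurable_consrV (R : realType) n : measurable_fun setT (@consrV R n).
Proof.
apply: measurable_fun_rV => i; case: (unliftP 0 i) => [j|] ->.
  rewrite (_ : (fun _ => _) =
      (fun x : 'rV[R]_n => x 0 j : measurableTypeR R) \o snd).
    by apply: measurableT_comp; [exact: measurable_coord|exact: measurable_snd].
  by apply/funext => p; rewrite /= mxE liftK.
rewrite (_ : (fun _ => _) = fst); first exact: measurable_fst.
by apply/funext => p; rewrite /= mxE unlift_none.
Qed.

(** * Lebesgue measure on row vectors *)

Section lebesgue_tonelli.
Context {R : realType}.
Local Open Scope ereal_scope.
Implicit Types n : nat.

Lemma measurable_comp_consrV n d (T : measurableType d) (f : 'rV[R]_n.+1 -> T) :
  measurable_fun setT f -> measurable_fun setT (f \o @consrV R n).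
Proof. by move=> mf; apply: measurableT_comp => //; exact: measurable_consrV. Qed.

Lemma ge0_integral_rVS n (f : 'rV[R]_n.+1 -> \bar R) :
  measurable_fun setT f -> (forall x, 0 <= f x) ->
  \int[lebesgue_rV R n.+1]_x f x =
  \int[@lebesgue_measure R]_t \int[lebesgue_rV R n]_x f (consrV (t, x)).
Proof.
move=> mf f0.
rewrite [LHS](ge0_integral_pushforward (@measurable_consrV R n))//.
by rewrite preimage_setT [LHS]fubini_tonelli1//; [exact: measurable_comp_consrV|move=> ?; exact: f0].
Qed.

Lemma ge0_integral_rVS_swap n (f : 'rV[R]_n.+1 -> \bar R) :
  measurable_fun setT f -> (forall x, 0 <= f x) ->
  \int[lebesgue_rV R n.+1]_x f x =
  \int[lebesgue_rV R n]_x \int[@lebesgue_measure R]_t f (consrV (t, x)).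
Proof.
move=> mf f0; rewrite ge0_integral_rVS//.
rewrite (@fubini_tonelli _ _ _ _ _ _ _ (f \o @consrV R n))//.
  exact: measurable_comp_consrV.
by move=> ?; exact: f0.
Qed.

Lemma measurable_integral_rVS n (f : 'rV[R]_n.+1 -> \bar R) :
  measurable_fun setT f -> (forall x, 0 <= f x) ->
  measurable_fun setT
    (fun t : measurableTypeR R => \int[lebesgue_rV R n]_x f (consrV (t, x))).
Proof.
move=> mf f0; apply: (@measurable_fun_fubini_tonelli_F _ _ _ _ _ _ (f \o @consrV R n)) => //.
  exact: measurable_comp_consrV.
by move=> ?; exact: f0.
Qed.

Lemma measurable_fun_translateR (a : R) :
  measurable_fun setT (fun t : measurableTypeR R => (t + a)%R : measurableTypeR R).
Proof. exact: measurable_funD. Qed.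

Lemma lebesgue_measure_translate (a : R) (A : set R) : measurable A ->
  lebesgue_measure ((fun t => (t + a)%R) @^-1` A) = lebesgue_measure A.
Proof.
move=> mA; have mt := measurable_fun_translateR a.
rewrite [LHS](_ : _ = pushforward (@lebesgue_measure R)
  (fun t : measurableTypeR R => (t + a)%R : measurableTypeR R) A)//.
apply/esym/(@lebesgue_measure_unique _ (pushforward (@lebesgue_measure R)
  (fun t : measurableTypeR R => (t + a)%R : measurableTypeR R))) => //=.
move=> _ [[b c]] _ <- /=; rewrite /pushforward.
rewrite (_ : _ @^-1` _ = `](b - a)%R, (c - a)%R]%classic).
  by rewrite !lebesgue_measure_itv/= !lte_fin ltrD2r -!EFinD; case: ifP => // _; congr EFin; lra.
by apply/seteqP; split => t /=; rewrite !in_itv /= => /andP[]; rewrite ltrBlDr lerBrDr => -> ->.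
Qed.

Lemma ge0_integral_translate_lebesgue (a : R) (f : R -> \bar R) :
  measurable_fun setT f -> (forall x, 0 <= f x) ->
  \int[@lebesgue_measure R]_t f (t + a)%R = \int[@lebesgue_measure R]_t f t.
Proof.
move=> mf f0.
have := @ge0_integral_pushforward _ _ _ _ R _ (measurable_fun_translateR a)
  (@lebesgue_measure R) setT f measurableT mf (fun x _ => f0 x).
rewrite preimage_setT => <-.
apply: eq_measure_integral; first exact: measurable_fun_translateR.
by move=> ? A mA _; exact: (@lebesgue_measure_translate a A mA).
Qed.

Lemma ge0_integral_translate n (v : 'rV[R]_n) (f : 'rV[R]_n -> \bar R) :
  measurable_fun setT f -> (forall x, 0 <= f x) ->
  \int[lebesgue_rV R n]_x f (x + v)%R = \int[lebesgue_rV R n]_x f x.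
Proof.
elim: n v f => [|n ih] v f mf f0.
  by apply: eq_integral => x _; congr f; rewrite [v]thinmx0 addr0.
rewrite !ge0_integral_rVS//; last exact: measurableT_comp (measurable_translation _).
pose w : 'rV[R]_n := (\row_j v 0 (lift 0 j))%R.
have addE t x : (consrV (t, x) + v = consrV ((t + v 0 0)%R, x + w))%R.
  apply/rowP => i; rewrite !mxE; case: (unliftP 0%R i) => [j|] -> /=.
    by rewrite !mxE.
  by [].
under eq_integral do under eq_integral do rewrite addE.
pose F t := \int[lebesgue_rV R n]_x f (consrV (t, x)).
transitivity (\int[@lebesgue_measure R]_t F (t + v 0 0)%R).
  apply: eq_integral => t _; apply: (ih w (fun x => f (consrV ((t + v 0 0)%R, x)))) => //.
  apply: (measurableT_comp (measurable_comp_consrV mf)).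
  exact: (measurable_pair1 _).
by apply: ge0_integral_translate_lebesgue;
  [exact: measurable_integral_rVS|move=> t; exact: integral_ge0].
Qed.

Lemma lebesgue_rV_translate n (v : 'rV[R]_n) (A : set 'rV[R]_n) : measurable A ->
  lebesgue_rV R n ((fun x => x + v)%R @^-1` A) = lebesgue_rV R n A.
Proof.
move=> mA; have mAv : measurable ((fun x => x + v)%R @^-1` A).
  by rewrite -[X in measurable X]setTI; exact: measurable_translation.
have E B : measurable B -> lebesgue_rV R n B = \int[lebesgue_rV R n]_x (\1_B x)%:E.
  by move=> mB; rewrite integral_indic// setIT.
rewrite !E//.
have := @ge0_integral_translate n v (fun x => (\1_A x)%:E).
by apply; [exact/measurable_EFinP/measurable_indic|move=> x; rewrite lee_fin].
Qed.

End lebesgue_tonelli.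

Section sigma_finite_copy.
Context d (T : measurableType d) (R : realType).
Variables (nu : {measure set T -> \bar R}) (sf : sigma_finite setT nu).

Definition sigma_finite_copy & sigma_finite setT nu : set T -> \bar R := nu.

HB.instance Definition _ := Measure.copy (sigma_finite_copy sf) nu.
HB.instance Definition _ := Measure_isSigmaFinite.Build _ _ _ (sigma_finite_copy sf) sf.

End sigma_finite_copy.

Section haar.
Context {R : realType} {n : nat}.
Local Open Scope ereal_scope.
Local Notation lam := (lebesgue_rV R n).

Lemma ge0_integral_invariant (nu : {measure set 'rV[R]_n -> \bar R}) (v : 'rV[R]_n)
    (f : 'rV[R]_n -> \bar R) :
  (forall A, measurable A -> nu ((fun x => x + v)%R @^-1` A) = nu A) ->
  measurable_fun setT f -> (forall x, 0 <= f x) ->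
  \int[nu]_x f (x + v)%R = \int[nu]_x f x.
Proof.
move=> nuv mf f0.
have := @ge0_integral_pushforward _ _ _ _ R _ (measurable_translation v)
  nu setT f measurableT mf (fun x _ => f0 x).
rewrite preimage_setT => <-.
apply: eq_measure_integral; first exact: measurable_translation.
by move=> ? A mA _; exact: nuv.
Qed.

(** Weil's uniqueness argument: the double integral of 1_A(x+y) 1_B(y) against
    nu and Lebesgue measure is computed in two ways, translating once the first
    and once the second variable. *)
Lemma translation_invariant_unique (nu : {measure set 'rV[R]_n -> \bar R})
    (A B : set 'rV[R]_n) :
  sigma_finite setT nu ->
  (forall v (A : set 'rV[R]_n), measurable A -> nu ((fun x => x + v)%R @^-1` A) = nu A) ->
  measurable A -> measurable B -> (forall x, B (- x)%R <-> B x) ->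
  nu A * lam B = lam A * nu B.
Proof.
move=> sf nuv mA mB BN.
pose nu' : {sigma_finite_measure set 'rV[R]_n -> \bar R} := sigma_finite_copy sf.
pose g (p : 'rV[R]_n * 'rV[R]_n) : \bar R := (\1_A (p.1 + p.2)%R * \1_B p.2)%:E.
have m1 (C : set 'rV[R]_n) : measurable C -> measurable_fun setT (fun x => (\1_C x)%:E : \bar R).
  by move=> mC; exact/measurable_EFinP/measurable_indic.
have i1 (C : set 'rV[R]_n) : measurable C -> \int[nu]_x (\1_C x)%:E = nu C.
  by move=> mC; rewrite integral_indic// setIT.
have i2 (C : set 'rV[R]_n) : measurable C -> \int[lam]_x (\1_C x)%:E = lam C.
  by move=> mC; rewrite integral_indic// setIT.
have mg : measurable_fun setT g.
  apply/measurable_EFinP; apply: measurable_funM.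
    apply: measurableT_comp; first exact: measurable_indic.
    by apply: measurable_addrV.
  by apply: measurableT_comp; first exact: measurable_indic.
have g0 x : 0 <= g x by rewrite lee_fin mulr_ge0.
have := @fubini_tonelli _ _ _ _ R nu' lam g mg g0.
have -> : \int[lam]_y \int[nu']_x g (x, y) = nu A * lam B.
  transitivity (\int[lam]_y (nu A * (\1_B y)%:E)).
    apply: eq_integral => y _; rewrite /g /=.
    under eq_integral do rewrite mulrC EFinM.
    rewrite ge0_integralZl//; last exact: (measurableT_comp (m1 _ mA) (measurable_translation y)).
    rewrite (ge0_integral_invariant (nuv y) (m1 _ mA)); last by move=> x; rewrite lee_fin.
    by rewrite i1// muleC.
  by rewrite ge0_integralZl ?i2//; exact: m1.
have -> : \int[nu']_x \int[lam]_y g (x, y) = lam A * nu B; last by [].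
transitivity (\int[nu']_x \int[lam]_y ((\1_A y)%:E * (\1_B (y - x)%R)%:E)).
  apply: eq_integral => x _.
  rewrite -[RHS](ge0_integral_translate x); last 2 first.
  - apply: emeasurable_funM; first exact: m1.
    exact: (measurableT_comp (m1 _ mB) (measurable_translation _)).
  - by move=> y; rewrite mule_ge0// lee_fin.
  by apply: eq_integral => y _; rewrite /g /= -EFinM addrK (addrC x).
rewrite (@fubini_tonelli _ _ _ _ R nu' lam
  (fun p : 'rV[R]_n * 'rV[R]_n => (\1_A p.2)%:E * (\1_B (p.2 - p.1)%R)%:E)); last 2 first.
- apply: emeasurable_funM; first exact: (measurableT_comp (m1 _ mA) (@measurable_snd _ _ _ _)).
  apply: (measurableT_comp (m1 _ mB)); apply: measurable_addrV => //.
  exact: (measurableT_comp measurable_opprV).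
- by move=> y; rewrite mule_ge0// lee_fin.
transitivity (\int[lam]_y (nu B * (\1_A y)%:E)).
  apply: eq_integral => y _ /=.
  have mByx : measurable_fun setT (fun x : 'rV[R]_n => (\1_B (y - x)%R)%:E : \bar R).
    apply: (measurableT_comp (m1 _ mB)); apply: measurable_addrV => //.
    exact: measurable_opprV.
  rewrite ge0_integralZl//.
  rewrite muleC; congr (_ * _).
  transitivity (\int[nu]_x (\1_B (x + - y)%R)%:E).
    apply: eq_integral => x _; congr EFin; rewrite !indicE.
    by congr (nat_of_bool _)%:R; apply/idP/idP; rewrite !inE -[(y - x)%R]opprB => /BN.
  rewrite (ge0_integral_invariant (nuv _) (m1 _ mB)) ?i1//.
by rewrite ge0_integralZl ?i2 1?muleC//; exact: m1.
Qed.

End haar.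

Section cubes_and_balls.
Context {R : realType}.
Local Open Scope ereal_scope.

Definition rV_cube n (r : R) : set 'rV[R]_n := [set x | forall i, `|x 0 i| <= r]%R.

Definition rV_ball n (r : R) : set 'rV[R]_n := [set x | enorm x <= r]%R.

Lemma measurable_rV_cube n r : measurable (@rV_cube n r).
Proof.
rewrite (_ : rV_cube r = \bigcap_(i in [set: 'I_n])
      ((fun x : 'rV[R]_n => x 0%R i : measurableTypeR R) @^-1` `[(- r)%R, r]%classic)); last first.
  apply/seteqP; split => [x xp i _|x xp i] /=.
    by rewrite in_itv /= -ler_norml; exact: xp.
  by have := xp i I; rewrite /= in_itv /= -ler_norml.
apply: fin_bigcap_measurable => // i _.
by rewrite -[X in measurable X]setTI; exact: measurable_coord.
Qed.

Lemma measurable_rV_ball n r : measurable (@rV_ball n r).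
Proof.
rewrite (_ : rV_ball r = @enorm R n @^-1` `]-oo, r]%classic); last first.
  by apply/seteqP; split => x /=; rewrite in_itv.
by rewrite -[X in measurable X]setTI; exact: measurable_enorm.
Qed.

Lemma lebesgue_rV_cube n r : (0 <= r)%R ->
  lebesgue_rV R n (rV_cube r) = ((2 * r) ^+ n)%:E.
Proof.
move=> r0; elim: n => [|n ih].
  rewrite expr0 /= diracE mem_set//.
  by move=> [].
have i2 m (C : set 'rV[R]_m) : measurable C ->
    lebesgue_rV R m C = \int[lebesgue_rV R m]_x (\1_C x)%:E.
  by move=> mC; rewrite integral_indic// setIT.
have mC := @measurable_rV_cube n.+1 r.
rewrite i2// ge0_integral_rVS; last 2 first.
- exact/measurable_EFinP/measurable_indic.
- by move=> x; rewrite lee_fin.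
transitivity (\int[@lebesgue_measure R]_t ((2 * r) ^+ n * \1_(`[(- r)%R, r]%classic) t)%:E).
  apply: eq_integral => t _.
  rewrite EFinM -ih muleC i2; last exact: measurable_rV_cube.
  rewrite -(@ge0_integralZl _ _ _ (lebesgue_rV R n) setT measurableT (fun x => (\1_(@rV_cube n r) x)%:E))//; last first.
    by apply/measurable_EFinP; apply: measurable_indic; exact: measurable_rV_cube.
  apply: eq_integral => x _; rewrite -EFinM; congr EFin.
  rewrite !indicE -natrM mulnb; congr (nat_of_bool _)%:R; apply/idP/andP; rewrite !inE.
    move=> H; split; first by have := H 0%R; rewrite mxE unlift_none /= in_itv/= ler_norml.
    by move=> i; have := H (lift 0%R i); rewrite mxE liftK.
  move=> [tr xr] i; rewrite mxE; case: (unliftP 0%R i) => [j|] _ /=; first exact: xr.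
  by move: tr; rewrite /= in_itv /= ler_norml.
under eq_integral do rewrite EFinM.
rewrite ge0_integralZl//=; last 2 first.
- by apply/(@measurable_EFinP _ (measurableTypeR R) R setT); exact: measurable_indic.
- by rewrite lee_fin exprn_ge0// mulr_ge0.
have -> : \int[@lebesgue_measure R]_t (\1_(`[(- r)%R, r]%classic) t)%:E =
    lebesgue_measure (`[(- r)%R, r]%classic : set R) by rewrite integral_indic// setIT.
rewrite lebesgue_measure_itv/= lte_fin.
case: ifPn => [_|]; first by rewrite -EFinM exprSr; congr EFin; ring.
rewrite -leNgt => r0'; have -> : (r = 0)%R by lra.
by rewrite mulr0 mule0 expr0n.
Qed.

Lemma sub_ball_cube n r : rV_ball r `<=` @rV_cube n r.
Proof. by move=> x xr i; exact: le_trans (coord_le_enorm _ _) xr. Qed.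

Lemma sub_cube_ball n r : (0 <= r)%R -> @rV_cube n r `<=` rV_ball (Num.sqrt n%:R * r).
Proof.
move=> r0 x xr; apply: le_trans (enorm_sup _) _.
rewrite ler_wpM2l ?sqrtr_ge0//.
rewrite [leLHS]/Num.Def.normr /= mx_normrE; apply/bigmax_leP; split => //= -[i j] _ /=.
by rewrite ord1.
Qed.

Lemma lebesgue_rV_ball_lty n r : lebesgue_rV R n (rV_ball r) < +oo.
Proof.
have [r0|r0] := leP 0%R r; last first.
  rewrite (_ : rV_ball r = set0) ?measure0//.
  by apply/seteqP; split => // x /= xr; have := enorm_ge0 x; rewrite leNgt (le_lt_trans xr).
apply: (@le_lt_trans _ _ (lebesgue_rV R n (rV_cube r))).
  apply: le_measure; rewrite ?inE; last exact: sub_ball_cube.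
    exact: measurable_rV_ball.
  exact: measurable_rV_cube.
by rewrite lebesgue_rV_cube// ltry.
Qed.

Lemma lebesgue_rV_ball_gt0 n r : (0 < r)%R -> 0 < lebesgue_rV R n (rV_ball r).
Proof.
move=> r0; have s0 : (0 < Num.sqrt n%:R + 1 :> R)%R by rewrite ltr_wpDl// sqrtr_ge0.
pose q := (r / (Num.sqrt n%:R + 1))%R.
have q0 : (0 < q)%R by rewrite divr_gt0.
apply: (@lt_le_trans _ _ (lebesgue_rV R n (rV_cube q))).
  by rewrite lebesgue_rV_cube ?ltW// lte_fin exprn_gt0// mulr_gt0.
apply: le_measure; rewrite ?inE; [exact: measurable_rV_cube|exact: measurable_rV_ball|].
move=> x /(sub_cube_ball (ltW q0)); rewrite /rV_ball/= => /le_trans; apply.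
by rewrite -[leRHS](divfK (lt0r_neq0 s0)) mulrC ler_wpM2l ?lerDl// ltW.
Qed.

Lemma sigma_finite_balls n (nu : {measure set 'rV[R]_n -> \bar R}) :
  (forall k : nat, nu (rV_ball k%:R) < +oo) -> sigma_finite setT nu.
Proof.
move=> nufin; exists (fun k => rV_ball k%:R); last first.
  by move=> k; split; [exact: measurable_rV_ball|exact: nufin].
apply/seteqP; split => // x _; exists (Num.truncn (enorm x)).+1 => //=.
by rewrite /rV_ball /= ltW// truncnS_gt.
Qed.

Lemma muleI_fin (x y a : \bar R) : 0 < a -> a < +oo -> x * a = y * a -> x = y.
Proof.
case: a => [a| |]//; rewrite lte_fin => a0 _ /(congr1 (fun z => z * (a^-1)%:E)).
by rewrite -!muleA -EFinM mulfV ?gt_eqF// !mule1.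
Qed.

(** An isometry preserves Lebesgue measure: the image measure is
    translation-invariant and gives the unit ball the same mass. *)
Lemma lebesgue_rV_isometry n (Q : 'M[R]_n) (A : set 'rV[R]_n) :
  Q *m Q^T = 1%:M -> measurable A ->
  lebesgue_rV R n ((fun x => x *m Q) @^-1` A) = lebesgue_rV R n A.
Proof.
move=> QQ mA; have mQ := measurable_mulmx Q.
pose nu := pushforward (lebesgue_rV R n) (fun x : 'rV[R]_n => x *m Q).
have nub r : nu (rV_ball r) = lebesgue_rV R n (rV_ball r).
  congr (lebesgue_rV R n _); apply/seteqP; split => x;
    by rewrite /rV_ball /= enorm_isometry.
apply: (muleI_fin (lebesgue_rV_ball_gt0 n ltr01) (lebesgue_rV_ball_lty n 1)).
rewrite -{2}(nub 1%R).
apply: (@translation_invariant_unique R n nu) => //.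
- apply: sigma_finite_balls => // k.
  by apply: le_lt_trans (lebesgue_rV_ball_lty n k%:R); rewrite -nub.
- move=> v B mB; have -> : v = v *m Q^T *m Q by rewrite -mulmxA (mulmx1C QQ) mulmx1.
  rewrite /nu /pushforward.
  rewrite -[RHS](lebesgue_rV_translate (v *m Q^T)); last first.
    by rewrite -[X in measurable X]setTI; exact: mQ.
  by congr (lebesgue_rV R n _); apply/seteqP; split => x /=; rewrite mulmxDl.
- exact: measurable_rV_ball.
- by move=> x; rewrite /rV_ball /= enormN.
Qed.

(** The image of Lebesgue measure under a dilation is translation-invariant; the
    factor is read off on a cube. *)
Lemma lebesgue_rV_scale n (r : R) (A : set 'rV[R]_n) : (0 < r)%R -> measurable A ->
  lebesgue_rV R n ((fun x => r *: x)%R @^-1` A) = (r ^- n)%:E * lebesgue_rV R n A.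
Proof.
move=> r0 mA.
have mr : measurable_fun setT (fun x : 'rV[R]_n => r *: x)%R.
  exact: (@measurable_scalerV _ _ _ _ (cst r) id).
pose nu := pushforward (lebesgue_rV R n) (fun x : 'rV[R]_n => r *: x)%R.
have c0 : 0 < lebesgue_rV R n (rV_cube 1).
  by rewrite lebesgue_rV_cube// lte_fin exprn_gt0// mulr_gt0.
have coo : lebesgue_rV R n (rV_cube 1) < +oo by rewrite lebesgue_rV_cube// ltry.
have nuc : nu (rV_cube 1) = (r ^- n)%:E * lebesgue_rV R n (rV_cube 1).
  rewrite /nu /pushforward (_ : _ @^-1` _ = rV_cube r^-1); last first.
    apply/seteqP; split => x /= xr i; have := xr i.
      by rewrite mxE normrM gtr0_norm// -ler_pdivlMl// mulr1.
    by rewrite -[(r^-1)%R]mulr1 mxE normrM gtr0_norm// -ler_pdivlMl.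
  rewrite !lebesgue_rV_cube ?invr_ge0 1?ltW// -EFinM; congr EFin.
  by rewrite !exprMn exprVn mulrC expr1n mulr1.
apply: (muleI_fin c0 coo).
rewrite muleAC -nuc [RHS]muleC.
apply: (@translation_invariant_unique R n nu) => //.
- apply: sigma_finite_balls => // k.
  change (lebesgue_rV R n ((fun x => r *: x)%R @^-1` rV_ball k%:R) < +oo).
  rewrite (_ : _ @^-1` _ = rV_ball (k%:R / r)); first exact: lebesgue_rV_ball_lty.
  by apply/seteqP; split => x /=;
     rewrite /rV_ball /= enormZ gtr0_norm// ler_pdivlMr// mulrC.
- move=> v B mB; have -> : (v = r *: (r^-1 *: v))%R.
    by rewrite scalerA divff ?scale1r// gt_eqF.
  rewrite /nu /pushforward.
  rewrite -[RHS](lebesgue_rV_translate (r^-1 *: v)%R); last first.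
    by rewrite -[X in measurable X]setTI; exact: mr.
  by congr (lebesgue_rV R n _); apply/seteqP; split => x /=; rewrite scalerDr.
- exact: measurable_rV_cube.
- by move=> x; split => xr i; have := xr i; rewrite mxE normrN.
Qed.

Lemma ge0_integral_isometry n (Q : 'M[R]_n) (f : 'rV[R]_n -> \bar R) :
  Q *m Q^T = 1%:M -> measurable_fun setT f -> (forall x, 0 <= f x) ->
  \int[lebesgue_rV R n]_x f (x *m Q)%R = \int[lebesgue_rV R n]_x f x.
Proof.
move=> QQ mf f0.
have := @ge0_integral_pushforward _ _ _ _ R _ (measurable_mulmx Q)
  (lebesgue_rV R n) setT f measurableT mf (fun x _ => f0 x).
rewrite preimage_setT => <-.
apply: eq_measure_integral; first exact: measurable_mulmx.
by move=> ? A mA _; exact: lebesgue_rV_isometry.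
Qed.

Lemma ge0_integral_opprV n (f : 'rV[R]_n -> \bar R) :
  measurable_fun setT f -> (forall x, 0 <= f x) ->
  \int[lebesgue_rV R n]_x f (- x)%R = \int[lebesgue_rV R n]_x f x.
Proof.
move=> mf f0; rewrite -[RHS](@ge0_integral_isometry n (- 1%:M)%R)//; last first.
  by rewrite linearN /= trmx1 mulmxN mulmx1 opprK.
by apply: eq_integral => x _; rewrite mulmxN mulmx1.
Qed.

Lemma ge0_integral_scalerV n (r : R) (f : 'rV[R]_n -> \bar R) : (0 < r)%R ->
  measurable_fun setT f -> (forall x, 0 <= f x) ->
  \int[lebesgue_rV R n]_x f (r *: x)%R = (r ^- n)%:E * \int[lebesgue_rV R n]_x f x.
Proof.
move=> r0 mf f0.
have mr : measurable_fun setT (fun x : 'rV[R]_n => r *: x)%R.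
  exact: (@measurable_scalerV _ _ _ _ (cst r) id).
have := @ge0_integral_pushforward _ _ _ _ R _ mr
  (lebesgue_rV R n) setT f measurableT mf (fun x _ => f0 x).
rewrite preimage_setT => <-.
have rn : (0 <= r ^- n)%R by rewrite invr_ge0 exprn_ge0// ltW.
rewrite -(ge0_integral_mscale (lebesgue_rV R n) measurableT (NngNum rn) mf)//.
by apply: eq_measure_integral => A mA _; exact: lebesgue_rV_scale.
Qed.

Lemma lebesgue_rV_ball n (r : R) : (0 < r)%R ->
  lebesgue_rV R n (rV_ball r) = (r ^+ n)%:E * lebesgue_rV R n (rV_ball 1).
Proof.
move=> r0; have ri : (0 < r^-1)%R by rewrite invr_gt0.
rewrite -[r in (r ^+ n)%R]invrK exprVn -lebesgue_rV_scale//; last exact: measurable_rV_ball.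
congr (lebesgue_rV R n _); apply/seteqP; split => x /=;
  by rewrite /rV_ball /= enormZ gtr0_norm// ler_pdivrMl// mulr1.
Qed.

(** The dyadic balls: on the shell between the radii 2^(j-1) and 2^j the
    function max(1,|y|)^(-p) is at most 2^p 2^(-jp), while the j-th ball has
    volume 2^(jn) times that of the unit ball. *)
Lemma decay_integral_lty n (p : R) : (n%:R < p)%R ->
  \int[lebesgue_rV R n]_y ((Num.max 1 (enorm y)) `^ (- p))%:E < +oo.
Proof.
move=> np; have p0 : (0 < p)%R by apply: le_lt_trans np.
have two0 : (0 < 2 `^ (- p))%R by rewrite powR_gt0.
pose u j (y : 'rV[R]_n) : \bar R :=
  ((2 `^ p * (2 `^ (- p)) ^+ j)%:E * (\1_(rV_ball (2 ^+ j)) y)%:E).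
have u0 j y : 0 <= u j y.
  by rewrite /u -EFinM lee_fin mulr_ge0// mulr_ge0 ?powR_ge0// exprn_ge0// powR_ge0.
have mball j : measurable_fun setT (fun y : 'rV[R]_n => (\1_(rV_ball (2 ^+ j)) y)%:E : \bar R).
  by apply/measurable_EFinP; apply: measurable_indic; exact: measurable_rV_ball.
have mu j : measurable_fun setT (u j) by apply: emeasurable_funM.
have mdec : measurable_fun setT (fun y : 'rV[R]_n => ((Num.max 1 (enorm y)) `^ (- p))%:E : \bar R).
  apply/measurable_EFinP; apply: (measurableT_comp (measurable_powR _)).
  by apply: measurable_maxr => //; exact: measurable_enorm.
have le_u y : ((Num.max 1 (enorm y)) `^ (- p))%:E <= \sum_(j <oo) u j y.
  have ex : exists k, (enorm y <= 2 ^+ k)%R.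
    exists (Num.truncn (enorm y)).+1; apply: ltW; apply: lt_le_trans (truncnS_gt _) _.
    by rewrite -natrX ler_nat ltnW// ltn_expl.
  have b1 : (1 <= Num.max 1 (enorm y))%R by rewrite le_max lexx.
  have [j yj uj] : exists2 j, (enorm y <= 2 ^+ j)%R &
      ((Num.max 1 (enorm y)) `^ (- p) <= 2 `^ p * (2 `^ (- p)) ^+ j)%R.
    case: (ex_minnP ex) => -[|j] yj jmin; [exists 0%N|exists j.+1] => //.
      rewrite expr0 mulr1; apply: (@le_trans _ _ 1%R).
        have := ler_powR b1 (_ : - p <= 0)%R; rewrite powRr0; apply.
        by rewrite oppr_le0 ltW.
      by have := @ler_powR R 2%R (ler1n _ _) 0%R p (ltW p0); rewrite powRr0.
    have yj' : (2 ^+ j <= Num.max 1 (enorm y))%R.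
      rewrite le_max; apply/orP; right; rewrite leNgt; apply/negP => /ltW/jmin.
      by rewrite ltnn.
    rewrite exprS mulrA !powRN mulfV ?gt_eqF ?powR_gt0// mul1r exprVn.
    rewrite lef_pV2 ?posrE ?exprn_gt0 ?powR_gt0//; last exact: lt_le_trans b1.
    rewrite -powR_mulrn ?powR_ge0// -powRrM mulrC powRrM powR_mulrn//.
    apply: ge0_ler_powR => //; rewrite ?nnegrE ?exprn_ge0// ?(ltW p0)//.
    exact: le_trans b1.
  apply: (@le_trans _ _ (u j y)); first by rewrite /u indicE mem_set// mule1 lee_fin.
  apply: le_trans (nneseries_lim_ge j.+1 _) => //.
  by rewrite big_nat_recr//= leeDr// sume_ge0.
apply: (@le_lt_trans _ _ (\int[lebesgue_rV R n]_y (\sum_(j <oo) u j y))).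
  apply: ge0_le_integral => //; first by move=> y _; rewrite lee_fin powR_ge0.
  by apply: ge0_emeasurable_sum.
rewrite integral_nneseries//.
have omfin : lebesgue_rV R n (rV_ball 1) \is a fin_num.
  by rewrite ge0_fin_numE// lebesgue_rV_ball_lty.
set om := fine (lebesgue_rV R n (rV_ball 1)).
pose q := (2 `^ (- p) * 2 ^+ n : R)%R.
have q0 : (0 < q)%R by rewrite mulr_gt0 ?powR_gt0// exprn_gt0.
have q1 : (q < 1)%R.
  rewrite /q -powR_mulrn// -powRD ?pnatr_eq0//; last by rewrite implybT.
  rewrite /powR pnatr_eq0/= expR_lt1 pmulr_llt0 ?ln_gt0 ?ltr1n//; lra.
have -> : \sum_(j <oo) \int[lebesgue_rV R n]_y u j y =
    \sum_(j <oo) (geometric (2 `^ p * om) q j)%:E.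
  apply: eq_eseriesr => j _; rewrite ge0_integralZl//.
  rewrite integral_indic//; last exact: measurable_rV_ball.
  have j0 : (0 < 2 ^+ j :> R)%R by rewrite exprn_gt0.
  rewrite setIT [X in _ * X](lebesgue_rV_ball n j0) -(fineK omfin) -/om -!EFinM.
  congr EFin.
  by rewrite /geometric /= /q exprMn -!exprM (mulnC j); ring.
apply: le_lt_trans (ltry (2 `^ p * om / (1 - q))%R); apply: lime_le.
  apply: is_cvg_nneseries => j _ _; rewrite lee_fin /geometric /=.
  by rewrite mulr_ge0 ?exprn_ge0 ?(ltW q0)// mulr_ge0 ?powR_ge0// fine_ge0.
near=> m; rewrite sumEFin lee_fin.
apply: (@geometric_le_lim R m (2 `^ p * om)%R q) => //.
  by rewrite mulr_ge0 ?powR_ge0// fine_ge0.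
by rewrite gtr0_norm.
Unshelve. all: by end_near. Qed.

End cubes_and_balls.

(** * The isodiametric inequality *)

Section prekopa_line.
Context {R : realType}.
Local Open Scope ereal_scope.
Local Notation leb := (@lebesgue_measure R).

(** Two translates of compact subsets of A and B lie in A + B and meet in one
    point only: the top of the first set is glued to the bottom of the second. *)
Lemma brunn_minkowski_line (A B C : set R) :
  measurable A -> measurable B -> measurable C -> A !=set0 -> B !=set0 ->
  (forall a b, A a -> B b -> C (a + b)%R) -> leb A + leb B <= leb C.
Proof.
move=> mA mB mC [a0 Aa0] [b0 Bb0] ABC.
(* By inner regularity it suffices to treat compact subsets. *)
suff H K L : compact K -> K `<=` A -> compact L -> L `<=` B -> leb K + leb L <= leb C.
  have supA := lebesgue_regularity_inner_sup mA.
  have supB := lebesgue_regularity_inner_sup mB.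
  have HL L : compact L -> L `<=` B -> leb A + leb L <= leb C.
    move=> cL LB; have Lfin : leb L < +oo by exact: compact_finite_measure.
    have Lnum : leb L \is a fin_num by rewrite ge0_fin_numE.
    rewrite -leeBrDr// supA; apply: ge_ereal_sup => _ [K [cK KA] <-].
    by rewrite leeBrDr//; exact: H.
  have [Aoo|Afin] := eqVneq (leb A) +oo.
    have := HL set0 (@compact0 _) (sub0set _); rewrite measure0 adde0 Aoo.
    by rewrite leye_eq => /eqP ->; rewrite leey.
  have Anum : leb A \is a fin_num by rewrite ge0_fin_numE// ltey.
  rewrite -leeBrDl// supB; apply: ge_ereal_sup => _ [L [cL LB] <-].
  by rewrite leeBrDl//; exact: HL.
move=> cK0 KA0 cL0 LB0.
(* Adjoining a point makes the compact sets nonempty, so that they have a top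
   and a bottom. *)
pose K' := K `|` [set a0]; pose L' := L `|` [set b0].
have cK : compact K' by apply: compactU => //; exact: compact_set1.
have cL : compact L' by apply: compactU => //; exact: compact_set1.
have KA : K' `<=` A by move=> x [/KA0//|->].
have LB : L' `<=` B by move=> x [/LB0//|->].
have cm (X : set R) : compact X -> measurable X by exact: compact_measurable.
have [mK mL] := (cm _ cK, cm _ cL).
have [a Ka maxa] : exists2 a, K' a & forall x, K' x -> (x <= a)%R.
  have [] := @compact_EVT_max R R id K' _ cK; first by exists a0; right.
    by apply: continuous_subspaceT => x; exact: cvg_id.
  by move=> a /set_mem Ka am; exists a => // x Kx; apply: am; rewrite inE.
have [b Lb minb] : exists2 b, L' b & forall x, L' x -> (b <= x)%R.
  have [] := @compact_EVT_min R R id L' _ cL; first by exists b0; right.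
    by apply: continuous_subspaceT => x; exact: cvg_id.
  by move=> b /set_mem Lb bm; exists b => // x Lx; apply: bm; rewrite inE.
have le0 : leb K + leb L <= leb K' + leb L'.
  by apply: leeD; apply: le_measure; rewrite ?inE//; try exact: cm; exact: subsetUl.
apply: le_trans le0 _.
pose X := [set x | K' (x + - b)%R]; pose Y := [set x | L' (x + - a)%R].
have mX : measurable X.
  by rewrite -[X]setTI; exact: measurable_fun_translateR.
have mY : measurable Y.
  by rewrite -[Y]setTI; exact: measurable_fun_translateR.
rewrite -(lebesgue_measure_translate (- b) mK) -(lebesgue_measure_translate (- a) mL).
rewrite -/X -/Y.
have XY : leb (Y `&` X) = 0.
  apply/eqP; rewrite -measure_le0 -(lebesgue_measure_set1 (a + b)%R).
  apply: le_measure; rewrite ?inE//; first exact: measurableI.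
  by move=> x [/= /minb ? /maxa ?]; apply/eqP; rewrite eq_le; apply/andP; split; lra.
have -> : leb X + leb Y = leb X + leb (Y `\` X).
  have mYX : measurable (Y `&` X) by exact: measurableI.
  have mYDX : measurable (Y `\` X) by exact: measurableD.
  have : leb ((Y `&` X) `|` (Y `\` X)) = leb (Y `&` X) + leb (Y `\` X).
    by apply: measureU => //; apply/seteqP; split => // x [[? ?] []].
  by rewrite setUIDK XY add0e => ->.
rewrite -measureU//; [|exact: measurableD|by apply/seteqP; split => // x [? []]].
apply: le_measure; rewrite ?inE//; first by apply: measurableU => //; exact: measurableD.
move=> x [|[]] /=.
  by move=> /KA Ax; have -> : x = (x + - b + b)%R by [rewrite subrK]; apply: ABC => //; exact: LB.
by move=> /LB Bx _; have -> : x = (a + (x + - a))%R by [rewrite addrC subrK]; apply: ABC => //; exact: KA.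
Qed.

(** The region under the graph of phi between the levels 0 and 1, integrated in
    both orders in [layer_cake01]. *)
Let level (phi : R -> R) (p : measurableTypeR R * measurableTypeR R) : \bar R :=
  (\1_([set p | (p.1 < phi p.2)%R] `&` (`]0%R, 1%R[%classic `*` setT)) p)%:E.

Let level_ge0 phi p : 0 <= level phi p.
Proof. by rewrite lee_fin. Qed.

Let measurable_level phi : measurable_fun setT phi -> measurable_fun setT (level phi).
Proof.
move=> mphi; apply/measurable_EFinP; apply: measurable_indic; apply: measurableI; last first.
  exact: measurableX.
have -> : [set p : measurableTypeR R * measurableTypeR R | (p.1 < phi p.2)%R] =
  (fun p => (p.1 < phi p.2)%R) @^-1` [set true] by apply/seteqP; split => p /=.
rewrite -[X in measurable X]setTI; apply: measurable_fun_ltr => //.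
by apply: measurableT_comp.
Qed.

Let level_fst phi (l : R) : measurable_fun setT phi ->
  \int[leb]_s level phi (l, s) = (\1_(`]0%R, 1%R[%classic) l)%:E * leb [set s | (l < phi s)%R].
Proof.
move=> mphi.
have mA : measurable [set s | (l < phi s)%R].
  have -> : [set s | (l < phi s)%R] = phi @^-1` `]l, +oo[%classic.
    by apply/seteqP; split => s /=; rewrite in_itv /= andbT.
  by rewrite -[X in measurable X]setTI; exact: mphi.
have -> : leb [set s | (l < phi s)%R] = \int[leb]_s (\1_[set s | (l < phi s)%R] s)%:E.
  by rewrite integral_indic// setIT.
rewrite -ge0_integralZl//; last by apply/(@measurable_EFinP _ (measurableTypeR R)); exact: measurable_indic.
apply: eq_integral => s _; rewrite /level -EFinM; congr EFin.
rewrite !indicE -natrM mulnb; congr (nat_of_bool _)%:R; apply/idP/andP; rewrite !inE /=.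
  by move=> [? []].
by move=> [].
Qed.

Let level_snd phi (s : R) : (0 <= phi s)%R ->
  \int[leb]_l level phi (l, s) = (Num.min (phi s) 1)%:E.
Proof.
move=> phi0.
transitivity (\int[leb]_l (\1_(`]0%R, Num.min (phi s) 1%R[%classic : set R) l)%:E).
  apply: eq_integral => l _; rewrite /level; congr EFin.
  rewrite !indicE; congr (nat_of_bool _)%:R; apply/idP/idP; rewrite !inE /= !in_itv /= lt_min.
    by move=> [-> [/andP[-> ->]]].
  by move=> /andP[-> /andP[-> ->]].
have -> : \int[leb]_l (\1_(`]0%R, Num.min (phi s) 1%R[%classic : set R) l)%:E =
    leb (`]0%R, Num.min (phi s) 1%R[%classic : set R) by rewrite integral_indic// setIT.
rewrite lebesgue_measure_itv/= lte_fin lt_min ltr01 andbT.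
rewrite sube0; case: ifPn => //; rewrite -leNgt => phi0'.
by rewrite (_ : phi s = 0%R) ?minEle ?ler01//; apply/eqP; rewrite eq_le phi0' phi0.
Qed.

Lemma layer_cake01 (phi : R -> R) : measurable_fun setT phi -> (forall s, 0 <= phi s)%R ->
  \int[leb]_l ((\1_(`]0%R, 1%R[%classic) l)%:E * leb [set s | (l < phi s)%R]) =
  \int[leb]_s (Num.min (phi s) 1)%:E.
Proof.
move=> mphi phi0.
transitivity (\int[leb]_l \int[leb]_s level phi (l, s)).
  by apply: eq_integral => l _; rewrite level_fst.
rewrite (@fubini_tonelli _ _ _ _ R leb leb (level phi))//; last exact: measurable_level.
by apply: eq_integral => s _; rewrite level_snd.
Qed.

Lemma measurable_layer (phi : R -> R) : measurable_fun setT phi ->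
  measurable_fun setT (fun l : measurableTypeR R =>
    (\1_(`]0%R, 1%R[%classic) l)%:E * leb [set s | (l < phi s)%R]).
Proof.
move=> mphi.
rewrite (_ : (fun _ => _) = (fun l => \int[leb]_s level phi (l, s))); last first.
  by apply/funext => l; rewrite level_fst.
exact: (@measurable_fun_fubini_tonelli_F _ _ (measurableTypeR R) (measurableTypeR R) R
  leb (level phi) (measurable_level mphi) (level_ge0 phi)).
Qed.

(** With f and g normalised to have supremum 1, their level sets above each level
    in (0, 1) are nonempty and add up inside the level set of h, so the
    Brunn-Minkowski inequality integrates over the levels to an arithmetic mean;
    the geometric mean is smaller. *)
Lemma prekopa_leindler_line (f g h : R -> R) (M : R) :
  measurable_fun setT f -> measurable_fun setT g -> measurable_fun setT h ->
  (forall s, 0 <= f s <= M)%R -> (forall s, 0 <= g s <= M)%R -> (forall s, 0 <= h s)%R ->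
  (forall s t, f s * g t <= h (s + t) ^+ 2)%R ->
  4%:E * (\int[leb]_s (f s)%:E * \int[leb]_s (g s)%:E) <=
    \int[leb]_s (h s)%:E * \int[leb]_s (h s)%:E.
Proof.
move=> mf mg mh f0 g0 h0 fgh.
have int0 (u : R -> R) : (forall s, 0 <= u s)%R -> 0 <= \int[leb]_s (u s)%:E.
  by move=> u0; apply: integral_ge0 => s _; rewrite lee_fin.
have ih0 := int0 h h0.
have fp s : (0 <= f s)%R by have /andP[] := f0 s.
have gp s : (0 <= g s)%R by have /andP[] := g0 s.
have bnd (u : R -> R) : (forall s, 0 <= u s <= M)%R -> has_sup (range u).
  move=> uM; split; first by exists (u 0%R); exists 0%R.
  by exists M => _ [s _ <-]; have /andP[] := uM s.
have [bf bg] := (bnd f f0, bnd g g0).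
pose a := sup (range f); pose b := sup (range g).
have fa s : (f s <= a)%R by apply: (sup_upper_bound bf); exists s.
have gb s : (g s <= b)%R by apply: (sup_upper_bound bg); exists s.
have int_0 (u : R -> R) c : (forall s, 0 <= u s)%R -> (forall s, u s <= c)%R -> (c <= 0)%R ->
    \int[leb]_s (u s)%:E = 0.
  move=> u0 uc c0; apply: integral0_eq => s _; congr EFin.
  by apply/eqP; rewrite eq_le u0 (le_trans (uc s)).
have [a0|a0] := leP a 0%R; first by rewrite (int_0 f a)// mul0e mule0 mule_ge0.
have [b0|b0] := leP b 0%R; first by rewrite (int_0 g b)// mule0 mule0 mule_ge0.
(* With this c the functions f / a, g / b and h / c satisfy the same inequality
   as f, g and h. *)
pose c := Num.sqrt (a * b).
have c0 : (0 < c)%R by rewrite sqrtr_gt0 mulr_gt0.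
have c2 : (c ^+ 2 = a * b)%R by rewrite sqr_sqrtr// mulr_ge0 ?ltW.
have ms (u : R -> R) k : measurable_fun setT u -> measurable_fun setT (fun s => u s / k)%R.
  by move=> mu; exact: measurable_funM.
have layer_le (l : R) :
  (\1_(`]0%R, 1%R[%classic) l)%:E * leb [set s | (l < f s / a)%R] +
  (\1_(`]0%R, 1%R[%classic) l)%:E * leb [set s | (l < g s / b)%R] <=
  (\1_(`]0%R, 1%R[%classic) l)%:E * leb [set s | (l < h s / c)%R].
  rewrite indicE; case: (boolP (l \in _)) => [|_]; last by rewrite !mul0e adde0.
  rewrite inE /= in_itv /= => /andP[l0 l1]; rewrite !mul1e.
  have mset (u : R -> R) : measurable_fun setT u -> measurable [set s | (l < u s)%R].
    move=> mu; have -> : [set s | (l < u s)%R] = u @^-1` `]l, +oo[%classic.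
      by apply/seteqP; split => s /=; rewrite in_itv /= andbT.
    by rewrite -[X in measurable X]setTI; exact: mu.
  have ne (u : R -> R) : has_sup (range u) -> (0 < sup (range u))%R ->
      [set s | (l < u s / sup (range u))%R] !=set0.
    move=> su u0; have [_ [s _ <-] us] : exists2 x, range u x & (l * sup (range u) < x)%R.
      by apply: sup_gt; [case: su|rewrite gtr_pMl].
    by exists s; rewrite /= ltr_pdivlMr.
  apply: brunn_minkowski_line; [by apply: mset; exact: ms|by apply: mset; exact: ms|by apply: mset; exact: ms|exact: ne|exact: ne|].
  move=> s t /=; rewrite !ltr_pdivlMr// => ls lt.
  rewrite -(ltr_pXn2r (ltn0Sn 1)) ?nnegrE ?mulr_ge0 ?(ltW c0) ?(ltW l0)//.
  apply: lt_le_trans (fgh s t); rewrite exprMn c2.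
  have -> : (l ^+ 2 * (a * b) = (l * a) * (l * b))%R by ring.
  by apply: ltr_pM => //; rewrite mulr_ge0// ltW.
have le_int : \int[leb]_s (f s / a)%:E + \int[leb]_s (g s / b)%:E <= \int[leb]_s (h s / c)%:E.
  have minE (u : R -> R) k : (0 < k)%R -> (forall s, u s <= k)%R ->
      \int[leb]_s (u s / k)%:E = \int[leb]_s (Num.min (u s / k) 1)%:E.
    move=> k0 uk; apply: eq_integral => s _; congr EFin; rewrite min_l//.
    by rewrite ler_pdivrMr// mul1r.
  have dv0 (u : R -> R) k : (0 < k)%R -> (forall s, 0 <= u s)%R -> (forall s, 0 <= u s / k)%R.
    by move=> k0 u0 s; rewrite divr_ge0// ltW.
  rewrite (minE f a)// (minE g b)// -!layer_cake01//; [|exact: ms|exact: dv0|exact: ms|exact: dv0].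
  rewrite -ge0_integralD//; last 4 first.
  - by move=> l _; rewrite mule_ge0// lee_fin.
  - by apply: measurable_layer; exact: ms.
  - by move=> l _; rewrite mule_ge0// lee_fin.
  - by apply: measurable_layer; exact: ms.
  apply: (@le_trans _ _ (\int[leb]_s (Num.min (h s / c) 1)%:E)); last first.
    apply: ge0_le_integral => //.
    - by move=> s _; rewrite lee_fin le_min ler01 andbT dv0.
    - by apply/measurable_EFinP; apply: measurable_minr => //; exact: ms.
    - by apply/measurable_EFinP; exact: ms.
    - by move=> s _; rewrite lee_fin ge_min lexx.
  rewrite -layer_cake01//; [|exact: ms|exact: dv0].
  apply: ge0_le_integral => //.
  - by move=> l _; rewrite adde_ge0// mule_ge0// lee_fin.
  - by apply: emeasurable_funD; apply: measurable_layer; exact: ms.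
  - by apply: measurable_layer; exact: ms.
have div_int (u : R -> R) k : measurable_fun setT u -> (forall s, 0 <= u s)%R -> (0 < k)%R ->
    \int[leb]_s (u s / k)%:E = (k^-1)%:E * \int[leb]_s (u s)%:E.
  move=> mu u0 k0; under eq_integral do rewrite mulrC EFinM.
  rewrite ge0_integralZl//; [exact/measurable_EFinP|by move=> s _; rewrite lee_fin|].
  by rewrite lee_fin invr_ge0 ltW.
move: le_int; rewrite !div_int//.
have [if0 ig0] := (int0 f fp, int0 g gp).
have [->|hfin] := eqVneq (\int[leb]_s (h s)%:E) +oo; first by rewrite mulyy leey.
have hnum : \int[leb]_s (h s)%:E \is a fin_num by rewrite ge0_fin_numE// ltey.
move=> le_int.
have num (u v x : \bar R) k : (0 < k)%R -> 0 <= u -> 0 <= v -> x \is a fin_num ->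
    (k^-1)%:E * u + v <= x -> u \is a fin_num.
  move=> k0 u0 v0 xf; case: u u0 => [r| |]// _.
  by rewrite gt0_muley ?lte_fin ?invr_gt0// addye// ?leye_eq => [/eqP xE|]; [rewrite xE in xf|rewrite -ltNye (lt_le_trans _ v0)].
have hcnum : (c^-1)%:E * \int[leb]_s (h s)%:E \is a fin_num by rewrite fin_numM.
have sg0 : 0 <= (b^-1)%:E * \int[leb]_s (g s)%:E by rewrite mule_ge0// lee_fin invr_ge0 ltW.
have sf0 : 0 <= (a^-1)%:E * \int[leb]_s (f s)%:E by rewrite mule_ge0// lee_fin invr_ge0 ltW.
have fnum := num _ _ _ _ a0 if0 sg0 hcnum le_int.
have gnum := num _ _ _ _ b0 ig0 sf0 hcnum (eq_ind _ (fun z => z <= _) le_int _ (addeC _ _)).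
move: le_int if0 ig0 ih0.
rewrite -(fineK fnum) -(fineK gnum) -(fineK hnum) -!EFinM -EFinD !lee_fin.
move: (fine _) (fine _) (fine _) => H G F le_int F0 G0 H0.
have ab : (0 < a * b)%R by rewrite mulr_gt0.
have -> : (H * H = a * b * (c^-1 * H) ^+ 2)%R.
  by rewrite exprMn exprVn c2 mulrA divff ?mul1r ?expr2// gt_eqF.
have le2 : ((a^-1 * F + b^-1 * G) ^+ 2 <= (c^-1 * H) ^+ 2)%R.
  by rewrite ler_pXn2r// nnegrE ?addr_ge0 ?mulr_ge0 ?invr_ge0 ?(ltW a0) ?(ltW b0) ?(ltW c0).
apply: le_trans (ler_wpM2l (ltW ab) le2).
have -> : (4 * (F * G) = a * b * (4 * (a^-1 * F) * (b^-1 * G)))%R.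
  by field; rewrite !gt_eqF.
rewrite ler_wpM2l ?(ltW ab)//.
by have := sqr_ge0 (a^-1 * F - b^-1 * G)%R; lra.
Qed.

End prekopa_line.

Section isodiametric.
Context {R : realType}.
Local Open Scope ereal_scope.

Lemma integral_indic_rV n (B : set 'rV[R]_n) : measurable B ->
  \int[lebesgue_rV R n]_x (\1_B x)%:E = lebesgue_rV R n B.
Proof. by move=> mB; rewrite integral_indic// setIT. Qed.

Let fine_slice n (u : 'rV[R]_n -> R) M r : (0 <= r)%R ->
  measurable_fun setT u -> (forall x, 0 <= u x <= M)%R ->
  (forall x, ~ rV_cube r x -> u x = 0%R) ->
  0 <= \int[lebesgue_rV R n]_x (u x)%:E <= (M * (2 * r) ^+ n)%:E.
Proof.
move=> r0 mu uM ur; have u0 x : (0 <= u x)%R by have /andP[] := uM x.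
apply/andP; split; first by apply: integral_ge0 => x _; rewrite lee_fin.
have mc := @measurable_rV_cube R n r.
have M0 : (0 <= M)%R by have /andP[a b] := uM 0%R; exact: le_trans b.
have -> : (M * (2 * r) ^+ n)%:E = \int[lebesgue_rV R n]_x (M%:E * (\1_(rV_cube r) x)%:E).
  have mi : measurable_fun setT (fun x : 'rV[R]_n => (\1_(rV_cube r) x)%:E : \bar R).
    by apply/measurable_EFinP; exact: measurable_indic.
  by rewrite ge0_integralZl// integral_indic// setIT [X in _ * X](lebesgue_rV_cube n r0).
apply: ge0_le_integral => //.
- by move=> x _; rewrite lee_fin.
- by apply/measurable_EFinP.
- by apply/measurable_EFinP; apply: measurable_funM => //; exact: measurable_indic.
- move=> x _; rewrite -EFinM lee_fin indicE.
  case: (boolP (x \in _)) => [_|]; first by rewrite mulr1; have /andP[] := uM x.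
  by rewrite notin_setE => /ur ->; rewrite mulr0.
Qed.

Let slice_cube n (r s : R) (x : 'rV[R]_n) : rV_cube r (consrV (s, x)) -> rV_cube r x.
Proof. by move=> sx i; have := sx (lift 0%R i); rewrite mxE liftK. Qed.

Let consrVD n (s t : R) (x y : 'rV[R]_n) :
  (consrV (s, x) + consrV (t, y) = consrV ((s + t)%R, (x + y)%R))%R.
Proof.
apply/rowP => i; rewrite !mxE; case: (unliftP 0%R i) => [j|] _ //=.
by rewrite mxE.
Qed.

(** The Prekopa-Leindler inequality, without the factor 1/2 in the argument of
    h; the integrals over the slices satisfy the hypothesis of the inequality
    on the line. *)
Lemma prekopa_leindler n (f g h : 'rV[R]_n -> R) (M r : R) : (0 <= r)%R ->
  measurable_fun setT f -> measurable_fun setT g -> measurable_fun setT h ->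
  (forall x, 0 <= f x <= M)%R -> (forall x, 0 <= g x <= M)%R -> (forall x, 0 <= h x <= M)%R ->
  (forall x, ~ rV_cube r x -> [/\ f x = 0, g x = 0 & h x = 0]%R) ->
  (forall x y, f x * g y <= h (x + y) ^+ 2)%R ->
  (4 ^+ n)%:E * (\int[lebesgue_rV R n]_x (f x)%:E * \int[lebesgue_rV R n]_x (g x)%:E) <=
    \int[lebesgue_rV R n]_x (h x)%:E * \int[lebesgue_rV R n]_x (h x)%:E.
Proof.
move=> r0; elim: n f g h M => [|n ih] f g h M mf mg mh fM gM hM fgh0 fgh.
  have E (u : 'rV[R]_0 -> R) : measurable_fun setT u ->
      \int[lebesgue_rV R 0]_x (u x)%:E = (u 0)%:E.
    move=> mu; rewrite [LHS]integral_dirac//; last exact/measurable_EFinP.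
    by rewrite diracT mul1e.
  rewrite !E// expr0 mul1e -!EFinM lee_fin -expr2.
  by have := fgh 0%R 0%R; rewrite addr0.
have sl (u : 'rV[R]_n.+1 -> R) : measurable_fun setT u -> forall s,
    measurable_fun setT (fun x : 'rV[R]_n => u (consrV (s, x))).
  move=> mu s; apply: (measurableT_comp (measurable_comp_consrV mu)).
  exact: (measurable_pair1 _).
pose F (u : 'rV[R]_n.+1 -> R) s := fine (\int[lebesgue_rV R n]_x (u (consrV (s, x)))%:E).
have FE (u : 'rV[R]_n.+1 -> R) : measurable_fun setT u -> (forall x, 0 <= u x <= M)%R ->
    (forall x, ~ rV_cube r x -> u x = 0%R) -> forall s,
    (F u s)%:E = \int[lebesgue_rV R n]_x (u (consrV (s, x)))%:E /\
    (0 <= F u s <= M * (2 * r) ^+ n)%R.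
  move=> mu uM ur s.
  have := @fine_slice n (fun x => u (consrV (s, x))) M r r0 (sl _ mu s) (fun x => uM _).
  move=> /(_ (fun x xr => ur _ (fun k => xr (slice_cube k)))).
  rewrite /F; move: (\int[_]_x _) => [a| |]//=; rewrite ?leye_eq ?andbF//.
have mF (u : 'rV[R]_n.+1 -> R) : measurable_fun setT u -> (forall x, 0 <= u x <= M)%R ->
    (forall x, ~ rV_cube r x -> u x = 0%R) -> measurable_fun setT (F u).
  move=> mu uM ur; apply/measurable_EFinP.
  rewrite (_ : _ \o _ = fun s => \int[lebesgue_rV R n]_x (u (consrV (s, x)))%:E); last first.
    by apply/funext => s /=; have [] := FE u mu uM ur s.
  apply: (@measurable_integral_rVS R n (EFin \o u)); first exact/measurable_EFinP.
  by move=> x; rewrite lee_fin; have /andP[] := uM x.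
have IE (u : 'rV[R]_n.+1 -> R) : measurable_fun setT u -> (forall x, 0 <= u x <= M)%R ->
    (forall x, ~ rV_cube r x -> u x = 0%R) ->
    \int[lebesgue_rV R n.+1]_x (u x)%:E = \int[@lebesgue_measure R]_s (F u s)%:E.
  move=> mu uM ur; rewrite ge0_integral_rVS//; last 2 first.
  - exact/measurable_EFinP.
  - by move=> x; rewrite lee_fin; have /andP[] := uM x.
  by apply: eq_integral => s _; have [] := FE u mu uM ur s.
have fr x : ~ rV_cube r x -> f x = 0%R by move=> /fgh0[].
have gr x : ~ rV_cube r x -> g x = 0%R by move=> /fgh0[].
have hr x : ~ rV_cube r x -> h x = 0%R by move=> /fgh0[].
rewrite !IE//.
have c0 : (0 <= 2 ^+ n :> R)%R by rewrite exprn_ge0.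
have line s t : (4 ^+ n * (F f s * F g t) <= F h (s + t) ^+ 2)%R.
  have := ih (fun x => f (consrV (s, x))) (fun x => g (consrV (t, x)))
    (fun x => h (consrV ((s + t)%R, x))) M (sl _ mf s) (sl _ mg t) (sl _ mh _)
    (fun x => fM _) (fun x => gM _) (fun x => hM _).
  have [<- _] := FE f mf fM fr s; have [<- _] := FE g mg gM gr t.
  have [<- _] := FE h mh hM hr (s + t)%R.
  rewrite -!EFinM lee_fin expr2; apply.
  - move=> x xr; have ar a : ~ rV_cube r (consrV (a, x)) by move=> /slice_cube.
    by split; [exact: fr|exact: gr|exact: hr].
  - by move=> x y; rewrite -consrVD; exact: fgh.
have Fpos (u : 'rV[R]_n.+1 -> R) : measurable_fun setT u -> (forall x, 0 <= u x <= M)%R ->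
    (forall x, ~ rV_cube r x -> u x = 0%R) -> forall s,
    (0 <= 2 ^+ n * F u s <= 2 ^+ n * (M * (2 * r) ^+ n))%R.
  move=> mu uM ur s; have [_ /andP[a b]] := FE u mu uM ur s.
  by rewrite mulr_ge0//= ler_wpM2l.
have := @prekopa_leindler_line R (fun s => 2 ^+ n * F f s)%R (fun s => 2 ^+ n * F g s)%R
  (F h) (2 ^+ n * (M * (2 * r) ^+ n))%R
  (measurable_funM (measurable_cst _) (mF _ mf fM fr))
  (measurable_funM (measurable_cst _) (mF _ mg gM gr)) (mF _ mh hM hr)
  (Fpos _ mf fM fr) (Fpos _ mg gM gr).
have intZ (u : 'rV[R]_n.+1 -> R) : measurable_fun setT u -> (forall x, 0 <= u x <= M)%R ->
    (forall x, ~ rV_cube r x -> u x = 0%R) ->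
    \int[@lebesgue_measure R]_s (2 ^+ n * F u s)%:E =
    (2 ^+ n)%:E * \int[@lebesgue_measure R]_s (F u s)%:E.
  move=> mu uM ur; under eq_integral do rewrite EFinM.
  rewrite ge0_integralZl//.
  - by apply/measurable_EFinP; exact: mF.
  - by move=> s _; rewrite lee_fin; have [_ /andP[]] := FE u mu uM ur s.
rewrite !intZ// => H; apply: le_trans (H _ _); last 2 first.
- by move=> s; have [_ /andP[]] := FE h mh hM hr s.
- move=> s t; apply: le_trans (line s t).
  rewrite (_ : 4 ^+ n = 2 ^+ n * 2 ^+ n)%R; last by rewrite -exprMn; congr (_ ^+ _)%R; ring.
  by rewrite le_eqVlt; apply/orP; left; apply/eqP; ring.
rewrite muleACA muleA -!EFinM (_ : 4 ^+ n.+1 = 4 * (2 ^+ n * 2 ^+ n) :> R)%R.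
  by rewrite !muleA -EFinM; exact: lexx.
by rewrite -exprMn exprS; congr (_ * _ ^+ _)%R; ring.
Qed.

Lemma lebesgue_rV_ball0 n : lebesgue_rV R n.+1 (rV_ball 0) = 0.
Proof.
apply/eqP; rewrite -measure_le0 (_ : 0 = lebesgue_rV R n.+1 (rV_cube 0)).
  apply: le_measure; rewrite ?inE; [exact: measurable_rV_ball|exact: measurable_rV_cube|].
  exact: sub_ball_cube.
by rewrite lebesgue_rV_cube// mulr0 exprS mul0r.
Qed.

Lemma lebesgue_rV_ball_ge0 n (r : R) : (0 <= r)%R ->
  lebesgue_rV R n.+1 (rV_ball r) = (r ^+ n.+1)%:E * lebesgue_rV R n.+1 (rV_ball 1).
Proof.
rewrite le_eqVlt => /predU1P[<-|]; last exact: lebesgue_rV_ball.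
by rewrite lebesgue_rV_ball0 exprS mul0r mul0e.
Qed.

(** The difference set A - A lies in the ball of radius D, and by the
    Prekopa-Leindler inequality its volume is at least 2^n times that of A. *)
Lemma isodiametric n (A : set 'rV[R]_n.+1) (D : R) : measurable A -> (0 <= D)%R ->
  (forall x y, A x -> A y -> enorm (x - y) <= D)%R ->
  lebesgue_rV R n.+1 A <= ((D / 2) ^+ n.+1)%:E * lebesgue_rV R n.+1 (rV_ball 1).
Proof.
move=> mA D0 AD; set om := lebesgue_rV R n.+1 (rV_ball 1).
have [->|/set0P[x0 Ax0]] := eqVneq A set0.
  by rewrite measure0; apply: mule_ge0; [rewrite lee_fin exprn_ge0// divr_ge0|exact: measure_ge0].
pose r := (D + enorm x0)%R.
have r0 : (0 <= r)%R by rewrite addr_ge0// enorm_ge0.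
have Ar x : A x -> rV_ball r x.
  move=> Ax; rewrite /rV_ball /= -(subrK x0 x) (le_trans (ler_enormD _ _))//.
  by rewrite lerD2r AD.
have mNA : measurable [set x | A (- x)%R].
  by rewrite -[X in measurable X]setTI; exact: measurable_opprV.
have mB := @measurable_rV_ball R n.+1 D.
have bnd (B : set 'rV[R]_n.+1) x : (0 <= (\1_B x : R) <= 1)%R.
  by rewrite indicE; case: (_ \in _); rewrite ?lexx ?ler01.
have := @prekopa_leindler n.+1 \1_A \1_[set x | A (- x)%R] \1_(rV_ball D) 1 r r0
  (measurable_indic mA) (measurable_indic mNA) (measurable_indic mB)
  (bnd _) (bnd _) (bnd _).
rewrite !integral_indic_rV//.
have -> : lebesgue_rV R n.+1 [set x | A (- x)%R] = lebesgue_rV R n.+1 A.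
  rewrite -!integral_indic_rV// -[RHS]ge0_integral_opprV//.
  - by apply/measurable_EFinP; exact: measurable_indic.
move=> H.
have {}H : (4 ^+ n.+1)%:E * (lebesgue_rV R n.+1 A * lebesgue_rV R n.+1 A) <=
    lebesgue_rV R n.+1 (rV_ball D) * lebesgue_rV R n.+1 (rV_ball D).
  apply: H.
  - move=> x xr; have Nb : ~ rV_ball r x by move/sub_ball_cube.
    rewrite !indicE !memNset//.
    + by move=> xD; apply: Nb; rewrite /rV_ball /= (le_trans xD)// lerDl enorm_ge0.
    + by move=> /Ar; rewrite /rV_ball /= enormN.
    + by move/Ar.
  - move=> x y; rewrite !indicE.
    case: (boolP (x \in A)); rewrite ?mul0r ?sqr_ge0// inE => Ax.
    case: (boolP (y \in _)); rewrite ?mulr0 ?sqr_ge0// inE /= => Ay.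
    by rewrite mem_set ?expr1n ?mulr1// /rV_ball /= -[y]opprK; exact: AD.
have omoo : om < +oo by exact: lebesgue_rV_ball_lty.
have omf : om \is a fin_num by rewrite ge0_fin_numE//; exact: measure_ge0.
have Aoo : lebesgue_rV R n.+1 A < +oo.
  apply: le_lt_trans (lebesgue_rV_ball_lty n.+1 r); apply: le_measure; rewrite ?inE//.
  exact: measurable_rV_ball.
have Af : lebesgue_rV R n.+1 A \is a fin_num by rewrite ge0_fin_numE.
move: H; rewrite lebesgue_rV_ball_ge0// -/om -(fineK omf) -(fineK Af) -!EFinM !lee_fin => H.
rewrite -(ler_pXn2r (ltn0Sn 1)) ?nnegrE ?mulr_ge0 ?exprn_ge0 ?fine_ge0 ?invr_ge0//.
rewrite -(ler_pM2l (_ : 0 < 4 ^+ n.+1)%R) ?exprn_gt0// expr2 (le_trans H)//.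
rewrite le_eqVlt; apply/orP; left; apply/eqP.
  rewrite expr_div_n (_ : 4 ^+ n.+1 = 2 ^+ n.+1 * 2 ^+ n.+1)%R.
    have t0 : (2 ^+ n.+1 != 0 :> R)%R by rewrite expf_neq0.
    by move: (2 ^+ n.+1)%R t0 (D ^+ n.+1)%R => a a0 b; field.
  by rewrite -exprMn; congr (_ ^+ _)%R; ring.
- by rewrite divr_ge0.
- exact: measure_ge0.
Qed.

End isodiametric.

(** * Hausdorff measure *)

Section hausdorff_theory.
Context {R : realType}.
Local Open Scope ereal_scope.

Lemma lee_expe (x y : \bar R) k : 0 <= x -> x <= y -> x ^+ k <= y ^+ k.
Proof.
move=> x0 xy; elim: k => [|k ih]; first by rewrite !expe0.
by rewrite !expeS lee_pmul// expe_ge0.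
Qed.

Lemma ediam_ge0 n (U : set 'rV[R]_n) : U !=set0 -> 0 <= ediam U.
Proof.
move=> [x Ux]; apply: ereal_sup_ubound; exists x => //; exists x => //.
by rewrite subrr enorm0.
Qed.

Lemma ediam_ub n (U : set 'rV[R]_n) x y : U x -> U y -> (enorm (x - y))%:E <= ediam U.
Proof. by move=> Ux Uy; apply: ereal_sup_ubound; exists x => //; exists y. Qed.

Lemma ediam_le n (U : set 'rV[R]_n) (D : \bar R) :
  (forall x y, U x -> U y -> (enorm (x - y))%:E <= D) -> ediam U <= D.
Proof. by move=> H; apply: ge_ereal_sup => _ [x Ux [y Uy <-]]; exact: H. Qed.

Lemma hausdorff_weight0 n k : hausdorff_weight k (set0 : set 'rV[R]_n) = 0.
Proof. by rewrite /hausdorff_weight eqxx. Qed.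

Lemma unit_ball_volume_ge0 k : 0 <= unit_ball_volume R k.
Proof. exact: measure_ge0. Qed.

Lemma hausdorff_weight_le n m k (U : set 'rV[R]_n) (V : set 'rV[R]_m) :
  (V !=set0 -> U !=set0) -> ediam V <= ediam U ->
  hausdorff_weight k V <= hausdorff_weight k U.
Proof.
rewrite /hausdorff_weight; case: eqP => [-> _ _|/eqP/set0P V0].
  case: eqP => // /eqP/set0P U0; apply: mule_ge0; first exact: unit_ball_volume_ge0.
  by apply: expe_ge0; apply: mule_ge0; [rewrite lee_fin|exact: ediam_ge0].
move=> /(_ V0) U0 VU; case: eqP => [UE|_]; first by move: U0 => /set0P; rewrite UE eqxx.
apply: lee_wpmul2l; first exact: unit_ball_volume_ge0.
apply: lee_expe; first by apply: mule_ge0; [rewrite lee_fin|exact: ediam_ge0].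
by apply: lee_wpmul2l => //; rewrite lee_fin.
Qed.

Lemma hausdorff_weight_ge0 n k (U : set 'rV[R]_n) : 0 <= hausdorff_weight k U.
Proof.
rewrite -(hausdorff_weight0 n k); apply: hausdorff_weight_le; first by move=> [].
by apply: ediam_le.
Qed.

Lemma hausdorff_delta_ge0 n k delta (A : set 'rV[R]_n) : 0 <= hausdorff_delta k delta A.
Proof.
apply: le_ereal_inf_tmp => _ [U _ <-]; apply: nneseries_ge0 => i _ _.
exact: hausdorff_weight_ge0.
Qed.

Lemma hausdorff_delta_le n k delta (A : set 'rV[R]_n) : (0 < delta)%R ->
  hausdorff_delta k delta A <= hausdorff k A.
Proof. by move=> d0; apply: ereal_sup_ubound; exists delta. Qed.

Lemma le_hausdorff_delta n k (d1 d2 : R) (A : set 'rV[R]_n) : (d1 <= d2)%R ->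
  hausdorff_delta k d2 A <= hausdorff_delta k d1 A.
Proof.
move=> d12; apply: le_ereal_inf => _ [U [AU Ud] <-]; exists U => //; split => // i.
by rewrite (le_trans (Ud i))// lee_fin.
Qed.

Lemma hausdorff_contraction n m k (f : 'rV[R]_n -> 'rV[R]_m) (A : set 'rV[R]_n) :
  (forall x y, A x -> A y -> enorm (f x - f y) <= enorm (x - y))%R ->
  hausdorff k (f @` A) <= hausdorff k A.
Proof.
move=> fA; apply: ge_ereal_sup => _ [delta d0 <-].
apply: le_trans (hausdorff_delta_le _ _ d0).
apply: le_ereal_inf_tmp => _ [U [AU Ud] <-].
pose V i := f @` (U i `&` A).
have VU i : ediam (V i) <= ediam (U i).
  apply: ediam_le => _ _ [x [Ux Ax] <-] [y [Uy Ay] <-].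
  by apply: le_trans (ediam_ub Ux Uy); rewrite lee_fin fA.
apply: (@le_trans _ _ (\sum_(i <oo) hausdorff_weight k (V i))).
  apply: ereal_inf_lbound; exists V => //; split.
    by move=> _ [x Ax <-]; have [i _ Ui] := AU x Ax; exists i => //; exists x.
  by move=> i; exact: le_trans (VU i) (Ud i).
apply: lee_nneseries => [i _ _|i _]; first exact: hausdorff_weight_ge0.
by apply: hausdorff_weight_le => // -[_ [x [Ux _] _]]; exists x.
Qed.

Lemma ereal_sup_add_le (S T : set (\bar R)) c :
  (forall s, S s -> 0 <= s) -> (forall t, T t -> 0 <= t) -> S !=set0 -> T !=set0 ->
  (forall s t, S s -> T t -> s + t <= c) -> ereal_sup S + ereal_sup T <= c.
Proof.
move=> S0 T0 [s0 Ss0] [t0 Tt0] STc; have [->|coo] := eqVneq c +oo; first exact: leey.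
have fin x y : 0 <= x -> 0 <= y -> x + y <= c -> x \is a fin_num.
  move=> x0 y0 xy; rewrite ge0_fin_numE// (@le_lt_trans _ _ c)// ?ltey//.
  by rewrite (le_trans _ xy)// leeDl.
have sT t : T t -> ereal_sup S + t <= c.
  move=> Tt; have tf : t \is a fin_num.
    by apply: (fin t s0); [exact: T0|exact: S0|rewrite addeC; exact: STc].
  rewrite -leeBrDr//; apply: ge_ereal_sup => s Ss; rewrite leeBrDr//; exact: STc.
have supS0 : 0 <= ereal_sup S by apply: le_trans (S0 _ Ss0) _; exact: ereal_sup_ubound.
have Sf : ereal_sup S \is a fin_num by apply: (fin _ t0) => //; [exact: T0|exact: sT].
by rewrite -leeBrDl//; apply: ge_ereal_sup => t Tt; rewrite leeBrDl//; exact: sT.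
Qed.

(** Sets at positive distance are not met by a common set of small diameter. *)
Lemma hausdorff_separated n k (A B : set 'rV[R]_n) (r : R) : (0 < r)%R ->
  (forall a b, A a -> B b -> r <= enorm (a - b))%R ->
  hausdorff k A + hausdorff k B <= hausdorff k (A `|` B).
Proof.
move=> r0 AB; apply: ereal_sup_add_le.
- by move=> _ [d _ <-]; exact: hausdorff_delta_ge0.
- by move=> _ [d _ <-]; exact: hausdorff_delta_ge0.
- by exists (hausdorff_delta k 1 A); exists 1%R => //=.
- by exists (hausdorff_delta k 1 B); exists 1%R => //=.
move=> _ _ [d1 d10 <-] [d2 d20 <-].
(* Sets of diameter at most d cannot meet both A and B. *)
pose d := Num.min (r / 2)%R (Num.min d1 d2).
have d0 : (0 < d)%R by rewrite !lt_min divr_gt0//= d10 d20.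
have dr : (d < r)%R by rewrite gt_min; apply/orP; left; rewrite ltr_pdivrMr// mulr_natr mulr2n ltrDl.
apply: le_trans (hausdorff_delta_le _ _ d0).
apply: (@le_trans _ _ (hausdorff_delta k d A + hausdorff_delta k d B)).
  by apply: leeD; apply: le_hausdorff_delta; rewrite !ge_min lexx ?orbT.
apply: le_ereal_inf_tmp => _ [U [ABU Ud] <-].
pose V (C : set 'rV[R]_n) i := if `[< U i `&` C !=set0 >] then U i else set0.
have VC C : C `<=` A `|` B -> hausdorff_delta k d C <= \sum_(i <oo) hausdorff_weight k (V C i).
  move=> CAB; apply: ereal_inf_lbound; exists (V C) => //; split.
    move=> x Cx; have [i _ Ui] := ABU x (CAB x Cx); exists i => //.
    by rewrite /V asboolT//; exists x.
  move=> i; rewrite /V; case: asboolP => // _; apply: ediam_le => x y [].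
apply: (@le_trans _ _ (\sum_(i <oo) hausdorff_weight k (V A i) +
    \sum_(i <oo) hausdorff_weight k (V B i))).
  by apply: leeD; apply: VC; [exact: subsetUl|exact: subsetUr].
rewrite -nneseriesD; last 2 first.
- by move=> i _ _; exact: hausdorff_weight_ge0.
- by move=> i _ _; exact: hausdorff_weight_ge0.
apply: lee_nneseries => [i _ _|i _].
  by apply: adde_ge0; exact: hausdorff_weight_ge0.
rewrite /V; case: asboolP => [[a [Ua Aa]]|_]; last first.
  by rewrite hausdorff_weight0 add0e; case: asboolP => // _;
     rewrite hausdorff_weight0 hausdorff_weight_ge0.
case: asboolP => [[b [Ub Bb]]|_]; last by rewrite hausdorff_weight0 adde0.
have := le_trans (ediam_ub Ua Ub) (Ud i).
by rewrite lee_fin leNgt (lt_le_trans dr)// AB.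
Qed.

Let hmeas n k := @hausdorff_outer R n k.

(** With u(t) the measure of the part of X below the level t, the slice between
    two consecutive levels t_j and t_(j+1) has measure at most
    u(t_(j+1)) - u(t_(j-1)), since it is at positive distance from the part below
    t_(j-1); these bounds telescope along levels increasing to c. *)
Lemma caratheodory_half_space n k (i : 'I_n) (c : R) :
  caratheodory_measurable (hmeas n k) [set x : 'rV[R]_n | x 0%R i < c]%R.
Proof.
set P := [set x | _]; apply: le_caratheodory_measurable => X.
have [XE|Xoo] := eqVneq (hmeas n k X) +oo; first by rewrite XE leey.
have Hge0 A : 0 <= hmeas n k A by exact: outer_measure_ge0.
have Hfin A : A `<=` X -> hmeas n k A \is a fin_num.
  move=> AX; rewrite ge0_fin_numE//; apply: (@le_lt_trans _ _ (hmeas n k X)).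
    exact: le_outer_measure.
  by rewrite ltey.
have sep (A B : set 'rV[R]_n) r : (0 < r)%R -> (forall a b, A a -> B b -> a 0%R i + r <= b 0%R i)%R ->
    A `<=` X -> B `<=` X -> hmeas n k A + hmeas n k B <= hmeas n k (A `|` B).
  move=> r0 ABr _ _; have := @hausdorff_separated n k A B r r0; apply => a b Aa Bb.
  rewrite enormB; apply: le_trans (coord_le_enorm _ i).
  by rewrite !mxE (le_trans _ (ler_norm _))//; have := ABr a b Aa Bb; lra.
pose t (m : nat) : R := (c - m.+1%:R^-1)%R.
have tS m : (t m < t m.+1)%R by rewrite ltrD2l ltrN2 ltf_pV2 ?posrE// ltr_nat.
have tc m : (t m < c)%R by rewrite gtrDl oppr_lt0 invr_gt0.
pose A m := X `&` [set x : 'rV[R]_n | x 0%R i <= t m]%R.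
pose D m := X `&` [set x : 'rV[R]_n | (t m.+1 < x 0%R i) && (x 0%R i <= t m.+2)]%R.
have AX m : A m `<=` X by exact: subIsetl.
have DX m : D m `<=` X by exact: subIsetl.
pose v m := fine (hmeas n k (A m)).
have vE m : (v m)%:E = hmeas n k (A m) by rewrite /v fineK// Hfin.
have vDv m : hmeas n k (D m) <= (v m.+2 - v m)%:E.
  rewrite EFinB !vE leeBrDl ?Hfin//.
  apply: (@le_trans _ _ (hmeas n k (A m `|` D m))).
    apply: (@sep _ _ (t m.+1 - t m)%R) => //; first by rewrite subr_gt0.
    by move=> a b [_ /= am] [_ /= /andP[bm _]]; lra.
  apply: le_outer_measure => x [[Xx /= xm]|[Xx /= /andP[_ xm]]]; split => //=.
  by rewrite (le_trans xm)// ltW// (lt_trans (tS _)).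
have vnd m : (v m <= v m.+1)%R.
  rewrite -lee_fin !vE; apply: le_outer_measure => x [Xx /= xm]; split => //=.
  by rewrite (le_trans xm)// ltW.
pose V := sup (range v).
have vX m : (v m <= fine (hmeas n k X))%R.
  by rewrite -lee_fin vE fineK ?Hfin//; exact: le_outer_measure.
have supv : has_sup (range v).
  by split; [exists (v 0%N); exists 0%N|exists (fine (hmeas n k X)) => _ [m _ <-]].
have vV m : (v m <= V)%R by apply: (sup_upper_bound supv); exists m.
have PA m : hmeas n k (X `&` P) <= (V + V - v m)%:E.
  have cover : X `&` P `<=` A m.+1 `|` \bigcup_j D (m + j)%N.
    move=> x [Xx /= xc]; have [xm|xm] := leP (x 0%R i) (t m.+1); first by left.
    right; have ex : exists j, (x 0%R i <= t (m + j).+2)%R.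
      have cx0 : (0 < c - x 0%R i)%R by rewrite subr_gt0.
      have [j _ jc] := @near_infty_natSinv_lt R (PosNum cx0).
      exists j; rewrite /t lerBrDr -lerBrDl ltW//.
      apply: le_lt_trans (jc j (leqnn j)).
      by rewrite lef_pV2 ?posrE// ler_nat; lia.
    case: (ex_minnP ex) => j xj jmin; exists j => //; split => //=; rewrite xj andbT.
    case: j xj jmin => [|j] _ jmin; first by rewrite addn0.
    by rewrite ltNge addnS; apply/negP => /jmin; rewrite ltnn.
  have part N : \sum_(0 <= j < N) hmeas n k (D (m + j)%N) <=
      (v (m + N).+1 + v (m + N)%N - v m - v m.+1)%:E.
    elim: N => [|N ih].
      by rewrite big_geq// addn0 lee_fin; lra.
    rewrite big_nat_recr; last by [].
    apply: (le_trans (leeD ih (vDv (m + N)%N))).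
    by rewrite -EFinD lee_fin addnS; lra.
  apply: (@le_trans _ _ (hmeas n k (A m.+1 `|` \bigcup_j D (m + j)%N))).
    exact: le_outer_measure.
  apply: le_trans (outer_measureU2 _ _ _) _.
  rewrite -vE (_ : (V + V - v m)%R = (v m.+1 + (V + V - v m - v m.+1))%R); last by ring.
  rewrite EFinD leeD2l//; apply: le_trans (outer_measure_sigma_subadditive _ _) _.
  apply: lime_le; first by apply: is_cvg_nneseries => j _ _.
  near=> N.
  apply: (le_trans (part N)); rewrite lee_fin; by have := vV (m + N).+1; have := vV (m + N)%N; lra.
have AnP m : (v m)%:E + hmeas n k (X `&` ~` P) <= hmeas n k X.
  rewrite vE; apply: (@le_trans _ _ (hmeas n k (A m `|` (X `&` ~` P)))).
    apply: (@sep _ _ (c - t m)%R) => //; first by rewrite subr_gt0.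
    by move=> a b [_ /= am] [_ /= /negP]; rewrite -leNgt; lra.
  by apply: le_outer_measure => x [[]|[]].
have XPf : hmeas n k (X `&` P) \is a fin_num by apply: Hfin; exact: subIsetl.
have XnPf : hmeas n k (X `&` ~` P) \is a fin_num by apply: Hfin; exact: subIsetl.
have Xf : hmeas n k X \is a fin_num by exact: Hfin.
move: PA AnP; rewrite -(fineK XPf) -(fineK XnPf) -(fineK Xf).
move: (fine _) (fine _) (fine _) => x b a PA AnP; rewrite -EFinD lee_fin.
have aV : (a <= V)%R.
  suff : (V <= V + V - a)%R by lra.
  by apply: ge_sup; [case: supv|move=> _ [m _ <-]; have := PA m; rewrite lee_fin; lra].
suff : (V <= x - b)%R by lra.
apply: ge_sup; first by case: supv.
by move=> _ [m _ <-]; have := AnP m; rewrite -EFinD lee_fin; lra.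
Unshelve. all: by end_near. Qed.

Lemma measurable_caratheodory_id n k :
  measurable_fun setT (id : caratheodory_type (hmeas n k) -> 'rV[R]_n).
Proof.
apply: measurable_fun_rV => i.
apply: (measurability _ (RGenInftyO.measurableE R)) => _ [_ [c ->] <-].
rewrite setTI (_ : _ @^-1` _ = [set x : 'rV[R]_n | x 0%R i < c]%R); last first.
  by apply/seteqP; split => x /=; rewrite in_itv.
exact: caratheodory_half_space.
Qed.

End hausdorff_theory.

Section hausdorff_lebesgue.
Context {R : realType}.
Local Open Scope ereal_scope.

Lemma hausdorff_delta_mono n k delta (A B : set 'rV[R]_n) : A `<=` B ->
  hausdorff_delta k delta A <= hausdorff_delta k delta B.
Proof.
move=> AB; apply: le_ereal_inf => _ [U [BU Ud] <-]; exists U => //; split => //.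
exact: subset_trans AB BU.
Qed.

Lemma hausdorff_delta0 n k delta : hausdorff_delta k delta (set0 : set 'rV[R]_n) <= 0.
Proof.
apply: ereal_inf_lbound; exists (fun=> set0).
  by split=> [|i]; [exact: sub0set|apply: ediam_le].
by apply: eseries0 => i _ _; exact: hausdorff_weight0.
Qed.

Lemma hausdorff_delta_setU1 n k delta (S A : set 'rV[R]_n) : ediam S <= delta%:E ->
  hausdorff_delta k delta (S `|` A) <= hausdorff_weight k S + hausdorff_delta k delta A.
Proof.
move=> Sd; have w0 := hausdorff_weight_ge0 k S.
have [wE|woo] := eqVneq (hausdorff_weight k S) +oo.
  by rewrite wE addye ?leey// gt_eqF// (lt_le_trans _ (hausdorff_delta_ge0 _ _ _)).
have wf : hausdorff_weight k S \is a fin_num by rewrite ge0_fin_numE// ltey.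
rewrite -leeBlDl//; apply: le_ereal_inf_tmp => _ [U [AU Ud] <-]; rewrite leeBlDl//.
apply: ereal_inf_lbound; exists (fun i => if i is j.+1 then U j else S).
  split; last by case.
  by move=> x [Sx|/AU[i _ Ui]]; [exists 0%N|exists i.+1].
rewrite nneseries_recl//; last by move=> [|i] _; exact: hausdorff_weight_ge0.
congr (_ + _); rewrite -(nneseries_addn 1); last by move=> [|i]; exact: hausdorff_weight_ge0.
by apply: eq_eseriesr => i _; rewrite addn1.
Qed.

Lemma hausdorff_delta_cover n k delta (I : finType) (S : I -> set 'rV[R]_n)
    (A B : set 'rV[R]_n) :
  (forall i, ediam (S i) <= delta%:E) -> A `<=` \bigcup_i S i `|` B ->
  hausdorff_delta k delta A <=
    \sum_(i : I) hausdorff_weight k (S i) + hausdorff_delta k delta B.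
Proof.
move=> Sd AB; apply: le_trans (hausdorff_delta_mono k delta AB) _.
have -> : \bigcup_i S i = \bigcup_(i in [set i | i \in enum I]) S i.
  by congr bigcup; apply/seteqP; split => i //= _; rewrite mem_enum.
rewrite -big_enum /=; elim: (enum I) => [|i s ih].
  by rewrite big_nil add0e; apply: hausdorff_delta_mono => x [[i]|].
rewrite big_cons -addeA; apply: le_trans (leeD2l _ ih).
apply: le_trans (hausdorff_delta_setU1 _ _ (Sd i)); apply: hausdorff_delta_mono.
move=> x [[j /= ]|Bx]; last by right; right.
by rewrite inE => /predU1P[->|js] xj; [left|right; left; exists j].
Qed.

Lemma hausdorff_weight_ball n k (S : set 'rV[R]_n) (r : R) : (0 <= r)%R ->
  (forall x y, S x -> S y -> enorm (x - y) <= 2 * r)%R ->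
  hausdorff_weight k S <= unit_ball_volume R k * (r ^+ k)%:E.
Proof.
move=> r0 Sr; rewrite /hausdorff_weight; case: eqP => [_|/eqP/set0P S0].
  by apply: mule_ge0; [exact: unit_ball_volume_ge0|rewrite lee_fin exprn_ge0].
apply: lee_wpmul2l; first exact: unit_ball_volume_ge0.
rewrite EFin_expe; apply: lee_expe; first by apply: mule_ge0; [rewrite lee_fin|exact: ediam_ge0].
apply: (@le_trans _ _ (2^-1%:E * (2 * r)%:E)).
  by apply: lee_wpmul2l; [rewrite lee_fin|apply: ediam_le => x y Sx Sy; rewrite lee_fin Sr].
by rewrite -EFinM lee_fin mulrA mulVf ?mul1r.
Qed.

Lemma closure_diameter n (U : set 'rV[R]_n) (D : R) :
  (forall x y, U x -> U y -> enorm (x - y) <= D)%R ->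
  forall x y, closure U x -> closure U y -> (enorm (x - y) <= D)%R.
Proof.
move=> UD x y cx cy; apply/ler_addgt0Pr => e e0.
have e2 : (0 < e / 2)%R by rewrite divr_gt0.
have near (z : 'rV[R]_n) : closure U z -> exists2 u, U u & (enorm (u - z) < e / 2)%R.
  move=> cz; have [|u [Uu uz]] := cz [set u | enorm (u - z) < e / 2]%R.
    by apply/nbhs_enormP; exists (e / 2)%R.
  by exists u.
have [u Uu ux] := near x cx; have [w Uw wy] := near y cy.
rewrite (_ : x - y = (u - w) - (u - x) + (w - y))%R.
  apply: le_trans (ler_enormD _ _) _; have := ler_enormB (u - w) (u - x).
  by have := UD u w Uu Uw; lra.
by apply/rowP => i; rewrite !mxE; ring.
Qed.

(** The isodiametric inequality bounds the volume of each set of a covering by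
    its Hausdorff weight; passing to the closures makes the sets measurable. *)
Lemma le_lebesgue_hausdorff n (B : set 'rV[R]_n.+1) : measurable B ->
  lebesgue_rV R n.+1 B <= hausdorff n.+1 B.
Proof.
move=> mB; apply: le_trans (hausdorff_delta_le _ _ ltr01).
apply: le_ereal_inf_tmp => _ [U [BU Ud] <-].
have mU i : measurable (closure (U i)).
  by apply: closed_measurable_rV; exact: closed_closure.
apply: (@le_trans _ _ (\sum_(i <oo) lebesgue_rV R n.+1 (closure (U i)))).
  apply: measure_sigma_subadditive => //.
  by move=> x /BU[i _ Ui]; exists i => //; exact: subset_closure.
apply: lee_nneseries => // i _; rewrite /hausdorff_weight.
case: eqP => [->|/eqP/set0P U0]; first by rewrite closure0 measure0.
have [d dE] : exists d : R, ediam (U i) = d%:E.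
  have := Ud i; have := ediam_ge0 U0.
  by case: (ediam _) => [d| |]// _ _; exists d.
have d0 : (0 <= d)%R by rewrite -lee_fin -dE ediam_ge0.
rewrite dE -EFinM -EFin_expe muleC mulrC; apply: isodiametric => //.
apply: closure_diameter => x y Ux Uy.
by rewrite -lee_fin -dE ediam_ub.
Qed.

Lemma hausdorff_translate n k (v : 'rV[R]_n) (A : set 'rV[R]_n) :
  hausdorff k ((fun x => x + v)%R @^-1` A) = hausdorff k A.
Proof.
apply/eqP; rewrite eq_le; apply/andP; split.
  rewrite (_ : _ @^-1` _ = (fun x => x - v)%R @` A); last first.
    apply/seteqP; split => x /=; first by exists (x + v)%R => //; rewrite addrK.
    by move=> [y Ay <-]; rewrite subrK.
  by apply: hausdorff_contraction => x y _ _; rewrite opprB addrA subrK.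
rewrite -{1}(_ : (fun x => x + v)%R @` ((fun x => x + v)%R @^-1` A) = A); last first.
  apply/seteqP; split => x /=; first by move=> [y Ay <-].
  by exists (x - v)%R; rewrite ?subrK.
by apply: hausdorff_contraction => x y _ _; rewrite opprD addrA addrAC addrK.
Qed.

(** The centers of the cubes of a regular subdivision of [-rho, rho]^n, with N
    cubes along each axis. *)
Definition cube_center n N (rho : R) (f : {ffun 'I_n -> 'I_N}) : 'rV[R]_n :=
  \row_i (rho * ((2 * (f i)%:R + 1) / N%:R - 1))%R.

Definition small_cube n N (rho : R) (f : {ffun 'I_n -> 'I_N}) : set 'rV[R]_n :=
  [set x | rV_cube (rho / N%:R) (x - cube_center rho f)%R].

Definition small_ball n N (rho : R) (f : {ffun 'I_n -> 'I_N}) : set 'rV[R]_n :=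
  [set x | rV_ball (rho / N%:R) (x - cube_center rho f)%R].

Lemma cube_cover n N (rho : R) : (0 < N)%N -> (0 < rho)%R ->
  @rV_cube R n rho `<=` \bigcup_(f : {ffun 'I_n -> 'I_N}) small_cube rho f.
Proof.
move=> N0 rho0 x xrho; have NR : (0 < N%:R :> R)%R by rewrite ltr0n.
pose u i := ((x 0%R i / rho + 1) / 2 * N%:R)%R.
have uE i : (x 0%R i = rho * (2 * u i / N%:R - 1))%R.
  by rewrite /u; field; rewrite !gt_eqF.
have u0 i : (0 <= u i)%R.
  have := xrho i; rewrite ler_norml => /andP[a _].
  rewrite mulr_ge0 ?(ltW NR)// divr_ge0// -lerBlDr sub0r ler_pdivlMr// mulN1r//.
have uN i : (u i <= N%:R)%R.
  have := xrho i; rewrite ler_norml => /andP[_ a].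
  rewrite -[leRHS]mul1r ler_wpM2r ?(ltW NR)// ler_pdivrMr//.
  suff : (x 0%R i / rho <= 1)%R by lra.
  by rewrite ler_pdivrMr// mul1r.
have lt i : (minn (Num.truncn (u i)) N.-1 < N)%N by rewrite -(prednK N0) ltnS geq_minr.
exists [ffun i => Ordinal (lt i)] => //= i; rewrite !mxE ffunE /= uE -mulrBr.
set t := minn _ _.
have /andP[t1 t2] : (t%:R <= u i <= t%:R + 1)%R.
  rewrite /t; case: (leqP (Num.truncn (u i)) N.-1) => [|Nt].
    move=> _; apply/andP; split; first by have /andP[] := truncn_itv (u0 i).
    by rewrite natr1 ltW// truncnS_gt.
  rewrite natr1 prednK// uN andbT (@le_trans _ _ (Num.truncn (u i))%:R)//.
    by rewrite ler_nat ltnW.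
  by have := truncn_itv (u0 i) => /andP[].
rewrite (_ : _ - _ = (2 * u i - (2 * t%:R + 1)) / N%:R)%R; last by field; rewrite gt_eqF.
rewrite normrM gtr0_norm// ler_wpM2l ?(ltW rho0)// normrM (gtr0_norm (_ : 0 < _^-1)%R) ?invr_gt0//.
rewrite -[leRHS]mul1r ler_wpM2r ?invr_ge0 ?(ltW NR)//.
by rewrite ler_norml; apply/andP; split; lra.
Qed.

Lemma small_scale (rho e : R) : (0 < e)%R -> exists2 N : nat, (0 < N)%N & (rho / N%:R <= e)%R.
Proof.
move=> e0; exists (Num.truncn (rho / e)).+1 => //.
by rewrite ler_pdivrMr ?ltr0n// mulrC -ler_pdivrMr// ltW// truncnS_gt.
Qed.

Lemma hausdorff_cube_lty n (rho : R) : (0 < rho)%R ->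
  hausdorff n.+1 (@rV_cube R n.+1 rho) < +oo.
Proof.
move=> rho0; set om := unit_ball_volume R n.+1.
pose s : R := Num.sqrt n.+1%:R.
have s0 : (0 < s)%R by rewrite sqrtr_gt0 ltr0n.
have omoo : om < +oo by exact: lebesgue_rV_ball_lty.
have omf : om \is a fin_num by rewrite ge0_fin_numE//; exact: unit_ball_volume_ge0.
suff : hausdorff n.+1 (@rV_cube R n.+1 rho) <= om * ((s * rho) ^+ n.+1)%:E.
  by move/le_lt_trans; apply; rewrite -(fineK omf) -EFinM ltry.
apply: ge_ereal_sup => _ [delta d0 <-].
have [N N0 Nd] := @small_scale (2 * s * rho)%R delta d0.
have NR : (0 < N%:R :> R)%R by rewrite ltr0n.
have diam f x y : @small_cube n.+1 N rho f x -> small_cube rho f y ->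
    (enorm (x - y) <= 2 * (s * (rho / N%:R)))%R.
  have q0 : (0 <= rho / N%:R)%R by rewrite divr_ge0 ?ltW.
  move=> /(sub_cube_ball q0); rewrite /rV_ball /= => xf /(sub_cube_ball q0); rewrite /rV_ball /= => yf.
  rewrite (_ : x - y = (x - cube_center rho f) - (y - cube_center rho f))%R.
    by apply: le_trans (ler_enormB _ _) _; rewrite mulr2n mulrDl mul1r lerD.
  by rewrite opprB addrA subrK.
have sub : @rV_cube R n.+1 rho `<=` \bigcup_(f : {ffun 'I_n.+1 -> 'I_N}) small_cube rho f `|` set0.
  by rewrite setU0; exact: cube_cover.
apply: le_trans (hausdorff_delta_cover n.+1 (delta := delta) _ sub) _.
  move=> f; apply: ediam_le => x y xf yf; rewrite lee_fin (le_trans (diam f x y xf yf))//.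
  by rewrite (le_trans _ Nd)// !mulrA.
apply: le_trans (leeD2l _ (hausdorff_delta0 _ _ _)) _; rewrite adde0.
apply: (@le_trans _ _ (\sum_(f : {ffun 'I_n.+1 -> 'I_N}) om * ((s * (rho / N%:R)) ^+ n.+1)%:E)).
  apply: lee_sum => f _; apply: hausdorff_weight_ball; last exact: diam.
  by rewrite mulr_ge0 ?(ltW s0)// divr_ge0 ?ltW.
rewrite -(fineK omf) -EFinM sumEFin lee_fin sumr_const card_ffun !card_ord.
rewrite -[(_ *+ (N ^ _)%N)%R]mulr_natr -mulrA natrX -exprMn le_eqVlt; apply/orP; left; apply/eqP.
by congr (_ * _ ^+ _)%R; field; rewrite gt_eqF.
Qed.

(** Let m be the dimension, omega the volume of the unit ball and C the Hausdorff
    measure of the cube [-1, 1]^m. Hausdorff measure is a translation-invariant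
    Borel measure, hence C 2^(-m) times Lebesgue measure. The factor is at least
    1 by the isodiametric inequality. Conversely the cube is covered by N^m balls
    and what they leave of N^m cubes; letting the scale of the covering tend to 0
    gives C <= omega + C 2^(-m) (2^m - omega), so that C <= 2^m. *)
Lemma hausdorff_lebesgue n (B : set 'rV[R]_n.+1) : measurable B ->
  hausdorff n.+1 B = lebesgue_rV R n.+1 B.
Proof.
move=> mB; set lam := lebesgue_rV R n.+1.
have mid := @measurable_caratheodory_id R n.+1 n.+1.
pose mu' : {measure set 'rV[R]_n.+1 -> \bar R} := pushforward (hausdorff_measure R n.+1 n.+1)
  (id : caratheodory_type (hausdorff_outer R n.+1 n.+1) -> 'rV[R]_n.+1).
pose mu := mu' mid; have muE A : mu A = hausdorff n.+1 A by [].
have mQ := @measurable_rV_cube R n.+1 1.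
have sf : sigma_finite setT mu.
  apply: sigma_finite_balls => k; rewrite muE.
  apply: le_lt_trans (@hausdorff_cube_lty n k.+1%:R _); last by rewrite ltr0n.
  have := @le_outer_measure R _ (hausdorff_outer R n.+1 n.+1); apply.
  move=> x /sub_ball_cube xk i; apply: le_trans (xk i) _.
  by rewrite ler_nat.
have uniq A : measurable A -> mu A * lam (rV_cube 1) = lam A * mu (rV_cube 1).
  move=> mA; apply: translation_invariant_unique => //.
  - by move=> v A' mA'; rewrite muE hausdorff_translate.
  - by move=> x; split => xr i; have := xr i; rewrite mxE normrN.
have Qfin : mu (rV_cube 1) \is a fin_num.
  by rewrite ge0_fin_numE ?measure_ge0// muE hausdorff_cube_lty.
pose C := fine (mu (rV_cube 1)); have CE : mu (rV_cube 1) = C%:E by rewrite fineK.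
pose L : R := (2 ^+ n.+1)%R.
have L0 : (0 < L)%R by rewrite exprn_gt0.
have LE : lam (rV_cube 1) = L%:E by rewrite /lam lebesgue_rV_cube// mulr1.
have muL A : measurable A -> mu A = lam A * (C / L)%:E.
  move=> mA; have := uniq A mA; rewrite CE LE => E.
  apply: (@muleI_fin R _ _ L%:E); rewrite ?lte_fin ?ltry//.
  by rewrite E -muleA -EFinM divfK// gt_eqF.
suff CL : C = L by rewrite -muE muL// CL divff ?mule1// gt_eqF.
have LC : (L <= C)%R by rewrite -lee_fin -LE -CE muE le_lebesgue_hausdorff.
apply/eqP; rewrite eq_le LC andbT.
have omoo := @lebesgue_rV_ball_lty R n.+1 1%R; have om0 := @lebesgue_rV_ball_gt0 R n.+1 1%R ltr01.
have omf : lam (rV_ball 1) \is a fin_num by rewrite ge0_fin_numE// ltW.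
pose w := fine (lam (rV_ball 1)); have wE : lam (rV_ball 1) = w%:E by rewrite fineK.
have w0 : (0 < w)%R by rewrite -lte_fin -wE.
(* Here L = 2^m and w = omega. *)
suff : (C <= w + C / L * (L - w))%R.
  rewrite mulrBr divfK ?gt_eqF// addrCA lerDl subr_ge0 mulrAC.
  by rewrite ler_pdivrMr// [leRHS]mulrC ler_pM2r.
rewrite -lee_fin -CE muE; apply: ge_ereal_sup => _ [delta d0 <-].
pose s : R := Num.sqrt n.+1%:R.
have [N N0 Nd] := @small_scale 2 delta d0.
have NR : (0 < N%:R :> R)%R by rewrite ltr0n.
have r0 : (0 < 1 / N%:R :> R)%R by rewrite divr_gt0.
pose rest f := @small_cube n.+1 N 1 f `\` small_ball 1 f.
have mcube f : measurable (@small_cube n.+1 N 1 f).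
  rewrite -[X in measurable X]setTI; apply: (measurable_translation (- cube_center 1 f)) => //.
  exact: measurable_rV_cube.
have mball f : measurable (@small_ball n.+1 N 1 f).
  rewrite -[X in measurable X]setTI; apply: (measurable_translation (- cube_center 1 f)) => //.
  exact: measurable_rV_ball.
have mrest f : measurable (rest f) by exact: measurableD.
have diam f x y : @small_ball n.+1 N 1 f x -> small_ball 1 f y ->
    (enorm (x - y) <= 2 * (1 / N%:R))%R.
  rewrite /small_ball /rV_ball /= => xf yf.
  rewrite (_ : x - y = (x - cube_center 1 f) - (y - cube_center 1 f))%R.
    by apply: le_trans (ler_enormB _ _) _; rewrite mulr2n mulrDl mul1r lerD.
  by rewrite opprB addrA subrK.
have sub : @rV_cube R n.+1 1 `<=`
    \bigcup_(f : {ffun 'I_n.+1 -> 'I_N}) small_ball 1 f `|` \bigcup_f rest f.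
  move=> x /(cube_cover N0 ltr01)[f _ xf].
  have [xb|xb] := pselect (small_ball 1 f x); first by left; exists f.
  by right; exists f.
apply: le_trans (hausdorff_delta_cover n.+1 (delta := delta) _ sub) _.
  move=> f; apply: ediam_le => x y xf yf; rewrite lee_fin (le_trans (diam f x y xf yf))//.
  by rewrite (le_trans _ Nd)// !mulrA mulr1.
rewrite EFinD; apply: leeD.
  apply: (@le_trans _ _ (\sum_(f : {ffun 'I_n.+1 -> 'I_N}) w%:E * ((1 / N%:R) ^+ n.+1)%:E)).
    by apply: lee_sum => f _; rewrite -wE; apply: hausdorff_weight_ball; [exact: ltW|exact: diam].
  rewrite -EFinM sumEFin lee_fin sumr_const card_ffun !card_ord.
  rewrite -[(_ *+ (N ^ _)%N)%R]mulr_natr -mulrA natrX -exprMn mul1r mulVf ?gt_eqF// expr1n mulr1 lexx//.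
apply: le_trans (hausdorff_delta_le _ _ d0) _; rewrite -muE.
have restE f : mu (rest f) = (C / L * ((L - w) * (1 / N%:R) ^+ n.+1))%:E.
  rewrite muL//; suff -> : lam (rest f) = ((L - w) * (1 / N%:R) ^+ n.+1)%:E.
    by rewrite -EFinM mulrC.
  have trans A : measurable A -> lam [set x | A (x - cube_center 1 f)%R] = lam A.
    by move=> mA; rewrite /lam -[RHS](lebesgue_rV_translate (- cube_center 1 f)%R).
  have bc : small_ball 1 f `<=` @small_cube n.+1 N 1 f by move=> x /sub_ball_cube.
  have cE : lam (small_cube 1 f) = (L * (1 / N%:R) ^+ n.+1)%:E.
    by rewrite /small_cube trans ?/lam ?lebesgue_rV_cube ?ltW// ?exprMn//; exact: measurable_rV_cube.
  have bE : lam (small_ball 1 f) = (w * (1 / N%:R) ^+ n.+1)%:E.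
    rewrite /small_ball trans; last exact: measurable_rV_ball.
    by rewrite /lam lebesgue_rV_ball// -/lam wE -EFinM mulrC.
  have Drest : lam (rest f) = lam (small_cube 1 f) - lam (small_cube 1 f `&` small_ball 1 f).
    by apply: measureD => //; exact: (eq_ind_r (fun z => z < +oo) (ltry _) cE).
  rewrite Drest setIidr// cE bE.
  by rewrite -EFinB -mulrBl.
apply: (@le_trans _ _ (\sum_(f : {ffun 'I_n.+1 -> 'I_N}) mu (rest f))).
  have -> : \bigcup_f rest f = \bigcup_(f in [set f | f \in enum {ffun 'I_n.+1 -> 'I_N}]) rest f.
    by congr bigcup; apply/seteqP; split => f //= _; rewrite mem_enum.
  rewrite bigcup_seq -[leRHS]big_enum muE (eq_bigr (fun f => hausdorff n.+1 (rest f)))//.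
  elim: (enum _) => [|f t ih].
    by rewrite !big_nil (outer_measure0 (hausdorff_outer R n.+1 n.+1)).
  rewrite !big_cons; apply: le_trans (leeD2l _ ih).
  exact: (outer_measureU2 (hausdorff_outer R n.+1 n.+1)).
rewrite (eq_bigr _ (fun f _ => restE f)) sumEFin lee_fin sumr_const card_ffun !card_ord.
rewrite -[(_ *+ (N ^ _)%N)%R]mulr_natr natrX -!mulrA -exprMn mul1r mulVf ?gt_eqF// expr1n mulr1 lexx//.
Qed.

Lemma hausdorff_isometry n m k (J : 'M[R]_(n, m)) (A : set 'rV[R]_n) :
  J *m J^T = 1%:M ->
  hausdorff k ((fun x => x *m J) @` A) = hausdorff k A.
Proof.
move=> JJ; apply/eqP; rewrite eq_le; apply/andP; split.
  by apply: hausdorff_contraction => x y _ _; rewrite -mulmxBl enorm_isometry.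
rewrite -{1}(_ : (fun x => x *m J^T) @` ((fun x => x *m J) @` A) = A); last first.
  apply/seteqP; split => x /=.
    by move=> [_ [y Ay <-] <-]; rewrite -mulmxA JJ mulmx1.
  by move=> Ax; exists (x *m J); [exists x|rewrite -mulmxA JJ mulmx1].
apply: hausdorff_contraction => _ _ [x Ax <-] [y Ay <-].
by rewrite -!mulmxA JJ !mulmx1 -mulmxBl enorm_isometry.
Qed.

(** Parametrized by an isometry J, the hyperplane orthogonal to nu carries the
    image of Lebesgue measure. *)
Lemma ge0_integral_hyperplane k (J : 'M[R]_(k.+1, k.+2)) (nu : 'rV[R]_k.+2)
    (f : 'rV[R]_k.+2 -> \bar R) :
  col_mx nu J *m (col_mx nu J)^T = 1%:M ->
  measurable_fun setT f -> (forall x, 0 <= f x) ->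
  \int[hausdorff_measure R k.+2 k.+1]_(x in [set x | dotv x nu = 0%R]) f x =
  \int[lebesgue_rV R k.+1]_y f (y *m J).
Proof.
move=> OO mf f0; set D := [set x | _].
have [vv vJ Jv JJ] : [/\ nu *m nu^T = 1%:M, nu *m J^T = 0%R, J *m nu^T = 0%R & J *m J^T = 1%:M].
  move: OO; rewrite tr_col_mx mul_col_row (@scalar_mx_block _ 1 k.+1) => E.
  by have [? ? ? ?] := eq_block_mx E.
have OO' := mulmx1C OO.
have mD : measurable D.
  rewrite (_ : D = (fun x => dotv x nu) @^-1` [set 0%R])//.
  by rewrite -[X in measurable X]setTI; apply: measurable_dotv.
have mid := @measurable_caratheodory_id R k.+2 k.+1.
have DJ y : D (y *m J).
  by rewrite /D /= dotvE -mulmxA Jv mulmx0 mxE.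
have imJ A : (fun y => y *m J) @` ((fun y => y *m J) @^-1` A) = A `&` D.
  apply/seteqP; split => x /=; first by move=> [y Ay <-].
  move=> [Ax Dx]; suff xE : x *m J^T *m J = x by exists (x *m J^T); rewrite xE.
  have := OO'; rewrite tr_col_mx mul_row_col => /(congr1 (mulmx x)).
  rewrite mulmx1 mulmxDr !mulmxA (_ : x *m nu^T = 0%R) ?mul0mx ?add0r//.
  by apply/rowP => i; rewrite ord1 -dotvE Dx mxE.
transitivity (\int[pushforward (hausdorff_measure R k.+2 k.+1)
    (id : caratheodory_type (hausdorff_outer R k.+2 k.+1) -> 'rV[R]_k.+2)]_(x in D) f x).
  by rewrite (ge0_integral_pushforward mid)//; exact: measurable_funTS.
transitivity (\int[pushforward (lebesgue_rV R k.+1) (fun y => y *m J)]_(x in D) f x).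
  apply: eq_measure_integral; [exact: measurable_mulmx|].
  move=> ? A mA AD; rewrite /= /pushforward.
  rewrite -hausdorff_lebesgue; last by rewrite -[X in measurable X]setTI; exact: measurable_mulmx.
  by rewrite -(hausdorff_isometry _ _ JJ) imJ setIidl.
rewrite (ge0_integral_pushforward (measurable_mulmx J))//; last exact: measurable_funTS.
by rewrite (_ : _ @^-1` D = setT)//; apply/seteqP; split => // y _; exact: DJ.
Qed.

End hausdorff_lebesgue.

(** * Symmetric matrices and orthonormal frames *)

Section symmetric_matrices.
Context {R : realType}.

Lemma mulmx_enorm_bound n m (M : 'M[R]_(n, m)) :
  exists2 c, 0 <= c & forall x, enorm (x *m M) <= c * enorm x.
Proof.
exists (\sum_i enorm (row i M)); first by apply: sumr_ge0 => i _; exact: enorm_ge0.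
move=> x; rewrite mulmx_sum_row mulr_suml.
elim/big_ind2 : _ => [|a b c d ab cd|i _]; first by rewrite enorm0.
  by rewrite (le_trans (ler_enormD _ _))// lerD.
by rewrite enormZ mulrC ler_wpM2l ?enorm_ge0// coord_le_enorm.
Qed.

Lemma unit_sphere_compact n : compact [set x : 'rV[R]_n | enorm x = 1].
Proof.
apply: bounded_closed_compact.
  exists 1; split; first exact: num_real.
  by move=> M M1 x /= x1; rewrite (le_trans (sup_enorm x))// x1 ltW.
apply: (@closed_comp _ _ (@enorm R n) [set 1]); last exact: closed_eq.
by move=> x _; exact: continuous_enorm.
Qed.

Lemma continuous_quadratic n (A : 'M[R]_n) :
  continuous (fun x : 'rV[R]_n => dotv (x *m A) x).
Proof.
apply: continuous_enormP => x e e0.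
have [c c0 cA] := mulmx_enorm_bound A.
pose K := c * (2 * enorm x + 1) + 1.
have K0 : 0 < K by rewrite ltr_wpDl// mulr_ge0// addr_ge0// mulr_ge0// enorm_ge0.
exists (Num.min 1 (e / K)); first by rewrite lt_min ltr01 divr_gt0.
move=> y; rewrite lt_min => /andP[yx1 yxe].
rewrite (_ : _ - _ = dotv ((y - x) *m A) y + dotv (x *m A) (y - x)); last first.
  by rewrite mulmxBl dotvBl dotvBr; ring.
have yb : enorm y <= enorm x + 1.
  by rewrite -(subrK x y) addrC (le_trans (ler_enormD _ _))// lerD2l ltW.
apply: le_lt_trans (ler_normD _ _) _.
have h1 := le_trans (cauchy_schwarz ((y - x) *m A) y)
  (ler_wpM2r (enorm_ge0 y) (cA (y - x))).
have h2 := le_trans (cauchy_schwarz (x *m A) (y - x))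
  (ler_wpM2r (enorm_ge0 (y - x)) (cA x)).
apply: (@le_lt_trans _ _ (K * enorm (y - x))); last first.
  by rewrite mulrC -ltr_pdivlMr.
apply: le_trans (lerD h1 h2) _.
have := ler_wpM2l (mulr_ge0 c0 (enorm_ge0 (y - x))) yb.
by rewrite /K; have := enorm_ge0 (y - x); nra.
Qed.

(** At a maximum point v of the quadratic form on the unit sphere, the first
    variation in the direction w = v A - q(v) v must vanish, and it is 2 |w|^2. *)
Lemma symmetric_eigenvector n (A : 'M[R]_n.+1) : A^T = A ->
  exists (v : 'rV[R]_n.+1) (a : R), enorm v = 1 /\ v *m A = a *: v.
Proof.
move=> symA; pose q x := dotv (x *m A) x.
have [||v /set_mem v1 vmax] := @compact_EVT_max 'rV[R]_n.+1 R q
    [set x | enorm x = 1] _ (@unit_sphere_compact n.+1).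
- by exists (delta_mx 0 0); exact: enorm_delta.
- by apply: continuous_subspaceT; exact: continuous_quadratic.
exists v, (q v); split=> //.
have qle x : q x <= q v * enorm x ^+ 2.
  have [->|x0] := eqVneq x 0; first by rewrite /q mul0mx dot0v enorm0 expr0n mulr0.
  have x0' : enorm x != 0 by rewrite enorm_eq0.
  rewrite -ler_pdivrMr ?exprn_gt0 ?enorm_gt0//.
  have : q ((enorm x)^-1 *: x) <= q v.
    by apply: vmax; apply/mem_set => /=; rewrite enormZ ger0_norm ?invr_ge0 ?enorm_ge0// mulVf.
  apply: le_trans; rewrite /q -scalemxAl dotvZl dotvZr mulrA -expr2 exprVn mulrC.
  exact: lexx.
have [w wE] : exists w, w = v *m A - q v *: v by exists (v *m A - q v *: v).
pose c := q w - q v * enorm w ^+ 2.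
have ineq t : 2 * t * dotv w w + t ^+ 2 * c <= 0.
  have ww : dotv w w = dotv (v *m A) w - q v * dotv v w.
    by rewrite {1}wE dotvBl dotvZl.
  have H := qle (v + t *: w); move: H; rewrite sqr_enorm {1}/q mulmxDl -scalemxAl.
  rewrite !dotvDl !dotvDr !dotvZl !dotvZr (dotv_enorm1 v1).
  rewrite (dotv_mulmx w) symA (dotvC w (v *m A)) (dotvC w v) /c sqr_enorm.
  rewrite -/(q v) -/(q w); move: ww; move: (dotv w w) (dotv v w) (dotv (v *m A) w) (q w) (q v).
  by move=> ww vw p qw qv E H; have := congr1 (fun z => 2 * t * z) E; lra.
suff /eqP : dotv w w = 0.
  by rewrite -sqr_enorm sqrf_eq0 enorm_eq0 wE subr_eq0 => /eqP.
have ww := dotvv_ge0 w; apply/eqP; rewrite eq_le ww andbT.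
have [c0|c0] := leP 0 c; first by have := ineq 1; lra.
have nc : 0 < - c by rewrite oppr_gt0.
have := ineq (dotv w w / - c); set b := dotv w w => H.
have E : 2 * (b / - c) * b + (b / - c) ^+ 2 * c = b ^+ 2 / - c.
  by field; rewrite lt_eqF.
move: H; rewrite E pmulr_lle0 ?invr_gt0// => b2.
by have : b ^+ 2 == 0; [rewrite eq_le b2 sqr_ge0|rewrite sqrf_eq0 => /eqP ->].
Qed.

(** The hyperplane orthogonal to an eigenvector is invariant, so the dimension
    decreases by one. *)
Lemma symmetric_diagonalization n (A : 'M[R]_n) : A^T = A ->
  exists (T : 'M[R]_n) (a : 'I_n -> R),
    T *m T^T = 1%:M /\ forall i, row i T *m A = a i *: row i T.
Proof.
elim: n A => [|n ih] A symA.
  by exists 1%:M, (fun=> 0); split; [rewrite trmx1 mulmx1|case].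
have [v [a [v1 va]]] := symmetric_eigenvector symA.
have [J [JJ vJ OO]] := orthonormal_completion v1.
have vv : v *m v^T = 1%:M.
  by apply/matrixP => i j; rewrite !ord1 -dotvE dotv_enorm1// mxE.
have Jv : J *m v^T = 0 by rewrite -[LHS]trmxK trmx_mul trmxK vJ trmx0.
have symJ : (J *m A *m J^T)^T = J *m A *m J^T.
  by rewrite !trmx_mul trmxK symA mulmxA.
have [T [b [TT Tb]]] := ih _ symJ.
pose T' : 'M[R]_(1 + n) := col_mx v (T *m J).
have T'u i : row (lshift n i) T' = v by rewrite rowKu (ord1 i) row_id.
have T'd i : row (rshift 1 i) T' = row i T *m J by rewrite rowKd row_mul.
have TT' : col_mx v (T *m J) *m (col_mx v (T *m J))^T = 1%:M.
  rewrite tr_col_mx mul_col_row (@scalar_mx_block _ 1 n) vv trmx_mul.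
  rewrite (mulmxA v) vJ mul0mx -(mulmxA T J v^T) Jv mulmx0.
  by rewrite -(mulmxA T J) (mulmxA J J^T) JJ mul1mx TT.
exists T', (fun i => if @fintype.split 1 n i is inr j then b j else a); split => //.
move=> i; case: (@split_ordP 1 n i) => j ->.
  by rewrite T'u.
rewrite T'd.
have JA : J *m A = J *m A *m J^T *m J.
  have /(congr1 (mulmx (J *m A))) := mulmx1C OO.
  rewrite tr_col_mx mul_row_col mulmx1 mulmxDr !mulmxA.
  have -> : J *m A *m v^T = 0.
    have : v *m (A *m J^T) = 0 by rewrite mulmxA va -scalemxAl vJ scaler0.
    by move/(congr1 trmx); rewrite !trmx_mul trmxK symA trmx0.
  by rewrite mul0mx add0r => ->.
by rewrite -mulmxA JA !mulmxA -(mulmxA _ J A) -(mulmxA _ (J *m A)) Tb -scalemxAl.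
Qed.

(** The quadratic form of B on the hyperplane orthogonal to nu is diagonal in any
    orthonormal frame of that hyperplane made of eigenvectors of the compression
    of B. *)
Lemma frame_diagonal k (nu : 'rV[R]_k.+1) (B L : 'M[R]_k.+1) (a : 'I_k -> R)
    (tau : 'I_k -> 'rV[R]_k.+1) : enorm nu = 1 ->
  (forall i j, dotv (tau i) (tau j) = (i == j)%:R) ->
  (forall i, dotv (tau i) nu = 0) ->
  (forall i, tau i *m L = a i *: tau i) ->
  (forall i y, dotv y nu = 0 -> dotv (tau i *m L) y = - dotv (tau i *m B) y) ->
  forall y, dotv y nu = 0 ->
    \sum_i a i * dotv (tau i) y ^+ 2 = - dotv (y *m B) y.
Proof.
move=> nu1 tt tn ta tLB y yn.
pose T : 'M[R]_(1 + k) := col_mx nu (\matrix_i tau i).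
have TT : T *m T^T = 1%:M.
  rewrite /T tr_col_mx mul_col_row (@scalar_mx_block _ 1 k); congr block_mx.
  - by apply/matrixP => i j; rewrite !ord1 -dotvE dotv_enorm1// mxE.
  - by apply/matrixP => i j; rewrite !mxE -[RHS](tn j) dotvC;
      apply: eq_bigr => l _; rewrite ord1 !mxE.
  - by apply/matrixP => i j; rewrite !mxE -[RHS](tn i);
      apply: eq_bigr => l _; rewrite ord1 !mxE.
  - by apply/matrixP => i j; rewrite !mxE -[RHS](tt i j);
      apply: eq_bigr => l _; rewrite !mxE.
have yE : y = \sum_i dotv (tau i) y *: tau i.
  have /(congr1 (mulmx y)) := mulmx1C TT; rewrite mulmx1 => {1}<-.
  rewrite tr_col_mx mul_row_col mulmxDr !mulmxA (_ : y *m nu^T = 0); last first.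
    by apply/rowP => i; rewrite ord1 -dotvE yn mxE.
  rewrite mul0mx add0r mulmx_sum_row; apply: eq_bigr => i _; rewrite rowK.
  congr (_ *: _); rewrite dotvC mxE; apply: eq_bigr => l _; rewrite !mxE.
  by [].
have -> : dotv (y *m B) y = \sum_i dotv (tau i) y * dotv (tau i *m B) y.
  rewrite {1}yE mulmx_suml dotvE mulmx_suml summxE.
  by apply: eq_bigr => i _; rewrite -!scalemxAl mxE -dotvE.
rewrite -sumrN; apply: eq_bigr => i _.
by rewrite -mulrN -tLB// ta dotvZl; ring.
Qed.

(** Diagonalising the compression of S to the hyperplane gives the frame. *)
Lemma exists_frame k (nu : 'rV[R]_k.+1) (S : 'M[R]_k.+1) : enorm nu = 1 ->
    S^T = S ->
  exists (a : 'I_k -> R) (tau : 'I_k -> 'rV[R]_k.+1),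
    [/\ forall i j, dotv (tau i) (tau j) = (i == j)%:R,
        forall i, dotv (tau i) nu = 0 &
        forall i, tau i *m (S *m (1%:M - nu^T *m nu)) = a i *: tau i].
Proof.
move=> nu1 symS; have [J [JJ nJ OO]] := orthonormal_completion nu1.
have Jn : J *m nu^T = 0 by rewrite -[LHS]trmxK trmx_mul trmxK nJ trmx0.
have symJ : (J *m S *m J^T)^T = J *m S *m J^T.
  by rewrite !trmx_mul trmxK symS mulmxA.
have [T [a [TT Ta]]] := symmetric_diagonalization symJ.
exists a, (fun i => row i T *m J); split=> [i j|i|i].
- have := congr1 (fun M : 'M[R]_k => M i j) TT; rewrite dotv_isometry// !mxE => <-.
  by apply: eq_bigr => l _; rewrite !mxE.
- by rewrite dotvE -mulmxA Jn mulmx0 mxE.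
have -> : 1%:M - nu^T *m nu = J^T *m J.
  have := mulmx1C OO; rewrite tr_col_mx mul_row_col => <-.
  by rewrite addrC addKr.
by rewrite !mulmxA -(mulmxA _ J S) -(mulmxA _ (J *m S)) Ta -scalemxAl.
Qed.

End symmetric_matrices.

(** * Second-order expansion of a function with Hölder continuous Hessian *)

Section taylor.
Context {R : realType}.

Definition grad n (f : 'rV[R]_n -> R) (y : 'rV[R]_n) : 'rV[R]_n :=
  \row_i 'D_(delta_mx 0 i) f y.

Lemma enorm_le_sum n (x : 'rV[R]_n) : enorm x <= \sum_i `|x 0 i|.
Proof.
rewrite {1}(row_sum_delta x); elim/big_ind2 : _ => [|a b c d ab cd|i _].
- by rewrite enorm0.
- by rewrite (le_trans (ler_enormD _ _))// lerD.
- by rewrite enormZ enorm_delta mulr1.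
Qed.

Lemma derive_grad n (f : 'rV[R]_n -> R) y w : differentiable f y ->
  'D_w f y = dotv w (grad f y).
Proof.
move=> df; rewrite deriveE// {1}(row_sum_delta w) linear_sum.
by apply: eq_bigr => i _; rewrite linearZ /= mxE -deriveE.
Qed.

Lemma is_derive_line n (f : 'rV[R]_n -> R) y w t : differentiable f (y + t *: w) ->
  is_derive t 1 (fun s => f (y + s *: w)) (dotv w (grad f (y + t *: w))).
Proof.
move=> df; have dv := diff_derivable (v := w) df.
have E : (fun h => h^-1 *: (((fun s => f (y + s *: w)) \o shift t) (h *: 1) - f (y + t *: w)))
     = (fun h : R => h^-1 *: ((f \o shift (y + t *: w)) (h *: w) - f (y + t *: w))).
  apply/funext => h; congr (_ *: (f _ - _)).
  by apply/rowP => i; rewrite !mxE /= /GRing.scale /=; ring.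
split; first by rewrite /derivable E; exact: dv.
by rewrite -derive_grad// /derive E.
Qed.

Lemma mean_value_bound (g g' : R -> R) (s M : R) : 0 <= s ->
  (forall t : R, 0 <= t <= s -> is_derive t 1 g (g' t)) ->
  (forall t, 0 <= t <= s -> `|g' t| <= M) -> `|g s - g 0| <= M * s.
Proof.
move=> s0 dg gM.
have [t|t|c] := @MVT_segment R g g' 0 s s0.
- by rewrite in_itv /= => /andP[t0 ts]; apply: dg; rewrite !ltW.
- move=> /=.
  have /= cg : {in `[0, s], continuous g}%classic.
    move=> u /set_mem; rewrite /= in_itv /= => us.
    by apply: differentiable_continuous; apply/derivable1_diffP; have [] := dg u us.
  exact: continuous_in_subspaceT cg t.
rewrite in_itv /= => cs ->.
by rewrite subr0 normrM (ger0_norm s0) ler_wpM2r// gM.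
Qed.

Lemma ler_powR_base (x y a : R) : 0 <= a -> 0 <= x -> x <= y -> x `^ a <= y `^ a.
Proof.
by move=> a0 x0 xy; apply: ge0_ler_powR => //; rewrite nnegrE// (le_trans x0).
Qed.

Lemma enorm_scale_powR n (w : 'rV[R]_n) t alpha : 0 < alpha -> 0 <= t <= 1 ->
  enorm (t *: w) `^ alpha <= enorm w `^ alpha.
Proof.
move=> a0 /andP[t0 t1]; apply: ler_powR_base; [exact: ltW|exact: enorm_ge0|].
by rewrite enormZ (ger0_norm t0) ler_piMl// enorm_ge0.
Qed.

Lemma mulr_powR (x a : R) : 0 <= x -> 0 <= a -> x * x `^ a = x `^ (1 + a).
Proof.
by move=> x0 a0; rewrite powRD ?powRr1//; apply/implyP; rewrite gt_eqF// ltr_pwDl.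
Qed.

Section C2holder.
Variables (n : nat) (alpha : R) (U : set 'rV[R]_n) (f : 'rV[R]_n -> R).
Hypotheses (alpha0 : 0 < alpha) (C2f : C2holder_on alpha U f).
Variables (x0 : 'rV[R]_n) (r : R).
Hypotheses (r0 : 0 < r) (rU : forall y, enorm (y - x0) < 2 * r -> U y).

Let in_U y w t : enorm (y - x0) < r -> enorm w < r -> 0 <= t <= 1 -> U (y + t *: w).
Proof.
move=> yr wr /andP[t0 t1]; apply: rU; rewrite addrAC (le_lt_trans (ler_enormD _ _))//.
rewrite enormZ (ger0_norm t0) mulrDl mul1r ltrD// (le_lt_trans _ wr)//.
by rewrite ler_piMl// enorm_ge0.
Qed.

Let in_U0 y : enorm (y - x0) < r -> U y.
Proof. by move=> yr; apply: rU; rewrite (lt_trans yr)// ltr_pMl// ltr1n. Qed.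

Let L : R := `|xget 0 [set L | forall i j y y', U y -> U y' ->
  `|hessian f y i j - hessian f y' i j| <= L * enorm (y - y') `^ alpha]|.

Let hL i j y y' : U y -> U y' ->
  `|hessian f y i j - hessian f y' i j| <= L * enorm (y - y') `^ alpha.
Proof.
move=> Uy Uy'; rewrite /L; case: xgetP => [K _ hK|]; last first.
  by move=> no; have [_ _ [K hK]] := C2f; case: (no K).
by rewrite (le_trans (hK _ _ _ _ Uy Uy'))// ler_wpM2r ?powR_ge0// ler_norm.
Qed.

Let L0 : 0 <= L. Proof. exact: normr_ge0. Qed.

Let mulmx_coord_dist (v : 'rV[R]_n) (A B : 'M[R]_n) j c :
  (forall i, `|A i j - B i j| <= c) ->
  `|(v *m A) 0 j - (v *m B) 0 j| <= n%:R * (enorm v * c).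
Proof.
move=> ABc; rewrite !mxE -sumrB (le_trans (ler_norm_sum _ _ _))//.
apply: (@le_trans _ _ (\sum_(i < n) enorm v * c)); last first.
  by rewrite sumr_const card_ord -[leLHS]mulr_natl.
by apply: ler_sum => i _; rewrite -mulrBr normrM ler_pM ?coord_le_enorm.
Qed.

Let mulmx_hessian y w j :
  (w *m hessian f y) 0 j = dotv w (grad ('D_(delta_mx 0 j) f) y).
Proof. by rewrite mxE; apply: eq_bigr => i _; rewrite !mxE. Qed.

Let hessian_diff y w (v : 'rV[R]_n) t j : enorm (y - x0) < r -> enorm w < r ->
  0 <= t <= 1 ->
  `|(v *m hessian f (y + t *: w)) 0 j - (v *m hessian f y) 0 j|
    <= n%:R * L * (enorm v * enorm w `^ alpha).
Proof.
move=> yr wr t01; set c := enorm w `^ alpha.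
rewrite (_ : n%:R * L * (enorm v * c) = n%:R * (enorm v * (L * c))); last by ring.
apply: mulmx_coord_dist => i.
apply: le_trans (hL _ _ (in_U yr wr t01) (in_U0 yr)) _.
by rewrite addrAC subrr add0r ler_wpM2l// enorm_scale_powR.
Qed.

Let deriv_expansion y w j : enorm (y - x0) < r -> enorm w < r ->
  `|'D_(delta_mx 0 j) f (y + w) - 'D_(delta_mx 0 j) f y - (w *m hessian f y) 0 j|
    <= n%:R * L * enorm w `^ (1 + alpha).
Proof.
move=> yr wr; rewrite -(mulr_powR (enorm_ge0 w) (ltW alpha0)).
pose g t := 'D_(delta_mx 0 j) f (y + t *: w) - t * (w *m hessian f y) 0 j.
have := @mean_value_bound g
  (fun t => (w *m hessian f (y + t *: w)) 0 j - (w *m hessian f y) 0 j) 1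
  (n%:R * L * (enorm w * enorm w `^ alpha)) ler01.
rewrite /g !scale1r scale0r addr0 mul0r subr0 mul1r mulr1 addrAC; apply.
  move=> t t01; have [_ d2 _] := C2f.
  apply: is_deriveB.
    apply: is_derive_eq; first exact: is_derive_line (d2 _ _ (in_U yr wr t01)).
    by symmetry; exact: mulmx_hessian.
  by apply: is_derive_eq; rewrite /GRing.scale /=; ring.
by move=> t t01; exact: hessian_diff.
Qed.

Lemma grad_expansion y w : enorm (y - x0) < r -> enorm w < r ->
  enorm (grad f (y + w) - grad f y - w *m hessian f y)
    <= n%:R * (n%:R * L) * enorm w `^ (1 + alpha).
Proof.
move=> yr wr; apply: le_trans (enorm_le_sum _) _.
apply: (@le_trans _ _ (\sum_(i < n) n%:R * L * enorm w `^ (1 + alpha))).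
  by apply: ler_sum => j _; have := deriv_expansion j yr wr; rewrite !mxE.
by rewrite sumr_const card_ord -[leLHS]mulr_natl mulrA.
Qed.

(** The mean value inequality along the segment from y to y + w, applied to the
    remainder, reduces to the first-order expansion of the gradient. *)
Lemma second_order_expansion y w : enorm (y - x0) < r -> enorm w < r ->
  `|f (y + w) - f y - dotv w (grad f y) - 2^-1 * dotv (w *m hessian f y) w|
    <= n%:R * (n%:R * L) * enorm w `^ (2 + alpha).
Proof.
move=> yr wr; have Ew := enorm_ge0 w.
have -> : 2 + alpha = 1 + (1 + alpha) by ring.
rewrite -(mulr_powR Ew); last by rewrite addr_ge0// ltW.
pose c := dotv w (grad f y); pose b := dotv (w *m hessian f y) w.
pose g t := f (y + t *: w) - (t * c + 2^-1 * (t * t) * b).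
have := @mean_value_bound g
  (fun t => dotv w (grad f (y + t *: w)) - (c + t * b)) 1
  (n%:R * (n%:R * L) * (enorm w * enorm w `^ (1 + alpha))) ler01.
have -> : g 1 - g 0 = f (y + w) - f y - dotv w (grad f y) -
    2^-1 * dotv (w *m hessian f y) w.
  by rewrite /g !scale1r scale0r addr0 /c /b; ring.
rewrite mulr1; apply.
  move=> t t01; have [d1 _ _] := C2f; apply: is_deriveB.
    exact: is_derive_line (d1 _ (in_U yr wr t01)).
  by apply: is_derive_eq; rewrite /GRing.scale /=; field.
move=> t t01; have /andP[t0 t1] := t01.
have tw : enorm (t *: w) <= enorm w.
  by rewrite enormZ (ger0_norm t0) ler_piMl.
have := grad_expansion yr (le_lt_trans tw wr).
have -> : dotv w (grad f (y + t *: w)) - (c + t * b) =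
    dotv w (grad f (y + t *: w) - grad f y - (t *: w) *m hessian f y).
  by rewrite !dotvBr -scalemxAl dotvZr (dotvC w (w *m _)) /c /b; ring.
move=> H; apply: le_trans (cauchy_schwarz _ _) _.
rewrite mulrCA ler_wpM2l//; apply: le_trans H _.
rewrite ler_wpM2l ?mulr_ge0//.
by apply: enorm_scale_powR => //; rewrite addr_gt0.
Qed.

(** Both second-order derivatives are the limit of the same second difference. *)
Lemma hessian_sym y i j : enorm (y - x0) < r -> hessian f y i j = hessian f y j i.
Proof.
move=> yr.
(* The second difference; [D] below estimates it in either order. *)
pose Delta i j s := f (y + s *: delta_mx 0 i + s *: delta_mx 0 j) -
  f (y + s *: delta_mx 0 i) - f (y + s *: delta_mx 0 j) + f y.
have DeltaC i' j' s : Delta i' j' s = Delta j' i' s.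
  by rewrite /Delta [y + s *: _ + _]addrAC; ring.
pose M := n%:R * L * 2 `^ (1 + alpha) * 2.
have M0 : 0 <= M by rewrite !mulr_ge0// powR_ge0.
have aux (a b c p p' q K : R) : `|a - c - (p + q)| <= K ->
    `|b - c - (0 * p' + q)| <= K -> `|a - b - p| <= 2 * K.
  by rewrite !ler_norml => /andP[? ?] /andP[? ?]; apply/andP; split; lra.
have D i' j' s : 0 < s -> 2 * s < r ->
    `|Delta i' j' s - s * s * hessian f y i' j'| <= M * s `^ (1 + alpha) * s.
  move=> s0 sr.
  pose ei := delta_mx 0 i' : 'rV[R]_n; pose ej := delta_mx 0 j' : 'rV[R]_n.
  pose g t := f (y + s *: ei + t *: ej) - f (y + t *: ej) - t * (s * hessian f y i' j').
  have t2 t (b : bool) : 0 <= t <= s -> enorm ((if b then s else 0) *: ei + t *: ej) <= 2 * s.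
    move=> /andP[t0 ts]; rewrite (le_trans (ler_enormD _ _))// !enormZ !enorm_delta.
    by rewrite !mulr1 (ger0_norm t0) mulrDl mul1r lerD//; case: b; rewrite ?normr0 ?gtr0_norm// ltW.
  have := @mean_value_bound g
    (fun t => 'D_ej f (y + s *: ei + t *: ej) - 'D_ej f (y + t *: ej) - s * hessian f y i' j') s
    (M * s `^ (1 + alpha)) (ltW s0).
  have -> : g s - g 0 = Delta i' j' s - s * s * hessian f y i' j'.
    by rewrite /g /Delta !scale0r !addr0; ring.
  have inU b t : 0 <= t <= s -> U (y + ((if b then s else 0) *: ei + t *: ej)).
    move=> ts; rewrite -[X in y + X]scale1r; apply: in_U => //.
      exact: le_lt_trans (t2 _ _ ts) sr.
    by rewrite ler01 lexx.
  apply => t ts.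
    have [d1 _ _] := C2f.
    have U1 := inU true t ts; have U2 := inU false t ts.
    rewrite /= addrA in U1; rewrite /= scale0r add0r in U2.
    have gE z : 'D_ej f z = grad f z 0 j' by rewrite mxE.
    have deE z : dotv ej z = z 0 j' by rewrite dotvC dotv_delta.
    apply: is_deriveB; first apply: is_deriveB.
    - by rewrite gE -deE; exact: is_derive_line (d1 _ U1).
    - by rewrite gE -deE; exact: is_derive_line (d1 _ U2).
    - by apply: is_derive_eq; rewrite /GRing.scale /=; ring.
  have h1 := deriv_expansion j' yr (le_lt_trans (t2 t true ts) sr).
  have h2 := deriv_expansion j' yr (le_lt_trans (t2 t false ts) sr).
  have E (z : R) : ((z *: ei + t *: ej) *m hessian f y) 0 j' =
      z * hessian f y i' j' + t * hessian f y j' j'.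
    by rewrite mulmxDl -!scalemxAl -!rowE !mxE.
  rewrite !E in h1 h2; rewrite /= addrA in h1; rewrite /= scale0r add0r in h2.
  have p2 b : n%:R * L * enorm ((if b then s else 0) *: ei + t *: ej) `^ (1 + alpha) <=
      n%:R * L * 2 `^ (1 + alpha) * s `^ (1 + alpha).
    rewrite -[leRHS]mulrA ler_wpM2l ?mulr_ge0// -powRM//; last exact: ltW.
    by apply: ler_powR_base; [rewrite addr_ge0// ltW|exact: enorm_ge0|exact: t2].
  have p2f := p2 false; rewrite /= scale0r add0r in p2f.
  apply: le_trans (aux _ _ _ _ _ _ _ (le_trans h1 (p2 true)) (le_trans h2 p2f)) _.
  rewrite /M le_eqVlt; apply/orP; left; apply/eqP.
  by move: (_ `^ _) (_ `^ _) => u v; ring.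
apply/eqP; rewrite -subr_eq0 -normr_eq0 eq_le normr_ge0 andbT.
apply/ler_addgt0Pl => e e0; rewrite addr0.
pose s := Num.min (r / 3) ((e / (2 * M + 1)) `^ alpha^-1).
have s0 : 0 < s by rewrite lt_min divr_gt0//= powR_gt0// divr_gt0// ltr_wpDl// mulr_ge0.
have sr : 2 * s < r.
  have : s <= r / 3 by rewrite ge_min lexx.
  by move: r0; lra.
have sa : s `^ alpha <= e / (2 * M + 1).
  have : s <= (e / (2 * M + 1)) `^ alpha^-1 by rewrite ge_min lexx orbT.
  move=> /(ler_powR_base (ltW alpha0) (ltW s0)).
  by rewrite -powRrM mulVf ?gt_eqF// powRr1// divr_ge0 ?ltW// ltr_wpDl// mulr_ge0.
have h1 := D i j s s0 sr; have h2 := D j i s s0 sr; rewrite DeltaC in h1.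
have H := le_trans (ler_normB _ _) (lerD h1 h2).
have EE (u s' p q : R) : u - s' * p - (u - s' * q) = - s' * (p - q) by ring.
rewrite EE normrM normrN (ger0_norm (mulr_ge0 (ltW s0) (ltW s0))) in H.
rewrite -(mulr_powR (ltW s0) (ltW alpha0)) in H.
have ss : 0 < s * s by rewrite mulr_gt0.
rewrite -(ler_pM2l ss); apply: le_trans H _.
rewrite (_ : _ + _ = s * s * (2 * M * s `^ alpha)); last by ring.
rewrite ler_wpM2l ?ltW//; move: sa; rewrite ler_pdivlMr ?ltr_wpDl ?mulr_ge0//.
by have := powR_ge0 s alpha; nra.
Qed.

Lemma C2holder_bounds : exists C, forall y w,
  enorm (y - x0) < r -> enorm w < r ->
  [/\ (hessian f y)^T = hessian f y, enorm (grad f y) <= C,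
      forall u, enorm (u *m hessian f y) <= C * enorm u,
      `|f (y + w) - f y - dotv w (grad f y) - 2^-1 * dotv (w *m hessian f y) w|
        <= C * enorm w `^ (2 + alpha) &
      enorm (grad f (y + w) - grad f y - w *m hessian f y)
        <= C * enorm w `^ (1 + alpha)].
Proof.
have [c c0 Hc] := mulmx_enorm_bound (hessian f x0).
pose C1 := n%:R * (n%:R * L).
have C10 : 0 <= C1 by rewrite !mulr_ge0.
pose C2 := enorm (grad f x0) + c * r + C1 * r `^ (1 + alpha).
pose C3 := c + C1 * r `^ alpha.
have C20 : 0 <= C2 by rewrite !addr_ge0 ?enorm_ge0 ?mulr_ge0 ?powR_ge0// ltW.
have C30 : 0 <= C3 by rewrite !addr_ge0 ?mulr_ge0 ?powR_ge0.
have xx : enorm (x0 - x0) < r by rewrite subrr enorm0.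
exists (C1 + C2 + C3) => y w yr wr; split.
- by apply/matrixP => i j; rewrite mxE hessian_sym.
- have := grad_expansion xx yr; rewrite (addrC x0) subrK => h.
  have -> : grad f y = grad f x0 + (y - x0) *m hessian f x0 +
    (grad f y - grad f x0 - (y - x0) *m hessian f x0).
    by apply/rowP => i; rewrite !mxE; ring.
  apply: (@le_trans _ _ C2); last by lra.
  apply: le_trans (ler_enormD _ _) _; apply: lerD.
    by rewrite (le_trans (ler_enormD _ _))// lerD2l (le_trans (Hc _))// ler_wpM2l// ltW.
  apply: le_trans h _; rewrite ler_wpM2l//.
  by apply: ler_powR_base; rewrite ?enorm_ge0 ?addr_ge0// ltW.
- move=> u; apply: (@le_trans _ _ (C3 * enorm u)); last first.
    by rewrite ler_wpM2r ?enorm_ge0//; lra.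
  have -> : u *m hessian f y = u *m hessian f x0 + (u *m hessian f y - u *m hessian f x0).
    by rewrite addrC subrK.
  rewrite (le_trans (ler_enormD _ _))// mulrDl lerD//.
  apply: le_trans (enorm_le_sum _) _.
  apply: (@le_trans _ _ (\sum_(i < n) n%:R * L * (enorm u * r `^ alpha))).
    apply: ler_sum => j _.
    have := @hessian_diff x0 (y - x0) u 1 j xx yr.
    rewrite scale1r (addrC x0) subrK ler01 lexx => /(_ isT) h.
    have BE (a b : 'rV[R]_n) : (a - b) 0 j = a 0 j - b 0 j by rewrite !mxE.
    rewrite BE; apply: le_trans h _; rewrite ler_wpM2l ?mulr_ge0// ler_wpM2l ?enorm_ge0//.
    by apply: ler_powR_base; rewrite ?enorm_ge0 ?addr_ge0// ltW.
  by rewrite sumr_const card_ord -[leLHS]mulr_natl le_eqVlt; apply/orP; left;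
    apply/eqP; rewrite /C1; ring.
- apply: le_trans (second_order_expansion yr wr) _.
  by rewrite ler_wpM2r ?powR_ge0// -/C1; lra.
- apply: le_trans (grad_expansion yr wr) _.
  by rewrite ler_wpM2r ?powR_ge0// -/C1; lra.
Qed.

End C2holder.
End taylor.

(** * Local geometry of a set with a regular defining function *)

Section defining_function.
Context {R : realType}.

Lemma powR_add_le (a b p : R) : 0 <= a -> 0 <= b -> 0 <= p <= 3 ->
  (a + b) `^ p <= 8 * (a `^ p + b `^ p).
Proof.
wlog ab : a b / a <= b => [W a0 b0 p3|a0 b0 /andP[p0 p3]].
  by have [ab|/ltW ba] := leP a b; [exact: W|rewrite addrC (addrC (a `^ p)); exact: W].
apply: (@le_trans _ _ ((2 * b) `^ p)).
  by apply: ler_powR_base; rewrite ?addr_ge0//; lra.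
rewrite powRM// (@le_trans _ _ (8 * b `^ p))// ?ler_wpM2r ?powR_ge0//.
  rewrite (_ : 8 = 2 `^ 3%:R); last by rewrite powR_mulrn// -natrX.
  by apply: ler_powR => //; rewrite ler1n.
by rewrite ler_wpM2l// lerDr powR_ge0.
Qed.

Lemma powR_le_expr (x p : R) k : 0 <= x <= 1 -> k.+1%:R <= p -> x `^ p <= x ^+ k.+1.
Proof.
move=> /andP[x0 x1] kp; have [->|xn] := eqVneq x 0.
  by rewrite powR0 ?expr0n// gt_eqF// (lt_le_trans _ kp).
rewrite -powR_mulrn//; apply: (ger_powR _ kp).
by rewrite lt_neqAle eq_sym xn x0.
Qed.

(** Let r = b / 2 - s be the height below the graph s = b / 2. The errors m and e
    are at most r / 2 plus a multiple of y ^ (2 + al), because |s| is at most r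
    plus a multiple of y ^ 2; the smallness of u absorbs the quadratic terms in
    r. *)
Lemma graph_error (C al u y s b m e : R) : 1 <= C -> 0 < al <= 1 ->
  0 <= y -> y <= u -> `|s| <= u -> u <= `|s| + y -> `|b| <= C * y ^+ 2 ->
  `|m| <= C * `|s| * (y + `|s|) -> `|e| <= C * u `^ (2 + al) ->
  u * (31 * C ^+ 3) <= 1 ->
  s < 2^-1 * b - 31 * C ^+ 3 * y `^ (2 + al) -> 0 < - s + 2^-1 * b + m + e.
Proof.
move=> C1 /andP[al0 al1] y0 yu su usy bC mC eC uC sb.
have C31 : 1 <= 31 * C ^+ 3 by rewrite !exprS expr0; nra.
have u0 : 0 <= u by lra.
have u1 : u <= 1 by nra.
have s0 : 0 <= `|s| by [].
have a3 : 0 <= 2 + al <= 3 by apply/andP; split; lra.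
set q := y `^ (2 + al) in sb.
have q0 : 0 <= q by exact: powR_ge0.
have y3 : y ^+ 3 <= q.
  have [->|yn] := eqVneq y 0; first by rewrite expr0n.
  rewrite -powR_mulrn//; apply: ger_powR; last by lra.
  by rewrite (le_trans yu u1) lt_neqAle eq_sym yn y0.
have ue : u `^ (2 + al) <= 8 * (`|s| * u + q).
  apply: (@le_trans _ _ ((`|s| + y) `^ (2 + al))).
    by apply: ler_powR_base => //; lra.
  apply: le_trans (powR_add_le s0 y0 a3) _; rewrite ler_wpM2l// lerD2r.
  apply: (@le_trans _ _ (`|s| ^+ 2)); last by rewrite expr2 ler_wpM2l.
  by apply: powR_le_expr; [rewrite s0 (le_trans su)|lra].
pose r := 2^-1 * b - s.
have r0 : 0 < r by rewrite /r; nra.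
have rq : 31 * C ^+ 3 * q < r by rewrite /r; lra.
have sr : `|s| <= 2^-1 * C * y ^+ 2 + r.
  rewrite (_ : s = 2^-1 * b - r); last by rewrite /r; ring.
  apply: le_trans (ler_normB _ _) _; rewrite (gtr0_norm r0) lerD2r.
  by rewrite normrM gtr0_norm ?invr_gt0// -mulrA ler_wpM2l// invr_ge0.
have y2u : y ^+ 2 <= u by rewrite expr2; nra.
have y2 : 0 <= y ^+ 2 by rewrite exprn_ge0.
have y4 : y ^+ 2 * y ^+ 2 <= y ^+ 3 by rewrite -exprD (exprS y 3) ler_piMl ?exprn_ge0//; lra.
have yyu : y ^+ 2 * u <= 3 / 2 * C * q + r * u.
  have : y ^+ 2 * u <= y ^+ 2 * (2^-1 * C * y ^+ 2 + r) + y ^+ 3.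
    have := ler_wpM2l y2 (le_trans usy (lerD sr (lexx y))).
    by rewrite (_ : y ^+ 3 = y ^+ 2 * y) ?exprSr//; lra.
  have := ler_wpM2l (ltW r0) y2u.
  have : C * (y ^+ 2 * y ^+ 2) <= C * y ^+ 3 by rewrite ler_wpM2l//; lra.
  have : C * y ^+ 3 <= C * q by rewrite ler_wpM2l//; lra.
  have : q <= C * q by rewrite ler_peMl.
  move: (y ^+ 3) (y ^+ 2) y3 => y3 y2' hq; move=> h1 h2 h3 h4 h5; nra.
have suC : `|s| * u <= 3 / 4 * C ^+ 2 * q + 3 / 2 * C * (r * u).
  have h1 := ler_wpM2r u0 sr.
  have h2 : C * (y ^+ 2 * u) <= C * (3 / 2 * C * q + r * u) by rewrite ler_wpM2l//; lra.
  have h3 : r * u <= C * (r * u) by rewrite ler_peMl// mulr_ge0// ltW.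
  by rewrite expr2; lra.
have me : `|m| + `|e| <= 10 * C * (`|s| * u) + 8 * C * q.
  have : C * `|s| * (y + `|s|) <= C * `|s| * (2 * u).
    by rewrite ler_wpM2l ?mulr_ge0//; lra.
  have : C * u `^ (2 + al) <= C * (8 * (`|s| * u + q)) by rewrite ler_wpM2l//; lra.
  by lra.
have C2 : C <= C ^+ 2 by rewrite expr2; nra.
have C3 : C ^+ 2 <= C ^+ 3 by rewrite (exprS C 2) ler_peMl// exprn_ge0//; lra.
have tot : `|m| + `|e| <= 31 / 2 * C ^+ 3 * q + 15 * C ^+ 2 * (r * u).
  have h1 : C * (`|s| * u) <= C * (3 / 4 * C ^+ 2 * q + 3 / 2 * C * (r * u)).
    by rewrite ler_wpM2l//; lra.
  have h2 : C * q <= C ^+ 3 * q by rewrite ler_wpM2r//; lra.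
  by move: h1 h2 me; rewrite !exprS expr0; lra.
have rr : 30 * C ^+ 2 * (r * u) <= r.
  have : r * (u * (31 * C ^+ 3)) <= r by rewrite ler_piMr// ltW.
  have : C ^+ 2 * (r * u) <= C ^+ 3 * (r * u) by rewrite ler_wpM2r// mulr_ge0// ltW.
  have : 0 <= C ^+ 3 * (r * u) by rewrite !mulr_ge0 ?exprn_ge0// ltW//; lra.
  by lra.
have := ler_norm (- m); have := ler_norm (- e); rewrite !normrN.
by rewrite /r in tot rr rq *; lra.
Qed.

(** The derivative of g / |g| in the direction dl is the part of dl orthogonal
    to g, divided by |g|. *)
Lemma normalize_expansion n (g dl : 'rV[R]_n) :
    1 <= enorm g -> 1 <= enorm (g + dl) ->
  forall m, m = (enorm g)^-1 *: g ->
  enorm ((enorm (g + dl))^-1 *: (g + dl) - m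
    - (enorm g)^-1 *: (dl - dotv dl m *: m)) <= 3 * enorm dl ^+ 2.
Proof.
move=> g1 g1' m mE; set a := enorm g; set a' := enorm (g + dl).
have a0 : a != 0 by rewrite gt_eqF// (lt_le_trans _ g1).
have a0' : a' != 0 by rewrite gt_eqF// (lt_le_trans _ g1').
have m1 : enorm m = 1 by rewrite mE enormZ ger0_norm ?invr_ge0 ?enorm_ge0// mulVf.
have gm : g = a *: m by rewrite mE scalerA mulfV// scale1r.
pose c := (a - a') / a' + dotv dl m / a.
have -> : a'^-1 *: (g + dl) - m - a^-1 *: (dl - dotv dl m *: m) =
    c *: m + ((a - a') / (a * a')) *: dl.
  rewrite [in LHS]gm; apply/rowP => i; rewrite !mxE /c.
  by move: (dotv _ _) (m _ _) (dl _ _) => z w v; field; rewrite a0 a0'.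
pose e := enorm dl; pose h := a' - a.
have he : `|h| <= e.
  by rewrite /h /a' (le_trans (ler_dist_enorm _ _))// addrAC subrr add0r.
have dm : dotv dl m = (h * (2 * a + h) - e ^+ 2) / (2 * a).
  have : a' ^+ 2 = a ^+ 2 + 2 * a * dotv dl m + e ^+ 2.
    rewrite -mulrA; have -> : a * dotv dl m = dotv dl g by rewrite -dotvZr -gm.
    by rewrite !sqr_enorm dotvDl !dotvDr (dotvC g dl); ring.
  move=> E; have -> : h * (2 * a + h) - e ^+ 2 = 2 * a * dotv dl m by rewrite /h; lra.
  by rewrite mulrC mulKf// mulf_neq0.
have a1 : 0 < a by exact: lt_le_trans g1.
have a1' : 0 < a' by exact: lt_le_trans g1'.
have cE : c = h ^+ 2 / (a * a') + (h ^+ 2 - e ^+ 2) / (2 * a ^+ 2).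
  by rewrite /c dm /h; field; rewrite a0.
have e0 : 0 <= e by exact: enorm_ge0.
have h2 : h ^+ 2 <= e ^+ 2 by rewrite -(real_normK (num_real h)) lerXn2r ?nnegrE.
have div1 (x y : R) : 0 <= x -> 1 <= y -> 0 <= x / y <= x.
  move=> x0 y1; have y0 : 0 < y by exact: lt_le_trans y1.
  by rewrite divr_ge0 ?(ltW y0)//= ler_pdivrMr// ler_peMr.
have aa' : 1 <= a * a' by rewrite mulr_ege1.
have a2 : 1 <= 2 * a ^+ 2 by have := mulr_ege1 g1 g1; rewrite -/a expr2; lra.
have c3 : `|c| <= 2 * e ^+ 2.
  have := div1 _ _ (sqr_ge0 h) aa'; have := div1 _ _ (sqr_ge0 h) a2.
  have := div1 _ _ (sqr_ge0 e) a2; rewrite cE mulrBl.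
  move: (_ / _) (_ / _) (_ / _) => p q p'; move=> /andP[? ?] /andP[? ?] /andP[? ?].
  by rewrite ler_norml; apply/andP; split; lra.
apply: le_trans (ler_enormD _ _) _; rewrite !enormZ m1 mulr1.
have -> : 3 * e ^+ 2 = 2 * e ^+ 2 + e * e by rewrite expr2; ring.
rewrite lerD// ler_wpM2r// normrM normfV (gtr0_norm (mulr_gt0 a1 a1')).
have := div1 _ _ (normr_ge0 (a - a')) aa' => /andP[_ h3].
by rewrite (le_trans h3)// -normrN opprB.
Qed.

End defining_function.

(** G and D play the role of the gradient and the Hessian of psi, the estimates
    being uniform on a neighbourhood of x0. [df_tangent] stands for the implicit
    function theorem: the zero set of psi has secants in every direction
    orthogonal to G. *)
Record defining_function (R : realType) n (E : set 'rV[R]_n) (al C rho : R)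
    (x0 : 'rV[R]_n) (psi : 'rV[R]_n -> R) (G : 'rV[R]_n -> 'rV[R]_n)
    (D : 'rV[R]_n -> 'M[R]_n) : Prop := {
  df_pos : forall x, enorm (x - x0) < 2 * rho -> 0 < psi x -> E x;
  df_neg : forall x, enorm (x - x0) < 2 * rho -> psi x < 0 -> ~ E x;
  df_grad : forall x, enorm (x - x0) < rho -> 1 <= enorm (G x) <= C;
  df_sym : forall x, enorm (x - x0) < rho -> (D x)^T = D x;
  df_D : forall x u, enorm (x - x0) < rho -> enorm (u *m D x) <= C * enorm u;
  df_taylor : forall x u, enorm (x - x0) < rho -> enorm u < rho ->
    `|psi (x + u) - psi x - dotv u (G x) - 2^-1 * dotv (u *m D x) u|
      <= C * enorm u `^ (2 + al);
  df_grad_taylor : forall x u, enorm (x - x0) < rho -> enorm u < rho ->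
    enorm (G (x + u) - G x - u *m D x) <= C * enorm u `^ (1 + al);
  df_tangent : forall x u, enorm (x - x0) < rho -> enorm u < rho ->
    psi x = 0 -> dotv u (G x) = 0 ->
    exists2 y, psi y = 0 & enorm (y - x - u) <= C * enorm u ^+ 2 }.

Section local_geometry.
Context {R : realType} (n : nat) (E : set 'rV[R]_n) (al C rho : R).
Variables (x0 : 'rV[R]_n) (psi : 'rV[R]_n -> R) (G : 'rV[R]_n -> 'rV[R]_n).
Variable D : 'rV[R]_n -> 'M[R]_n.
Hypothesis dfn : defining_function E al C rho x0 psi G D.
Hypotheses (al01 : 0 < al <= 1) (C1 : 1 <= C) (rho01 : 0 < rho <= 1).

Let C0 : 0 <= C. Proof. by move: C1; lra. Qed.
Let rho0 : 0 < rho. Proof. by have /andP[] := rho01. Qed.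
Let rho1 : rho <= 1. Proof. by have /andP[] := rho01. Qed.
Let al0 : 0 < al. Proof. by have /andP[] := al01. Qed.

Definition df_normal x := - (enorm (G x))^-1 *: G x.

Section at_point.
Variables (x : 'rV[R]_n).
Hypothesis xx0 : enorm (x - x0) < rho.
Variable nu : 'rV[R]_n.
Hypothesis nuE : nu = df_normal x.
Let g := enorm (G x).

Let g1 : 1 <= g. Proof. by have /andP[] := df_grad dfn xx0. Qed.
Let g0 : 0 < g. Proof. exact: lt_le_trans g1. Qed.

Lemma df_normal1 : enorm nu = 1.
Proof. by rewrite nuE enormZ normrN gtr0_norm ?invr_gt0// mulVf// gt_eqF. Qed.

Lemma df_gradE : G x = - g *: nu.
Proof. by rewrite nuE scalerA mulrNN mulfV ?scale1r// gt_eqF. Qed.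

Lemma dotv_grad y : dotv y (G x) = - g * dotv y nu.
Proof. by rewrite df_gradE dotvZr. Qed.

Lemma dotv_normal_eq0 y : dotv y (G x) = 0 <-> dotv y nu = 0.
Proof.
rewrite dotv_grad; split=> [/eqP|->]; last by rewrite mulr0.
by rewrite mulf_eq0 oppr_eq0 (gt_eqF g0) => /eqP.
Qed.

Lemma df_close u : enorm u < rho -> enorm (x + u - x0) < 2 * rho.
Proof.
move=> ur; rewrite addrAC (le_lt_trans (ler_enormD _ _))// mulrDl mul1r.
exact: ltrD.
Qed.

(** Dividing the Taylor expansion of psi at x by |G x| leaves -s + b / 2 plus
    errors which [graph_error] absorbs. *)
Lemma df_sandwich s y : psi x = 0 -> dotv y nu = 0 ->
  enorm (s *: nu + y) < rho -> enorm (s *: nu + y) * (31 * C ^+ 3) <= 1 ->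
  let b := dotv (y *m (g^-1 *: D x)) y in
  let q := 31 * C ^+ 3 * enorm y `^ (2 + al) in
  (s < 2^-1 * b - q -> 0 < psi (x + (s *: nu + y))) /\
  (2^-1 * b + q < s -> psi (x + (s *: nu + y)) < 0).
Proof.
move=> px yn ur uC b q; set u := s *: nu + y.
have nu1 := df_normal1.
have uu : enorm u ^+ 2 = s ^+ 2 + enorm y ^+ 2.
  rewrite !sqr_enorm dotvDl !dotvDr !dotvZl !dotvZr (dotv_enorm1 nu1).
  by rewrite (dotvC nu y) yn; ring.
have u0 := enorm_ge0 u; have y0 := enorm_ge0 y.
have su : `|s| <= enorm u.
  rewrite -ler_sqr ?nnegrE ?normr_ge0//; have := sqr_ge0 (enorm y).
  by rewrite real_normK ?num_real// uu; lra.
have yu : enorm y <= enorm u.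
  by rewrite -ler_sqr ?nnegrE// uu lerDr sqr_ge0.
have usy : enorm u <= `|s| + enorm y.
  by rewrite (le_trans (ler_enormD _ _))// enormZ nu1 mulr1.
pose B := g^-1 *: D x.
have BC v w : `|dotv (v *m B) w| <= C * enorm v * enorm w.
  rewrite (le_trans (cauchy_schwarz _ _))// ler_wpM2r ?enorm_ge0//.
  rewrite -scalemxAr enormZ gtr0_norm ?invr_gt0// ler_pdivrMl//.
  apply: le_trans (df_D dfn _ xx0) _.
  by rewrite ler_peMl// mulr_ge0// enorm_ge0.
have DB v w : dotv (v *m D x) w = g * dotv (v *m B) w.
  by rewrite -scalemxAr dotvZl mulVKf// gt_eqF.
have Bsym v w : dotv (v *m B) w = dotv (w *m B) v.
  have BT : B^T = B.
    apply/matrixP => i j; rewrite !mxE; congr (_ * _).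
    by have := congr1 (fun M : 'M[R]_n => M i j) (df_sym dfn xx0); rewrite mxE.
  by rewrite dotv_mulmx BT dotvC.
pose m := s * dotv (nu *m B) y + 2^-1 * s ^+ 2 * dotv (nu *m B) nu.
pose e0 := psi (x + u) - psi x - dotv u (G x) - 2^-1 * dotv (u *m D x) u.
have e0C : `|e0| <= C * enorm u `^ (2 + al) := df_taylor dfn xx0 ur.
have eC : `|e0 / g| <= C * enorm u `^ (2 + al).
  rewrite normrM normfV (gtr0_norm g0); apply: le_trans e0C.
  by rewrite ler_pdivrMr// ler_peMr.
(* m collects the cross terms of the Hessian, e0 is the Taylor remainder. *)
have psiE : psi (x + u) = g * (- s + 2^-1 * b + m + e0 / g).
  have -> : psi (x + u) = e0 + dotv u (G x) + 2^-1 * dotv (u *m D x) u.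
    by rewrite /e0 px; ring.
  have -> : dotv u (G x) = - g * s.
    by rewrite dotv_grad dotvDl dotvZl (dotv_enorm1 nu1) yn; ring.
  have -> : dotv (u *m D x) u = g * (s ^+ 2 * dotv (nu *m B) nu +
      2 * s * dotv (nu *m B) y + b).
    rewrite DB /b -/B; congr (_ * _).
    rewrite mulmxDl -scalemxAl !dotvDl !dotvDr !dotvZl !dotvZr.
    by rewrite (Bsym y nu); ring.
  by rewrite /m; field; rewrite gt_eqF.
have bC : `|b| <= C * enorm y ^+ 2 by rewrite expr2 mulrA BC.
have mC : `|m| <= C * `|s| * (enorm y + `|s|).
  have h1 := BC nu y; have h2 := BC nu nu; rewrite nu1 !mulr1 in h1 h2.
  rewrite (le_trans (ler_normD _ _))// mulrDr lerD//.
    by rewrite normrM; have := ler_wpM2l (normr_ge0 s) h1; lra.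
  rewrite !normrM gtr0_norm ?invr_gt0//.
  have ss := mulr_ge0 (normr_ge0 s) (normr_ge0 s).
  by have := ler_wpM2l ss h2; have := mulr_ge0 ss (normr_ge0 (dotv (nu *m B) nu)); lra.
rewrite psiE pmulr_rgt0// pmulr_rlt0//; split=> h.
  exact: (graph_error C1 al01 y0 yu su usy bC mC eC uC).
rewrite -oppr_gt0.
have -> : - (- s + 2^-1 * b + m + e0 / g) =
    - (- s) + 2^-1 * (- b) + (- m) + - (e0 / g) by ring.
apply: (@graph_error R C al (enorm u) (enorm y)); rewrite ?normrN//.
by move: h; rewrite /q; lra.
Qed.

Lemma df_side s : psi x = 0 -> 0 < `|s| -> `|s| * (31 * C ^+ 3) <= 1 -> `|s| < rho ->
  (s < 0 -> 0 < psi (x + s *: nu)) /\ (0 < s -> psi (x + s *: nu) < 0).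
Proof.
move=> px s0 sC sr; have := @df_sandwich s 0 px (dot0v nu).
rewrite addr0 enormZ df_normal1 mulr1 => /(_ sr sC) /=.
rewrite mul0mx dot0v enorm0 powR0 ?mulr0 ?subr0 ?addr0//.
by rewrite gt_eqF// ltr_pwDr.
Qed.

Lemma df_lipschitz u : enorm u < rho -> `|psi (x + u) - psi x| <= 3 * C * enorm u.
Proof.
move=> ur; have u0 := enorm_ge0 u; have u1 : enorm u <= 1 by rewrite ltW// (lt_le_trans ur).
have h1 := df_taylor dfn xx0 ur.
have h2 : `|dotv u (G x)| <= C * enorm u.
  rewrite (le_trans (cauchy_schwarz _ _))// mulrC ler_wpM2r//.
  by have /andP[] := df_grad dfn xx0.
have h3 : `|dotv (u *m D x) u| <= C * enorm u.
  rewrite (le_trans (cauchy_schwarz _ _))//.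
  have := ler_wpM2r u0 (df_D dfn u xx0); have := mulr_ge0 C0 u0; nra.
have h4 : enorm u `^ (2 + al) <= enorm u.
  rewrite -[leRHS]expr1; apply: powR_le_expr; first by rewrite u0.
  by move: al0; lra.
have h5 := ler_wpM2l C0 h4.
rewrite (_ : psi (x + u) - psi x = (psi (x + u) - psi x - dotv u (G x) -
  2^-1 * dotv (u *m D x) u) + dotv u (G x) + 2^-1 * dotv (u *m D x) u); last by ring.
set a := _ - _ - _ - _ in h1 *; set b := dotv u _ in h2 *.
set c := dotv (_ *m _) _ in h3 *; move: a b c h1 h2 h3 h5 => a b c; rewrite !ler_norml => /andP[? ?] /andP[? ?] /andP[? ?] ?.
by have Cu := mulr_ge0 C0 u0; apply/andP; split; lra.
Qed.

Lemma df_boundary : boundary E x <-> psi x = 0.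
Proof.
have near_sign : psi x != 0 -> exists2 r, 0 < r & forall y, enorm (y - x) < r ->
    enorm (y - x0) < 2 * rho /\ 0 < psi y * psi x.
  move=> p0; have np : 0 < `|psi x| by rewrite normr_gt0.
  have pC : 0 < `|psi x| / (3 * C) by rewrite divr_gt0// mulr_gt0// (lt_le_trans _ C1).
  exists (Num.min rho (`|psi x| / (3 * C))); first by rewrite lt_min rho0.
  move=> y; rewrite lt_min => /andP[yr yp]; have := df_lipschitz yr.
  have := df_close yr; rewrite [x + _]addrC subrK => yx0 H; split=> //.
  have : `|psi y - psi x| < `|psi x|.
    apply: le_lt_trans H _; rewrite mulrC -ltr_pdivlMr// mulr_gt0//.
    exact: lt_le_trans C1.
  move: np; rewrite normr_gt0 ltr_norml.
  have [p1|p1|->] := ltgtP (psi x) 0; last by rewrite ?eqxx.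
  - by rewrite (ltr0_norm p1) => _ /andP[? ?]; rewrite nmulr_lgt0//; lra.
  - by rewrite (gtr0_norm p1) => _ /andP[? ?]; rewrite pmulr_lgt0//; lra.
split=> [[cE nE]|px].
  apply/eqP/negP => /negP p0; have [r r0 hr] := near_sign p0.
  have nr : nbhs x [set y | enorm (y - x) < r] by apply/nbhs_enormP; exists r.
  have [p1|p1|p1] := ltgtP (psi x) 0; last by rewrite p1 eqxx in p0.
  - have [y [Ey yr]] := cE _ nr; have [yx0 pp] := hr _ yr.
    by apply: (df_neg dfn yx0 _ Ey); rewrite nmulr_lgt0 in pp.
  - apply: nE; apply/nbhs_enormP; exists r => // y yr; have [yx0 pp] := hr _ yr.
    by apply: (df_pos dfn yx0); rewrite pmulr_lgt0 in pp.
have pick r : 0 < r -> exists s, [/\ 0 < s, s < r, s < rho & s * (31 * C ^+ 3) <= 1].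
  move=> r0; have K0 : 0 < 31 * C ^+ 3 by rewrite mulr_gt0// exprn_gt0// (lt_le_trans _ C1).
  exists (Num.min (Num.min r rho / 2) (31 * C ^+ 3)^-1).
  have m0 : 0 < Num.min r rho by rewrite lt_min r0.
  split.
  - by rewrite lt_min divr_gt0//= invr_gt0.
  - rewrite gt_min; apply/orP; left; have : Num.min r rho <= r by rewrite ge_min lexx.
    by move: m0; lra.
  - rewrite gt_min; apply/orP; left; have : Num.min r rho <= rho by rewrite ge_min lexx orbT.
    by move: m0; lra.
  - by rewrite -ler_pdivlMr// mul1r ge_min lexx orbT.
split.
  move=> B /nbhs_enormP[r r0 rB]; have [s [s0 sr srho sC]] := pick _ r0.
  have Ns : `|- s| = s by rewrite normrN gtr0_norm.
  exists (x + (- s) *: nu); split.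
    apply: (df_pos dfn); first by apply: df_close; rewrite enormZ df_normal1 Ns mulr1.
    by apply: (proj1 (df_side px _ _ _)); rewrite ?Ns// oppr_lt0.
  by apply: rB; rewrite addrAC subrr add0r enormZ df_normal1 Ns mulr1.
move=> /nbhs_enormP[r r0 rB]; have [s [s0 sr srho sC]] := pick _ r0.
have Ns : `|s| = s by rewrite gtr0_norm.
suff : ~ E (x + s *: nu).
  by apply; apply: rB; rewrite addrAC subrr add0r enormZ df_normal1 Ns mulr1.
apply: (df_neg dfn); first by apply: df_close; rewrite enormZ df_normal1 Ns mulr1.
by apply: (proj2 (df_side px _ _ _)); rewrite ?Ns.
Qed.

End at_point.
End local_geometry.

(** * Normal and principal frame *)

Section normal.
Context {R : realType} (n : nat) (E : set 'rV[R]_n) (al C rho : R).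
Variables (x0 : 'rV[R]_n) (psi : 'rV[R]_n -> R) (G : 'rV[R]_n -> 'rV[R]_n).
Variable D : 'rV[R]_n -> 'M[R]_n.
Hypothesis dfn : defining_function E al C rho x0 psi G D.
Hypotheses (al01 : 0 < al <= 1) (C1 : 1 <= C) (rho01 : 0 < rho <= 1).

Let C0 : 0 <= C. Proof. by move: C1; lra. Qed.
Let rho0 : 0 < rho. Proof. by have /andP[] := rho01. Qed.
Let rho1 : rho <= 1. Proof. by have /andP[] := rho01. Qed.
Let al0 : 0 < al. Proof. by have /andP[] := al01. Qed.

(** By [df_tangent] the direction of u is a limit of directions of secants of the
    boundary. *)
Lemma tangent_secants x u p (M : 'M[R]_(n, p)) :
  enorm (x - x0) < rho -> psi x = 0 -> dotv u (G x) = 0 ->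
  (forall e : R, 0 < e -> \forall y \near x, boundary E y ->
    enorm ((y - x) *m M) <= e * enorm (y - x)) ->
  u *m M = 0.
Proof.
move=> xx0 px uG secM; have [c c0 Mc] := mulmx_enorm_bound M.
apply/eqP; rewrite -enorm_eq0 eq_le enorm_ge0 andbT.
apply/ler_addgt0Pl => e e0; rewrite addr0.
have u0 := enorm_ge0 u.
pose W := enorm u + C * enorm u ^+ 2; pose K := c * (C * enorm u ^+ 2).
have W0 : 0 <= W by rewrite addr_ge0// mulr_ge0// exprn_ge0.
have K0 : 0 <= K by rewrite !mulr_ge0// exprn_ge0.
(* The secant from x to the boundary point y near x + t u; t is small enough for
   y to stay in the range of every estimate. *)
pose Z := W + K + 2; have Z0 : 0 < Z by rewrite /Z; lra.
have e1 : 0 < e / (2 * Z) by rewrite divr_gt0// mulr_gt0.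
have /nbhs_enormP[r r0 rM] := secM _ e1.
pose q := Num.min (Num.min r e) (Num.min (rho - enorm (x - x0)) rho).
have q0 : 0 < q by rewrite !lt_min r0 e0 rho0 subr_gt0 xx0.
pose t := Num.min 1 (q / 2) / Z.
have m0 : 0 < Num.min 1 (q / 2) by rewrite lt_min ltr01 divr_gt0.
have t0 : 0 < t by rewrite divr_gt0.
have tZ : t * Z = Num.min 1 (q / 2) by rewrite divfK// gt_eqF.
have tZ1 : t * Z <= 1 by rewrite tZ ge_min lexx.
have tZq : t * Z < q.
  by rewrite tZ (@le_lt_trans _ _ (q / 2)) ?ge_min ?lexx ?orbT//; move: q0; lra.
have [qr qe qx qrho] : [/\ q <= r, q <= e, q <= rho - enorm (x - x0) & q <= rho].
  by rewrite /q !ge_min !lexx ?orbT.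
have t1 : t <= 1 by move: tZ1; rewrite /Z; nra.
have tW : t * W <= t * Z by rewrite ler_wpM2l ?(ltW t0)// /Z; lra.
have tK : t * K <= t * Z by rewrite ler_wpM2l ?(ltW t0)// /Z; lra.
have tu : enorm (t *: u) = t * enorm u by rewrite enormZ gtr0_norm.
have Cu2 : 0 <= C * enorm u ^+ 2 by rewrite mulr_ge0// exprn_ge0.
have tuW : t * enorm u <= t * W by rewrite ler_wpM2l ?(ltW t0)// /W; lra.
have tur : enorm (t *: u) < rho by rewrite tu; lra.
have tuG : dotv (t *: u) (G x) = 0 by rewrite dotvZl uG mulr0.
have [y py] := df_tangent dfn xx0 tur px tuG; rewrite tu => yu.
have {}yu : enorm (y - x - t *: u) <= t * (t * (C * enorm u ^+ 2)).
  by apply: le_trans yu _; rewrite exprMn le_eqVlt; apply/orP; left; apply/eqP; ring.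
have yx : enorm (y - x) <= t * W.
  rewrite -(subrK (t *: u) (y - x)) (le_trans (ler_enormD _ _))// tu /W mulrDr addrC.
  by rewrite lerD2l (le_trans yu)// ler_wpM2l ?(ltW t0)// ler_piMl.
have yx0 : enorm (y - x0) < rho.
  rewrite -(subrK x y) -addrA (le_lt_trans (ler_enormD _ _))//.
  by move: (enorm (x - x0)) qx => w qx; lra.
have By : boundary E y by apply/(df_boundary dfn al01 C1 rho01 yx0).
have yr : enorm (y - x) < r by apply: le_lt_trans yx _; lra.
have h1 := rM y yr By.
have h2 := Mc (y - x - t *: u).
have h3 : t * enorm (u *m M) <= e / (2 * Z) * (t * W) + c * (t * (t * (C * enorm u ^+ 2))).
  rewrite -[X in X * _ <= _](gtr0_norm t0) -enormZ scalemxAl.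
  rewrite (_ : t *: u *m M = (y - x) *m M - (y - x - t *: u) *m M); last first.
    by rewrite -mulmxBl; congr (_ *m _); apply/rowP => i; rewrite !mxE; ring.
  rewrite (le_trans (ler_enormB _ _))// lerD//.
    by rewrite (le_trans h1)// ler_wpM2l// ltW.
  by rewrite (le_trans h2)// ler_wpM2l.
rewrite -(ler_pM2l t0) (le_trans h3)//.
rewrite (_ : _ + _ = t * (e / (2 * Z) * W + t * K)); last by rewrite /K; ring.
rewrite ler_wpM2l ?(ltW t0)//.
have : e / (2 * Z) * W <= e / 2.
  rewrite invfM mulrA -mulrA ler_piMr// ?divr_ge0 ?(ltW e0)//.
  by rewrite mulrC ler_pdivrMr// mul1r /Z; lra.
have : t * K <= q / 2 by rewrite (le_trans tK)// tZ ge_min lexx orbT.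
by lra.
Qed.

(** A unit vector orthogonal to all secants is orthogonal to everything
    orthogonal to G x, hence plus or minus G / |G|; the sign is forced because E lies on the side where
    psi > 0. *)
Lemma df_outer_normal x : enorm (x - x0) < rho -> psi x = 0 ->
  outer_unit_normal E x = df_normal G x.
Proof.
move=> xx0 px; have [nu nuE] : exists nu, nu = df_normal G x by exists (df_normal G x).
rewrite -nuE; have nu1 := df_normal1 dfn xx0 nuE.
have K0 : 0 < 31 * C ^+ 3 by rewrite mulr_gt0// exprn_gt0// (lt_le_trans _ C1).
have side : exists2 r, 0 < r & forall s, 0 < s < r -> E (x - s *: nu) /\ ~ E (x + s *: nu).
  exists (Num.min rho (31 * C ^+ 3)^-1); first by rewrite lt_min rho0 invr_gt0.
  move=> s /andP[s0]; rewrite lt_min => /andP[sr sC].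
  have Ns : `|s| = s by rewrite gtr0_norm.
  have Ns' : `|- s| = s by rewrite normrN.
  have {}sC : s * (31 * C ^+ 3) <= 1 by rewrite -ler_pdivlMr// mul1r ltW.
  split.
    rewrite -scaleNr; apply: (df_pos dfn).
      by apply: (df_close xx0); rewrite enormZ nu1 mulr1 Ns'.
    apply: (proj1 (df_side dfn al01 C1 xx0 nuE px _ _ _)); rewrite ?Ns'//.
    by rewrite oppr_lt0.
  apply: (df_neg dfn).
    by apply: (df_close xx0); rewrite enormZ nu1 mulr1 Ns.
  by apply: (proj2 (df_side dfn al01 C1 xx0 nuE px _ _ _)); rewrite ?Ns.
have [r r0 hr] := side.
apply: xget_subset1.
  split=> //.
    move=> e e0; apply/nbhs_enormP.
    have eC : 0 < e / (2 * C) by rewrite divr_gt0// mulr_gt0// (lt_le_trans _ C1).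
    exists (Num.min (Num.min rho (rho - enorm (x - x0))) (e / (2 * C))).
      by rewrite !lt_min rho0 subr_gt0 xx0.
    move=> y; rewrite !lt_min => /andP[/andP[yr yx] ye] By.
    have yx0 : enorm (y - x0) < rho.
      rewrite -(subrK x y) -addrA (le_lt_trans (ler_enormD _ _))//.
      by move: (enorm (x - x0)) yx => w; lra.
    have py := proj1 (df_boundary dfn al01 C1 rho01 yx0 erefl) By.
    have u0 := enorm_ge0 (y - x).
    have := df_taylor dfn xx0 yr; rewrite [x + _]addrC subrK py px subr0 sub0r.
    have := le_trans (cauchy_schwarz _ _) (ler_wpM2r u0 (df_D dfn (y - x) xx0)).
    have g1 : 1 <= enorm (G x) by have /andP[] := df_grad dfn xx0.
    rewrite (dotv_grad dfn xx0 nuE).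
    have h4 : enorm (y - x) `^ (2 + al) <= enorm (y - x) * enorm (y - x).
      rewrite -expr2; apply: powR_le_expr; first by rewrite u0 ltW// (lt_le_trans yr).
      by move: al0; lra.
    have h5 := ler_wpM2l C0 h4.
    have h6 : C * enorm (y - x) * enorm (y - x) * 2 <= e * enorm (y - x).
      move: ye; rewrite ltr_pdivlMr ?mulr_gt0// ?(lt_le_trans _ C1)// => ye.
      by have := ler_wpM2r u0 (ltW ye); lra.
    set b := dotv (_ *m _) _; set a := dotv _ nu; set w := enorm (y - x) in h4 h5 h6 u0 *.
    move=> h2 h3; have gpos : 0 <= enorm (G x) by exact: enorm_ge0.
    have : enorm (G x) * `|a| <= e * w.
      rewrite -[X in X * _](ger0_norm gpos) -normrM.
      move: h2 h3; rewrite !ler_norml => /andP[? ?] /andP[? ?]; apply/andP; split; lra.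
    apply: le_trans; rewrite ler_peMl//.
  apply: filterS2 (nbhs_right_gt 0) (nbhs_right_lt r0) => t t0 tr.
  by apply: (proj2 (hr t _)); rewrite t0.
move=> v w [v1 vsec vout] [w1 wsec wout].
suff H z : is_outer_unit_normal E x z -> z = nu by rewrite (H v)// (H w).
move=> {v w v1 vsec vout w1 wsec wout} [z1 zsec zout].
pose c := dotv z nu; pose u := z - c *: nu.
have un : dotv u nu = 0 by rewrite dotvBl dotvZl (dotv_enorm1 nu1) mulr1 subrr.
have uz : u *m z^T = 0.
  apply: (tangent_secants xx0 px); first by apply/(dotv_normal_eq0 dfn xx0 nuE).
  move=> e e0; apply: filterS (zsec e e0) => y H By; apply: le_trans (H By).
  have -> : (y - x) *m z^T = const_mx (dotv (y - x) z).
    by apply/matrixP => i j; rewrite !ord1 -dotvE mxE.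
  by rewrite (le_trans (enorm_le_sum _))// big_ord1 mxE.
have {}uz : dotv u z = 0 by rewrite dotvE uz mxE.
have u00 : u = 0.
  apply/eqP; rewrite -enorm_eq0 -sqrf_eq0 sqr_enorm {2}/u dotvBr dotvZr uz un.
  by rewrite mulr0 subr0.
have zE : z = c *: nu by apply/eqP; rewrite -subr_eq0 -/u u00.
have c1 : `|c| = 1 by rewrite -z1 zE enormZ nu1 mulr1.
have [c0|c0] := leP 0 c; first by move: c1; rewrite zE ger0_norm// => ->; rewrite scale1r.
exfalso.
have : \forall t \near (0 : R)^'+, ~ E (x + t *: z) /\ (0 < t < r).
  apply: filterS3 zout (nbhs_right_gt 0) (nbhs_right_lt r0) => t zt t0 tr.
  by split=> //; rewrite t0.
move=> /filter_ex[t [nE /(hr t)[]]] + _.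
have -> : x - t *: nu = x + t *: z; last by [].
by move: c1; rewrite zE ltr0_norm// => /eqP; rewrite eqr_oppLR => /eqP ->; rewrite scaleN1r scalerN.
Qed.

(** The differential of G / |G| is the differential of G followed by the
    orthogonal projection along G, divided by |G|. *)
Lemma df_tangential_differential x : enorm (x - x0) < rho -> psi x = 0 ->
  is_tangential_differential (boundary E) (outer_unit_normal E) x
    ((- (enorm (G x))^-1 *: D x)
      *m (1%:M - (df_normal G x)^T *m df_normal G x)).
Proof.
move=> xx0 px e e0; set g := enorm (G x).
have g1 : 1 <= g by have /andP[] := df_grad dfn xx0.
have g0 : 0 < g by exact: lt_le_trans g1.
have [m mE] : exists m, m = g^-1 *: G x by exists (g^-1 *: G x).
have nE : df_normal G x = - m by rewrite mE /df_normal -/g scaleNr.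
have m1 : enorm m = 1 by rewrite mE enormZ gtr0_norm ?invr_gt0// mulVf// gt_eqF.
have eK : 0 < e / (16 * C ^+ 2) by rewrite divr_gt0// mulr_gt0// exprn_gt0// (lt_le_trans _ C1).
apply/nbhs_enormP.
exists (Num.min (Num.min rho (rho - enorm (x - x0)))
    (Num.min (e / (24 * C ^+ 2)) ((e / (4 * C)) `^ al^-1))).
  by rewrite !lt_min rho0 subr_gt0 xx0 powR_gt0 divr_gt0 ?mulr_gt0 ?exprn_gt0 ?(lt_le_trans _ C1).
move=> y; rewrite !lt_min => /andP[/andP[yr yx] /andP[ye ya]] By.
have yx0 : enorm (y - x0) < rho.
  rewrite -(subrK x y) -addrA (le_lt_trans (ler_enormD _ _))//.
  by move: (enorm (x - x0)) yx => w; lra.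
have py := proj1 (df_boundary dfn al01 C1 rho01 yx0 erefl) By.
rewrite (df_outer_normal xx0 px) (df_outer_normal yx0 py) nE.
have [w wE] : exists w, w = y - x by exists (y - x).
rewrite -wE in yr yx ye ya *.
have w0 := enorm_ge0 w.
have [dl dlE] : exists dl, dl = G y - G x by exists (G y - G x).
have Gy : G y = G x + dl by rewrite dlE addrC subrK.
have g1' : 1 <= enorm (G x + dl) by rewrite -Gy; have /andP[] := df_grad dfn yx0.
have := normalize_expansion g1 g1' mE.
rewrite -Gy; set N := _ - _ - _ => NE.
have err := df_grad_taylor dfn xx0 yr.
rewrite wE (addrC x) subrK -dlE -wE in err.
set r := dl - _ in err.
have wC : enorm w `^ (1 + al) <= enorm w * (e / (4 * C)).
  rewrite -mulr_powR ?(ltW al0)// ler_wpM2l//.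
  have := ler_powR_base (ltW al0) w0 (ltW ya).
  by rewrite -powRrM mulVf ?gt_eqF// powRr1// divr_ge0 ?(ltW e0)// mulr_ge0.
have w1 : enorm w <= 1 by rewrite ltW// (lt_le_trans yr).
have wC1 : enorm w `^ (1 + al) <= enorm w.
  rewrite -[leRHS]expr1; apply: powR_le_expr; first by rewrite w0.
  by move: al0; lra.
have dC : enorm dl <= 2 * C * enorm w.
  rewrite -(subrK (w *m D x) dl) -/r (le_trans (ler_enormD _ _))//.
  have := df_D dfn w xx0; have := ler_wpM2l C0 wC1.
  by move: err; move: (enorm w) (enorm r) (_ `^ _) => a b c; lra.
pose T (v : 'rV[R]_n) := v - dotv v m *: m.
have T2 v : enorm (T v) <= 2 * enorm v.
  rewrite /T (le_trans (ler_enormB _ _))// enormZ m1 mulr1.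
  have := cauchy_schwarz v m; rewrite m1 mulr1.
  by move: (enorm v) (`|_|) => a b; lra.
have -> : - (enorm (G y))^-1 *: G y - - m - w *m ((- g^-1 *: D x) *m
    (1%:M - (- m)^T *m - m)) = - N - g^-1 *: T r.
  have -> : w *m ((- g^-1 *: D x) *m (1%:M - (- m)^T *m - m)) = - g^-1 *: T (w *m D x).
    rewrite mulmxA -scalemxAr -scalemxAl; congr (_ *: _).
    have -> : (- m)^T *m - m = m^T *m m.
      by apply/matrixP => i j; rewrite !mxE !big_ord1 !mxE mulrNN.
    rewrite mulmxBr mulmx1 /T mulmxA; congr (_ - _).
    by rewrite dotvE; apply/rowP => i; rewrite [in RHS]mxE [in LHS]mxE big_ord1.
  have TB a b : T (a - b) = T a - T b.
    by rewrite /T dotvBl; apply/rowP => i; rewrite !mxE; ring.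
  rewrite /r TB /N /T -/g; move: (w *m D x) => z.
  by move: (dotv z m) (dotv dl m) => a b; apply/rowP => i; rewrite !mxE; ring.
rewrite -opprD enormN (le_trans (ler_enormD _ _))// enormZ gtr0_norm ?invr_gt0//.
have Tr : g^-1 * enorm (T r) <= 2 * enorm r.
  by rewrite ler_pdivrMl// (le_trans (T2 r))// ler_peMl// mulr_ge0// enorm_ge0.
have dl2 : 3 * enorm dl ^+ 2 <= e / 2 * enorm w.
  have : enorm dl ^+ 2 <= (2 * C * enorm w) ^+ 2.
    by rewrite lerXn2r ?nnegrE ?enorm_ge0// mulr_ge0// mulr_ge0.
  move: ye; rewrite ltr_pdivlMr ?mulr_gt0 ?exprn_gt0 ?(lt_le_trans _ C1)// => /ltW ye.
  have := ler_wpM2l w0 ye; rewrite !exprMn !expr2.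
  by move: (enorm w) (enorm dl) => a b; lra.
have rC : 2 * enorm r <= e / 2 * enorm w.
  have := ler_wpM2l C0 wC.
  rewrite (_ : C * (enorm w * (e / (4 * C))) = e / 4 * enorm w); last first.
    by field; rewrite gt_eqF// (lt_le_trans _ C1).
  by move: err; move: (enorm w) (enorm r) (_ `^ _) => a b c; lra.
by move: NE Tr dl2 rC; move: (enorm w) (enorm r) (enorm dl ^+ 2) => a b c; lra.
Qed.

End normal.

(** What the expansion of the convolution uses about E near the boundary point x:
    the boundary lies within |y|^(2+al) of a paraboloid over the tangent plane,
    and the principal curvatures diagonalise its quadratic form. *)
Definition boundary_paraboloid (R : realType) n (al : R) (E : set 'rV[R]_n)
    (C : R) (x : 'rV[R]_n) : Prop :=
  let nu := outer_unit_normal E x in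
  exists B : 'M[R]_n,
  [/\ enorm nu = 1, forall y, `|dotv (y *m B) y| <= C * enorm y ^+ 2,
      forall s y, dotv y nu = 0 -> C * enorm (s *: nu + y) <= 1 ->
        let b := 2^-1 * dotv (y *m B) y in
        let q := C * enorm y `^ (2 + al) in
        (s < b - q -> E (x + (s *: nu + y))) /\
        (b + q < s -> ~ E (x + (s *: nu + y))) &
      forall y, dotv y nu = 0 -> let kt := principal_frame E x in
        \sum_i kt.1 i * dotv (kt.2 i) y ^+ 2 = - dotv (y *m B) y].

Lemma boundary_paraboloid_le (R : realType) n (al : R) (E : set 'rV[R]_n) C C' x :
  0 <= C -> C <= C' -> boundary_paraboloid al E C x -> boundary_paraboloid al E C' x.
Proof.
move=> C0 CC' [B [n1 BC EC frame]]; exists B; split=> // [y|s y yn uC b q].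
  by rewrite (le_trans (BC y))// ler_wpM2r// exprn_ge0// enorm_ge0.
have [|h1 h2] := EC s y yn.
  by apply: le_trans uC; rewrite ler_wpM2r// enorm_ge0.
have qq : C * enorm y `^ (2 + al) <= q by rewrite ler_wpM2r// powR_ge0.
by split=> h; [apply: h1; move: h qq; rewrite -/b; lra|apply: h2; move: h qq; rewrite -/b; lra].
Qed.

(** The frame of the statement is chosen arbitrarily among the principal frames,
    for a tangential differential chosen arbitrarily as well; the latter is
    determined on tangent vectors by [tangent_secants], which is all that the
    quadratic form sees. *)
Lemma defining_function_paraboloid (R : realType) n (al C rho : R)
    (E : set 'rV[R]_n.+1) x0 psi G D :
  0 < al <= 1 -> 1 <= C -> 0 < rho <= 1 ->
  defining_function E al C rho x0 psi G D ->
  forall x, enorm (x - x0) < rho -> boundary E x ->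
    boundary_paraboloid al E (31 * C ^+ 3 + 2 / rho) x.
Proof.
move=> al01 C1 rho01 dfn x xx0 Bx; have /andP[rho0 rho1] := rho01.
have px := proj1 (df_boundary dfn al01 C1 rho01 xx0 erefl) Bx.
rewrite /boundary_paraboloid.
have nuE := df_outer_normal dfn al01 C1 rho01 xx0 px.
have dN := df_tangential_differential dfn al01 C1 rho01 xx0 px.
have nu1 := df_normal1 dfn xx0 nuE.
rewrite -nuE in dN.
set nu := outer_unit_normal E x in nuE nu1 dN *.
set g := enorm (G x) in dN.
have g1 : 1 <= g by have /andP[] := df_grad dfn xx0.
have g0 : 0 < g by exact: lt_le_trans g1.
have C3 : C <= C ^+ 3 by rewrite !exprS expr0; nra.
have r2 : 0 < 2 / rho by rewrite divr_gt0.
pose K := 31 * C ^+ 3 + 2 / rho.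
have CK : C <= K by rewrite /K; lra.
exists (g^-1 *: D x); split=> //.
- move=> y; rewrite (le_trans (cauchy_schwarz _ _))// expr2 mulrA ler_wpM2r ?enorm_ge0//.
  rewrite -scalemxAr enormZ gtr0_norm ?invr_gt0// ler_pdivrMl//.
  have := df_D dfn y xx0; have y0 := enorm_ge0 y.
  have := ler_wpM2r y0 CK; rewrite -/K => h1 h2.
  rewrite (le_trans h2)// (le_trans h1)// ler_peMl// mulr_ge0//.
  by move: CK C1; lra.
- move=> s y yn; rewrite -/K => uC; set u := s *: nu + y in uC *.
  set b := 2^-1 * _; set q := K * _.
  have u0 := enorm_ge0 u.
  have K31 : 31 * C ^+ 3 <= K by rewrite /K; lra.
  have ur : enorm u < rho.
    have : 2 / rho * enorm u <= 1.
      by apply: le_trans uC; rewrite ler_wpM2r// /K; move: C3 C1; lra.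
    by rewrite mulrAC ler_pdivrMr//; lra.
  have uC' : enorm u * (31 * C ^+ 3) <= 1.
    by apply: le_trans uC; rewrite mulrC ler_wpM2r.
  have := df_sandwich dfn al01 C1 xx0 nuE px yn ur uC'.
  rewrite -/g -/u => -[h1 h2].
  have qq : 31 * C ^+ 3 * enorm y `^ (2 + al) <= q by rewrite ler_wpM2r// powR_ge0.
  split=> h.
    by apply: (df_pos dfn (df_close xx0 ur)); apply: h1; move: h qq; rewrite /b; lra.
  by apply: (df_neg dfn (df_close xx0 ur)); apply: h2; move: h qq; rewrite /b; lra.
move=> y yn; set kt := principal_frame E x.
have [a [tau [tt tn ta]]] : exists (a : 'I_n -> R) (tau : 'I_n -> 'rV[R]_n.+1),
    [/\ forall i j, dotv (tau i) (tau j) = (i == j)%:R,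
        forall i, dotv (tau i) nu = 0 &
        forall i, tau i *m ((- g^-1 *: D x) *m (1%:M - nu^T *m nu)) = a i *: tau i].
  apply: exists_frame => //; apply/matrixP => i j; rewrite !mxE; congr (_ * _).
  by have := congr1 (fun M : 'M[R]_n.+1 => M i j) (df_sym dfn xx0); rewrite mxE.
have : is_principal_frame E x kt.
  apply: (@xgetPex _ (fun=> 0, fun=> 0) [set kt | is_principal_frame E x kt]).
  by exists (a, tau); split=> //; eexists; [exact: dN|exact: ta].
move=> [ktt ktn [L dL kL]].
apply: (frame_diagonal nu1 ktt ktn kL) => //.
move=> i v vn.
have Gt : dotv (kt.2 i) (G x) = 0 by apply/(dotv_normal_eq0 dfn xx0 nuE); exact: ktn.
have -> : kt.2 i *m L = kt.2 i *m ((- g^-1 *: D x) *m (1%:M - nu^T *m nu)).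
  apply/eqP; rewrite -subr_eq0 -mulmxBr; apply/eqP.
  apply: (tangent_secants dfn al01 C1 rho01 xx0 px Gt) => e e0.
  have e2 : 0 < e / 2 by rewrite divr_gt0.
  apply: filterS2 (dL _ e2) (dN _ e2) => z h1 h2 Bz.
  rewrite mulmxBr.
  set p := (z - x) *m L in h1 *; set p' := (z - x) *m _ in h2 *.
  set f := outer_unit_normal E z - _ in h1 h2.
  have -> : p - p' = (f - p') - (f - p) by apply/rowP => k; rewrite !mxE; ring.
  rewrite (le_trans (ler_enormB _ _))//.
  by have := lerD (h2 Bz) (h1 Bz); move: (enorm (z - x)) => w; lra.
rewrite mulmxA mulmxBr mulmx1 dotvBl mulmxA [X in _ - X](_ : _ = 0).
  by rewrite subr0 scaleNr mulmxN dotvNl.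
rewrite dotv_mulmx (_ : v *m nu^T = 0) ?dotv0//.
by apply/matrixP => i' j'; rewrite !ord1 -dotvE vn mxE.
Qed.

(** * Charts, and uniformity over the boundary *)

Section chart.
Context {R : realType} (n : nat) (j : 'I_n.+1).
Implicit Types (x u : 'rV[R]_n.+1).

Let Q : 'M[R]_(n.+1, n) := col' j 1%:M.

Let mulQ x : x *m Q = col' j x.
Proof.
apply/rowP => i; rewrite !mxE (bigD1 (lift j i))//= big1 ?addr0.
  by rewrite !mxE eqxx mulr1.
by move=> k ki; rewrite !mxE (negPf ki) mulr0.
Qed.

Let QQ : Q^T *m Q^T^T = 1%:M.
Proof.
have /matrixP H := mul1mx (1%:M : 'M[R]_n.+1).
apply/matrixP => i k; have := H (lift j i) (lift j k).
rewrite [RHS]mxE (inj_eq lift_inj) !mxE => <-.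
by apply: eq_bigr => l _; rewrite !mxE eq_sym.
Qed.

Let dQ : delta_mx 0 j *m Q = 0 :> 'rV[R]_n.
Proof. by rewrite mulQ; apply/rowP => i; rewrite !mxE eqxx eq_sym (negPf (neq_lift j i)). Qed.

Let splitQ x : x = x *m Q *m Q^T + x 0 j *: delta_mx 0 j.
Proof.
apply/rowP => k; rewrite mulQ mxE mxE [X in _ = _ + X]mxE [X in _ * X]mxE eqxx /=.
have [i|] := unliftP j k => ->.
  rewrite eq_sym (negPf (neq_lift j i)) mulr0 addr0 (bigD1 i)//= big1 ?addr0.
    by rewrite !mxE eqxx mulr1.
  by move=> l li; rewrite !mxE (inj_eq lift_inj) eq_sym (negPf li) mulr0.
rewrite eqxx mulr1 big1 ?add0r// => i _.
by rewrite !mxE (negPf (neq_lift j i)) mulr0.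
Qed.

Let sqr_split (w : 'rV[R]_n) (c : R) :
  enorm (w *m Q^T + c *: delta_mx 0 j) ^+ 2 = enorm w ^+ 2 + c ^+ 2.
Proof.
have wd : dotv (w *m Q^T) (delta_mx 0 j) = 0 by rewrite dotv_mulmx trmxK dQ dotv0.
rewrite !sqr_enorm dotvDl !dotvDr !dotvZl !dotvZr (dotvC (delta_mx 0 j) (_ *m _)) wd.
rewrite (dotv_isometry _ _ QQ) (dotv_enorm1 (enorm_delta _)); ring.
Qed.

Let leQ x : enorm (x *m Q) <= enorm x.
Proof.
rewrite -ler_sqr ?nnegrE ?enorm_ge0// [in leRHS](splitQ x) sqr_split.
by rewrite lerDl sqr_ge0.
Qed.

(** The defining function of a graph: psi x = gamma (x') - (+/-) x_j. Moving
    along the j-th axis brings any nearby point back to the zero set of psi. *)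
Lemma chart_defining_function (alpha : R) (E : set 'rV[R]_n.+1) x0 (s : bool)
    (gamma : 'rV[R]_n -> R) U :
  0 < alpha -> open_nbhs (col' j x0) U -> C2holder_on alpha U gamma ->
  nbhs x0 [set x : 'rV[R]_n.+1 | ((-1) ^+ s * x 0 j < gamma (col' j x) -> E x) /\
                   (gamma (col' j x) < (-1) ^+ s * x 0 j -> ~ E x)] ->
  exists C rho psi G D,
    [/\ 1 <= C, 0 < rho <= 1 & defining_function E alpha C rho x0 psi G D].
Proof.
move=> a0 [oU Ux0] C2g /nbhs_enormP[r1 r10 hr1].
have /nbhs_enormP[r2 r20 hr2] : nbhs (col' j x0) U by exact: open_nbhs_nbhs.
pose ep : R := (-1) ^+ s.
have ep2 : ep * ep = 1 by rewrite /ep; case: s {hr1 ep}; rewrite ?expr0 ?expr1; ring.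
have nep : `|ep| = 1 by rewrite /ep normr_sign.
have r0 : 0 < r2 / 2 by rewrite divr_gt0.
have rU y : enorm (y - col' j x0) < 2 * (r2 / 2) -> U y.
  by rewrite mulrC divfK ?pnatr_eq0//; exact: hr2.
have [C hC] := C2holder_bounds a0 C2g r0 rU.
have w0 : enorm (0 : 'rV[R]_n) < r2 / 2 by rewrite enorm0.
have C0 : 0 <= C.
  have y0 : enorm (col' j x0 - col' j x0) < r2 / 2 by rewrite subrr enorm0.
  have [_ h _ _ _] := hC _ 0 y0 w0.
  by apply: le_trans h; exact: enorm_ge0.
pose rho := Num.min 1 (Num.min (r2 / 2) (r1 / 2)).
have [rh1 rh2 rh3] : [/\ rho <= 1, rho <= r2 / 2 & rho <= r1 / 2].
  by rewrite /rho !ge_min !lexx ?orbT.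
have rho0 : 0 < rho by rewrite !lt_min ltr01 r0 divr_gt0.
pose p x := x *m Q.
pose psi x := gamma (p x) - ep * x 0 j.
pose G x := grad gamma (p x) *m Q^T - ep *: delta_mx 0 j.
pose D x := Q *m hessian gamma (p x) *m Q^T.
have close x : enorm (x - x0) < rho -> enorm (p x - col' j x0) < r2 / 2.
  by move=> xr; rewrite -mulQ -mulmxBl (le_lt_trans (leQ _))// (lt_le_trans xr).
have small u : enorm u < rho -> enorm (p u) < r2 / 2.
  by move=> ur; rewrite (le_lt_trans (leQ _))// (lt_le_trans ur).
have pD x u : p (x + u) = p x + p u by exact: mulmxDl.
have dG u x : dotv u (G x) = dotv (p u) (grad gamma (p x)) - ep * u 0 j.
  rewrite dotvBr dotvZr dotv_delta dotvC dotv_mulmx trmxK dotvC; congr (_ - _).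
have uD u x : u *m D x = p u *m hessian gamma (p x) *m Q^T by rewrite !mulmxA.
have dD u x : dotv (u *m D x) u = dotv (p u *m hessian gamma (p x)) (p u).
  by rewrite uD dotv_mulmx trmxK.
have powQ u a : 0 <= a -> C * enorm (p u) `^ a <= (2 * C + 1) * enorm u `^ a.
  move=> a0'; have := ler_powR_base a0' (enorm_ge0 _) (leQ u).
  have := powR_ge0 (enorm (p u)) a; move: C0.
  by move: (_ `^ _) (_ `^ _) => b c; nra.
have taylor x u : enorm (x - x0) < rho -> enorm u < rho ->
    `|psi (x + u) - psi x - dotv u (G x) - 2^-1 * dotv (u *m D x) u|
      <= C * enorm (p u) `^ (2 + alpha).
  move=> xr ur; have [_ _ _ h _] := hC _ _ (close _ xr) (small _ ur).
  rewrite dG dD /psi pD [(x + u) 0 j]mxE; apply: le_trans h; rewrite le_eqVlt.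
  by apply/orP; left; apply/eqP; congr (`| _ |);
    move: (gamma _) (gamma _) (dotv _ _) (dotv _ _) => *; ring.
have Gbound x : enorm (x - x0) < rho -> 1 <= enorm (G x) <= C + 1.
  move=> xr; have [_ h _ _ _] := hC (p x) 0 (close _ xr) w0.
  have := sqr_split (grad gamma (p x)) (- ep).
  rewrite scaleNr -/(G x) sqrrN [ep ^+ 2]expr2 ep2 => E1.
  have g0 := enorm_ge0 (grad gamma (p x)); have G0 := enorm_ge0 (G x).
  apply/andP; split; rewrite -ler_sqr ?nnegrE// ?addr_ge0// E1 ?expr1n.
    by rewrite lerDr sqr_ge0.
  by rewrite !expr2; nra.
exists (2 * C + 1), rho, psi, G, D; split; [lra|by rewrite rho0|split].
- move=> x xr; rewrite /psi /p mulQ subr_gt0 => h.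
  by apply: (proj1 (hr1 x _)) h; rewrite (lt_le_trans xr)//; lra.
- move=> x xr; rewrite /psi /p mulQ subr_lt0 => h.
  by apply: (proj2 (hr1 x _)) h; rewrite (lt_le_trans xr)//; lra.
- by move=> x /Gbound /andP[-> h]; rewrite (le_trans h)//; lra.
- move=> x xr; have [h _ _ _ _] := hC (p x) 0 (close _ xr) w0.
  by rewrite /D !trmx_mul trmxK h mulmxA.
- move=> x u xr; have [_ _ h _ _] := hC (p x) 0 (close _ xr) w0.
  rewrite uD (enorm_isometry _ QQ) (le_trans (h _))//.
  by have := leQ u; have := enorm_ge0 (p u); rewrite /p; nra.
- move=> x u xr ur; rewrite (le_trans (taylor _ _ xr ur))// powQ//; lra.
- move=> x u xr ur; have [_ _ _ _ h] := hC _ _ (close _ xr) (small _ ur).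
  rewrite uD /G pD [_ - _ - (_ - _)](_ : _ =
    (grad gamma (p x + p u) - grad gamma (p x)) *m Q^T); last first.
    by rewrite mulmxBl opprB addrA subrK.
  by rewrite -mulmxBl (enorm_isometry _ QQ) (le_trans h)// powQ//; lra.
move=> x u xr ur px uG.
have tay := taylor _ _ xr ur; rewrite px uG !subr0 in tay.
(* The point of the graph above or below x + u. *)
exists (x + u + (ep * psi (x + u)) *: delta_mx 0 j).
  rewrite {1}/psi {1}/p mulmxDl -scalemxAl dQ scaler0 addr0.
  have jE (v : 'rV[R]_n.+1) c : (v + c *: delta_mx 0 j) 0 j = v 0 j + c.
    by rewrite !mxE !eqxx mulr1.
  rewrite jE.
  by rewrite mulrDr mulrA ep2 mul1r opprD addrA -/(p _) -/(psi _) subrr.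
rewrite (_ : _ - x - u = (ep * psi (x + u)) *: delta_mx 0 j); last first.
  by apply/rowP => i; rewrite !mxE; ring.
rewrite enormZ enorm_delta mulr1 normrM nep mul1r.
have [_ _ h _ _] := hC (p x) 0 (close _ xr) w0.
have pu0 := enorm_ge0 (p u); have u0 := enorm_ge0 u.
have h1 : `|dotv (u *m D x) u| <= C * enorm u ^+ 2.
  rewrite dD (le_trans (cauchy_schwarz _ _))//.
  rewrite (le_trans (ler_wpM2r pu0 (h (p u))))// -mulrA ler_wpM2l// expr2.
  by rewrite ler_pM// leQ.
have h2 : C * enorm (p u) `^ (2 + alpha) <= C * enorm u ^+ 2.
  rewrite ler_wpM2l// (le_trans (ler_powR_base _ _ (leQ u)))//; first by lra.
  by apply: powR_le_expr; [rewrite u0 ltW// (lt_le_trans ur)|lra].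
have u2 : 0 <= C * enorm u ^+ 2 by rewrite mulr_ge0// exprn_ge0.
have u3 : 0 <= enorm u ^+ 2 by rewrite exprn_ge0.
move: tay h1 h2; set a := psi _; set b := dotv _ _; rewrite !ler_norml.
move=> /andP[? ?] /andP[? ?] ?; apply/andP; split; lra.
Qed.

End chart.

Section uniform.
Context {R : realType}.

Lemma boundary_compact n (E : set 'rV[R]_n) : bounded_set E -> compact (boundary E).
Proof.
move=> [M0 [M0r hM]]; apply: bounded_closed_compact.
  exists (M0 + 1); split; first exact: num_real.
  move=> M M1 x [cE _]; apply/ler_addgt0Pl => e e0.
  have [y [Ey]] := cE _ (nbhsx_ballx x e e0).
  rewrite -ball_normE /= => xy.
  have yM : `|y| <= M by apply: hM => //; move: M1; lra.
  by rewrite -(subrK y x) (le_trans (ler_normD _ _))// lerD// ltW.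
rewrite /boundary setDE; apply: closedI; first exact: closed_closure.
by apply: open_closedC; exact: open_interior.
Qed.

(** Each chart gives a constant on a neighbourhood, and the boundary is compact. *)
Lemma uniform_boundary_paraboloid n (alpha : R) (E : set 'rV[R]_n.+1) :
  0 < alpha <= 1 -> bounded_set E -> C2holder_boundary alpha E ->
  exists2 C, 1 <= C & forall x, boundary E x -> boundary_paraboloid alpha E C x.
Proof.
move=> a01 bE C2E; have /andP[a0 a1] := a01.
have /compact_near_coveringP cov := boundary_compact bE.
have := cov R (pinfty_nbhs R)
  (fun C x => boundary E x -> boundary_paraboloid alpha E C x) _.
case.
  move=> x0 Bx0; have [j [s [gamma [U [oU C2g nE]]]]] := C2E x0 Bx0.
  have [C [rho [psi [G [D [C1 rho01 dfn]]]]]] := chart_defining_function a0 oU C2g nE.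
  have /andP[rho0 _] := rho01.
  have K0 : 0 <= 31 * C ^+ 3 + 2 / rho.
    by rewrite addr_ge0 ?mulr_ge0 ?exprn_ge0 ?divr_ge0 ?invr_ge0 ?(ltW rho0)//; lra.
  exists ([set x | enorm (x - x0) < rho], [set c | 31 * C ^+ 3 + 2 / rho < c]).
    split; first by apply/nbhs_enormP; exists rho.
    by exists (31 * C ^+ 3 + 2 / rho); split; first exact: num_real.
  move=> [x c] [/= xr cK] Bx.
  apply: (boundary_paraboloid_le K0 (ltW cK)).
  exact: (defining_function_paraboloid a01 C1 rho01 dfn).
move=> M [Mr hM]; exists (Num.max 1 (M + 1)); first by rewrite le_max lexx.
by move=> x Bx; apply: (hM _ _ _ Bx Bx); rewrite lt_max ltrDl ltr01 orbT.
Qed.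

End uniform.

(** * Kernels with polynomial decay *)

Section weights.
Context {R : realType}.

Definition bracket n (y : 'rV[R]_n) : R := Num.max 1 (enorm y).

Definition weight n (p : R) (y : 'rV[R]_n) : R := bracket y `^ (- p).

Definition weight_mass n (p : R) : R := \int[lebesgue_rV R n]_y weight p y.

Section basic.
Variable n : nat.
Implicit Types (y u v : 'rV[R]_n).

Lemma bracket_ge1 y : 1 <= bracket y. Proof. by rewrite le_max lexx. Qed.

Lemma bracket_gt0 y : 0 < bracket y.
Proof. exact: lt_le_trans (bracket_ge1 y). Qed.

Lemma enorm_le_bracket y : enorm y <= bracket y.
Proof. by rewrite le_max lexx orbT. Qed.

Lemma le_bracket m (u : 'rV[R]_m) v : enorm u <= enorm v -> bracket u <= bracket v.
Proof. by move=> uv; rewrite ge_max !le_max lexx uv orbT. Qed.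

Lemma weight_ge0 p y : 0 <= weight p y. Proof. exact: powR_ge0. Qed.

Lemma weight_le1 p y : 0 <= p -> weight p y <= 1.
Proof.
move=> p0; rewrite -(powRr0 (bracket y)); apply: ler_powR (bracket_ge1 _) _ _ _.
by rewrite oppr_le0.
Qed.

Lemma le_weight p q y : p <= q -> weight q y <= weight p y.
Proof. by move=> pq; apply: ler_powR (bracket_ge1 _) _ _ _; rewrite lerN2. Qed.

Lemma weight_bracket p m y : weight p y * bracket y ^+ m = weight (p - m%:R) y.
Proof.
rewrite -powR_mulrn ?(ltW (bracket_gt0 y))// -powRD.
  by rewrite /weight opprB addrC.
by apply/implyP => _; rewrite gt_eqF// bracket_gt0.
Qed.

Lemma measurable_bracket : measurable_fun setT (@bracket n).
Proof. by apply: measurable_maxr => //; exact: measurable_enorm. Qed.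

Lemma measurable_weight p : measurable_fun setT (@weight n p).
Proof.
by apply: (measurableT_comp (measurable_powR _)); exact: measurable_bracket.
Qed.

Lemma weight_integrable p : n%:R < p ->
  (lebesgue_rV R n).-integrable setT (EFin \o @weight n p).
Proof.
move=> np; apply/integrableP; split.
  by apply/measurable_EFinP; exact: measurable_weight.
apply: le_lt_trans (decay_integral_lty np); rewrite le_eqVlt; apply/orP; left.
by apply/eqP; apply: eq_integral => y _; rewrite /= ger0_norm ?weight_ge0.
Qed.

Lemma weight_mass_ge0 p : 0 <= weight_mass n p.
Proof. by apply: Rintegral_ge0 => y _; exact: weight_ge0. Qed.

Lemma dominated_integrable (f : 'rV[R]_n -> R) c p : n%:R < p ->
  measurable_fun setT f -> (forall y, `|f y| <= c * weight p y) ->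
  (lebesgue_rV R n).-integrable setT (EFin \o f).
Proof.
move=> np mf fc.
have := @integrableZl _ _ _ (lebesgue_rV R n) setT measurableT c _ (weight_integrable np).
apply: le_integrable => //; first exact/measurable_EFinP.
by move=> y _; rewrite /= lee_fin (le_trans (fc y))// ler_norm.
Qed.

Lemma dominated_Rintegral (f : 'rV[R]_n -> R) c p : n%:R < p ->
  measurable_fun setT f -> (forall y, `|f y| <= c * weight p y) ->
  `|\int[lebesgue_rV R n]_y f y| <= c * weight_mass n p.
Proof.
move=> np mf fc; have fi := dominated_integrable np mf fc.
apply: le_trans (le_normr_Rintegral measurableT fi) _.
rewrite /weight_mass -RintegralZl//; last exact: weight_integrable.
apply: le_Rintegral => //; first exact: integrable_norm.
exact: (integrableZl _ _ (weight_integrable np)).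
Qed.

End basic.

Lemma weight_mono m n p (u : 'rV[R]_m) (v : 'rV[R]_n) : 0 <= p -> bracket u <= bracket v -> weight p v <= weight p u.
Proof.
move=> p0 uv; rewrite /weight !powRN lef_pV2 ?posrE ?powR_gt0 ?bracket_gt0//.
by apply: ler_powR_base => //; exact/ltW/bracket_gt0.
Qed.

(** The common denominator of the two classes of kernels. The exponents are
    those that make K times a quadratic weight integrable on R^n, and K times a
    cubic one, or its Hölder modulus times |y|^4, integrable on a hyperplane. *)
Record tame_kernel n (K : 'rV[R]_n -> R) (M eta beta : R) : Prop := {
  tame_M : 0 <= M;
  tame_eta : 0 < eta;
  tame_beta : 0 < beta <= 1;
  tame_decay : forall u, `|K u| <= M * weight (n%:R + 2 + eta) u;
  tame_holder : forall u v, bracket u <= bracket v ->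
    `|K u - K v| <= M * weight (n%:R + 3 + eta) u * enorm (u - v) `^ beta }.

Lemma holder_continuous n (f : 'rV[R]_n -> R) (L a : R) : 0 <= L -> 0 < a ->
  (forall x y, `|f x - f y| <= L * enorm (x - y) `^ a) -> continuous f.
Proof.
move=> L0 a0 fL; apply: continuous_enormP => x e e0.
have L1 : 0 < L + 1 by lra.
exists ((e / (L + 1)) `^ a^-1); first by rewrite powR_gt0// divr_gt0.
move=> y yx; apply: le_lt_trans (fL y x) _.
have := ler_powR_base (ltW a0) (enorm_ge0 _) (ltW yx).
rewrite -powRrM mulVf ?gt_eqF// powRr1 ?divr_ge0 ?(ltW e0) ?(ltW L1)// => h.
apply: le_lt_trans (ler_wpM2l L0 h) _.
by rewrite mulrCA gtr_pMr// ltr_pdivrMr// mul1r ltrDl.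
Qed.

Lemma tame_continuous n (K : 'rV[R]_n -> R) M eta beta : tame_kernel K M eta beta ->
  continuous K.
Proof.
move=> [M0 eta0 /andP[beta0 beta1] _ hK]; apply: (holder_continuous M0 beta0).
have p0 : 0 <= n%:R + 3 + eta by rewrite !addr_ge0// ltW.
have W u v : bracket u <= bracket v -> `|K u - K v| <= M * enorm (u - v) `^ beta.
  move=> uv; apply: le_trans (hK _ _ uv) _; rewrite ler_wpM2r ?powR_ge0//.
  by rewrite ler_piMr// weight_le1.
move=> u v; have [uv|/ltW vu] := leP (bracket u) (bracket v); first exact: W.
by rewrite -normrN opprB -(enormN (u - v)) opprB W.
Qed.

Lemma tame_measurable n (K : 'rV[R]_n -> R) M eta beta : tame_kernel K M eta beta ->
  measurable_fun setT K.
Proof. by move=> /tame_continuous; exact: continuous_measurable_rV. Qed.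

Lemma tame_integrable n (K : 'rV[R]_n -> R) M eta beta : tame_kernel K M eta beta ->
  (lebesgue_rV R n).-integrable setT (EFin \o K).
Proof.
move=> tK; have [_ eta0 _ dK _] := tK.
by apply: dominated_integrable (tame_measurable tK) dK; lra.
Qed.

(** On the bounded support the weights are bounded below. *)
Lemma compact_kernel_tame n (K : 'rV[R]_n -> R) alpha : 0 < alpha <= 1 ->
  compactly_supported_holder_kernel alpha K ->
  exists r M, [/\ 1 <= r, forall u, r < enorm u -> K u = 0 &
                  tame_kernel K M 1 alpha].
Proof.
move=> a01 [cK [L hL]]; have /andP[a0 a1] := a01.
have [b [b_r hb]] := compact_bounded cK.
pose r := Num.max 1 (Num.sqrt n%:R * (`|b| + 1)).
have r1 : 1 <= r by rewrite le_max lexx.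
have supp u : r < enorm u -> K u = 0.
  move=> ru; apply/eqP/negP => /negP Ku; move: ru; rewrite ltNge => /negP; apply.
  rewrite le_max; apply/orP; right; apply: le_trans (enorm_sup u) _.
  rewrite ler_wpM2l ?sqrtr_ge0//; apply: hb; last exact: subset_closure.
  by rewrite (le_lt_trans (ler_norm b))// ltrDl.
have bound u : K u = 0 \/ bracket u <= r.
  have [ur|/supp] := leP (enorm u) r; [right|by left].
  by rewrite ge_max r1.
pose p := n%:R + 3 + 1 : R.
have p0 : 0 <= p by rewrite !addr_ge0.
have n2p : n%:R + 2 + 1 <= p by rewrite /p; lra.
have rp0 : 0 < r `^ p by rewrite powR_gt0// (lt_le_trans _ r1).
have wr q u : 0 <= q -> q <= p -> bracket u <= r -> 1 <= r `^ p * weight q u.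
  move=> q0 qp ur; apply: le_trans (ler_wpM2l (ltW rp0) (le_weight u qp)).
  rewrite /weight powRN ler_pdivlMr ?powR_gt0 ?bracket_gt0// mul1r.
  by apply: ler_powR_base => //; exact/ltW/bracket_gt0.
have Kbound u : `|K u| <= `|K 0| + `|L| * r `^ alpha.
  have [->|ur] := bound u.
    by rewrite normr0 addr_ge0// mulr_ge0// powR_ge0.
  rewrite -[K u](subrK (K 0)) (le_trans (ler_normD _ _))// addrC lerD2l.
  apply: le_trans (hL u 0) _; apply: (@le_trans _ _ (`|L| * enorm (u - 0) `^ alpha)).
    by rewrite ler_wpM2r ?powR_ge0// ler_norm.
  rewrite ler_wpM2l// subr0; apply: ler_powR_base; rewrite ?enorm_ge0 ?(ltW a0)//.
  exact: le_trans (enorm_le_bracket u) ur.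
have B0 : 0 <= `|K 0| + `|L| * r `^ alpha by rewrite addr_ge0// mulr_ge0// powR_ge0.
have absorb (b' x t : R) : 0 <= b' -> 0 <= x -> 1 <= t -> x <= (x + b') * t.
  by move=> h1 h2 h3; rewrite -[leLHS]mulr1 ler_pM//; lra.
exists r, ((`|K 0| + `|L| * r `^ alpha + `|L|) * r `^ p); split=> //.
have M0 : 0 <= (`|K 0| + `|L| * r `^ alpha + `|L|) * r `^ p.
  by apply: mulr_ge0; [rewrite addr_ge0|exact: ltW].
split=> // [u|u v uv].
  have [->|ur] := bound u; first by rewrite normr0 mulr_ge0// weight_ge0.
  rewrite -mulrA; apply: le_trans (Kbound u) _; apply: absorb => //.
  by apply: wr => //; rewrite !addr_ge0.
have [ur|ru] := leP (bracket u) r.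
  apply: le_trans (hL u v) _; rewrite ler_wpM2r ?powR_ge0// -mulrA.
  apply: le_trans (ler_norm L) _; rewrite [X in X * _]addrC; apply: absorb => //.
  exact: wr.
have out w : r < bracket w -> K w = 0.
  by rewrite lt_max ltNge r1 /= => /supp.
rewrite (out _ ru) (out _ (lt_le_trans ru uv)) subrr normr0.
by rewrite mulr_ge0 ?powR_ge0// mulr_ge0// weight_ge0.
Qed.

(** The singular bounds are used outside the unit ball, the global Lipschitz
    bound inside. *)
Lemma decaying_kernel_tame n (K : 'rV[R]_n -> R) : decaying_lipschitz_kernel K ->
  exists M eta, tame_kernel K M eta 1.
Proof.
move=> [[L hL] [C [e [dl [[C0 e0 dl0] dK hK _]]]]].
pose eta := Num.min e dl.
have [ee ed] : eta <= e /\ eta <= dl by rewrite /eta !ge_min !lexx orbT.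
have L1 u v : `|K u - K v| <= `|L| * enorm (u - v).
  apply: le_trans (hL u v) _; rewrite powRr1 ?enorm_ge0//.
  by rewrite ler_wpM2r ?enorm_ge0// ler_norm.
have small (u : 'rV[R]_n) p : enorm u <= 1 -> weight p u = 1.
  by move=> u1; rewrite /weight /bracket max_l// powR1.
have large (u : 'rV[R]_n) : 1 < enorm u -> bracket u = enorm u /\ u != 0.
  move=> u1; split; first by rewrite /bracket max_r// ltW.
  by rewrite -enorm_eq0 gt_eqF// (lt_trans _ u1).
exists (`|K 0| + `|L| + C), eta; split.
- by rewrite !addr_ge0// ltW.
- by rewrite lt_min e0.
- by rewrite ltr01 lexx.
- move=> u; have [u1|u1] := leP (enorm u) 1.
    rewrite small// mulr1 -[K u](subrK (K 0)) (le_trans (ler_normD _ _))//.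
    have := L1 u 0; rewrite subr0; have := ler_wpM2l (normr_ge0 L) u1.
    by move: C0; lra.
  have [bu u0] := large u u1; apply: le_trans (dK u u0) _.
  rewrite -bu; apply: (@le_trans _ _ (C * weight (n%:R + 2 + eta) u)).
    by rewrite ler_wpM2l ?(ltW C0)//; apply: le_weight; lra.
  by rewrite ler_wpM2r ?weight_ge0// lerDr addr_ge0.
move=> u v uv; rewrite powRr1 ?enorm_ge0//.
have [u1|u1] := leP (enorm u) 1.
  rewrite small// mulr1; apply: le_trans (L1 u v) _.
  by rewrite ler_wpM2r ?enorm_ge0//; have := normr_ge0 (K 0); move: C0; lra.
have [bu u0] := large u u1.
have v1 : enorm u <= enorm v.
  by move: uv; rewrite bu /bracket le_max leNgt u1.
have [bv v0] := large v (lt_le_trans u1 v1).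
apply: le_trans (hK u v u0 v0) _; rewrite min_l// ler_wpM2r ?enorm_ge0// -bu.
apply: (@le_trans _ _ (C * weight (n%:R + 3 + eta) u)).
  by rewrite ler_wpM2l ?(ltW C0)//; apply: le_weight; lra.
by rewrite ler_wpM2r ?weight_ge0// lerDr addr_ge0.
Qed.

End weights.

(** * Integrals over thin regions along a hyperplane *)

Section real_integrals.
Context {R : realType} (n : nat).
Implicit Types f g : 'rV[R]_n -> R.

Definition rint f : R := \int[lebesgue_rV R n]_y f y.

Definition rintegrable f : Prop := (lebesgue_rV R n).-integrable setT (EFin \o f).

Lemma eq_rint f g : f =1 g -> rint f = rint g.
Proof. by move=> fg; congr (rint _); exact/funext. Qed.

Lemma rintegrable_measurable f : rintegrable f -> measurable_fun setT f.
Proof. by move=> /integrableP[/measurable_EFinP]. Qed.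

Lemma rintegrable_le f g : measurable_fun setT f -> (forall y, `|f y| <= `|g y|) ->
  rintegrable g -> rintegrable f.
Proof.
move=> mf fg; apply: le_integrable => //; first exact/measurable_EFinP.
by move=> y _; rewrite lee_fin fg.
Qed.

Lemma rintegrable_norm f : rintegrable f -> rintegrable (fun y => `|f y|).
Proof.
move=> fi; apply: (rintegrable_le _ _ fi) => [|y]; last by rewrite normr_id.
by apply: measurableT_comp => //; exact: rintegrable_measurable.
Qed.

Lemma rintegrableD f g : rintegrable f -> rintegrable g ->
  rintegrable (fun y => f y + g y).
Proof. by move=> fi gi; exact: (integrableD measurableT fi gi). Qed.

Lemma rintegrableB f g : rintegrable f -> rintegrable g ->
  rintegrable (fun y => f y - g y).
Proof. by move=> fi gi; exact: (integrableB measurableT fi gi). Qed.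

Lemma rintegrableZ c f : rintegrable f -> rintegrable (fun y => c * f y).
Proof. by move=> fi; exact: (integrableZl measurableT c fi). Qed.

Lemma rintD f g : rintegrable f -> rintegrable g ->
  rint (fun y => f y + g y) = rint f + rint g.
Proof. by move=> fi gi; exact: RintegralD. Qed.

Lemma rintB f g : rintegrable f -> rintegrable g ->
  rint (fun y => f y - g y) = rint f - rint g.
Proof. by move=> fi gi; exact: RintegralB. Qed.

Lemma rintZ c f : rintegrable f -> rint (fun y => c * f y) = c * rint f.
Proof. by move=> fi; exact: RintegralZl. Qed.

Lemma rint_ge0 f : (forall y, 0 <= f y) -> 0 <= rint f.
Proof. by move=> f0; apply: Rintegral_ge0. Qed.

Lemma le_rint f g : rintegrable f -> rintegrable g -> (forall y, f y <= g y) ->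
  rint f <= rint g.
Proof. by move=> fi gi fg; apply: le_Rintegral. Qed.

Lemma rint_norm_le f g : rintegrable f -> rintegrable g ->
  (forall y, `|f y| <= g y) -> `|rint f| <= rint g.
Proof.
move=> fi gi fg; apply: le_trans (le_normr_Rintegral measurableT fi) _.
by apply: le_rint => //; exact: rintegrable_norm.
Qed.

Lemma EFin_rint f : rintegrable f -> (rint f)%:E = (\int[lebesgue_rV R n]_y (f y)%:E)%E.
Proof. by move=> fi; rewrite /rint /Rintegral fineK//; exact: integrable_fin_num. Qed.

Lemma rintegrable_indic f (A : set 'rV[R]_n) : measurable A -> rintegrable f ->
  rintegrable (fun y => f y * \1_A y).
Proof.
move=> mA fi; apply: (rintegrable_le _ _ fi) => [|y].
  by apply: measurable_funM; [exact: rintegrable_measurable|exact: measurable_indic].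
by rewrite normrM ler_piMr// indicE; case: (_ \in _); rewrite ?normr1 ?normr0.
Qed.

Lemma measurable_lt_set f g : measurable_fun setT f -> measurable_fun setT g ->
  measurable [set y | f y < g y].
Proof.
move=> mf mg; have := measurable_fun_ltr mf mg => /(_ measurableT [set true]).
by rewrite setTI; apply.
Qed.

Lemma measurable_le_set f g : measurable_fun setT f -> measurable_fun setT g ->
  measurable [set y | f y <= g y].
Proof.
move=> mf mg; have := measurable_fun_ler mf mg => /(_ measurableT [set true]).
by rewrite setTI; apply.
Qed.

End real_integrals.

Section hyperplane.
Context {R : realType} (k : nat) (nu : 'rV[R]_k.+1) (J : 'M[R]_(k, k.+1)).
Hypothesis OO : col_mx nu J *m (col_mx nu J)^T = 1%:M.

Lemma frame_relations : [/\ dotv nu nu = 1, nu *m J^T = 0, J *m nu^T = 0 & J *m J^T = 1%:M].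
Proof.
have := OO; rewrite tr_col_mx mul_col_row (@scalar_mx_block _ 1 k).
move=> /eq_block_mx[h1 h2 h3 h4]; split=> //.
by rewrite dotvE h1 mxE.
Qed.

Lemma consrV_frame (p : measurableTypeR R * 'rV[R]_k) :
  consrV p *m col_mx nu J = (p.1 : R) *: nu + p.2 *m J.
Proof.
have -> : consrV p = row_mx (const_mx (p.1 : R)) p.2 :> 'rV[R]_(1 + k).
  apply/rowP => i; case: (@split_ordP 1 k i) => j ->.
    rewrite row_mxEl !mxE (_ : lshift k j = 0) ?unlift_none//.
    by apply/val_inj; rewrite /= (ord1 j).
  rewrite row_mxEr !mxE (_ : rshift 1 j = lift 0 j) ?liftK//.
  exact/val_inj.
have E := @mul_row_col R 1 1 k k.+1 (const_mx (p.1 : R)) p.2 nu J.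
apply: (etrans E); congr (_ + _).
by apply/rowP => i; rewrite !mxE big_ord1 mxE.
Qed.

Lemma frame_coords s (y : 'rV[R]_k) :
  dotv (s *: nu + y *m J) nu = s /\ (s *: nu + y *m J) *m J^T = y.
Proof.
have [nn nJ Jn JJ] := frame_relations; split.
  rewrite dotvDl dotvZl nn mulr1 dotvE -mulmxA Jn mulmx0 mxE addr0//.
by rewrite mulmxDl -scalemxAl nJ scaler0 add0r -mulmxA JJ mulmx1.
Qed.

Lemma frame_split (u : 'rV[R]_k.+1) : u = dotv u nu *: nu + u *m J^T *m J.
Proof.
have := mulmx1C OO; rewrite tr_col_mx mul_row_col => /(congr1 (mulmx u)).
rewrite mulmx1 mulmxDr !mulmxA => {1}<-; congr (_ + _).
by rewrite dotvE; apply/rowP => i; rewrite [in RHS]mxE [in LHS]mxE big_ord1.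
Qed.

Lemma ge0_integral_frame (f : 'rV[R]_k.+1 -> \bar R) :
  measurable_fun setT f -> (forall x, 0 <= f x)%E ->
  (\int[lebesgue_rV R k.+1]_x f x =
   \int[lebesgue_rV R k]_y \int[@lebesgue_measure R]_t f ((t : R) *: nu + y *m J)%R)%E.
Proof.
move=> mf f0.
have OO' : col_mx nu J *m (col_mx nu J)^T = 1%:M :> 'M[R]_(k.+1) := OO.
rewrite -(ge0_integral_isometry OO' mf f0) ge0_integral_rVS_swap//; last first.
  by apply: (measurableT_comp mf); exact: measurable_mulmx.
by apply: eq_integral => y _; apply: eq_integral => t _; rewrite consrV_frame.
Qed.

Definition slab (a b : 'rV[R]_k -> R) : set 'rV[R]_k.+1 :=
  [set u | a (u *m J^T) <= dotv u nu] `&` [set u | dotv u nu < b (u *m J^T)].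

Definition below (b : 'rV[R]_k -> R) : set 'rV[R]_k.+1 :=
  [set u | dotv u nu < b (u *m J^T)].

Lemma indic_slab a b s y :
  \1_(slab a b) (s *: nu + y *m J) = \1_(`[a y, b y[%classic) s :> R.
Proof.
have [dt yt] := frame_coords s y.
rewrite !indicE; congr (nat_of_bool _)%:R; apply/idP/idP => /set_mem.
  by rewrite /slab /= dt yt => -[h1 h2]; apply/mem_set; rewrite /= in_itv /= h1.
rewrite /= in_itv /= => /andP[h1 h2]; apply/mem_set.
by rewrite /slab /= dt yt.
Qed.

Lemma measurable_comp_proj (p : 'rV[R]_k -> R) : measurable_fun setT p ->
  measurable_fun setT (fun u : 'rV[R]_k.+1 => p (u *m J^T)).
Proof. by move=> mp; apply: (measurableT_comp mp); exact: measurable_mulmx. Qed.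

Lemma measurable_below b : measurable_fun setT b -> measurable (below b).
Proof.
move=> mb; apply: measurable_lt_set; last exact: measurable_comp_proj.
exact: measurable_dotv.
Qed.

Lemma measurable_slab a b : measurable_fun setT a -> measurable_fun setT b ->
  measurable (slab a b).
Proof.
move=> ma mb; apply: measurableI; last exact: measurable_below.
apply: measurable_le_set; first exact: measurable_comp_proj.
exact: measurable_dotv.
Qed.

(** Fubini's theorem: the line through y J in the direction of nu meets the slab
    in the interval from a y to b y. *)
Lemma slab_integral_ge0 (p a b : 'rV[R]_k -> R) :
  measurable_fun setT p -> measurable_fun setT a -> measurable_fun setT b ->
  (forall y, 0 <= p y) ->
  (\int[lebesgue_rV R k.+1]_u (p (u *m J^T) * \1_(slab a b) u)%:E =
   \int[lebesgue_rV R k]_y (p y * Num.max 0 (b y - a y))%:E)%E.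
Proof.
move=> mp ma mb p0; rewrite ge0_integral_frame; last 2 first.
- apply/measurable_EFinP; apply: measurable_funM; first exact: measurable_comp_proj.
  by apply: measurable_indic; exact: measurable_slab.
- by move=> u; rewrite lee_fin mulr_ge0.
apply: eq_integral => y _.
under eq_integral => t _.
  have [_ yt] := frame_coords t y.
  have -> : p ((t *: nu + y *m J) *m J^T) * \1_(slab a b) (t *: nu + y *m J) =
      p y * \1_(`[a y, b y[%classic) t.
    by rewrite yt; congr (_ * _); exact: indic_slab.
  rewrite EFinM; over.
rewrite ge0_integralZl//; last 2 first.
- by apply/measurable_EFinP; apply: measurable_indic; exact: measurable_itv.
- by rewrite lee_fin.
have mI : measurable (`[a y, b y[%classic : set (measurableTypeR R)) by exact: measurable_itv.
rewrite integral_indic// setIT.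
rewrite [X in (_ * X)%E]lebesgue_measure_itv /= lte_fin.
have [ab|ba] := ltP (a y) (b y); first by rewrite -EFinM max_r// subr_ge0 ltW.
by rewrite max_l ?mulr0 ?mule0// subr_le0.
Qed.

Lemma slab_rint (p a b : 'rV[R]_k -> R) :
  measurable_fun setT p -> measurable_fun setT a -> measurable_fun setT b ->
  rintegrable (fun y => p y * Num.max 0 (b y - a y)) ->
  rintegrable (fun u : 'rV[R]_k.+1 => p (u *m J^T) * \1_(slab a b) u) /\
  rint (fun u : 'rV[R]_k.+1 => p (u *m J^T) * \1_(slab a b) u) =
    rint (fun y => p y * Num.max 0 (b y - a y)).
Proof.
move=> mp ma mb ip.
have mx0 y : 0 <= Num.max 0 (b y - a y) by rewrite le_max lexx.
have mpos (q : 'rV[R]_k -> R) : measurable_fun setT q -> measurable_fun setT (fun y : 'rV[R]_k => Num.max 0 (q y)).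
  by move=> mq; apply: measurable_maxr.
have key c (q : 'rV[R]_k -> R) : (forall y, q y = Num.max 0 (c * p y)) -> `|c| <= 1 ->
    (\int[lebesgue_rV R k.+1]_u (q (u *m J^T) * \1_(slab a b) u)%:E =
    (rint (fun y => q y * Num.max 0 (b y - a y)))%:E)%E /\
    rintegrable (fun y => q y * Num.max 0 (b y - a y)).
  move=> qE c1; have mq : measurable_fun setT q.
    rewrite (_ : q = fun y => Num.max 0 (c * p y)); last exact/funext.
    by apply: mpos; exact: measurable_funM.
  have q0 y : 0 <= q y by rewrite qE le_max lexx.
  have iq : rintegrable (fun y => q y * Num.max 0 (b y - a y)).
    apply: (rintegrable_le _ _ ip) => [|y].
      by apply: measurable_funM => //; apply: mpos; exact: measurable_funB.
    rewrite !normrM ler_wpM2r// ger0_norm// qE ge_max normr_ge0/=.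
    by rewrite (le_trans (ler_norm _))// normrM ler_piMl.
  by split=> //; rewrite slab_integral_ge0// EFin_rint.
have mf : measurable_fun setT (fun u : 'rV[R]_k.+1 => p (u *m J^T) * \1_(slab a b) u).
  apply: measurable_funM; first exact: measurable_comp_proj.
  by apply: measurable_indic; exact: measurable_slab.
have n1 : `|1 : R| <= 1 by rewrite normr1.
have n2 : `|-1 : R| <= 1 by rewrite normrN normr1.
have [k1 i1] := key 1 (fun y => Num.max 0 (1 * p y)) (fun=> erefl) n1.
have [k2 i2] := key (-1) (fun y => Num.max 0 (-1 * p y)) (fun=> erefl) n2.
have pE (x : R) : x = Num.max 0 (1 * x) - Num.max 0 (-1 * x).
  rewrite mul1r mulN1r; have [x0|x0] := leP 0 x.
    by rewrite max_l ?subr0// oppr_le0.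
  by rewrite max_r ?oppr_ge0 ?(ltW x0)// sub0r opprK.
have ind u : 0 <= \1_(slab a b) u :> R by [].
have int1 (c : R) (kc : (\int[lebesgue_rV R k.+1]_u
      (Num.max 0 (c * p (u *m J^T)) * \1_(slab a b) u)%:E =
      (rint (fun y => Num.max 0 (c * p y) * Num.max 0 (b y - a y)))%:E)%E) :
    rintegrable (fun u : 'rV[R]_k.+1 => Num.max 0 (c * p (u *m J^T)) * \1_(slab a b) u) /\
    rint (fun u : 'rV[R]_k.+1 => Num.max 0 (c * p (u *m J^T)) * \1_(slab a b) u) =
      rint (fun y => Num.max 0 (c * p y) * Num.max 0 (b y - a y)).
  split; last by rewrite [LHS]/rint /Rintegral kc.
  apply/integrableP; split.
    apply/measurable_EFinP; apply: measurable_funM.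
      apply: measurable_maxr => //; apply: measurable_funM => //.
      exact: measurable_comp_proj.
    by apply: measurable_indic; exact: measurable_slab.
  under eq_integral => u _.
    rewrite /= ger0_norm; last by rewrite mulr_ge0// le_max lexx.
    over.
  by rewrite kc ltry.
have [j1 e1] := int1 _ k1; have [j2 e2] := int1 _ k2.
have fE : (fun u : 'rV[R]_k.+1 => p (u *m J^T) * \1_(slab a b) u) =
    fun u => Num.max 0 (1 * p (u *m J^T)) * \1_(slab a b) u -
             Num.max 0 (-1 * p (u *m J^T)) * \1_(slab a b) u.
  by apply/funext => u; rewrite -mulrBl -pE.
rewrite fE; split; first exact: rintegrableB.
rewrite rintB// e1 e2 -rintB//; apply: eq_rint => y.
by rewrite -mulrBl -pE.
Qed.

(** Up to the variation e of G across the region between the graph of tau and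
    the hyperplane, its integral over that region is the one of tau * G over the
    hyperplane. *)
Lemma below_expansion (G : 'rV[R]_k.+1 -> R) (tau e : 'rV[R]_k -> R) :
  measurable_fun setT tau -> measurable_fun setT e ->
  rintegrable G -> measurable_fun setT (fun y => G (y *m J)) ->
  rintegrable (fun y => tau y * G (y *m J)) -> rintegrable (fun y => tau y * e y) ->
  (forall s y, `|s| <= `|tau y| -> `|G (s *: nu + y *m J) - G (y *m J)| <= e y) ->
  `|rint (fun u => G u * \1_(below tau) u) - rint (fun u => G u * \1_(below (fun=> 0)) u)
    - rint (fun y => tau y * G (y *m J))| <= rint (fun y => `|tau y| * e y).
Proof.
move=> mt me iG mG0 itG ite hG.
have m0 : measurable_fun setT (fun _ : 'rV[R]_k => 0 : R) by exact: measurable_cst.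
pose g0 y := G (y *m J).
pose z : 'rV[R]_k -> R := fun=> 0.
pose pp y := Num.max 0 (tau y - z y); pose pn y := Num.max 0 (z y - tau y).
have ppn y : tau y = pp y - pn y.
  rewrite /pp /pn /z subr0 sub0r; have [x0|x0] := leP 0 (tau y).
    by rewrite max_l ?subr0// oppr_le0.
  by rewrite max_r ?oppr_ge0 ?(ltW x0)// sub0r opprK.
have ppn' y : `|tau y| = pp y + pn y.
  rewrite /pp /pn /z subr0 sub0r; have [x0|x0] := leP 0 (tau y).
    by rewrite max_l ?addr0 ?ger0_norm// oppr_le0.
  by rewrite max_r ?oppr_ge0 ?(ltW x0)// add0r ltr0_norm.
have pp0 y : 0 <= pp y by rewrite le_max lexx.
have pn0 y : 0 <= pn y by rewrite le_max lexx.
have mpp : measurable_fun setT pp.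
  by apply: measurable_maxr => //; exact: measurable_funB.
have mpn : measurable_fun setT pn.
  by apply: measurable_maxr => //; exact: measurable_funB.
have part (q r : 'rV[R]_k -> R) : measurable_fun setT q -> measurable_fun setT r ->
    (forall y, 0 <= r y <= `|tau y|) -> rintegrable (fun y => tau y * q y) ->
    rintegrable (fun y => q y * r y).
  move=> mq mr rt iq; apply: (rintegrable_le _ _ iq) => [|y].
    exact: measurable_funM.
  rewrite !normrM mulrC; have /andP[r0 rty] := rt y.
  by rewrite ler_wpM2r// ger0_norm.
have tp y : 0 <= pp y <= `|tau y| by rewrite pp0 ppn' lerDl pn0.
have tn y : 0 <= pn y <= `|tau y| by rewrite pn0 ppn' lerDr pp0.
have [ip ep] := slab_rint mG0 m0 mt (part _ _ mG0 mpp tp itG).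
have [im em] := slab_rint mG0 mt m0 (part _ _ mG0 mpn tn itG).
have [jp fp] := slab_rint me m0 mt (part _ _ me mpp tp ite).
have [jm fm] := slab_rint me mt m0 (part _ _ me mpn tn ite).
have mbt := measurable_below mt; have mb0 := measurable_below m0.
have iA := rintegrable_indic mbt iG; have iB := rintegrable_indic mb0 iG.
have -> : rint (fun y => tau y * G (y *m J)) =
    rint (fun u : 'rV[R]_k.+1 => g0 (u *m J^T) * \1_(slab z tau) u) -
    rint (fun u : 'rV[R]_k.+1 => g0 (u *m J^T) * \1_(slab tau z) u).
  rewrite ep em -rintB.
  - by apply: eq_rint => y; rewrite -mulrBr mulrC; congr (_ * _); exact: ppn.
  - exact: (part _ _ mG0 mpp tp itG).
  - exact: (part _ _ mG0 mpn tn itG).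
have -> : rint (fun y => `|tau y| * e y) =
    rint (fun u : 'rV[R]_k.+1 => e (u *m J^T) * \1_(slab z tau) u) +
    rint (fun u : 'rV[R]_k.+1 => e (u *m J^T) * \1_(slab tau z) u).
  rewrite fp fm -rintD.
  - by apply: eq_rint => y; rewrite -mulrDr mulrC; congr (_ * _); exact: ppn'.
  - exact: (part _ _ me mpp tp ite).
  - exact: (part _ _ me mpn tn ite).
rewrite -(rintB iA iB) -(rintB ip im) -(rintD jp jm).
rewrite -rintB; [|exact: rintegrableB|exact: rintegrableB].
apply: rint_norm_le.
- by apply: rintegrableB; exact: rintegrableB.
- exact: rintegrableD.
move=> u; set s := dotv u nu; set y := u *m J^T.
have uE : u = s *: nu + y *m J := frame_split u.
have := hG s y; rewrite -uE.
have indE (P : bool) (A : set 'rV[R]_k.+1) : (A u <-> P) -> \1_A u = P%:R :> R.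
  by move=> AP; rewrite indicE; congr (nat_of_bool _)%:R; apply/idP/idP => [/set_mem/AP|/AP/mem_set].
rewrite (indE (s < tau y) (below tau))// (indE (s < 0) (below _))//.
have slabE (a b : 'rV[R]_k -> R) : \1_(slab a b) u = (a y <= s < b y)%R%:R :> R.
  by apply: indE; split=> [[h1 h2]|/andP[h1 h2]]; [apply/andP; split|split].
rewrite !slabE /z /g0 => H.
have [st|ts] := ltP s (tau y); have [s0|s0] := ltP s 0; rewrite ?(mulr1,mulr0,subr0,addr0,sub0r,subrr,add0r)/=.
- by rewrite oppr0 normr0.
- apply: H; rewrite (ger0_norm s0) ger0_norm; first exact: ltW.
  exact: le_trans s0 (ltW st).
- rewrite -opprD normrN; apply: H; rewrite (ltr0_norm s0) ler0_norm ?lerN2//.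
  exact: le_trans ts (ltW s0).
- by rewrite oppr0 normr0.
Qed.

End hyperplane.

(** * Second derivatives of the surface tension *)

Section surface_tension.
Context {R : realType}.

Lemma derive_bound n (f : 'rV[R]_n -> R) p v (l C r a : R) : 0 < a -> 0 < r ->
  (forall t, `|t| < r -> `|f (p + t *: v) - f p - t * l| <= C * `|t| `^ (1 + a)) ->
  'D_v f p = l.
Proof.
move=> a0 r0 fl; apply: cvg_lim => //; apply/cvgrPdist_lt => e e0.
pose c := `|C| + 1; have c0 : 0 < c by rewrite ltr_pwDr.
pose d := Num.min r ((e / c) `^ a^-1).
have d0 : 0 < d by rewrite lt_min r0 powR_gt0// divr_gt0.
exists d => // t /=; rewrite sub0r normrN lt_min => /andP[tr te] t0.
have nt : 0 < `|t| by rewrite normr_gt0.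
have -> : l - t^-1 *: ((f \o shift p) (t *: v) - f p) =
    - (t^-1 * (f (p + t *: v) - f p - t * l)).
  rewrite /= (addrC (t *: v)) /GRing.scale /=.
  by move: (f _) (f _) => x y; field.
rewrite normrN normrM normfV ltr_pdivrMl//.
apply: le_lt_trans (fl _ tr) _.
rewrite -mulr_powR ?(ltW a0)// mulrCA ltr_pM2l//.
have h : `|t| `^ a <= e / c.
  apply: le_trans (ler_powR_base (ltW a0) (normr_ge0 t) (ltW te)) _.
  by rewrite -powRrM mulVf ?gt_eqF// powRr1// divr_ge0 ?ltW.
apply: (@le_lt_trans _ _ (`|C| * (e / c))).
  apply: (@le_trans _ _ (`|C| * `|t| `^ a)); first by rewrite ler_wpM2r ?powR_ge0// ler_norm.
  by rewrite ler_wpM2l.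
by rewrite mulrA ltr_pdivrMr// mulrC ltr_pM2l// /c ltrDl.
Qed.

Lemma exists_frame_of n (p : 'rV[R]_n.+1) : p != 0 ->
  exists (m : 'rV[R]_n.+1) (J : 'M[R]_(n, n.+1)),
    p = enorm p *: m /\ col_mx m J *m (col_mx m J)^T = 1%:M.
Proof.
move=> p0; have np : enorm p != 0 by rewrite enorm_eq0.
have m1 : enorm ((enorm p)^-1 *: p) = 1.
  by rewrite enormZ ger0_norm ?invr_ge0 ?enorm_ge0// mulVf.
have [J [_ _ OO]] := orthonormal_completion m1.
by exists ((enorm p)^-1 *: p), J; split; rewrite // scalerA mulfV// scale1r.
Qed.

Lemma bracket_isometry n m (J : 'M[R]_(n, m)) y : J *m J^T = 1%:M ->
  bracket (y *m J) = bracket y.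
Proof. by move=> JJ; rewrite /bracket (enorm_isometry _ JJ). Qed.

Lemma weight_isometry n m (J : 'M[R]_(n, m)) p y : J *m J^T = 1%:M ->
  weight p (y *m J) = weight p y.
Proof. by move=> JJ; rewrite /weight bracket_isometry. Qed.

Lemma enorm_plane_le n (m : 'rV[R]_n.+1) (J : 'M[R]_(n, n.+1)) s y :
  col_mx m J *m (col_mx m J)^T = 1%:M -> enorm y <= enorm (s *: m + y *m J).
Proof.
move=> OO; have [nn nJ Jn JJ] := frame_relations OO.
rewrite -(enorm_isometry y JJ) -ler_sqr ?nnegrE ?enorm_ge0// !sqr_enorm.
have ym : dotv (y *m J) m = 0 by rewrite dotvE -mulmxA Jn mulmx0 mxE.
rewrite dotvDl !dotvDr !dotvZl !dotvZr nn (dotvC m) ym.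
by have := sqr_ge0 s; rewrite expr2; lra.
Qed.

Lemma le_bracket_frame n (m : 'rV[R]_n.+1) (J : 'M[R]_(n, n.+1)) s y :
  col_mx m J *m (col_mx m J)^T = 1%:M -> bracket y <= bracket (s *: m + y *m J).
Proof. by move=> OO; apply: le_bracket; exact: enorm_plane_le. Qed.

Lemma enorm_frame_le n (m : 'rV[R]_n.+1) (J : 'M[R]_(n, n.+1)) s y :
  col_mx m J *m (col_mx m J)^T = 1%:M -> enorm (s *: m + y *m J) <= `|s| + enorm y.
Proof.
move=> OO; have [nn nJ Jn JJ] := frame_relations OO.
rewrite (le_trans (ler_enormD _ _))// (enorm_isometry y JJ) enormZ.
by rewrite /enorm nn sqrtr1 mulr1.
Qed.

Lemma rint_sum n m (f : 'I_m -> 'rV[R]_n -> R) : (forall i, rintegrable (f i)) ->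
  rintegrable (fun y => \sum_i f i y) /\
  rint (fun y => \sum_i f i y) = \sum_i rint (f i).
Proof.
elim: m f => [|m ih] f fi.
  rewrite (_ : (fun y => _) = fun=> 0); last by apply/funext => y; rewrite big_ord0.
  split; first exact: integrable0.
  by rewrite big_ord0 /rint /Rintegral integral0.
rewrite big_ord_recr (_ : (fun y => _) = fun y =>
    \sum_(i < m) f (widen_ord (leqnSn m) i) y + f ord_max y); last first.
  by apply/funext => y; rewrite big_ord_recr.
have [i1 e1] := ih _ (fun i => fi (widen_ord (leqnSn m) i)).
by split; [exact: rintegrableD|rewrite rintD// e1].
Qed.

Section hessian.
Variables (k : nat) (K : 'rV[R]_k.+1 -> R) (M eta beta : R).
Hypothesis tK : tame_kernel K M eta beta.
Let n : R := k.+1%:R.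

Let M0 : 0 <= M. Proof. by case: tK. Qed.
Let eta0 : 0 < eta. Proof. by case: tK. Qed.
Let beta0 : 0 < beta. Proof. by case: tK => _ _ /andP[]. Qed.
Let beta1 : beta <= 1. Proof. by case: tK => _ _ /andP[]. Qed.
Let dK u : `|K u| <= M * weight (n + 2 + eta) u. Proof. by case: tK. Qed.
Let mK : measurable_fun setT K. Proof. exact: tame_measurable tK. Qed.
Let kn : k%:R + 1 = n. Proof. by rewrite /n -natr1. Qed.

Let K_moment u : enorm u * `|K u| <= M * weight (n + 1 + eta) u.
Proof.
have h : enorm u * `|K u| <= bracket u * (M * weight (n + 2 + eta) u).
  by rewrite ler_pM ?enorm_ge0 ?enorm_le_bracket.
apply: le_trans h _.
rewrite mulrCA ler_wpM2l// mulrC -[X in _ * X]expr1 weight_bracket.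
by apply: le_weight; lra.
Qed.

Let first_moment (j : 'I_k.+1) (u : 'rV[R]_k.+1) : R := u 0 j * K u.

Let moment_le j u : `|first_moment j u| <= M * weight (n + 1 + eta) u.
Proof.
apply: le_trans (K_moment u); rewrite normrM ler_wpM2r//.
exact: coord_le_enorm.
Qed.

Let m_moment j : measurable_fun setT (first_moment j).
Proof. by apply: measurable_funM => //; exact: measurable_coord. Qed.

Let i_moment j : rintegrable (first_moment j).
Proof.
apply: (dominated_integrable _ (m_moment j) (moment_le j)).
by rewrite -/n; move: eta0; lra.
Qed.

Let neg_half (p : 'rV[R]_k.+1) : set 'rV[R]_k.+1 := [set u | dotv u p < 0].

Let m_neg p : measurable (neg_half p).
Proof.
apply: measurable_lt_set; first exact: measurable_dotv.
exact: measurable_cst.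
Qed.

(** The kink of |p . x| at p . x = 0 contributes at second order only, since the
    wedge |p . x| <= |t x_j| has width of order t. *)
Lemma derive_surface_tension p j : p != 0 ->
  'D_(delta_mx 0 j) (surface_tension K) p =
  2^-1 * rint (first_moment j) - rint (fun u => first_moment j u * \1_(neg_half p) u).
Proof.
move=> p0; have [m [J [pE OO]]] := exists_frame_of p0.
have np : 0 < enorm p by rewrite enorm_gt0.
set v : 'rV[R]_k.+1 := delta_mx 0 j.
pose c := 2 / enorm p; have c0 : 0 < c by rewrite divr_gt0.
have iabs q : rintegrable (fun u => `|dotv q u| * K u).
  apply: (@dominated_integrable _ _ _ (enorm q * M) (n + 1 + eta)).
  - by rewrite -/n; move: eta0; lra.
  - apply: measurable_funM => //; apply: measurableT_comp => //.
    rewrite (_ : dotv q = fun u : 'rV[R]_k.+1 => dotv u q); first exact: measurable_dotv.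
    by apply/funext => u; exact: dotvC.
  - move=> u; rewrite normrM normr_id.
    apply: (@le_trans _ _ (enorm q * (enorm u * `|K u|))).
      by rewrite mulrA ler_wpM2r// cauchy_schwarz.
    by rewrite -mulrA ler_wpM2l ?enorm_ge0.
apply: (@derive_bound _ _ _ _ _ (4 * c * M * weight_mass k (k%:R + 1 + eta)) (enorm p / 2) 1).
- exact: ltr01.
- by rewrite divr_gt0.
move=> t tp.
have [->|t0] := eqVneq t 0.
  rewrite scale0r addr0 subrr mul0r subr0 normr0 powR0 ?mulr0// gt_eqF//; lra.
have nt : 0 < `|t| by rewrite normr_gt0.
(* 2 c |t| max(1, |y|) is the half width of the wedge at the point y of the
   hyperplane. *)
have mW : measurable_fun setT (fun y : 'rV[R]_k => 2 * c * `|t| * bracket y).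
  by apply: measurable_funM => //; exact: measurable_bracket.
have mNW : measurable_fun setT (fun y : 'rV[R]_k => - (2 * c * `|t| * bracket y)).
  exact: measurableT_comp.
pose wt (y : 'rV[R]_k) := weight (k%:R + 2 + eta) y.
have wW : (fun y : 'rV[R]_k => wt y * Num.max 0 (2 * c * `|t| * bracket y -
     - (2 * c * `|t| * bracket y))) = fun y => 4 * c * `|t| * weight (k%:R + 1 + eta) y.
  apply/funext => y; have b0 := bracket_gt0 y.
  rewrite max_r; last first.
    have W0 : 0 <= 2 * c * `|t| * bracket y.
      exact: (mulr_ge0 (mulr_ge0 (mulr_ge0 (ler0n _ _) (ltW c0)) (normr_ge0 _)) (ltW b0)).
    by rewrite opprK addr_ge0.
  have := weight_bracket (k%:R + 2 + eta) 1 y; rewrite expr1.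
  rewrite (_ : k%:R + 2 + eta - 1 = k%:R + 1 + eta); last by ring.
  by move=> <-; rewrite /wt; ring.
have kk : k%:R < k%:R + 1 + eta by move: eta0; lra.
have iwt : rintegrable (fun y : 'rV[R]_k => wt y * Num.max 0 (2 * c * `|t| * bracket y -
     - (2 * c * `|t| * bracket y))).
  by rewrite wW; apply: rintegrableZ; exact: weight_integrable.
have [iS eS] := slab_rint OO (measurable_weight _) mNW mW iwt.
set S := slab m J _ _ in iS eS.
have -> : surface_tension K (p + t *: v) - surface_tension K p -
    t * (2^-1 * rint (first_moment j) - rint (fun u => first_moment j u * \1_(neg_half p) u)) =
    rint (fun u => 2^-1 * (`|dotv (p + t *: v) u| * K u) - 2^-1 * (`|dotv p u| * K u) -
      (t * (2^-1 * first_moment j u - first_moment j u * \1_(neg_half p) u))).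
  have i1 := rintegrableZ 2^-1 (iabs (p + t *: v)).
  have i2 := rintegrableZ 2^-1 (iabs p).
  have i3 := rintegrableZ 2^-1 (i_moment j).
  have i4 := rintegrable_indic (m_neg p) (i_moment j).
  rewrite rintB; [|exact: rintegrableB|exact/rintegrableZ/rintegrableB].
  rewrite rintB// !rintZ//; last exact: rintegrableB.
  by rewrite rintB// rintZ.
rewrite (_ : _ * `|t| `^ (1 + 1) = `|t| * M * rint (fun u : 'rV[R]_k.+1 =>
    wt (u *m J^T) * \1_S u)); last first.
  rewrite eS wW rintZ; last exact: weight_integrable.
  rewrite -/(weight_mass k (k%:R + 1 + eta)).
  rewrite (_ : `|t| `^ (1 + 1) = `|t| * `|t|); first by rewrite /weight_mass /rint; ring.
  by rewrite -mulr_powR// powRr1.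
rewrite -rintZ//; apply: rint_norm_le; last 1 first.
- move=> u; rewrite /first_moment.
  have dv : dotv (p + t *: v) u = dotv p u + t * u 0 j.
    by rewrite dotvDl dotvZl dotvC (dotvC v) dotv_delta (dotvC u).
  rewrite dv; set a := dotv p u; set x := u 0 j.
  have indE (P : bool) (A : set 'rV[R]_k.+1) : (A u <-> P) -> \1_A u = P%:R :> R.
    by move=> AP; rewrite indicE; congr (nat_of_bool _)%:R; apply/idP/idP => [/set_mem/AP|/AP/mem_set].
  rewrite (indE (a < 0) (neg_half p)); last by rewrite /neg_half /= dotvC.
  rewrite (_ : _ - _ = 2^-1 * ((`|a + t * x| - `|a| - t * x * (1 - 2 * (a < 0)%R%:R)) * K u)); last first.
    by field.
  have pw : `| `|a + t * x| - `|a| - t * x * (1 - 2 * (a < 0)%R%:R)| <=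
      2 * `|t * x| * (`|a| <= `|t * x|)%R%:R.
    move: (t * x) => b; have [ab|ba] := leP `|a| `|b|; rewrite /= ?mulr1 ?mulr0.
      have h1 := ler_normD a b; have h2 := ler_normB (a + b) b; rewrite addrK in h2.
      have h3 := ler_norm b; have h4 := ler_norm (- b); rewrite normrN in h4.
      rewrite ler_norml; case: (a < 0); rewrite ?mulr1 ?mulr0 ?subr0; apply/andP; split; lra.
    rewrite normr_le0; move: ba; rewrite ltr_norml => /andP[h1 h2].
    have [a0|a0] := ltP a 0.
      rewrite (ltr0_norm a0) in h1 h2 *; rewrite ler0_norm; last lra.
      by apply/eqP; rewrite mulr1; ring.
    rewrite (ger0_norm a0) in h1 h2 *; rewrite ger0_norm; last lra.
    by apply/eqP; rewrite mulr0; ring.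
  rewrite normrM gtr0_norm ?invr_gt0// normrM.
  have tx : `|t * x| <= `|t| * enorm u by rewrite normrM ler_wpM2l// coord_le_enorm.
  move: pw; have [ax|xa] := leP `|a| `|t * x|; rewrite /= ?mulr1 ?mulr0 => pw; last first.
    move: pw; rewrite normr_le0 => /eqP ->.
    by rewrite normr0 mul0r mulr0 !mulr_ge0 ?weight_ge0.
  have uE := frame_split OO u; set s := dotv u m in uE; set y := u *m J^T in uE *.
  have as_ : `|a| = enorm p * `|s|.
    by rewrite /a dotvC [in LHS]pE dotvZr normrM (ger0_norm (enorm_ge0 p)).
  have us : enorm u <= `|s| + enorm y by rewrite [in leLHS]uE (enorm_frame_le _ _ OO).
  have sW : `|s| < 2 * c * `|t| * bracket y.
    have h1 : enorm p * `|s| <= `|t| * (`|s| + enorm y).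
      by rewrite -as_ (le_trans ax)// (le_trans tx)// ler_wpM2l.
    have h2 : `|t| * `|s| <= enorm p / 2 * `|s| by rewrite ler_wpM2r// ltW.
    have yb := enorm_le_bracket y; have b0 := bracket_gt0 y.
    have h3 : `|t| * enorm y <= `|t| * bracket y by rewrite ler_wpM2l.
    have h4 : 0 < `|t| * bracket y by rewrite mulr_gt0.
    rewrite /c; have -> : 2 * (2 / enorm p) * `|t| * bracket y = (4 * (`|t| * bracket y)) / enorm p.
      by field; rewrite gt_eqF.
    by rewrite ltr_pdivlMr// mulrC; lra.
  rewrite (indE true S); last first.
    split=> // _; rewrite /S /slab /= -/y -/s.
    by move: sW; rewrite ltr_norml => /andP[/ltW h1 h2]; split.
  rewrite /= mulr1; apply: (@le_trans _ _ (`|t| * (enorm u * `|K u|))).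
    have := ler_wpM2r (normr_ge0 (K u)) (le_trans pw (ler_wpM2l (ler0n _ 2) tx)).
    by move: (`| _ |) => z; lra.
  rewrite -mulrA ler_wpM2l//; apply: le_trans (K_moment u) _.
  rewrite ler_wpM2l// /wt (_ : n + 1 + eta = k%:R + 2 + eta); last by rewrite -kn; ring.
  apply: weight_mono; first by rewrite !addr_ge0// ltW.
  by rewrite [in leRHS]uE (le_bracket_frame _ _ OO).
- have i4 := rintegrable_indic (m_neg p) (i_moment j).
  by apply: rintegrableB; [apply: rintegrableB|];
    [exact: rintegrableZ|exact: rintegrableZ|apply: rintegrableZ; apply: rintegrableB => //; exact: rintegrableZ].
- exact: rintegrableZ.
Qed.

Let K_plane J (y : 'rV[R]_k) : J *m J^T = 1%:M ->
  enorm y * (enorm y * `|K (y *m J)|) <= M * weight (k%:R + 1 + eta) y.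
Proof.
move=> JJ; have := dK (y *m J).
rewrite (weight_isometry _ _ JJ) => h.
have b0 := bracket_gt0 y; have yb := enorm_le_bracket y.
rewrite mulrA (le_trans (ler_pM _ _ (ler_pM _ _ yb yb) h)) ?mulr_ge0 ?enorm_ge0//.
rewrite mulrCA ler_wpM2l// mulrC -expr2 weight_bracket; apply: le_weight.
by rewrite -kn; lra.
Qed.

Let i_plane (J : 'M[R]_(k, k.+1)) i j : J *m J^T = 1%:M ->
  rintegrable (fun y => (y *m J) 0 i * (y *m J) 0 j * K (y *m J)).
Proof.
move=> JJ; apply: (@dominated_integrable _ _ _ M (k%:R + 1 + eta)).
- by move: eta0; lra.
- have mJ := measurable_mulmx J.
  apply: measurable_funM; last exact: (measurableT_comp mK mJ).
  by apply: measurable_funM; exact: (measurableT_comp (measurable_coord _) mJ).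
- move=> y; apply: le_trans (K_plane y JJ); rewrite mulrA normrM ler_wpM2r//.
  by rewrite normrM -(enorm_isometry y JJ) ler_pM// coord_le_enorm.
Qed.

(** Moving nu turns the half-space {u . nu < 0} into the region below a graph
    over the hyperplane orthogonal to nu. *)
Lemma hessian_surface_tension (nu : 'rV[R]_k.+1) (J : 'M[R]_(k, k.+1)) i j :
  col_mx nu J *m (col_mx nu J)^T = 1%:M ->
  hessian (surface_tension K) nu i j =
  rint (fun y => (y *m J) 0 i * (y *m J) 0 j * K (y *m J)).
Proof.
move=> OO; have [nn nJ Jn JJ] := frame_relations OO.
have nu1 : enorm nu = 1 by rewrite /enorm nn sqrtr1.
set X := rint _.
rewrite mxE; set v : 'rV[R]_k.+1 := delta_mx 0 i.
pose C := 8 * M * weight_mass k (k%:R + eta) + 2 * `|X|.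
apply: (@derive_bound _ _ _ _ _ C 2^-1 beta beta0); first by rewrite invr_gt0.
move=> t t2; have t0 := normr_ge0 t.
have p0 : nu + t *: v != 0.
  apply/negP => /eqP E; have : enorm (t *: v) = 1.
    by rewrite -nu1 -(enormN nu); congr enorm; apply/eqP; rewrite -addr_eq0 addrC E.
  by rewrite enormZ enorm_delta mulr1; lra.
have n0 : nu != 0 by rewrite -enorm_eq0 nu1 oner_eq0.
rewrite !derive_surface_tension//.
set c := 1 + t * nu 0 i.
have nui : `|t * nu 0 i| <= `|t|.
  by rewrite normrM ler_piMr// -nu1 coord_le_enorm.
have c2 : 2^-1 < c.
  by move: nui t2; rewrite ler_norml /c => /andP[? ?]; lra.
have c0 : 0 < c by apply: lt_trans c2; rewrite invr_gt0.
(* The hyperplane orthogonal to nu + t e_i is the graph of tau. *)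
pose tau (y : 'rV[R]_k) := - t / c * (y *m J) 0 i.
pose ee (y : 'rV[R]_k) := 4 * M * `|t| `^ beta * weight (n + eta) y.
have half1 : neg_half (nu + t *: v) = below nu J tau.
  have EE u : (dotv u (nu + t *: v) < 0) = (dotv u nu < tau (u *m J^T)).
    have uE : u 0 i = dotv u nu * nu 0 i + (u *m J^T *m J) 0 i.
      have := congr1 (fun w : 'rV[R]_k.+1 => w 0 i) (frame_split OO u).
      by rewrite [in RHS]mxE [in X in _ = X + _]mxE.
    rewrite dotvDr dotvZr dotv_delta uE /tau; move: (dotv u nu) ((_ *m J) 0 i) => s z.
    by rewrite mulrAC ltr_pdivlMr// /c; apply/idP/idP; lra.
  by apply/seteqP; split=> u; rewrite /neg_half /below /= EE.
have half0 : neg_half nu = below nu J (fun=> 0) by [].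
have mtau : measurable_fun setT tau.
  apply: measurable_funM => //.
  exact: (measurableT_comp (measurable_coord _) (measurable_mulmx J)).
have tauy y : `|tau y| <= 2 * `|t| * enorm y.
  rewrite /tau normrM -(enorm_isometry y JJ) ler_pM// ?coord_le_enorm//.
  rewrite normrM normrN normfV (gtr0_norm c0) ler_pdivrMr//.
  by rewrite mulrAC; nra.
have mee : measurable_fun setT ee.
  by apply: measurable_funM => //; exact: measurable_weight.
have tG : rintegrable (fun y => tau y * first_moment j (y *m J)) /\
    rint (fun y => tau y * first_moment j (y *m J)) = - t / c * X.
  rewrite -rintZ; last exact: i_plane.
  split; last by apply: eq_rint => y; rewrite /tau /first_moment; ring.
  rewrite (_ : (fun y => _) = fun y => - t / c * ((y *m J) 0 i * (y *m J) 0 j * K (y *m J))).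
    by apply: rintegrableZ; exact: i_plane.
  by apply/funext => y; rewrite /tau /first_moment; ring.
have M4 : 0 <= 4 * M * `|t| `^ beta by rewrite !mulr_ge0// powR_ge0.
have tee y : `|tau y| * ee y <= 8 * M * `|t| `^ (1 + beta) * weight (k%:R + eta) y.
  have yb := enorm_le_bracket y; have b0 := bracket_gt0 y.
  apply: (@le_trans _ _ (2 * `|t| * bracket y * ee y)).
    rewrite ler_wpM2r ?mulr_ge0 ?weight_ge0// (le_trans (tauy y))//.
    by rewrite ler_wpM2l// mulr_ge0.
  have := weight_bracket (n + eta) 1 y; rewrite expr1.
  rewrite (_ : n + eta - 1 = k%:R + eta); last by rewrite -kn; ring.
  by move=> <-; rewrite -mulr_powR// ?(ltW beta0)// /ee le_eqVlt; apply/orP; left; apply/eqP; ring.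
have kk : k%:R < k%:R + eta by move: eta0; lra.
have iee : rintegrable (fun y => tau y * ee y).
  apply: (dominated_integrable kk _ (c := 8 * M * `|t| `^ (1 + beta))).
    exact: measurable_funM.
  move=> y; rewrite normrM (ger0_norm (_ : 0 <= ee y)) ?mulr_ge0 ?weight_ge0//.
have hG s y : `|s| <= `|tau y| ->
    `|first_moment j (s *: nu + y *m J) - first_moment j (y *m J)| <= ee y.
  move=> st; set u := s *: nu + y *m J; set u0 := y *m J.
  have yb := enorm_le_bracket y; have b0 := bracket_gt0 y.
  have bu0 : bracket u0 = bracket y by exact: bracket_isometry.
  have buy : bracket y <= bracket u by exact: le_bracket_frame.
  have uu : enorm (u0 - u) = `|s|.
    by rewrite /u opprD addrCA subrr addr0 enormN enormZ nu1 mulr1.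
  have sb : `|s| <= 2 * `|t| * bracket y.
    by rewrite (le_trans st)// (le_trans (tauy y))// ler_wpM2l// mulr_ge0.
  have sb1 : `|s| <= bracket y.
    apply: le_trans sb _; rewrite ler_piMl ?(ltW b0)//; lra.
  have w0 := weight_ge0 (n + 2 + eta) y.
  have h1 : `|K u| <= M * weight (n + 2 + eta) y.
    apply: le_trans (dK u) _; rewrite ler_wpM2l//; apply: weight_mono => //.
    by rewrite !addr_ge0// ltW.
  have h2 : `|K u0 - K u| <= M * weight (n + 3 + eta) y * `|s| `^ beta.
    have [_ _ _ _ hol] := tK; have := hol u0 u; rewrite uu bu0 => /(_ buy) h.
    by apply: le_trans h _; rewrite -/n (weight_isometry _ _ JJ).
  (* The factor |s| coming from the first moment is lowered to |s|^beta. *)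
  have sbeta : `|s| <= bracket y * `|s| `^ beta.
    have [->|s0] := eqVneq s 0; first by rewrite normr0 mulr_ge0 ?powR_ge0 ?ltW.
    have ns : 0 < `|s| by rewrite normr_gt0.
    rewrite -[leLHS]powRr1// -[in leLHS](subrK beta 1) powRD; last first.
      by apply/implyP => _; rewrite gt_eqF.
    rewrite ler_wpM2r ?powR_ge0//.
    apply: le_trans (ler_powR_base _ _ sb1) _; rewrite ?subr_ge0//.
    by rewrite -[leRHS]powRr1 ?(ltW b0)//; apply: ler_powR; [exact: bracket_ge1|move: beta0; lra].
  have sbeta2 : `|s| `^ beta <= 2 * `|t| `^ beta * bracket y.
    apply: le_trans (ler_powR_base (ltW beta0) (normr_ge0 s) sb) _.
    rewrite powRM ?mulr_ge0// ?(ltW b0)// powRM//.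
    have two : 2 `^ beta <= 2 :> R.
      by rewrite -[leRHS]powRr1//; apply: ler_powR => //; rewrite ler1n.
    have bb : bracket y `^ beta <= bracket y.
      by rewrite -[leRHS]powRr1 ?(ltW b0)//; apply: ler_powR; rewrite ?bracket_ge1.
    by rewrite ler_pM ?mulr_ge0 ?powR_ge0// ler_wpM2r ?powR_ge0.
  have W1 : bracket y * weight (n + 2 + eta) y = weight (n + 1 + eta) y.
    rewrite mulrC -[X in _ * X]expr1 weight_bracket; congr (weight _ _); ring.
  have W2 : bracket y * weight (n + 3 + eta) y <= weight (n + 1 + eta) y.
    rewrite mulrC -[X in _ * X]expr1 weight_bracket; apply: le_weight; lra.
  have W3 : bracket y * weight (n + 1 + eta) y = weight (n + eta) y.
    rewrite mulrC -[X in _ * X]expr1 weight_bracket; congr (weight _ _); ring.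
  have ujE : u 0 j = s * nu 0 j + u0 0 j by rewrite /u mxE mxE.
  rewrite /first_moment ujE (_ : _ - _ = s * nu 0 j * K u + u0 0 j * (K u - K u0)); last by ring.
  rewrite (le_trans (ler_normD _ _))//.
  have a1 : `|s * nu 0 j * K u| <= M * weight (n + 1 + eta) y * `|s| `^ beta.
    rewrite !normrM -W1; apply: (@le_trans _ _ (`|s| * (M * weight (n + 2 + eta) y))).
      rewrite ler_pM ?mulr_ge0// ler_piMr// -nu1 coord_le_enorm//.
    by have := ler_wpM2r (mulr_ge0 M0 w0) sbeta; lra.
  have a2 : `|u0 0 j * (K u - K u0)| <= M * weight (n + 1 + eta) y * `|s| `^ beta.
    rewrite normrM -[`|K u - _|]normrN opprB.
    have u0b : `|u0 0 j| <= bracket y.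
      by rewrite (le_trans (coord_le_enorm _ _))// (enorm_isometry _ JJ).
    apply: le_trans (ler_pM _ _ u0b h2) _ => //.
    rewrite mulrA ler_wpM2r ?powR_ge0// mulrCA ler_wpM2l//.
  apply: le_trans (lerD a1 a2) _; rewrite /ee -W3.
  have Mw : 0 <= M * weight (n + 1 + eta) y by rewrite mulr_ge0// weight_ge0.
  by have := ler_wpM2l Mw sbeta2; lra.
have mG0 : measurable_fun setT (fun y => first_moment j (y *m J)).
  exact: (measurableT_comp (m_moment j) (measurable_mulmx J)).
have := below_expansion OO mtau mee (i_moment j) mG0 tG.1 iee hG.
rewrite half1 half0 tG.2.
set S1 := rint (fun u => _ * \1_(below _ _ tau) u); set S0 := rint (fun u => _ * \1_(below _ _ _) u).
move=> H; rewrite (_ : _ - _ - _ = - (S1 - S0 - - t / c * X) + (t / c - t) * X); last by ring.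
have b2 : rint (fun y => `|tau y| * ee y) <= 8 * M * weight_mass k (k%:R + eta) * `|t| `^ (1 + beta).
  rewrite mulrAC /weight_mass -rintZ; last exact: weight_integrable.
  apply: le_rint => //; last by apply: rintegrableZ; exact: weight_integrable.
  apply: (rintegrable_le _ _ iee) => [|y].
    by apply: measurable_funM => //; exact: measurableT_comp.
  by rewrite normrM normr_id -normrM.
have b3 : `|(t / c - t) * X| <= 2 * `|X| * `|t| `^ (1 + beta).
  rewrite normrM mulrAC ler_wpM2r//.
  rewrite (_ : t / c - t = - (t * (t * nu 0 i)) / c); last first.
    by rewrite /c; field; rewrite gt_eqF.
  rewrite normrM normfV (gtr0_norm c0) ler_pdivrMr// normrN normrM.
  have tt : `|t| * `|t| <= `|t| `^ (1 + beta).
    have [->|tn0] := eqVneq t 0; first by rewrite normr0 mul0r powR_ge0.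
    rewrite -mulr_powR ?(ltW beta0)// ler_wpM2l// -[leLHS]powRr1//.
    apply: ger_powR => //; rewrite normr_gt0 tn0/=; lra.
  have := ler_wpM2l t0 nui; have := powR_ge0 `|t| (1 + beta).
  by move: (_ `^ _) tt (`|t * _|) => p tt q p0' tq; nra.
rewrite (le_trans (ler_normD _ _))// normrN /C [leRHS]mulrDl lerD//.
exact: le_trans H b2.
Qed.

(** The principal frame diagonalises the paraboloid, so the sum over the
    principal directions is a single moment of K on the tangent plane. *)
Lemma aniso_mean_curvatureE (E : set 'rV[R]_k.+1) x (J : 'M[R]_(k, k.+1))
    (B : 'M[R]_k.+1) :
  let nu := outer_unit_normal E x in
  let kt := principal_frame E x in
  col_mx nu J *m (col_mx nu J)^T = 1%:M ->
  (forall y, dotv y nu = 0 ->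
    \sum_i kt.1 i * dotv (kt.2 i) y ^+ 2 = - dotv (y *m B) y) ->
  aniso_mean_curvature K E x =
  - rint (fun y => dotv (y *m J *m B) (y *m J) * K (y *m J)).
Proof.
move=> nu kt OO frame; have [nn nJ Jn JJ] := frame_relations OO.
pose P i j (y : 'rV[R]_k) := (y *m J) 0 i * (y *m J) 0 j * K (y *m J).
have iP i j : rintegrable (P i j) by exact: i_plane.
have quad (tau : 'rV[R]_k.+1) :
    rintegrable (fun y => dotv tau (y *m J) ^+ 2 * K (y *m J)) /\
    dotv tau (tau *m hessian (surface_tension K) nu) =
      rint (fun y => dotv tau (y *m J) ^+ 2 * K (y *m J)).
  have i1 j := rint_sum (fun i => rintegrableZ (tau 0 i) (iP i j)).
  have [i2 e2] := rint_sum (fun j => rintegrableZ (tau 0 j) (i1 j).1).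
  have -> : (fun y => dotv tau (y *m J) ^+ 2 * K (y *m J)) =
      fun y => \sum_j tau 0 j * \sum_i tau 0 i * P i j y.
    apply/funext => y; rewrite expr2 -mulrA mulr_suml; apply: eq_bigr => j _.
    rewrite -mulrA; congr (_ * _); rewrite mulrCA [dotv _ _]/dotv mulr_suml.
    by apply: eq_bigr => i _; rewrite /P; ring.
  split; first exact: i2.
  rewrite e2; apply: eq_bigr => j _; rewrite rintZ; last exact: (i1 j).1.
  congr (_ * _); rewrite (i1 j).2 mxE; apply: eq_bigr => i _.
  by rewrite rintZ// (hessian_surface_tension _ _ OO).
rewrite /aniso_mean_curvature -/nu -/kt.
under eq_bigr => i _ do rewrite (quad (kt.2 i)).2 -(rintZ _ (quad (kt.2 i)).1).
rewrite -(rint_sum (fun i => rintegrableZ (kt.1 i) (quad (kt.2 i)).1)).2.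
have [iF _] := rint_sum (fun i => rintegrableZ (kt.1 i) (quad (kt.2 i)).1).
pose F (y : 'rV[R]_k) := \sum_i kt.1 i * (dotv (kt.2 i) (y *m J) ^+ 2 * K (y *m J)).
pose Q (y : 'rV[R]_k) := dotv (y *m J *m B) (y *m J) * K (y *m J).
have FQ y : F y = -1 * Q y.
  have yn : dotv (y *m J) nu = 0 by rewrite dotvE -mulmxA Jn mulmx0 mxE.
  rewrite /F /Q mulrA mulN1r -frame// mulr_suml.
  by apply: eq_bigr => i _; rewrite mulrA.
have iQ : rintegrable Q.
  have := rintegrableZ (-1) iF; congr rintegrable; apply/funext => y.
  by rewrite -/(F y) FQ !mulN1r opprK.
by rewrite -[LHS]/(rint F) (eq_rint FQ) rintZ// mulN1r.
Qed.

End hessian.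

End surface_tension.

(** * Convolution with the rescaled kernel *)

Section convolution_bounds.
Context {R : realType}.

Lemma le_nonneg_integral d (T : measurableType d) (mu : {measure set T -> \bar R})
    (f g : T -> \bar R) :
  (forall x, 0 <= f x)%E -> (forall x, f x <= g x)%E ->
  (\int[mu]_x f x <= \int[mu]_x g x)%E.
Proof.
move=> f0 fg; have g0 x : (0 <= g x)%E by exact: le_trans (fg x).
rewrite !ge0_integralTE//; apply: ereal_sup_le => _ [k kf <-].
by exists k => // x; exact: le_trans (kf x) (fg x).
Qed.

Section dilation.
Variables (n : nat) (h : R).
Hypothesis h0 : 0 < h.
Let ep := Num.sqrt h.

Let ep0 : 0 < ep. Proof. by rewrite sqrtr_gt0. Qed.

Lemma dilation_integral (F : 'rV[R]_n -> R) z : measurable_fun setT F ->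
  (forall u, 0 <= F u) ->
  (\int[lebesgue_rV R n]_y (h `^ (- (n%:R / 2)) * F (ep^-1 *: (y - z)))%:E =
   \int[lebesgue_rV R n]_u (F u)%:E)%E.
Proof.
move=> mF F0; have c0 : 0 <= h `^ (- (n%:R / 2)) by exact: powR_ge0.
have mS : measurable_fun setT (fun y : 'rV[R]_n => F (ep^-1 *: y)).
  apply: (measurableT_comp mF).
  exact: (measurable_scalerV (measurable_cst ep^-1) (@measurable_id _ _ _)).
pose G (w : 'rV[R]_n) : \bar R := (h `^ (- (n%:R / 2)) * F (ep^-1 *: w))%:E.
have mG : measurable_fun setT G by apply/measurable_EFinP; exact: measurable_funM.
have G0 w : (0 <= G w)%E by rewrite lee_fin mulr_ge0.
rewrite -[LHS]/(\int[lebesgue_rV R n]_y G (y - z)%R)%E (ge0_integral_translate (- z) mG G0).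
have mFE : measurable_fun setT (EFin \o F) by exact/measurable_EFinP.
have epi : 0 < ep^-1 by rewrite invr_gt0.
have := ge0_integral_scalerV epi mFE (fun u => F0 u : (0 <= (F u)%:E)%E).
rewrite /G; under [in X in _ -> X = _]eq_integral do rewrite EFinM.
rewrite ge0_integralZl//; last 2 first.
- exact/measurable_EFinP.
- by move=> u _; rewrite lee_fin.
move=> /= ->; rewrite muleA -EFinM exprVn invrK.
suff -> : h `^ (- (n%:R / 2)) * ep ^+ n = 1 by rewrite mul1e.
rewrite powRN -[X in X ^+ _]powR12_sqrt ?(ltW h0)//.
rewrite -powR_mulrn ?powR_ge0// -powRrM (mulrC 2^-1) mulVf//.
by rewrite gt_eqF// powR_gt0.
Qed.

Variables (K : 'rV[R]_n -> R).
Hypotheses (K0 : forall u, 0 <= K u) (Keven : forall u, K (- u) = K u).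
Hypothesis iK : rintegrable K.

Let dilate y z : ep^-1 *: (z - y) = - (ep^-1 *: (y - z)) :> 'rV[R]_n.
Proof. by rewrite -scalerN opprB. Qed.

Let undilate y z : z + ep *: (ep^-1 *: (y - z)) = y :> 'rV[R]_n.
Proof. by rewrite scalerA mulfV ?gt_eqF// scale1r addrC subrK. Qed.

Let mask_integral (S : set 'rV[R]_n) z : measurable S ->
  (\int[lebesgue_rV R n]_y
    (h `^ (- (n%:R / 2)) * (K (ep^-1 *: (y - z)) * \1_S (ep^-1 *: (y - z))))%:E =
   (rint (fun u => K u * \1_S u))%:E)%E.
Proof.
move=> mS; have iKS := rintegrable_indic mS iK.
rewrite EFin_rint//.
apply: (@dilation_integral (fun u => K u * \1_S u)); last by move=> u; rewrite mulr_ge0.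
exact: rintegrable_measurable.
Qed.

(** The indicator of E is compared pointwise with indicators of measurable sets,
    which bounds the integral for an arbitrary set E. *)
Lemma convolution_bounds (E S S' : set 'rV[R]_n) z : measurable S -> measurable S' ->
  (forall u, K u != 0 -> E (z + ep *: u) -> S u) ->
  (forall u, S' u -> E (z + ep *: u)) ->
  rint (fun u => K u * \1_S' u) <= convolution (rescaled_kernel K h) \1_E z
    <= rint (fun u => K u * \1_S u).
Proof.
move=> mS mS' ES SE.
have f0 y : (0 <= (rescaled_kernel K h (z - y) * \1_E y)%:E)%E.
  by rewrite lee_fin mulr_ge0// mulr_ge0 ?powR_ge0.
have fE y : rescaled_kernel K h (z - y) = h `^ (- (n%:R / 2)) * K (ep^-1 *: (y - z)).
  by rewrite /rescaled_kernel -/ep dilate Keven.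
have up : (\int[lebesgue_rV R n]_y (rescaled_kernel K h (z - y) * \1_E y)%:E <=
    (rint (fun u => K u * \1_S u))%:E)%E.
  rewrite -(mask_integral z mS); apply: le_nonneg_integral => // y.
  rewrite lee_fin fE -mulrA ler_wpM2l ?powR_ge0//.
  have [->|Ku] := eqVneq (K (ep^-1 *: (y - z))) 0; first by rewrite !mul0r.
  rewrite ler_wpM2l// !indicE ler_nat; case: (boolP (y \in E)) => [/set_mem Ey|//].
  by rewrite mem_set//; apply: ES => //; rewrite undilate.
have lo : ((rint (fun u => K u * \1_S' u))%:E <=
    \int[lebesgue_rV R n]_y (rescaled_kernel K h (z - y) * \1_E y)%:E)%E.
  rewrite -(mask_integral z mS'); apply: le_nonneg_integral => y.
    by rewrite lee_fin !mulr_ge0 ?powR_ge0.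
  rewrite lee_fin fE -mulrA ler_wpM2l ?powR_ge0// ler_wpM2l//.
  rewrite !indicE ler_nat; case: (boolP (_ \in S')) => [/set_mem Sy|//].
  by rewrite mem_set// -(undilate y z); exact: SE.
have fin : (\int[lebesgue_rV R n]_y (rescaled_kernel K h (z - y) * \1_E y)%:E)%E \is a fin_num.
  rewrite ge0_fin_numE; last by apply: integral_ge0 => y _; exact: f0.
  exact: le_lt_trans up (ltry _).
have cE : (convolution (rescaled_kernel K h) \1_E z)%:E =
    (\int[lebesgue_rV R n]_y (rescaled_kernel K h (z - y) * \1_E y)%:E)%E.
  by rewrite /convolution /Rintegral fineK.
by apply/andP; split; rewrite -lee_fin cE.
Qed.

End dilation.

Section band.
Variables (k : nat) (K : 'rV[R]_k.+1 -> R) (M eta beta : R).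
Hypothesis tK : tame_kernel K M eta beta.
Hypotheses (K0 : forall u, 0 <= K u) (Keven : forall u, K (- u) = K u).
Hypothesis K1 : rint K = 1.
Variables (nu : 'rV[R]_k.+1) (J : 'M[R]_(k, k.+1)).
Hypothesis OO : col_mx nu J *m (col_mx nu J)^T = 1%:M.

Let M0 : 0 <= M. Proof. by case: tK. Qed.
Let eta0 : 0 < eta. Proof. by case: tK. Qed.
Let beta0 : 0 < beta. Proof. by case: tK => _ _ /andP[]. Qed.
Let beta1 : beta <= 1. Proof. by case: tK => _ _ /andP[]. Qed.
Let mK : measurable_fun setT K. Proof. exact: tame_measurable tK. Qed.
Let iK : rintegrable K. Proof. exact: tame_integrable tK. Qed.
Let kk : k%:R < k%:R + eta. Proof. by rewrite ltrDl. Qed.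
Let kn : k.+1%:R = k%:R + 1 :> R. Proof. by rewrite -natr1. Qed.

Lemma measurable_plane : measurable_fun setT (fun y => K (y *m J)).
Proof. exact: (measurableT_comp mK (measurable_mulmx J)). Qed.

Lemma plane_moment (f : 'rV[R]_k -> R) c : 0 <= c -> measurable_fun setT f ->
  (forall y, `|f y| <= c * bracket y ^+ 3) ->
  rintegrable (fun y => f y * K (y *m J)) /\
  `|rint (fun y => f y * K (y *m J))| <= c * M * weight_mass k (k%:R + eta).
Proof.
move=> c0 mf fc; have [nn nJ Jn JJ] := frame_relations OO.
have b y : `|f y * K (y *m J)| <= c * M * weight (k%:R + eta) y.
  have [_ _ _ dK _] := tK; have := dK (y *m J); rewrite (weight_isometry _ _ JJ) => h.
  rewrite normrM; apply: le_trans (ler_pM _ _ (fc y) h) _ => //.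
  rewrite mulrACA ler_wpM2l ?mulr_ge0// mulrC weight_bracket.
  by apply: le_weight; rewrite kn; lra.
have m : measurable_fun setT (fun y => f y * K (y *m J)).
  by apply: measurable_funM => //; exact: measurable_plane.
by split; [exact: dominated_integrable b|exact: dominated_Rintegral b].
Qed.

(** By Hölder continuity K differs from its value on the hyperplane by
    O((t |y|^2)^beta) in a band of thickness of order t |y|^2, with a constant
    that decays in y. *)
Lemma band_expansion (tau : 'rV[R]_k -> R) t : 0 <= t -> measurable_fun setT tau ->
  (forall y, `|tau y| <= t * bracket y ^+ 2) ->
  `|rint (fun u => K u * \1_(below nu J tau) u)
    - rint (fun u => K u * \1_(below nu J (fun=> 0)) u)
    - rint (fun y => tau y * K (y *m J))| <= M * weight_mass k (k%:R + eta) * t `^ (1 + beta).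
Proof.
move=> t0 mt tb; have [nn nJ Jn JJ] := frame_relations OO.
have nu1 : enorm nu = 1 by rewrite /enorm nn sqrtr1.
pose e y := M * weight (k.+1%:R + 3 + eta) y * `|tau y| `^ beta.
have e0 y : 0 <= e y by rewrite !mulr_ge0 ?weight_ge0 ?powR_ge0.
have me : measurable_fun setT e.
  apply: measurable_funM.
    by apply: measurable_funM => //; exact: measurable_weight.
  by apply: (measurableT_comp (measurable_powR _)); exact: measurableT_comp.
have te y : `|tau y| * e y <= M * t `^ (1 + beta) * weight (k%:R + eta) y.
  have b1 := bracket_ge1 y; have b0 := bracket_gt0 y.
  have -> : `|tau y| * e y = M * (weight (k.+1%:R + 3 + eta) y * `|tau y| `^ (1 + beta)).
    by rewrite -mulr_powR ?(ltW beta0)// /e; ring.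
  rewrite -mulrA ler_wpM2l//.
  have h : `|tau y| `^ (1 + beta) <= t `^ (1 + beta) * bracket y ^+ 4.
    apply: le_trans (ler_powR_base _ (normr_ge0 _) (tb y)) _; first by rewrite addr_ge0 ?ltW.
    rewrite powRM ?exprn_ge0 ?(ltW b0)// ler_wpM2l ?powR_ge0//.
    rewrite -powR_mulrn ?(ltW b0)// -powRrM -[leRHS]powR_mulrn ?(ltW b0)//.
    by apply: ler_powR => //; move: beta1; lra.
  apply: le_trans (ler_wpM2l (weight_ge0 _ _) h) _.
  rewrite mulrCA ler_wpM2l ?powR_ge0// weight_bracket; apply: le_weight.
  by rewrite kn; lra.
have ite : rintegrable (fun y => `|tau y| * e y).
  apply: (dominated_integrable kk _ (c := M * t `^ (1 + beta))).
    by apply: measurable_funM => //; exact: measurableT_comp.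
  by move=> y; rewrite ger0_norm ?te// mulr_ge0 ?e0.
have ite' : rintegrable (fun y => tau y * e y).
  apply: (rintegrable_le _ _ ite) => [|y]; first exact: measurable_funM.
  by rewrite !normrM normr_id.
have tb3 y : `|tau y| <= t * bracket y ^+ 3.
  apply: le_trans (tb y) _; rewrite ler_wpM2l//.
  by apply: ler_weXn2l => //; exact: bracket_ge1.
have [itG _] := plane_moment t0 mt tb3.
apply: le_trans (below_expansion OO mt me iK measurable_plane itG ite' _) _.
  move=> s y st; have [_ _ _ _ hol] := tK.
  rewrite -normrN opprB; apply: le_trans (hol _ _ _) _.
    by rewrite (bracket_isometry _ JJ) (le_bracket_frame _ _ OO).
  have -> : y *m J - (s *: nu + y *m J) = - (s *: nu) by rewrite opprD addrCA subrr addr0.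
  rewrite (weight_isometry _ _ JJ) enormN enormZ nu1 mulr1.
  rewrite ler_wpM2l ?mulr_ge0 ?weight_ge0//; apply: ler_powR_base => //.
  exact: ltW.
rewrite mulrAC /weight_mass -rintZ; last exact: weight_integrable.
apply: le_rint => //.
by apply: rintegrableZ; exact: weight_integrable.
Qed.

(** By evenness u . nu < 0 and u . nu > 0 carry the same mass, so it is at most
    1/2. The complement of the two lies in every band 0 <= u . nu < d, whose mass
    is O(d) by [band_expansion]. *)
Lemma half_mass : rint (fun u => K u * \1_(below nu J (fun=> 0)) u) = 2^-1.
Proof.
have [nn nJ Jn JJ] := frame_relations OO.
have m0 (c : R) : measurable_fun setT (fun _ : 'rV[R]_k => c) by exact: measurable_cst.
have mb c := measurable_below nu J (m0 c).
pose A' c : set 'rV[R]_k.+1 := [set u | - c < dotv u nu].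
have mA' c : measurable (A' c).
  apply: measurable_lt_set; first exact: measurable_cst.
  exact: measurable_dotv.
pose I c := rint (fun u => K u * \1_(below nu J (fun=> c)) u).
have iI c := rintegrable_indic (mb c) iK; have iA' c := rintegrable_indic (mA' c) iK.
have indE (P : bool) (A : set 'rV[R]_k.+1) u : (A u <-> P) -> \1_A u = P%:R :> R.
  by move=> AP; rewrite indicE; congr (nat_of_bool _)%:R; apply/idP/idP => [/set_mem/AP|/AP/mem_set].
have IE c u : \1_(below nu J (fun=> c)) u = (dotv u nu < c)%R%:R :> R by exact: indE.
have IE' c u : \1_(A' c) u = (- c < dotv u nu)%R%:R :> R by exact: indE.
have flip c : rint (fun u => K u * \1_(A' c) u) = I c.
  have mF : measurable_fun setT (EFin \o (fun u => K u * \1_(below nu J (fun=> c)) u)).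
    by apply/measurable_EFinP; exact: rintegrable_measurable.
  have F0 u : (0 <= (K u * \1_(below nu J (fun=> c)) u)%:E)%E by rewrite lee_fin mulr_ge0.
  rewrite /I /rint /Rintegral -(ge0_integral_opprV mF F0); congr fine.
  apply: eq_integral => u _; congr (_%:E); rewrite /= Keven IE' IE dotvNl.
  by rewrite ltrNl.
have low : I 0 + I 0 <= 1.
  rewrite -{2}(flip 0) -K1 -rintD//; apply: le_rint => // [|u]; first exact: rintegrableD.
  rewrite IE IE' oppr0 -mulrDr ler_piMr//.
  by have [s0|s0|s0] := ltgtP (dotv u nu) 0; rewrite ?addr0 ?add0r.
have high d : 0 < d <= 1 -> 1 <= I 0 + I 0 + d * (`|rint (fun y => K (y *m J))| +
    M * weight_mass k (k%:R + eta)).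
  move=> /andP[d0 d1].
  have h1 : 1 <= I 0 + I d.
    rewrite -(flip d) -K1 -rintD//; apply: le_rint => // [|u]; first exact: rintegrableD.
    rewrite IE IE' -mulrDr ler_peMr//.
    have [s0|s0] := ltP (dotv u nu) 0; first by rewrite lerDl.
    by rewrite (lt_le_trans _ s0) ?oppr_lt0// lerDr.
  have dd (y : 'rV[R]_k) : `|d| <= d * bracket y ^+ 2.
    by rewrite gtr0_norm// ler_peMr ?(ltW d0)// exprn_ege1// bracket_ge1.
  have := band_expansion (ltW d0) (m0 d) dd; rewrite -/(I d) -/(I 0) rintZ; last first.
    have [|+ _] := @plane_moment (fun=> 1) 1 ler01 (m0 1).
      by move=> y; rewrite normr1 mul1r exprn_ege1// bracket_ge1.
    by under eq_fun do rewrite mul1r.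
  set k0 := rint _; set W := M * _ => H.
  have W0 : 0 <= W by rewrite mulr_ge0// weight_mass_ge0.
  have dp : d `^ (1 + beta) <= d.
    by rewrite -[leRHS]powRr1 ?(ltW d0)//; apply: ger_powR; rewrite ?d0//; move: beta0; lra.
  have h2 : d * k0 <= d * `|k0| by rewrite ler_wpM2l ?(ltW d0)// ler_norm.
  have h3 := ler_wpM2l W0 dp.
  have h4 := le_trans (ler_norm _) H.
  by rewrite mulrDr; lra.
set c := `|_| + _ in high.
have c0 : 0 <= c by rewrite addr_ge0// mulr_ge0// weight_mass_ge0.
have : 1 <= I 0 + I 0.
  apply/ler_addgt0Pl => e e0.
  pose d := Num.min 1 (e / (c + 1)).
  have d0 : 0 < d by rewrite lt_min ltr01 divr_gt0// ltr_wpDl.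
  have d1 : d <= 1 by rewrite ge_min lexx.
  have de : d * (c + 1) <= e by rewrite -ler_pdivlMr ?ltr_wpDl// ge_min lexx orbT.
  have := high d; rewrite d0 d1 => /(_ isT); nra.
by rewrite -/(I 0); move: low; lra.
Qed.

End band.
End convolution_bounds.

(** * Expansion of the convolution at a boundary point *)

Section expansion.
Context {R : realType} (k : nat).
Variables (K : 'rV[R]_k.+2 -> R) (M eta beta alpha C A : R).
Hypothesis tK : tame_kernel K M eta beta.
Hypotheses (K0 : forall u, 0 <= K u) (Keven : forall u, K (- u) = K u).
Hypothesis K1 : rint K = 1.
Hypotheses (alpha0 : 0 < alpha) (ab : alpha <= beta) (C1 : 1 <= C) (A0 : 0 <= A).

Let M0 : 0 <= M. Proof. by case: tK. Qed.
Let eta0 : 0 < eta. Proof. by case: tK. Qed.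
Let beta0 : 0 < beta. Proof. by case: tK => _ _ /andP[]. Qed.
Let beta1 : beta <= 1. Proof. by case: tK => _ _ /andP[]. Qed.
Let alpha1 : alpha <= 1. Proof. exact: le_trans ab beta1. Qed.
Let mK : measurable_fun setT K. Proof. exact: tame_measurable tK. Qed.
Let iK : rintegrable K. Proof. exact: tame_integrable tK. Qed.
Let C0 : 0 < C. Proof. exact: lt_le_trans C1. Qed.

Lemma inv_mobilityE (nu : 'rV[R]_k.+2) (J : 'M[R]_(k.+1, k.+2)) :
  col_mx nu J *m (col_mx nu J)^T = 1%:M ->
  inv_mobility K nu = 2 * rint (fun y => K (y *m J)).
Proof.
move=> OO; congr (2 * fine _).
apply: (@ge0_integral_hyperplane R k J nu (EFin \o K) OO) => //.
exact/measurable_EFinP.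
Qed.

Let W := weight_mass k.+1 (k.+1%:R + eta) : R.
Let Wn := weight_mass k.+2 (k.+2%:R + eta) : R.
Let W0 : 0 <= W. Proof. exact: weight_mass_ge0. Qed.
Let Wn0 : 0 <= Wn. Proof. exact: weight_mass_ge0. Qed.

(** Where the paraboloid is not available, |u| is at least a multiple of 1 / ep,
    so a factor |u|^2 of the integrable function |u|^2 |K u| can be traded for
    ep^2. *)
Lemma far_mass ep : 0 < ep ->
  let far := [set u : 'rV[R]_k.+2 | 1 <= 2 * C * ep * enorm u] in
  measurable far /\ rint (fun u => K u * \1_far u) <= 4 * C ^+ 2 * M * Wn * ep ^+ 2.
Proof.
move=> ep0 far.
have mfar : measurable far.
  apply: measurable_le_set; first exact: measurable_cst.
  by apply: measurable_funM => //; exact: measurable_enorm.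
split=> //.
have np : k.+2%:R < k.+2%:R + eta by rewrite ltrDl.
rewrite (_ : _ * ep ^+ 2 = (4 * C ^+ 2 * M * ep ^+ 2) * Wn); last by ring.
rewrite /Wn /weight_mass -rintZ; last exact: weight_integrable.
apply: le_rint; first exact: rintegrable_indic.
  by apply: rintegrableZ; exact: weight_integrable.
move=> u; have b0 := bracket_gt0 u.
have -> : weight (k.+2%:R + eta) u = weight (k.+2%:R + 2 + eta) u * bracket u ^+ 2.
  by rewrite weight_bracket; congr (weight _ _); ring.
have [_ _ _ dK _] := tK; have := dK u; rewrite ger0_norm// => Ku.
have w0 := weight_ge0 (k.+2%:R + 2 + eta) u.
have Mw : 0 <= M * weight (k.+2%:R + 2 + eta) u by rewrite mulr_ge0.
rewrite indicE; case: (boolP (u \in far)) => [/set_mem /= uf|_]; last first.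
  by rewrite mulr0 !mulr_ge0 ?exprn_ge0 ?(ltW ep0) ?(ltW C0)// ltW.
rewrite mulr1; apply: le_trans Ku _.
have u1 : 1 <= 2 * C * ep * bracket u.
  apply: le_trans uf _; rewrite ler_wpM2l ?enorm_le_bracket//.
  by rewrite !mulr_ge0 ?(ltW ep0) ?(ltW C0).
have u2 : 1 <= (2 * C * ep * bracket u) ^+ 2 by rewrite exprn_ege1.
apply: le_trans (ler_peMr Mw u2) _.
by rewrite le_eqVlt; apply/orP; left; apply/eqP; rewrite !exprMn; ring.
Qed.

(** In the variable u, the set E is caught between the regions below
    ep b - l / ep - q and ep b - l / ep + q, with q of order ep^(1+alpha), up to
    the far set; [band_expansion] gives the mass of both to the same order. *)
Lemma convolution_expansion : exists D e0, [/\ 0 <= D, 0 < e0 &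
  forall h (E : set 'rV[R]_k.+2) x l, 0 < h -> Num.sqrt h < e0 ->
    boundary_paraboloid alpha E C x -> `|l| <= A * h ->
    let nu := outer_unit_normal E x in
    `|convolution (rescaled_kernel K h) \1_E (x + l *: nu) - 2^-1
      + 2^-1 * (Num.sqrt h * aniso_mean_curvature K E x
                + l / Num.sqrt h * inv_mobility K nu)|
      <= D * Num.sqrt h `^ (1 + alpha)].
Proof.
(* T bounds the thickness of the bands divided by ep max(1, |y|)^2. *)
pose T := 3 * C + 1 + A.
have T1 : 1 <= T by rewrite /T; move: C1 A0; lra.
exists (M * W * (T ^+ 2 + C + 1) + 4 * C ^+ 2 * M * Wn), (Num.min 1 (2 * (A + 1) * C)^-1).
have AC0 : 0 < 2 * (A + 1) * C by rewrite !mulr_gt0 ?ltr_wpDl.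
split.
- rewrite addr_ge0 ?mulr_ge0 ?addr_ge0 ?exprn_ge0 ?(ltW C0)//.
  by move: T1; lra.
- by rewrite lt_min ltr01 invr_gt0.
move=> h E x l h0 + [B [nu1 BC EC frame]] lA /=.
set nu := outer_unit_normal E x in nu1 EC frame *; set ep := Num.sqrt h; rewrite lt_min => /andP[ep1 epAC].
have ep0 : 0 < ep by rewrite sqrtr_gt0.
have epE : ep ^+ 2 = h by rewrite sqr_sqrtr ?ltW.
have [J [JJ nJ OO]] := orthonormal_completion nu1.
rewrite (inv_mobilityE OO) (aniso_mean_curvatureE tK OO frame).
set a := l / ep.
have la : l = ep * a by rewrite /a mulrC divfK// gt_eqF.
have aA : `|a| <= A * ep.
  rewrite /a normrM normfV (gtr0_norm ep0) ler_pdivrMr//.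
  by apply: le_trans lA _; rewrite -epE expr2 mulrA.
pose b (y : 'rV[R]_k.+1) := 2^-1 * dotv (y *m J *m B) (y *m J).
(* q is the error C |y|^(2+alpha) of the paraboloid in the variable u; the minimum
   changes nothing where the paraboloid is used, and keeps q quadratic. *)
pose q (y : 'rV[R]_k.+1) := C * ep * enorm y ^+ 2 * Num.min 1 ((ep * enorm y) `^ alpha).
pose p := ep `^ (1 + alpha).
have p0 : 0 <= p by exact: powR_ge0.
have pep : p <= ep.
  by rewrite -[leRHS]powRr1 ?(ltW ep0)//; apply: ger_powR; [rewrite ep0 ltW|move: alpha0; lra].
have ep2p : ep ^+ 2 <= p.
  rewrite -powR_mulrn ?(ltW ep0)//; apply: ger_powR; first by rewrite ep0 ltW.
  by move: alpha1; lra.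
have yb (y : 'rV[R]_k.+1) : enorm y ^+ 2 <= bracket y ^+ 2.
  by rewrite lerXn2r ?nnegrE ?enorm_ge0 ?(ltW (bracket_gt0 y))// enorm_le_bracket.
have bb y : `|b y| <= C * bracket y ^+ 2.
  rewrite /b normrM gtr0_norm ?invr_gt0//.
  have := BC (y *m J); rewrite (enorm_isometry _ JJ).
  have := ler_wpM2l (ltW C0) (yb y); have := mulr_ge0 (ltW C0) (sqr_ge0 (bracket y)).
  by move: (`| _ |) => w; lra.
have q0 y : 0 <= q y.
  rewrite /q !mulr_ge0 ?exprn_ge0 ?enorm_ge0 ?(ltW C0) ?(ltW ep0)//.
  by rewrite le_min ler01 powR_ge0.
have qb y : q y <= C * ep * bracket y ^+ 2.
  rewrite /q -[leRHS]mulr1; apply: ler_pM.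
  - by rewrite !mulr_ge0 ?exprn_ge0 ?enorm_ge0 ?(ltW C0) ?(ltW ep0).
  - by rewrite le_min ler01 powR_ge0.
  - by rewrite ler_wpM2l// mulr_ge0 ?(ltW C0) ?(ltW ep0).
  - by rewrite ge_min lexx.
have qb3 y : `|q y| <= C * p * bracket y ^+ 3.
  rewrite (ger0_norm (q0 y)) /q /p -mulr_powR ?(ltW ep0) ?(ltW alpha0)//.
  have y1 := bracket_ge1 y.
  have h1 : Num.min 1 ((ep * enorm y) `^ alpha) <= ep `^ alpha * bracket y.
    rewrite ge_min; apply/orP; right; rewrite powRM ?enorm_ge0 ?(ltW ep0)//.
    rewrite ler_wpM2l ?powR_ge0//.
    apply: le_trans (ler_powR_base (ltW alpha0) (enorm_ge0 y) (enorm_le_bracket y)) _.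
    by rewrite -[leRHS]powRr1 ?(le_trans ler01 y1)//; exact: ler_powR.
  have -> : C * (ep * ep `^ alpha) * bracket y ^+ 3 =
    C * ep * bracket y ^+ 2 * (ep `^ alpha * bracket y) by ring.
  apply: ler_pM => //.
  - by rewrite !mulr_ge0 ?exprn_ge0 ?enorm_ge0 ?(ltW C0) ?(ltW ep0).
  - by rewrite le_min ler01 powR_ge0.
  - by rewrite ler_wpM2l// mulr_ge0 ?(ltW C0) ?(ltW ep0).
have mb : measurable_fun setT b.
  apply: measurable_funM => //.
  have mB := continuous_measurable_rV (@continuous_quadratic _ _ B).
  exact: (measurableT_comp mB (measurable_mulmx J)).
have me := @measurable_enorm R k.+1.
have mq : measurable_fun setT q.
  apply: measurable_funM.
    by apply: measurable_funM => //; exact: measurable_funX.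
  apply: measurable_minr => //.
  by apply: (measurableT_comp (measurable_powR _)); exact: measurable_funM.
have m1 (c : R) : measurable_fun setT (fun _ : 'rV[R]_k.+1 => c) by exact: measurable_cst.
have b3 y : `|b y| <= C * bracket y ^+ 3.
  apply: le_trans (bb y) _; rewrite ler_wpM2l ?(ltW C0)//.
  by apply: ler_weXn2l => //; exact: bracket_ge1.
have one3 (y : 'rV[R]_k.+1) : `|1 : R| <= 1 * bracket y ^+ 3.
  by rewrite normr1 mul1r exprn_ege1// bracket_ge1.
have [ib _] := plane_moment tK OO (ltW C0) mb b3.
have [iq Qb] := plane_moment tK OO (mulr_ge0 (ltW C0) p0) mq qb3.
have [i1 kb] := plane_moment tK OO ler01 (m1 1) one3.
set k0 := rint (fun y => K (y *m J)).
have k0E : rint (fun y => 1 * K (y *m J)) = k0 by apply: eq_rint => y; rewrite mul1r.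
have k00 : 0 <= k0 by exact: rint_ge0.
rewrite k0E mul1r (ger0_norm k00) -/W in kb.
rewrite -/W -(mulrA (C * p)) in Qb; set Q := rint _ in Qb.
have -> : rint (fun y => dotv (y *m J *m B) (y *m J) * K (y *m J)) =
    2 * rint (fun y => b y * K (y *m J)).
  by rewrite -rintZ//; apply: eq_rint => y; rewrite /b; field.
set c := rint (fun y => b y * K (y *m J)).
have moment sg r : rint (fun y => (ep * b y + sg * q y + r) * K (y *m J)) =
    ep * c + sg * Q + r * k0.
  rewrite -k0E -!rintZ// -!rintD; try exact: rintegrableZ.
    by apply: eq_rint => y; ring.
  by apply: rintegrableD; exact: rintegrableZ.
pose tau sg r y := ep * b y + sg * q y + r : R.
have mtau sg r : measurable_fun setT (tau sg r).
  apply: measurable_funD => //; apply: measurable_funD; exact: measurable_funM.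
have band sg r : `|sg| <= 1 -> `|r| <= (A + 1) * ep ->
    `|rint (fun u => K u * \1_(below nu J (tau sg r)) u) - 2^-1 -
      (ep * c + sg * Q + r * k0)| <= M * W * T ^+ 2 * p.
  move=> sg1 rA.
  have tb y : `|tau sg r y| <= ep * T * bracket y ^+ 2.
    have h1 := ler_wpM2l (ltW ep0) (bb y).
    have h2 : `|sg * q y| <= C * ep * bracket y ^+ 2.
      rewrite normrM (ger0_norm (q0 y)); apply: le_trans (qb y).
      by rewrite ler_piMl.
    have h3 : 1 <= bracket y ^+ 2 by rewrite exprn_ege1// bracket_ge1.
    have h4 : `|r| <= (A + 1) * ep * bracket y ^+ 2.
      by apply: le_trans rA _; rewrite ler_peMr// mulr_ge0 ?(ltW ep0)// addr_ge0.
    rewrite /tau (le_trans (ler_normD _ _))// (le_trans (lerD (ler_normD _ _) h4))//.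
    rewrite normrM (gtr0_norm ep0).
    have h5 := le_trans (q0 y) (qb y).
    by move: h1 h2 h5; rewrite /T; lra.
  have t0 : 0 <= ep * T by rewrite mulr_ge0 ?(ltW ep0)//; move: T1; lra.
  have := band_expansion tK OO t0 (mtau sg r) tb.
  rewrite (half_mass tK K0 Keven K1 OO) moment => /le_trans; apply.
  rewrite -/W -[leRHS]mulrA; rewrite ler_wpM2l ?mulr_ge0// powRM ?(ltW ep0)//; last first.
    by move: T1; lra.
  rewrite mulrC ler_pM ?powR_ge0//.
    rewrite -powR_mulrn; last by move: T1; lra.
    by apply: ler_powR => //; move: beta1; lra.
  by apply: ger_powR; [rewrite ep0 ltW|move: ab; lra].
have [mfar farb] := far_mass ep0.
set far := [set u : 'rV[R]_k.+2 | _] in mfar farb.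
(* Membership in E bounds s only by a non-strict inequality; the summand p, of
   the order of the error, makes it strict. *)
pose tp := tau 1 (p - a); pose tm := tau (-1) (- a).
have mbp := measurable_below nu J (mtau 1 (p - a)).
have mbm := measurable_below nu J (mtau (-1) (- a)).
have point u : x + l *: nu + ep *: u =
    x + ((ep * (dotv u nu + a)) *: nu + ep *: (u *m J^T *m J)).
  rewrite {1}(frame_split OO u) la; move: (dotv u nu) (u *m J^T *m J) => s w.
  by apply/rowP => i; rewrite !mxE; ring.
(* Outside the far set, the point lies within the range of the paraboloid. *)
have near_bound u : ~ far u ->
    C * enorm ((ep * (dotv u nu + a)) *: nu + ep *: (u *m J^T *m J)) <= 1 /\
    ep * enorm (u *m J^T) <= 1.
  move=> /negP; rewrite -ltNge => uf.
  have yu : enorm (u *m J^T) <= enorm u.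
    by rewrite [in leRHS](frame_split OO u) enorm_plane_le.
  split.
    have -> : (ep * (dotv u nu + a)) *: nu + ep *: (u *m J^T *m J) = ep *: u + l *: nu.
      apply: (addrI x); rewrite -point.
      by apply/rowP => i; rewrite !mxE; ring.
    have h1 := ler_enormD (ep *: u) (l *: nu).
    rewrite !enormZ nu1 mulr1 (gtr0_norm ep0) in h1.
    have h2 : C * `|l| <= 2^-1.
      have : A * h <= (A + 1) * ep.
        rewrite -epE expr2 mulrA ler_wpM2r ?(ltW ep0)//.
        have : A * ep <= A by rewrite ler_piMr// ltW.
        by lra.
      move: epAC; rewrite -[ltRHS]mul1r ltr_pdivlMr// => h3 h4.
      by have := ler_wpM2l (ltW C0) (le_trans lA h4); lra.
    by have := ler_wpM2l (ltW C0) h1; move: uf; lra.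
  apply: le_trans (ler_wpM2l (ltW ep0) yu) _.
  have : ep * enorm u <= C * (ep * enorm u) by rewrite ler_peMl// mulr_ge0 ?enorm_ge0 ?(ltW ep0).
  have := mulr_ge0 (ltW ep0) (enorm_ge0 u); move: uf; lra.
have qE y : ep * enorm y <= 1 -> C * enorm (ep *: (y *m J)) `^ (2 + alpha) = ep * q y.
  move=> ey; have ey0 : 0 <= ep * enorm y by rewrite mulr_ge0 ?enorm_ge0 ?(ltW ep0).
  rewrite enormZ (gtr0_norm ep0) (enorm_isometry _ JJ) powRD; last first.
    by apply/implyP; rewrite gt_eqF// addr_gt0.
  rewrite /q min_r; first by rewrite powR_mulrn// exprMn; ring.
  rewrite -[leRHS](powRr0 (ep * enorm y)).
  have [->|en] := eqVneq (ep * enorm y) 0; first by rewrite powR0 ?gt_eqF// powRr0.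
  by apply: ger_powR; rewrite ?ey ?andbT ?lt_neqAle 1?eq_sym ?en ?(ltW alpha0).
have bE y : 2^-1 * dotv (ep *: (y *m J) *m B) (ep *: (y *m J)) = ep * (ep * b y).
  by rewrite -scalemxAl dotvZl dotvZr /b; ring.
have perp u : dotv (ep *: (u *m J^T *m J)) nu = 0.
  have [_ _ Jn _] := frame_relations OO.
  by rewrite dotvZl dotvE -mulmxA Jn mulmx0 mxE mulr0.
have ES u : K u != 0 -> E (x + l *: nu + ep *: u) -> (below nu J tp `|` far) u.
  move=> _; rewrite point => Eu; have [uf|nf] := pselect (far u); [by right|left].
  have [h1 h2] := near_bound u nf.
  have [_ out] := EC _ _ (perp u) h1.
  rewrite /below /= ltNge; apply/negP => su; apply: out Eu.
  rewrite bE qE// -mulrDr ltr_pM2l//.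
  have pp : 0 < p by exact: powR_gt0.
  by move: su; rewrite /tp /tau mul1r; lra.
have SE u : (below nu J tm `\` far) u -> E (x + l *: nu + ep *: u).
  move=> [su nf]; rewrite point; have [h1 h2] := near_bound u nf.
  have [inE _] := EC _ _ (perp u) h1; apply: inE.
  rewrite bE qE// -mulrBr ltr_pM2l//.
  by move: su; rewrite /below /= /tm /tau mulN1r; lra.
have mSp : measurable (below nu J tp `|` far) by exact: measurableU.
have mSm : measurable (below nu J tm `\` far) by exact: measurableD.
have /andP[lo up] := convolution_bounds h0 K0 Keven iK mSp mSm ES SE.
have iF := rintegrable_indic mfar iK.
have iP := rintegrable_indic mbp iK; have iM := rintegrable_indic mbm iK.
have up' : rint (fun u => K u * \1_(below nu J tp `|` far) u) <=
    rint (fun u => K u * \1_(below nu J tp) u) + rint (fun u => K u * \1_far u).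
  rewrite -rintD//; apply: le_rint => [||u]; [exact: rintegrable_indic|exact: rintegrableD|].
  rewrite -mulrDr ler_wpM2l// !indicE -natrD ler_nat in_setU.
  by case: (_ \in _); case: (_ \in _).
have lo' : rint (fun u => K u * \1_(below nu J tm) u) - rint (fun u => K u * \1_far u) <=
    rint (fun u => K u * \1_(below nu J tm `\` far) u).
  rewrite -rintB//; apply: le_rint => [||u]; [exact: rintegrableB|exact: rintegrable_indic|].
  rewrite -mulrBr ler_wpM2l// lerBlDr !indicE -natrD ler_nat in_setD.
  by case: (_ \in _); case: (_ \in _).
have n1 : `|1 : R| <= 1 by rewrite normr1.
have nN1 : `|-1 : R| <= 1 by rewrite normrN normr1.
have ra : `|- a| <= (A + 1) * ep by rewrite normrN; move: aA ep0; lra.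
have rp : `|p - a| <= (A + 1) * ep.
  by rewrite (le_trans (ler_normB _ _))// (ger0_norm p0); move: aA pep; lra.
have hp := band 1 (p - a) n1 rp; have hm := band (-1) (- a) nN1 ra.
rewrite -/tp in hp; rewrite -/tm in hm.
have kp : k0 * p <= M * W * p by rewrite ler_wpM2r.
have fp : 4 * C ^+ 2 * M * Wn * ep ^+ 2 <= 4 * C ^+ 2 * M * Wn * p.
  by rewrite ler_wpM2l// !mulr_ge0 ?exprn_ge0 ?(ltW C0).
have k0p : 0 <= k0 * p by exact: mulr_ge0.
rewrite -/p; set cv := convolution _ _ _ in lo up *.
move: hp hm Qb; rewrite !ler_norml => /andP[hp1 hp2] /andP[hm1 hm2] /andP[Q1 Q2].
move: up up' lo lo' farb.
move: (rint (fun u => K u * \1_(below nu J tp) u)) hp1 hp2 => Ip hp1 hp2.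
move: (rint (fun u => K u * \1_(below nu J tm) u)) hm1 hm2 => Im hm1 hm2.
move: (rint (fun u => K u * \1_(_ `|` _) u)) (rint (fun u => K u * \1_(_ `\` _) u)) => I1 I2.
move: (rint (fun u => K u * \1_far u)) => If up up' lo lo' farb.
have aE : 2^-1 * (ep * - (2 * c) + a * (2 * k0)) = - (ep * c) + a * k0 by field.
rewrite aE; move: (M * W) (4 * C ^+ 2 * M * Wn) kp fp hp1 hp2 hm1 hm2 Q1 Q2 farb.
move=> MW F kp fp hp1 hp2 hm1 hm2 Q1 Q2 farb.
by apply/andP; split; lra.
Qed.

End expansion.

(** * From the convolution to the displacement *)

Section crossing.
Context {R : realType}.
Implicit Types (P : R -> Prop) (p m D L : R).

(** Right before the infimum P holds, and ~ P holds at points decreasing to it;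
    the affine function is continuous. *)
Lemma first_exit P p m D L : 0 <= L -> 0 <= m ->
  (forall l, `|l| <= L -> P l -> p + m * l <= D) ->
  (forall l, `|l| <= L -> ~ P l -> - D <= p + m * l) ->
  P 0 -> ~ P L ->
  let z := inf [set l | 0 <= l /\ ~ P l] in
  ereal_inf [set l%:E | l in [set l | 0 <= l /\ ~ P l]] = z%:E /\ `|p + m * z| <= D.
Proof.
move=> L0 m0 up lo P0 PL; set S := [set l | _]; move=> z.
have SL : S L by [].
have lbS : lbound S 0 by move=> l [].
have hlb : has_lbound S by exists 0.
have S0 : S !=set0 by exists L.
have zlb l : S l -> z <= l by move=> Sl; exact: ge_inf.
have z0 : 0 <= z by exact: lb_le_inf.
have zL : z <= L by exact: zlb.
split; first exact: ereal_inf_EFin.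
rewrite ler_norml; apply/andP; split.
  apply/ler_addgt0Pl => e e0.
  have m1 : 0 < m + 1 by rewrite ltr_wpDl.
  have d0 : 0 < e / (m + 1) by rewrite divr_gt0.
  have [l [l0 Pl] lz] := inf_adherent d0 (conj S0 hlb).
  have [l' [Sl' l'L l'z]] : exists l', [/\ S l', l' <= L & l' < z + e / (m + 1)].
    have [lL|Ll] := leP l L; first by exists l.
    by exists L; split=> //; exact: lt_trans lz.
  have [l'0 Pl'] := Sl'.
  have := lo l'; rewrite ger0_norm// => /(_ l'L Pl') h.
  have zl' := zlb _ Sl'.
  have h1 : m * (l' - z) <= e.
    have : l' - z <= e / (m + 1) by move: l'z; lra.
    rewrite ler_pdivlMr// => h2; rewrite mulrC; apply: le_trans h2.
    by rewrite ler_wpM2l ?subr_ge0//; lra.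
  by move: h h1; rewrite mulrBr; lra.
apply/ler_addgt0Pl => e e0.
have m1 : 0 < m + 1 by rewrite ltr_wpDl.
have d0 : 0 < e / (m + 1) by rewrite divr_gt0.
pose l := Num.max 0 (z - e / (m + 1)).
have l0 : 0 <= l by rewrite le_max lexx.
have lz : l <= z by rewrite ge_max z0; move: d0; lra.
have zl : z - l <= e / (m + 1).
  have : z - e / (m + 1) <= l by rewrite le_max lexx orbT.
  by lra.
have Pl : P l.
  apply: contrapT => nPl; have zl' : z <= l by apply: zlb.
  have le : l = z by apply/eqP; rewrite eq_le lz.
  have [l1|l1] := leP (z - e / (m + 1)) 0; last first.
    by move: (zl') d0; rewrite /l max_r ?(ltW l1)//; lra.
  by apply: nPl; rewrite /l max_l.
have := up l; rewrite ger0_norm// => /(_ (le_trans lz zL) Pl) h.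
have h1 : m * (z - l) <= e.
  move: zl; rewrite ler_pdivlMr// => h2; rewrite mulrC; apply: le_trans h2.
  by rewrite ler_wpM2l ?subr_ge0//; lra.
by move: h h1; rewrite mulrBr; lra.
Qed.

(** The signed distance to the first crossing inherits the bound on the affine
    function, although P need not change only once. *)
Lemma first_crossing P p m D L : 0 <= L -> 0 <= m ->
  (forall l, `|l| <= L -> P l -> p + m * l <= D) ->
  (forall l, `|l| <= L -> ~ P l -> - D <= p + m * l) ->
  P (- L) -> ~ P L ->
  exists2 z, (if `[< P 0 >] then ereal_inf [set l%:E | l in [set l | 0 <= l /\ ~ P l]]
              else ereal_sup [set l%:E | l in [set l | l <= 0 /\ P l]]) = z%:E &
             `|p + m * z| <= D.
Proof.
move=> L0 m0 up lo PNL PL; case: asboolP => P0.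
  have [h1 h2] := first_exit L0 m0 up lo P0 PL.
  by exists (inf [set l | 0 <= l /\ ~ P l]).
have [] := @first_exit (fun l => ~ P (- l)) (- p) m D L L0 m0.
- by move=> l lL Pl; have := lo (- l); rewrite normrN => /(_ lL Pl); lra.
- move=> l lL /contrapT Pl; have := up (- l); rewrite normrN => /(_ lL Pl); lra.
- by rewrite oppr0.
- by move=> h; apply: h.
set z := inf _ => _ zD; exists (- z); last first.
  by rewrite -normrN; move: zD; rewrite mulrN opprD opprK.
have SE : [set l | l <= 0 /\ P l] = [set - l | l in [set l | 0 <= l /\ ~ ~ P (- l)]].
  apply/seteqP; split=> [l [l0 Pl]|_ [l [l0 /contrapT Pl] <-]] /=; last first.
    by rewrite oppr_le0.
  exists (- l); last by rewrite opprK.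
  by rewrite oppr_ge0 opprK; split.
rewrite ereal_sup_EFin.
- by congr (_%:E); rewrite /z /inf opprK SE.
- by exists 0 => l [].
- by exists (- L); split=> //; rewrite oppr_le0.
Qed.

End crossing.

Section mobility.
Context {R : realType}.

Lemma rint_ball_lower n (f : 'rV[R]_n -> R) c y0 r : rintegrable f ->
  (forall y, 0 <= f y) -> (forall y, enorm (y - y0) <= r -> c <= f y) ->
  c * fine (lebesgue_rV R n (rV_ball r)) <= rint f.
Proof.
move=> fi f0 fc.
pose B : set 'rV[R]_n := (fun y => y - y0) @^-1` rV_ball r.
have mB : measurable B.
  by rewrite -[B]setTI; apply: measurable_translation => //; exact: measurable_rV_ball.
have lB : lebesgue_rV R n B = lebesgue_rV R n (rV_ball r).
  exact: lebesgue_rV_translate (measurable_rV_ball r).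
have iB : rintegrable (\1_B : 'rV[R]_n -> R).
  apply/integrableP; split; first by apply/measurable_EFinP; exact: measurable_indic.
  under eq_integral do rewrite /= ger0_norm//.
  by rewrite integral_indic// setIT [X in (X < _)%E]lB lebesgue_rV_ball_lty.
have -> : c * fine (lebesgue_rV R n (rV_ball r)) = rint (fun y => c * \1_B y).
  rewrite rintZ//; congr (c * _); apply: EFin_inj; rewrite EFin_rint//.
  rewrite integral_indic// setIT [RHS]lB fineK// ge0_fin_numE//.
  exact: lebesgue_rV_ball_lty.
apply: le_rint => // [|y]; first exact: rintegrableZ.
rewrite indicE; case: (boolP (y \in B)) => [/set_mem yB|_]; last by rewrite mulr0.
by rewrite mulr1 fc.
Qed.

Lemma fine_rV_ball_gt0 n (r : R) : 0 < r -> 0 < fine (lebesgue_rV R n (rV_ball r)).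
Proof.
by move=> r0; rewrite fine_gt0// lebesgue_rV_ball_gt0// lebesgue_rV_ball_lty.
Qed.

Lemma continuous_gt_ball n (f : 'rV[R]_n -> R) y0 c : continuous f -> c < f y0 ->
  exists2 r, 0 < r & forall y, enorm (y - y0) <= r -> c <= f y.
Proof.
move=> cf cy; have : \forall y \near y0, c < f y.
  exact: (cvgr_gt (f y0) (cf y0)).
move=> /nbhs_enormP[r r0 hr]; exists (r / 2); first by rewrite divr_gt0.
move=> y yr; apply: ltW; apply: hr; apply: le_lt_trans yr _.
by rewrite ltr_pdivrMr//; lra.
Qed.

(** A positive value persists on a ball. *)
Lemma rint_eq0 n (f : 'rV[R]_n -> R) : rintegrable f -> continuous f ->
  (forall y, 0 <= f y) -> rint f = 0 -> forall y, f y = 0.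
Proof.
move=> fi cf f0 If y; apply/eqP; rewrite eq_le f0 andbT leNgt; apply/negP => fy.
have [|r r0 hr] := @continuous_gt_ball n f y (f y / 2) cf; first by rewrite ltr_pdivrMr//; lra.
have := rint_ball_lower fi f0 hr; rewrite If leNgt => /negP; apply.
by rewrite mulr_gt0 ?fine_rV_ball_gt0// divr_gt0.
Qed.

Variables (k : nat) (K : 'rV[R]_k.+2 -> R) (M eta beta : R).
Hypothesis tK : tame_kernel K M eta beta.
Hypothesis K0 : forall u, 0 <= K u.

Section plane.
Variables (nu : 'rV[R]_k.+2) (J : 'M[R]_(k.+1, k.+2)).
Hypothesis OO : col_mx nu J *m (col_mx nu J)^T = 1%:M.

Lemma plane_integrable : rintegrable (fun y => K (y *m J)).
Proof.
have [|||] := @plane_moment R k.+1 K M eta beta tK nu J OO (fun=> 1) 1 => //.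
  by move=> y; rewrite normr1 mul1r exprn_ege1// bracket_ge1.
by under eq_fun do rewrite mul1r.
Qed.

Lemma inv_mobility_ge0 : 0 <= inv_mobility K nu.
Proof. by rewrite (inv_mobilityE tK K0 OO) mulr_ge0//; exact: rint_ge0. Qed.

Lemma continuous_plane : continuous (fun y : 'rV[R]_k.+1 => K (y *m J)).
Proof.
have [C C0 CJ] := mulmx_enorm_bound J.
move=> y; apply: continuous_enormP => {}y e e0.
have : \forall u \near y *m J, `|K u - K (y *m J)| < e.
  have := (tame_continuous tK (x := y *m J)); move=> /cvgrPdist_lt /(_ e e0).
  by apply: filterS => u; rewrite distrC.
move=> /nbhs_enormP[r r0 hr]; exists (r / (C + 1)); first by rewrite divr_gt0// ltr_wpDl.
move=> z zy; apply: hr; rewrite -mulmxBl; apply: le_lt_trans (CJ _) _.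
by move: zy; rewrite ltr_pdivlMr ?ltr_wpDl//; have := enorm_ge0 (z - y); nra.
Qed.

Lemma inv_mobility_eq0 : inv_mobility K nu = 0 -> forall y, K (y *m J) = 0.
Proof.
rewrite (inv_mobilityE tK K0 OO) => h; apply: rint_eq0 => //.
- exact: plane_integrable.
- exact: continuous_plane.
- lra.
Qed.

End plane.

(** A positive value of K at a point of the hyperplane normal to nu persists on
    a ball, which every nearby hyperplane meets in a ball of comparable size. *)
Lemma inv_mobility_bounded_below :
  (forall nu, enorm nu = 1 -> 0 < inv_mobility K nu) ->
  exists2 c, 0 < c & forall nu, enorm nu = 1 -> c <= inv_mobility K nu.
Proof.
move=> pos; have cK := tame_continuous tK.
have /compact_near_coveringP cov := @unit_sphere_compact R k.+2.
have := cov R (pinfty_nbhs R)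
  (fun c nu => enorm nu = 1 -> 1 <= c * inv_mobility K nu) _.
case.
  move=> nu0 nu01; have [J0 [_ _ OO0]] := orthonormal_completion nu01.
  have [nn0 nJ0 Jn0 JJ0] := frame_relations OO0.
  have [y0 Ky0] : exists y, 0 < K (y *m J0).
    apply/not_existsP => h; have := pos _ nu01.
    rewrite (inv_mobilityE tK K0 OO0) (@eq_rint _ _ _ (fun y => 0 * 0)).
      by rewrite rintZ; [rewrite mul0r mulr0 ltxx|exact: integrable0].
    move=> y; rewrite mul0r; apply/eqP; rewrite eq_le K0 andbT leNgt.
    by apply/negP; exact: h.
  pose p0 := y0 *m J0.
  have p0n : dotv p0 nu0 = 0 by rewrite dotvE -mulmxA Jn0 mulmx0 mxE.
  have [|r r0 hr] := @continuous_gt_ball _ K p0 (K p0 / 2) cK.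
    by rewrite ltr_pdivrMr//; move: Ky0; rewrite -/p0; lra.
  pose m0 := 2 * (K p0 / 2 * fine (lebesgue_rV R k.+1 (rV_ball (r / 2)))).
  have m00 : 0 < m0.
    by rewrite !mulr_gt0 ?fine_rV_ball_gt0 ?divr_gt0// invr_gt0.
  pose d := r / 2 / (enorm p0 + 1).
  have p1 : 0 < enorm p0 + 1 by rewrite ltr_wpDl ?enorm_ge0.
  have d0 : 0 < d by rewrite !divr_gt0.
  exists ([set nu | enorm (nu - nu0) < d], [set c | m0^-1 < c]).
    split; first by apply/nbhs_enormP; exists d.
    by exists m0^-1; split; first exact: num_real.
  move=> [nu c] [/= nud mc] nu1.
  have [J [JJ nJ OO]] := orthonormal_completion nu1.
  have close y : enorm (y - p0 *m J^T) <= r / 2 -> K p0 / 2 <= K (y *m J).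
    move=> yr; apply: hr; rewrite [in leLHS](frame_split OO p0).
    rewrite opprD addrCA -mulmxBl; apply: le_trans (ler_enormD _ _) _.
    rewrite (enorm_isometry _ JJ) enormN enormZ nu1 mulr1.
    have : `|dotv p0 nu| <= r / 2.
      rewrite -[dotv p0 nu]subr0 -p0n -dotvBr; apply: le_trans (cauchy_schwarz _ _) _.
      have := ltW nud; rewrite /d ler_pdivlMr// => h.
      by have := enorm_ge0 p0; have := enorm_ge0 (nu - nu0); nra.
    by move: yr; lra.
  have mm : m0 <= inv_mobility K nu.
    rewrite (inv_mobilityE tK K0 OO) ler_wpM2l//.
    exact: rint_ball_lower (plane_integrable OO) (fun y => K0 (y *m J)) close.
  have c0 : 0 < c by apply: lt_trans mc; rewrite invr_gt0.
  apply: le_trans (ler_wpM2l (ltW c0) mm).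
  by move: mc; rewrite -[_^-1]mul1r ltr_pdivrMr// => /ltW.
move=> c [_ hc]; pose a := Num.max 1 (c + 1).
have a0 : 0 < a by rewrite lt_max ltr01.
exists a^-1; first by rewrite invr_gt0.
move=> nu nu1; have : 1 <= a * inv_mobility K nu.
  by apply: hc => //; rewrite lt_max ltrDl ltr01 orbT.
by rewrite -[_^-1]mul1r ler_pdivrMr// mulrC.
Qed.

End mobility.

(** * Displacement of the thresholded boundary *)

Lemma powR_half_order (R : realType) (h a : R) : 0 < h -> 0 < a ->
  h `^ (1 + a / 2) = Num.sqrt h * Num.sqrt h `^ (1 + a).
Proof.
move=> h0 a0; have a1 : 0 <= 1 + a by lra.
rewrite (mulr_powR (sqrtr_ge0 h) a1) -powR12_sqrt ?(ltW h0)// -powRrM.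
by congr (h `^ _); field.
Qed.

Section displacement.
Context {R : realType} (k : nat).
Variables (K : 'rV[R]_k.+2 -> R) (M eta beta alpha C : R).
Hypothesis tK : tame_kernel K M eta beta.
Hypotheses (K0 : forall u, 0 <= K u) (Keven : forall u, K (- u) = K u).
Hypothesis K1 : rint K = 1.
Hypotheses (alpha0 : 0 < alpha) (ab : alpha <= beta) (C1 : 1 <= C).

Let M0 : 0 <= M. Proof. by case: tK. Qed.
Let eta0 : 0 < eta. Proof. by case: tK. Qed.
Let beta0 : 0 < beta. Proof. by case: tK => _ _ /andP[]. Qed.
Let iK : rintegrable K. Proof. exact: tame_integrable tK. Qed.
Let C0 : 0 < C. Proof. exact: lt_le_trans C1. Qed.
Let W := weight_mass k.+1 (k.+1%:R + eta) : R.
Let W0 : 0 <= W. Proof. exact: weight_mass_ge0. Qed.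

(** The a priori bound |z| <= A h on the displacement z. *)
Definition crossing_trapped (A e1 : R) : Prop := forall h E x, 0 < h ->
  Num.sqrt h < e1 -> boundary_paraboloid alpha E C x ->
  let nu := outer_unit_normal E x in
  0 < inv_mobility K nu ->
  thresholded_set K h E (x + (- (A * h)) *: nu) /\
  ~ thresholded_set K h E (x + (A * h) *: nu).

Lemma aniso_mean_curvature_bound E x : boundary_paraboloid alpha E C x ->
  `|aniso_mean_curvature K E x| <= C * M * W.
Proof.
move=> [B [nu1 BC _ frame]]; have [J [JJ _ OO]] := orthonormal_completion nu1.
rewrite (aniso_mean_curvatureE tK OO frame) normrN.
have mB := continuous_measurable_rV (@continuous_quadratic _ _ B).
have mf : measurable_fun setT (fun y : 'rV[R]_k.+1 => dotv (y *m J *m B) (y *m J)).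
  exact: (measurableT_comp mB (measurable_mulmx J)).
have [|_ //] := plane_moment tK OO (ltW C0) mf.
move=> y; apply: le_trans (BC _) _; rewrite (enorm_isometry _ JJ) ler_wpM2l ?(ltW C0)//.
apply: (@le_trans _ _ (bracket y ^+ 2)).
  by rewrite lerXn2r ?nnegrE ?enorm_ge0 ?(ltW (bracket_gt0 y))// enorm_le_bracket.
by apply: ler_weXn2l => //; exact: bracket_ge1.
Qed.

(** If 1 / mu vanishes, then K vanishes on the hyperplane, the only place where
    the curvature term evaluates it. *)
Lemma aniso_mean_curvature_degenerate E x : boundary_paraboloid alpha E C x ->
  inv_mobility K (outer_unit_normal E x) = 0 -> aniso_mean_curvature K E x = 0.
Proof.
move=> [B [nu1 _ _ frame]] m0; have [J [_ _ OO]] := orthonormal_completion nu1.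
have KJ := inv_mobility_eq0 tK K0 OO m0.
rewrite (aniso_mean_curvatureE tK OO frame) (@eq_rint _ _ _ (fun y => 0 * 0)).
  by rewrite rintZ; [rewrite mul0r oppr0|exact: integrable0].
by move=> y; rewrite KJ mulr0 mul0r.
Qed.

(** On both sides of the crossing the expansion reads h H + l / mu <= O(ep^(2+alpha))
    or >= - O(ep^(2+alpha)), after multiplication by 2 ep. *)
Lemma displacement_expansion A e1 : 0 <= A -> 0 < e1 -> crossing_trapped A e1 ->
  exists D e0, 0 < e0 /\ forall h E x, 0 < h -> Num.sqrt h < e0 ->
    boundary_paraboloid alpha E C x ->
    (`| (inv_mobility K (outer_unit_normal E x))%:E * normal_displacement K h E x
        - (- (h * aniso_mean_curvature K E x))%:E | <= (D * h `^ (1 + alpha / 2))%:E)%E.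
Proof.
move=> A0 e10 trap.
have [D [e2 [D0 e20 conv]]] := convolution_expansion tK K0 Keven K1 alpha0 ab C1 A0.
exists (2 * D), (Num.min e1 e2); split; first by rewrite lt_min e10.
move=> h E x h0; rewrite lt_min => /andP[he1 he2] par.
set nu := outer_unit_normal E x; set H := aniso_mean_curvature K E x.
have [nu1 [J [_ _ OO]]] : enorm nu = 1 /\ exists J : 'M[R]_(k.+1, k.+2),
    [/\ J *m J^T = 1%:M, nu *m J^T = 0 & col_mx nu J *m (col_mx nu J)^T = 1%:M].
  by have [B [nu1 _ _ _]] := par; split=> //; exact: orthonormal_completion.
set m := inv_mobility K nu; have m0 : 0 <= m := inv_mobility_ge0 tK K0 OO.
have r0 : 0 <= 2 * D * h `^ (1 + alpha / 2) by rewrite !mulr_ge0 ?powR_ge0.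
move: (m0); rewrite le_eqVlt => /predU1P[mE|mp].
  have -> : H = 0 by exact: aniso_mean_curvature_degenerate.
  by rewrite -mE mul0e mulr0 oppr0 sube0 abse0 lee_fin.
have [PNL PL] := trap h E x h0 he1 par mp; rewrite -/nu in PNL PL.
pose P l := thresholded_set K h E (x + l *: nu).
set ep := Num.sqrt h in he1 he2; have ep0 : 0 < ep by rewrite sqrtr_gt0.
have epE : ep * ep = h by rewrite -expr2 sqr_sqrtr ?ltW.
set D' := 2 * D * h `^ (1 + alpha / 2) in r0 *.
have D'E : 2 * ep * (D * ep `^ (1 + alpha)) = D'.
  by rewrite /D' (powR_half_order h0 alpha0) -/ep; ring.
have est l : `|l| <= A * h ->
    `|2 * ep * (convolution (rescaled_kernel K h) \1_E (x + l *: nu) - 2^-1)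
      + (h * H + m * l)| <= D'.
  move=> lA; have := conv h E x l h0 he2 par lA; rewrite /= -/nu -/H -/m -/ep => e.
  rewrite -D'E; have -> : h * H + m * l = 2 * ep * (2^-1 * (ep * H + l / ep * m)).
    by rewrite -epE; field; rewrite gt_eqF.
  have ep2 : 0 < 2 * ep by rewrite mulr_gt0.
  by rewrite -mulrDr normrM (gtr0_norm ep2) ler_pM2l.
have up l : `|l| <= A * h -> P l -> h * H + m * l <= D'.
  move=> lA; rewrite /P /thresholded_set /= -subr_gt0 => Pl.
  have c0 := mulr_gt0 (mulr_gt0 (@ltr0Sn R 1) ep0) Pl.
  by move: (est l lA); rewrite ler_norml => /andP[_]; move: c0; lra.
have lo l : `|l| <= A * h -> ~ P l -> - D' <= h * H + m * l.
  move=> lA /negP; rewrite -leNgt -subr_le0 => Pl.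
  have c0 := ler_wpM2l (mulr_ge0 (ler0n R 2) (ltW ep0)) Pl.
  by move: (est l lA); rewrite ler_norml => /andP[+ _]; move: c0; rewrite mulr0; lra.
have Ah : 0 <= A * h by rewrite mulr_ge0 ?(ltW h0).
have [z zE zD] := first_crossing Ah m0 up lo PNL PL.
have -> : normal_displacement K h E x = z%:E.
  by rewrite -zE /normal_displacement -/nu /P scale0r addr0.
rewrite -EFinM -EFinB abse_EFin lee_fin opprK addrC.
exact: zD.
Qed.

(** The affine term dominates both the curvature term and the remainder once A
    is large compared with 1 / c. *)
Lemma crossing_trapped_mobility c : 0 < c ->
  (forall nu, enorm nu = 1 -> c <= inv_mobility K nu) ->
  exists A e1, [/\ 0 <= A, 0 < e1 & crossing_trapped A e1].
Proof.
(* A c exceeds the bound on |H| by 2. *)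
move=> c0 cm; pose A := (C * M * W + 2) / c.
have CMW : 0 <= C * M * W by rewrite !mulr_ge0 ?(ltW C0).
have A0 : 0 <= A by rewrite divr_ge0 ?(ltW c0)// addr_ge0.
have [D [e2 [D0 e20 conv]]] := convolution_expansion tK K0 Keven K1 alpha0 ab C1 A0.
pose e3 := (D + 1)^-1 `^ alpha^-1.
have D1 : 0 < D + 1 by rewrite ltr_wpDl.
have e30 : 0 < e3 by rewrite powR_gt0// invr_gt0.
exists A, (Num.min e2 e3); split=> //; first by rewrite lt_min e20.
move=> h E x h0; rewrite lt_min => /andP[he2 he3] par nu mp.
have nu1 : enorm nu = 1 by case: par => ? [].
have Hb := aniso_mean_curvature_bound par.
have cvA l := conv h E x l h0 he2 par; rewrite -/nu /= in cvA.
set ep := Num.sqrt h in he2 he3 cvA; set H := aniso_mean_curvature K E x in Hb cvA.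
set m := inv_mobility K nu in mp cvA.
have ep0 : 0 < ep by rewrite sqrtr_gt0.
have epE : h = ep * ep by rewrite -expr2 sqr_sqrtr ?ltW.
have small : D * ep `^ (1 + alpha) < ep.
  rewrite -mulr_powR ?(ltW ep0) ?(ltW alpha0)// mulrCA gtr_pMr//.
  have : ep `^ alpha < (D + 1)^-1.
    have -> : (D + 1)^-1 = e3 `^ alpha.
      by rewrite /e3 -powRrM mulVf ?gt_eqF// powRr1// invr_ge0 ltW.
    by apply: gt0_ltr_powR; rewrite ?nnegrE ?(ltW ep0) ?(ltW e30).
  rewrite -[ltRHS]mul1r ltr_pdivlMr// => h1.
  by have := powR_ge0 ep alpha; move: h1; nra.
have Am : C * M * W + 2 <= A * m.
  by rewrite /A [leRHS]mulrAC ler_pdivlMr// ler_wpM2l ?cm ?addr_ge0.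
have hep : ep * (C * M * W + 2) <= ep * (A * m) by rewrite ler_pM2l.
have hH : `|ep * H| <= ep * (C * M * W) by rewrite normrM (gtr0_norm ep0) ler_pM2l.
have Ah : 0 <= A * h by rewrite mulr_ge0 ?(ltW h0).
have lE : A * h / ep = A * ep by rewrite epE mulrA mulfK// gt_eqF.
rewrite /thresholded_set /=; split.
  have := cvA (- (A * h)); rewrite normrN ger0_norm// => /(_ (lexx _)).
  rewrite mulNr lE ler_norml => /andP[h1 _].
  by move: hH h1 small hep; rewrite ler_norml => /andP[_]; set cv := convolution _ _ _; lra.
apply/negP; rewrite -leNgt.
have := cvA (A * h); rewrite ger0_norm// => /(_ (lexx _)).
rewrite lE ler_norml => /andP[_ h1].
by move: hH h1 small hep; rewrite ler_norml => /andP[+ _]; set cv := convolution _ _ _; lra.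
Qed.

Section plane.
Variables (nu : 'rV[R]_k.+2) (J : 'M[R]_(k.+1, k.+2)).
Hypothesis OO : col_mx nu J *m (col_mx nu J)^T = 1%:M.

(** The band 0 <= u . nu < t has mass t times the integral of K over the
    hyperplane up to O(t^(1+beta)), which is positive for small t. *)
Lemma mass_beyond_half d : 0 < inv_mobility K nu -> 0 < d ->
  2^-1 < rint (fun u => K u * \1_(below nu J (fun=> d)) u).
Proof.
rewrite (inv_mobilityE tK K0 OO); set k0 := rint _ => k02 d0.
have k00 : 0 < k0 by move: k02; rewrite pmulr_rgt0.
pose MW := M * W; have MW0 : 0 <= MW by rewrite mulr_ge0.
have MW1 : 0 < MW + 1 by rewrite ltr_wpDl.
pose e := (k0 / (MW + 1)) `^ beta^-1; have e0 : 0 < e by rewrite powR_gt0// divr_gt0.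
pose t := Num.min d (e / 2).
have t0 : 0 < t by rewrite lt_min d0 divr_gt0.
have te : t < e.
  by rewrite gt_min; apply/orP; right; rewrite ltr_pdivrMr//; move: e0; lra.
have m1 (c : R) : measurable_fun setT (fun _ : 'rV[R]_k.+1 => c) by exact: measurable_cst.
have tb (y : 'rV[R]_k.+1) : `|t| <= t * bracket y ^+ 2.
  by rewrite gtr0_norm// ler_peMr ?(ltW t0)// exprn_ege1// bracket_ge1.
have := band_expansion tK OO (ltW t0) (m1 t) tb.
rewrite (half_mass tK K0 Keven K1 OO) rintZ; last exact: (plane_integrable tK OO).
rewrite -/k0 -/W -/MW.
rewrite ler_norml => /andP[h1 _].
have h2 : MW * t `^ (1 + beta) < t * k0.
  rewrite -mulr_powR ?(ltW t0) ?(ltW beta0)// mulrCA ltr_pM2l//.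
  have : t `^ beta < k0 / (MW + 1).
    have -> : k0 / (MW + 1) = e `^ beta.
      by rewrite /e -powRrM mulVf ?gt_eqF// powRr1// divr_ge0 ?ltW.
    by apply: gt0_ltr_powR; rewrite ?nnegrE ?(ltW t0) ?(ltW e0).
  rewrite ltr_pdivlMr// => h3; have := powR_ge0 t beta; move: h3; lra.
have mb c := measurable_below nu J (m1 c).
have h4 : rint (fun u => K u * \1_(below nu J (fun=> t)) u) <=
    rint (fun u => K u * \1_(below nu J (fun=> d)) u).
  apply: le_rint => [||u]; [exact: rintegrable_indic|exact: rintegrable_indic|].
  rewrite ler_wpM2l// !indicE ler_nat; case: (boolP (_ \in _)) => [/set_mem ut|//].
  by rewrite mem_set//; apply: (lt_le_trans ut); rewrite ge_min lexx.
by move: h1 h2 h4; lra.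
Qed.

End plane.

(** Seen at distance at most ep r, the boundary deviates from its tangent plane by
    at most b0 h, so that moving E by (b0 + 1) h along the normal puts it beyond
    the tangent plane. *)
Lemma crossing_trapped_support r : 1 <= r ->
  (forall u, r < enorm u -> K u = 0) ->
  exists A e1, [/\ 0 <= A, 0 < e1 & crossing_trapped A e1].
Proof.
move=> r1 Kr; have r0 : 0 < r by exact: lt_le_trans r1.
pose b0 := 2 * C * r ^+ 2; have b00 : 0 < b0 by rewrite !mulr_gt0 ?exprn_gt0.
pose A := b0 + 1; have A0 : 0 < A by rewrite ltr_wpDl// ltW.
have CrA : 0 < C * (r + A) by rewrite mulr_gt0// addr_gt0.
exists A, (Num.min 1 (C * (r + A))^-1); split; [exact: ltW|by rewrite lt_min ltr01 invr_gt0|].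
move=> h E x h0 + par nu mp; set ep := Num.sqrt h; rewrite lt_min => /andP[ep1 epC].
have ep0 : 0 < ep by rewrite sqrtr_gt0.
have epE : h = ep * ep by rewrite -expr2 sqr_sqrtr ?ltW.
move: epC; rewrite -[ltRHS]mul1r ltr_pdivlMr// => epC.
have [B [nu1 BC EC _]] := par; rewrite -/nu in nu1 EC.
have [J [JJ nJ OO]] := orthonormal_completion nu1.
have [nn _ Jn _] := frame_relations OO.
(* With l = ep a, the position relative to the tangent plane decides membership in E
   up to b0 ep. *)
have flat a u : `|a| <= A * ep -> enorm u <= r ->
    (dotv u nu + a < - (b0 * ep) -> E (x + (ep * a) *: nu + ep *: u)) /\
    (b0 * ep < dotv u nu + a -> ~ E (x + (ep * a) *: nu + ep *: u)).
  move=> aA ur; have ae : `|a| <= A.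
    by apply: le_trans aA _; rewrite ler_piMr ?(ltW A0) ?ltW.
  have yr : enorm (u *m J^T) <= r.
    by apply: le_trans ur; rewrite [in leRHS](frame_split OO u) enorm_plane_le.
  pose y := ep *: (u *m J^T *m J); pose s := ep * (dotv u nu + a).
  have yn : dotv y nu = 0.
    by rewrite dotvZl dotvE -mulmxA Jn mulmx0 mxE mulr0.
  have point : ep *: u + (ep * a) *: nu = s *: nu + y.
    rewrite {1}(frame_split OO u) /s /y; move: (dotv u nu) (u *m J^T *m J) => t w.
    by apply/rowP => i; rewrite !mxE; ring.
  rewrite -addrA [_ + ep *: u]addrC point.
  have ney : enorm y <= ep * r.
    by rewrite enormZ (gtr0_norm ep0) (enorm_isometry _ JJ) ler_pM2l.
  have sy : C * enorm (s *: nu + y) <= 1.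
    rewrite -point; have := ler_enormD (ep *: u) ((ep * a) *: nu).
    rewrite !enormZ nu1 mulr1 normrM (gtr0_norm ep0) -mulrDr => h1.
    have h2 : ep * (enorm u + `|a|) <= ep * (r + A) by rewrite ler_pM2l// lerD.
    by have := ler_wpM2l (ltW C0) (le_trans h1 h2); move: epC; lra.
  have y1 : enorm y <= 1.
    apply: le_trans ney _; apply: ltW; apply: le_lt_trans epC; rewrite ler_pM2l//.
    by have := ler_wpM2r (ltW (addr_gt0 r0 A0)) C1; move: A0; lra.
  have y2 : enorm y ^+ 2 <= ep * ep * r ^+ 2.
    rewrite -expr2 -exprMn lerXn2r// nnegrE ?enorm_ge0// mulr_ge0 ?(ltW ep0)//.
    exact: ltW.
  have q1 : C * enorm y `^ (2 + alpha) <= C * (ep * ep * r ^+ 2).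
    rewrite ler_pM2l//; apply: le_trans y2; apply: powR_le_expr.
      by rewrite enorm_ge0.
    by move: alpha0; lra.
  have b1 : `|2^-1 * dotv (y *m B) y| <= C * (ep * ep * r ^+ 2).
    rewrite normrM gtr0_norm ?invr_gt0//; have := BC y.
    have := ler_wpM2l (ltW C0) y2; have := normr_ge0 (dotv (y *m B) y).
    by move: (`| _ |) => w; lra.
  have bE : b0 * ep * ep = C * (ep * ep * r ^+ 2) + C * (ep * ep * r ^+ 2).
    by rewrite /b0; ring.
  have [inE outE] := EC s y yn sy; split=> hs; [apply: inE|apply: outE].
    move: b1; rewrite ler_norml => /andP[b1 _].
    have : s < - (b0 * ep * ep) by rewrite /s mulrC -mulNr ltr_pM2r.
    by move: b1 q1 bE; lra.
  move: b1; rewrite ler_norml => /andP[_ b1].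
  have : b0 * ep * ep < s by rewrite /s [ltRHS]mulrC ltr_pM2r.
  by move: b1 q1 bE; lra.
have AhE : A * h = ep * (A * ep) by rewrite epE; ring.
have Ae : 0 <= A * ep by rewrite mulr_ge0 ?ltW.
have m1 (c : R) : measurable_fun setT (fun _ : 'rV[R]_k.+1 => c) by exact: measurable_cst.
have mb c := measurable_below nu J (m1 c).
have mr : measurable (@rV_ball R k.+2 r) by exact: measurable_rV_ball.
have Kball u : K u != 0 -> enorm u <= r.
  by move=> Ku; rewrite leNgt; apply/negP => /Kr Ku0; rewrite Ku0 eqxx in Ku.
rewrite /thresholded_set /= AhE -mulrN; split.
  have aA : `|- (A * ep)| <= A * ep by rewrite normrN ger0_norm.
  have SE u : (below nu J (fun=> ep) `&` rV_ball r) u ->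
      E (x + (ep * - (A * ep)) *: nu + ep *: u).
    move=> [us ur]; apply: (proj1 (flat _ _ aA ur)).
    by move: us; rewrite /below /A /=; lra.
  have /andP[lo _] := convolution_bounds h0 K0 Keven iK measurableT
    (measurableI _ _ (mb ep) mr) (fun _ _ _ => I) SE.
  apply: lt_le_trans lo.
  rewrite (@eq_rint _ _ _ (fun u => K u * \1_(below nu J (fun=> ep)) u)).
    exact: mass_beyond_half.
  move=> u; have [->|/Kball ur] := eqVneq (K u) 0; first by rewrite !mul0r.
  by rewrite indicI /= [X in _ * (_ * X)]indicE mem_set// mulr1.
have aA : `|A * ep| <= A * ep by rewrite ger0_norm.
have ES u : K u != 0 -> E (x + (ep * (A * ep)) *: nu + ep *: u) ->
    below nu J (fun=> 0) u.
  move=> /Kball ur Eu; rewrite /below /= ltNge; apply/negP => us.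
  by apply: (proj2 (flat _ _ aA ur)) Eu; rewrite /A; move: us ep0; lra.
have /andP[_ up] := convolution_bounds h0 K0 Keven iK (mb 0) measurable0 ES
  (fun u => False_ind _).
by apply/negP; rewrite -leNgt -(half_mass tK K0 Keven K1 OO).
Qed.

End displacement.

Theorem theorem4p4 (R : realType) (d : nat) (alpha : R)
    (E0 : set 'rV[R]_d) (K : 'rV[R]_d -> R) :
  (2 <= d)%N ->
  0 < alpha <= 1 ->
  bounded_set E0 ->
  C2holder_boundary alpha E0 ->
  suitable_kernel K ->
  compactly_supported_holder_kernel alpha K \/ decaying_lipschitz_kernel K ->
  exists C : R, \forall h \near (0 : R)^'+, forall x, boundary E0 x ->
    (`| (inv_mobility K (outer_unit_normal E0 x))%:E
          * normal_displacement K h E0 x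
        - (- (h * aniso_mean_curvature K E0 x))%:E |
      <= (C * h `^ (1 + alpha / 2))%:E)%E.
Proof.
case: d E0 K => [//|[//|k]] E0 K _ a01 bE C2E [K0 Keven IK] cases.
have /andP[a0 a1] := a01.
have K1 : rint K = 1 by rewrite /rint /Rintegral IK.
have [C C1 par] := uniform_boundary_paraboloid a01 bE C2E.
suff [M [eta [beta [tK ab [A [e1 [A0 e10 trap]]]]]]] : exists M eta beta,
    [/\ tame_kernel K M eta beta, alpha <= beta &
        exists A e1, [/\ 0 <= A, 0 < e1 & crossing_trapped K alpha C A e1]].
  have [D [e0 [e00 exp]]] :=
    displacement_expansion tK K0 Keven K1 a0 ab C1 A0 e10 trap.
  exists D; near=> h => x /par px; apply: exp => //.
  have h0 : 0 < h by near: h; exact: nbhs_right_gt.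
  rewrite -(ger0_norm (ltW e00)) -sqrtr_sqr ltr_sqrt ?exprn_gt0//.
  by near: h; apply: nbhs_right_lt; rewrite exprn_gt0.
have [cK|dK] := cases.
  have [r [M [r1 Kr tK]]] := compact_kernel_tame a01 cK.
  exists M, 1, alpha; split=> //.
  exact: (crossing_trapped_support tK K0 Keven K1 a0 C1 r1 Kr).
have [M [eta tK]] := decaying_kernel_tame dK.
have [_ [_ [_ [_ [_ _ _ pos]]]]] := dK.
have [c c0 cm] := inv_mobility_bounded_below tK K0 pos.
exists M, eta, 1; split=> //.
exact: (crossing_trapped_mobility tK K0 Keven K1 a0 a1 C1 c0 cm).
Unshelve. all: by end_near.
Qed.
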